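(* There exists a finite set $\mathcal{R}$ of at most $10^6$ rectangular tiles such that the following decision problem is $\mathsf{NP}$-complete: given as input a simply connected region $\Gamma$, decide whether $\Gamma$ admits a tiling by translated copies of tiles from $\mathcal{R}$.
   Context: Consider $\mathbb{Z}^2$ as a union of closed unit squares with pairwise disjoint interiors. A region is a finite union of such unit squares whose interior is connected; it is simply connected if it is simply connected as a subset of the plane. A tile is a finite simply connected region; a rectangular tile is an $a\times b$ rectangle of unit squares. Given a set $\mathcal{T}$ of tiles, a $\mathcal{T}$-tiling of a region $\Gamma$ is a collection of translated copies of tiles from $\mathcal{T}$ (rotations not allowed) with pairwise disjoint interiors whose union is $\Gamma$. The input region is given as the finite list of unit squares it contains; the tile set $\mathcal{R}$ is fixed and not part of the input. *)

(* Defs.v *)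
From HB Require Import structures.
From mathcomp Require Import all_boot all_order all_algebra.
From mathcomp Require Import finmap.
From mathcomp Require Import all_classical all_reals topology normedtype.
Set Implicit Arguments.
Unset Strict Implicit.
Unset Printing Implicit Defensive.
Import Order.TTheory GRing.Theory Num.Theory.
Import numFieldNormedType.Exports.

(** * Turing machines *)

Inductive move := MoveL | MoveR | Stay.

Definition move_code (m : move) : 'I_3 :=
  match m with
  | MoveL => inord 0
  | MoveR => inord 1
  | Stay => inord 2
  end.

Definition move_decode (i : 'I_3) : move :=
  match val i with
  | 0 => MoveL
  | 1 => MoveR
  | _ => Stay
  end.

Lemma move_codeK : cancel move_code move_decode.
Proof. by case; rewrite /move_decode /= inordK. Qed.

HB.instance Definition _ := Finite.copy move (can_type move_codeK).

(* A nondeterministic machine with [ntapes.+1] two-way infinite tapes; it halts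
   when no transition applies. *)
Record tm := TM {
  ntapes : nat;
  state : finType;
  symb : finType;
  blank : symb;
  start : state;
  accept : {set state};
  delta : state -> {ffun 'I_ntapes.+1 -> symb} ->
          {set state * {ffun 'I_ntapes.+1 -> symb * move}}
}.

Definition deterministic (M : tm) : Prop :=
  forall (q : state M) r, #|delta q r| <= 1.

Section Semantics.
Variable M : tm.

(* [(l, r)] is the tape whose cells left of the head are [l], nearest first,
   and whose cells from the head rightwards are [r]; all the others are blank *)
Definition tape : Type := (seq (symb M) * seq (symb M))%type.

Definition scan (t : tape) : symb M := head (blank M) t.2.

Definition update (t : tape) (a : symb M * move) : tape :=
  let: (l, r) := t in
  let r' := a.1 :: behead r in
  match a.2 with
  | MoveL => (behead l, head (blank M) l :: r')
  | MoveR => (a.1 :: l, behead r)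
  | Stay => (l, r')
  end.

Definition config : Type := (state M * ('I_(ntapes M).+1 -> tape))%type.

Definition reads (c : config) : {ffun 'I_(ntapes M).+1 -> symb M} :=
  [ffun i => scan (c.2 i)].

Definition step (c c' : config) : Prop :=
  exists2 a, (c'.1, a) \in delta c.1 (reads c) &
    forall i, c'.2 i = update (c.2 i) (a i).

Fixpoint steps (n : nat) (c c' : config) : Prop :=
  if n is m.+1 then exists2 d, step c d & steps m d c' else c = c'.

Definition halted (c : config) : Prop := delta c.1 (reads c) = finset.set0.

Definition init (w : seq (symb M)) : config :=
  (start M, fun i => if i == ord0 then ([::], w) else ([::], [::])).

(* the word that starts under the head of tape 0 and ends before the first
   blank *)
Definition output (c : config) : seq (symb M) :=
  let r := (c.2 ord0).2 in take (index (blank M) r) r.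

End Semantics.

Definition embedding (M : tm) (A : finType) (e : A -> symb M) : Prop :=
  injective e /\ forall a, e a <> blank M.

(** * NP-completeness *)

Definition language (A : finType) : Type := seq A -> Prop.

Definition NP (A : finType) (L : language A) : Prop :=
  exists (M : tm) (e : A -> symb M) (p : {poly nat}),
    embedding e /\
    forall w : seq A,
      (forall n c, steps n (init (map e w)) c -> n <= p.[size w]%R) /\
      (L w <-> exists n c, [/\ steps n (init (map e w)) c, halted c
                             & c.1 \in accept M]).

Definition polytime (A B : finType) (f : seq A -> seq B) : Prop :=
  exists (M : tm) (e : A -> symb M) (d : B -> symb M) (p : {poly nat}),
    [/\ deterministic M, embedding e, embedding d
      & forall w : seq A, exists n c,
          [/\ n <= p.[size w]%R, steps n (init (map e w)) c, halted c
            & output c = map d (f w)]].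

Definition reduces (A B : finType) (L : language A) (L' : language B) : Prop :=
  exists2 f : seq A -> seq B, polytime f & forall w, L w <-> L' (f w).

Definition NP_hard (B : finType) (L : language B) : Prop :=
  forall (A : finType) (L' : language A), NP L' -> reduces L' L.

Definition NP_complete (B : finType) (L : language B) : Prop :=
  NP L /\ NP_hard L.

(** * Regions and tilings *)

Local Open Scope classical_set_scope.
Local Open Scope ring_scope.

(* the unit square [x, x + 1] * [y, y + 1] is represented by (x, y) *)
Definition square : Type := (int * int)%type.
Definition cells : Type := {fset int * int}.

Section Plane.
Variable R : realType.

Definition unit_square (c : square) : set (R * R) :=
  `[c.1%:~R, c.1%:~R + 1] `*` `[c.2%:~R, c.2%:~R + 1].

Definition realize (S : cells) : set (R * R) :=
  \bigcup_(c in [set` S]) unit_square c.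

Definition region (S : cells) : Prop := connected (realize S)°.

Definition unit_itv : set R := `[0, 1].

Definition is_path (A : set (R * R)) (g : R -> R * R) : Prop :=
  {within unit_itv, continuous g} /\ g @` unit_itv `<=` A.

Definition path_connected (A : set (R * R)) : Prop :=
  forall x y, A x -> A y -> exists g, [/\ is_path A g, g 0 = x & g 1 = y].

(* homotopy inside A, relative to the base point g 0 = g 1 *)
Definition null_homotopic (A : set (R * R)) (g : R -> R * R) : Prop :=
  exists H : R * R -> R * R,
    [/\ {within unit_itv `*` unit_itv, continuous H},
        H @` (unit_itv `*` unit_itv) `<=` A,
        forall t, unit_itv t -> H (0, t) = g t /\ H (1, t) = g 0
      & forall s, unit_itv s -> H (s, 0) = g 0 /\ H (s, 1) = g 0].

Definition simply_connected (A : set (R * R)) : Prop :=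
  [/\ A !=set0, path_connected A
    & forall g, is_path A g -> g 0 = g 1 -> null_homotopic A g].

Definition translate (v : int * int) (S : cells) : cells :=
  [fset (((c.1 + v.1)%R, (c.2 + v.2)%R) : int * int) | c in S]%fset.

(* a placement is a pair (tile, translation vector) *)
Definition placed (p : cells * (int * int)) : set (R * R) :=
  realize (translate p.2 p.1).

Definition is_tiling (T : {fset cells}) (G : cells)
    (P : {fset cells * (int * int)}) : Prop :=
  [/\ forall p, p \in P -> p.1 \in T,
      forall p q, p \in P -> q \in P -> p != q ->
        (placed p)° `&` (placed q)° = set0
    & \bigcup_(p in [set` P]) placed p = realize G].

Definition tileable (T : {fset cells}) (G : cells) : Prop :=
  exists P, is_tiling T G P.

End Plane.

Definition rectangle (a b : nat) : cells :=
  [fset ((i%:Z, j%:Z) : int * int) | i in iota 0 a, j in iota 0 b]%fset.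

Definition rectangular (t : cells) : Prop :=
  exists a b : nat, [/\ (0 < a)%N, (0 < b)%N & t = rectangle a b].

(** * The decision problem *)

Inductive letter := Bit of bool | Minus | Comma | Semicolon.

Definition letter_code (l : letter) : bool + 'I_3 :=
  match l with
  | Bit b => inl b
  | Minus => inr (inord 0)
  | Comma => inr (inord 1)
  | Semicolon => inr (inord 2)
  end.

Definition letter_decode (x : bool + 'I_3) : letter :=
  match x with
  | inl b => Bit b
  | inr i => match val i with
             | 0%N => Minus
             | 1%N => Comma
             | _ => Semicolon
             end
  end.

Lemma letter_codeK : cancel letter_code letter_decode.
Proof. by case=> //=; rewrite inordK. Qed.

HB.instance Definition _ := Finite.copy letter (can_type letter_codeK).

(* binary expansion, most significant bit first; 0 is written as one bit *)
Definition encode_nat (n : nat) : seq letter :=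
  rev [seq Bit (odd (n %/ 2 ^ i)%N) | i <- iota 0 (trunc_log 2 n).+1].

Definition encode_int (z : int) : seq letter :=
  match z with
  | Posz n => encode_nat n
  | Negz n => Minus :: encode_nat n.+1
  end.

Definition encode (s : seq square) : seq letter :=
  flatten [seq encode_int c.1 ++ Comma :: encode_int c.2 ++ [:: Semicolon]
          | c <- s].

Definition tiling_problem (R : realType) (T : {fset cells}) : language letter :=
  fun w => exists s : seq square,
    let G : cells := [fset c in s]%fset in
    [/\ uniq s /\ w = encode s, region R G, simply_connected (@realize R G)
      & tileable R T G].

(* Main.v *)
From HB Require Import structures.
From mathcomp Require Import all_boot all_order all_algebra.
From mathcomp Require Import finmap.
From mathcomp Require Import all_classical all_reals interval_inference topology normedtype
  convex.
From mathcomp Require Import zify ring lra.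
Require Import Defs.
Set Implicit Arguments.
Unset Strict Implicit.
Unset Printing Implicit Defensive.
Import Order.TTheory GRing.Theory Num.Theory.
Import numFieldNormedType.Exports.

(** Membership in NP. A finite set of cells is simply connected (with connected
    interior) exactly when its cells can be added one after the other so that
    each new cell meets the union of the previous ones in an arc of its
    boundary. Such a shelling contracts the region; conversely, a cell that
    meets a connected rest in several pieces yields a loop crossing a line
    inside the cell once, and counting crossings modulo 2 along a homotopy
    shows that it is not contractible. A certificate lists the cells in shelling
    order, each with the rectangle covering it and its position there, and is
    checked locally.

    Hardness. The computation of a nondeterministic machine is written as a CNF
    formula (Cook-Levin), and the formula as a coloring problem on a grid with
    prescribed boundary colors: each row carries the value of one variable, each
    literal owns a column, and a trigger travelling diagonally meets that column
    in the row of its variable, so that a fixed set of colors suffices; a last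
    row checks the clauses. The grid becomes a staircase-shaped region tiled by
    small rectangles of width 4 and big ones of widths 5 and 7. The widths force
    the combinatorial structure of a tiling, and the colors are read off as
    digits of the levels of the corners, one digit for each class of grid
    points modulo 2. Polynomial-time functions are generated on binary trees by
    composition and bounded iteration, and compiled to multi-tape machines. *)

(** * Stack programs *)

Inductive reg := Inp | Main | ScratchX | ScratchY | Counter.

Definition reg_index (r : reg) : 'I_5 :=
  match r with
  | Inp => inord 0 | Main => inord 1 | ScratchX => inord 2 | ScratchY => inord 3
  | Counter => inord 4
  end.

Definition reg_of_index (i : 'I_5) : reg :=
  match val i with
  | 0 => Inp | 1 => Main | 2 => ScratchX | 3 => ScratchY | _ => Counter
  end.

Lemma reg_indexK : cancel reg_index reg_of_index.
Proof. by case; rewrite /reg_of_index /= inordK. Qed.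

Lemma reg_index_Inp : reg_index Inp = ord0.
Proof. by apply/val_inj; rewrite /= inordK. Qed.

Record store (S : Type) := Mem { inp_stack : seq S; main_stack : seq S; x_stack : seq S;
  y_stack : seq S;
  counter_stack : seq S }.

Definition get_reg (S : Type) (r : reg) (m : store S) : seq S :=
  match r with
  | Inp => inp_stack m | Main => main_stack m | ScratchX => x_stack m | ScratchY => y_stack m
  | Counter => counter_stack m
  end.

Definition set_reg (S : Type) (r : reg) (s : seq S) (m : store S) : store S :=
  let: Mem a b c d e := m in
  match r with
  | Inp => Mem s b c d e | Main => Mem a s c d e | ScratchX => Mem a b s d e
  | ScratchY => Mem a b c s e | Counter => Mem a b c d s
  end.

Lemma get_set_reg (S : Type) r (s : seq S) m r' :
  get_reg r' (set_reg r s m) = if reg_index r' == reg_index r then s else get_reg r' m.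
Proof.
case: eqP => [/(can_inj reg_indexK) ->|h]; first by case: m; case: r.
by case: m => a b c d e; case: r r' h => [] [].
Qed.

Section Programs.
Variable S : finType.

Inductive prog :=
  | Push of reg & S
  | Pop of reg
  | Seq of prog & prog
  | If of reg & pred (option S) & prog & prog
  | While of reg & pred (option S) & prog.

Inductive exec : prog -> store S -> nat -> store S -> Prop :=
  | ExecPush r a m : exec (Push r a) m 2 (set_reg r (a :: get_reg r m) m)
  | ExecPop r m : exec (Pop r) m 1 (set_reg r (behead (get_reg r m)) m)
  | ExecSeq p q m t m' t' m'' : exec p m t m' -> exec q m' t' m'' ->
      exec (Seq p q) m (t + t') m''
  | ExecIf r (P : pred (option S)) p q m t m' :
      exec (if P (ohead (get_reg r m)) then p else q) m t m' ->
      exec (If r P p q) m t.+1 m'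
  | ExecWhileF r (P : pred (option S)) p m : ~~ P (ohead (get_reg r m)) -> exec (While r P p) m 1 m
  | ExecWhileT r (P : pred (option S)) p m t m' t' m'' : P (ohead (get_reg r m)) ->
      exec p m t m' -> exec (While r P p) m' t' m'' ->
      exec (While r P p) m (t + t').+1 m''.

Fixpoint prog_state (p : prog) : finType :=
  match p with
  | Push _ _ => bool
  | Pop _ => unit
  | Seq p q => (prog_state p + prog_state q)%type
  | If _ _ p q => option (prog_state p + prog_state q)
  | While _ _ p => option (prog_state p)
  end.

Fixpoint entry (p : prog) : prog_state p :=
  match p with
  | Push _ _ => true
  | Pop _ => tt
  | Seq p q => inl (entry p)
  | If _ _ p q => None
  | While _ _ p => None
  end.

Definition tape_action := option (reg * (option S * move)).

Definition continue_with (A B : Type) (f : A -> B) (k : option B) (x : option A * tape_action) :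
    option B * tape_action :=
  (if x.1 is Some a then Some (f a) else k, x.2).

Fixpoint prog_next (p : prog) : prog_state p -> (reg -> option S) ->
    option (prog_state p) * tape_action :=
  match p return prog_state p -> (reg -> option S) -> option (prog_state p) * tape_action with
  | Push r a => fun s rd =>
      if s then (Some false, Some (r, (rd r, MoveL)))
      else (None, Some (r, (Some a, Stay)))
  | Pop r => fun _ _ => (None, Some (r, (None, MoveR)))
  | Seq p q => fun s rd =>
      match s with
      | inl s => continue_with inl (Some (inr (entry q))) (prog_next s rd)
      | inr s => continue_with inr None (prog_next s rd)
      end
  | If r P p q => fun s rd =>
      match s with
      | None => (Some (Some (if P (rd r) then inl (entry p)
                             else inr (entry q))), None)
      | Some (inl s) => continue_with (Some \o inl) None (prog_next s rd)
      | Some (inr s) => continue_with (Some \o inr) None (prog_next s rd)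
      end
  | While r P p => fun s rd =>
      match s with
      | None => (if P (rd r) then Some (Some (entry p)) else None, None)
      | Some s => continue_with Some (Some None) (prog_next s rd)
      end
  end.

Definition prog_tape := (seq (option S) * seq (option S))%type.

Definition scan_top (t : prog_tape) : option S := head None t.2.

Definition update_tape (t : prog_tape) (a : option S * move) : prog_tape :=
  let: (l, r) := t in
  let r' := a.1 :: behead r in
  match a.2 with
  | MoveL => (behead l, head None l :: r')
  | MoveR => (a.1 :: l, behead r)
  | Stay => (l, r')
  end.

Definition tape_actions (a : tape_action) (rd : 'I_5 -> option S) :
    {ffun 'I_5 -> option S * move} :=
  [ffun j => if a is Some (r, x) then if j == reg_index r then x else (rd j, Stay)
             else (rd j, Stay)].

Definition apply_action (a : tape_action) (T : 'I_5 -> prog_tape) : 'I_5 -> prog_tape :=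
  fun j => update_tape (T j) (tape_actions a (fun i => scan_top (T i)) j).

Fixpoint prog_steps (p : prog) n (s : option (prog_state p)) (T : 'I_5 -> prog_tape)
    (s' : option (prog_state p)) (T' : 'I_5 -> prog_tape) : Prop :=
  if n is n'.+1 then
    if s is Some s0 then
      let x := prog_next s0 (fun r => scan_top (T (reg_index r))) in
      prog_steps n' x.1 (apply_action x.2 T) s' T'
    else False
  else s = s' /\ T = T'.

Lemma prog_steps_cat p n1 n2 (s1 s2 s3 : option (prog_state p)) T1 T2 T3 :
  prog_steps n1 s1 T1 s2 T2 -> prog_steps n2 s2 T2 s3 T3 -> prog_steps (n1 + n2) s1 T1 s3 T3.
Proof. by elim: n1 s1 T1 => [|n IH] [s|] T1 //= => [[-> ->]|[-> ->]|/IH]. Qed.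

Lemma prog_steps_lift p q (f : prog_state p -> prog_state q) (k : option (prog_state q)) :
  (forall s rd, prog_next (f s) rd = continue_with f k (prog_next s rd)) ->
  forall n s T T', prog_steps n (Some s) T None T' -> prog_steps n (Some (f s)) T k T'.
Proof.
move=> hf; elim=> [|n IH] s T T' /=; first by case.
rewrite hf /continue_with /=; case E: (prog_next _ _) => [[s'|] a] /=; first exact: IH.
by case: n {IH} => [|n] //= [_ ->].
Qed.

Definition represents (s : seq S) (t : prog_tape) :=
  exists k, t.2 = map Some s ++ nseq k None.

Lemma represents_top s t : represents s t -> scan_top t = ohead s.
Proof. by case=> k; rewrite /scan_top => ->; case: s => //; case: k. Qed.

Lemma represents_stay s t : represents s t -> represents s (update_tape t (scan_top t, Stay)).
Proof.
case: t => l r [k /= ->]; rewrite /represents /scan_top /=.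
by case: s => [|a s]; [case: k => [|k]; [exists 1|exists k.+1] | exists k].
Qed.

Lemma represents_pop s t x : represents s t -> represents (behead s) (update_tape t (x, MoveR)).
Proof.
case: t => l r [k /= ->]; rewrite /represents /=.
by case: s => [|a s]; [exists k.-1; case: k | exists k].
Qed.

Lemma represents_push s t a :
  represents s t ->
    represents (a :: s) (update_tape (update_tape t (scan_top t, MoveL)) (Some a, Stay)).
Proof.
case: t => l r [k /= ->]; rewrite /represents /scan_top /=.
by case: s => [|b s]; [case: k => [|k]; [exists 1|exists k.+1] | exists k].
Qed.

Definition represents_store (m : store S) (T : 'I_5 -> prog_tape) :=
  forall r, represents (get_reg r m) (T (reg_index r)).

Lemma represents_store_none m T : represents_store m T -> represents_store m (apply_action None T).
Proof. by move=> h r; rewrite /apply_action /tape_actions ffunE; apply: represents_stay. Qed.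

Lemma represents_store_pop m T r x : represents_store m T ->
  represents_store (set_reg r (behead (get_reg r m)) m) (apply_action (Some (r, (x, MoveR))) T).
Proof.
move=> h r'; rewrite get_set_reg /apply_action /tape_actions ffunE.
by case: eqP => [->|_]; [apply: represents_pop; apply: h | apply: represents_stay; apply: h].
Qed.

Lemma represents_store_push m T r a : represents_store m T ->
  represents_store (set_reg r (a :: get_reg r m) m) (apply_action (Some (r, (Some a, Stay)))
    (apply_action (Some (r, (scan_top (T (reg_index r)), MoveL))) T)).
Proof.
move=> h r'; rewrite get_set_reg /apply_action /tape_actions !ffunE.
case: eqP => [->|_]; first by apply: represents_push; apply: h.
by apply: represents_stay; apply: represents_stay; apply: h.
Qed.

Lemma exec_prog_steps p m n m' : exec p m n m' -> forall T, represents_store m T ->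
  exists2 T', represents_store m' T' & prog_steps n (Some (entry p)) T None T'.
Proof.
elim=> {p m n m'}.
- by move=> r a m T h; eexists; first exact: (represents_store_push r a h).
- by move=> r m T h; eexists; first exact: (represents_store_pop r None h).
- move=> p q m t m' t' m'' _ IH1 _ IH2 T h.
  have [T1 /IH2[T2 h2 r2] r1] := IH1 _ h; exists T2 => //.
  apply: (@prog_steps_cat (Seq p q) _ _ _ (Some (inr (entry q))) _ _ T1).
    exact: (@prog_steps_lift p (Seq p q) inl).
  exact: (@prog_steps_lift q (Seq p q) inr).
- move=> r P p q m t m' _ IH T h.
  have [T' h' r'] := IH _ (represents_store_none h); exists T' => //=.
  rewrite (represents_top (h r)); move: r'; case: ifP => _.
    exact: (@prog_steps_lift p (If r P p q) (Some \o inl)).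
  exact: (@prog_steps_lift q (If r P p q) (Some \o inr)).
- move=> r P p m hP T h; exists (apply_action None T); first exact: represents_store_none.
  by rewrite /= (represents_top (h r)) (negbTE hP).
- move=> r P p m t m' t' m'' hP _ IH1 _ IH2 T h.
  have [T1 /IH2[T2 h2 r2] r1] := IH1 _ (represents_store_none h); exists T2 => //=.
  rewrite (represents_top (h r)) hP.
  apply: (@prog_steps_cat (While r P p) _ _ _ (Some None) _ _ T1) => //.
  exact: (@prog_steps_lift p (While r P p) Some).
Qed.

Definition machine_of (p : prog) : tm :=
  @TM 4 (option (prog_state p)) (option S) None (Some (entry p)) finset.set0
    (fun s r => if s is Some s0 then
       let x := prog_next s0 (fun i => r (reg_index i)) in
       [set (x.1, tape_actions x.2 r)]%SET else finset.set0).

Lemma machine_of_deterministic p : deterministic (machine_of p).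
Proof. by move=> [s|] r /=; rewrite ?cards1 ?cards0. Qed.

Lemma prog_steps_steps p n (s s' : option (prog_state p)) T T' : prog_steps n s T s' T' ->
  @steps (machine_of p) n (s, T) (s', T').
Proof.
elim: n s T => [|n IH] [s|] T //=; try by case=> -> ->.
move/IH; set x := prog_next _ _ => h.
exists (x.1, apply_action x.2 T) => //.
have rdE : (fun i => @reads (machine_of p) (Some s, T) (reg_index i))
    = (fun r => scan_top (T (reg_index r))) by apply/funext => r; rewrite ffunE.
exists (tape_actions x.2 (@reads (machine_of p) (Some s, T))) => /=.
  by rewrite rdE -/x finset.set11.
move=> i; rewrite /apply_action; congr (update_tape _ (_ i)).
by congr (tape_actions _ _); apply/funext => j; rewrite ffunE.
Qed.

End Programs.

(** * Polynomial-time functions on binary trees *)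

Inductive tree := Leaf | Node of tree & tree.

Fixpoint tree_bits (d : tree) : seq bool :=
  if d is Node a b then true :: tree_bits a ++ tree_bits b else [:: false].

Definition tree_size (d : tree) : nat := size (tree_bits d).

Definition tree_left (d : tree) := if d is Node a _ then a else Leaf.
Definition tree_right (d : tree) := if d is Node _ b then b else Leaf.
Definition tree_bool (b : bool) : tree := if b then Node Leaf Leaf else Leaf.

Lemma tree_size_Node a b : tree_size (Node a b) = (tree_size a + tree_size b).+1.
Proof. by rewrite /tree_size /= size_cat. Qed.

Lemma tree_bits_cat_inj a b r r' : tree_bits a ++ r = tree_bits b ++ r' -> a = b /\ r = r'.
Proof.
elim: a b r r' => [|a1 IH1 a2 IH2] [|b1 b2] r r' //=; first by case.
by rewrite -!catA; case=> /IH1[-> /IH2[-> ->]].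
Qed.

Lemma tree_bits_inj : injective tree_bits.
Proof. by move=> a b h; case: (@tree_bits_cat_inj a b [::] [::]); rewrite ?h. Qed.

Definition poly_bounded (t : nat -> nat) := exists k, forall n, t n <= (n + 2) ^ k.

Lemma poly_bounded_le s t : (forall n, s n <= t n) -> poly_bounded t -> poly_bounded s.
Proof. by move=> h [k hk]; exists k => n; apply: leq_trans (h n) (hk n). Qed.

Lemma poly_bounded_cst c : poly_bounded (fun _ => c).
Proof.
exists c => n; apply: leq_trans (ltnW (ltn_expl c (ltnSn 1))) _.
by case: c => // c; rewrite leq_exp2r // addn2.
Qed.

Lemma poly_bounded_id : poly_bounded id.
Proof. by exists 1 => n; rewrite expn1 leq_addr. Qed.

Lemma leq_expn_addn2 n k l : k <= l -> (n + 2) ^ k <= (n + 2) ^ l.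
Proof. by move=> h; rewrite leq_exp2l // addn2. Qed.

Lemma poly_boundedM s t : poly_bounded s -> poly_bounded t -> poly_bounded (fun n => s n * t n).
Proof.
by move=> [k hk] [l hl]; exists (k + l) => n; rewrite expnD leq_mul.
Qed.

Lemma poly_boundedD s t : poly_bounded s -> poly_bounded t -> poly_bounded (fun n => s n + t n).
Proof.
move=> [k hk] [l hl]; exists (maxn k l).+1 => n.
have a := leq_trans (hk n) (leq_expn_addn2 n (leq_maxl k l)).
have b := leq_trans (hl n) (leq_expn_addn2 n (leq_maxr k l)).
rewrite expnS; apply: leq_trans (leq_add a b) _.
by rewrite addnn -mul2n leq_mul2r leq_addl orbT.
Qed.

Lemma poly_boundedX s k : poly_bounded s -> poly_bounded (fun n => s n ^ k).
Proof.
move=> hs; elim: k => [|k IH]; first exact: poly_bounded_cst.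
by apply: poly_bounded_le (poly_boundedM hs IH) => n; rewrite expnS.
Qed.

Section Runs.
Variable S : finType.

Definition runs (p : prog S) m t m' := exists2 n, n <= t & exec p m n m'.

Lemma runs_exec p m t m' : exec p m t m' -> runs p m t m'.
Proof. by move=> h; exists t. Qed.

Lemma runs_le p m t t' m' : t <= t' -> runs p m t m' -> runs p m t' m'.
Proof. by move=> h [n hn e]; exists n => //; apply: leq_trans h. Qed.

Lemma runs_seq p q m t m' t' m'' : runs p m t m' -> runs q m' t' m'' ->
  runs (Seq p q) m (t + t') m''.
Proof.
move=> [n hn e] [n' hn' e']; exists (n + n'); first exact: leq_add.
exact: ExecSeq e e'.
Qed.

Lemma runs_if r (P : pred (option S)) p q m t m' :
  runs (if P (ohead (get_reg r m)) then p else q) m t m' ->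
  runs (If r P p q) m t.+1 m'.
Proof. by move=> [n hn e]; exists n.+1 => //; apply: ExecIf. Qed.

Lemma runs_whileF r (P : pred (option S)) p m :
  ~~ P (ohead (get_reg r m)) -> runs (While r P p) m 1 m.
Proof. by move=> h; apply/runs_exec/ExecWhileF. Qed.

Lemma runs_whileT r (P : pred (option S)) p m t m' t' m'' :
  P (ohead (get_reg r m)) -> runs p m t m' -> runs (While r P p) m' t' m'' ->
  runs (While r P p) m (t + t').+1 m''.
Proof.
move=> h [n hn e] [n' hn' e']; exists (n + n').+1.
  by rewrite ltnS leq_add.
exact: ExecWhileT h e e'.
Qed.

End Runs.

Section TreePrograms.
Variable X : finType.
Local Notation S := (bool + X)%type.
Local Notation prog := (prog S).

Definition bit_stack (s : seq bool) : seq S := map inl s.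

Definition is_bit (b : bool) : pred (option S) := fun o => o == Some (inl b).
Definition nonempty : pred (option S) := isSome.

Definition Skip : prog := While Main pred0 (Pop _ Main).

Lemma runs_skip m : runs Skip m 1 m.
Proof. exact: runs_whileF. Qed.

Definition bit_move (i j : reg) : prog :=
  If i (is_bit true) (Seq (Pop _ i) (Push j (inl true)))
                    (Seq (Pop _ i) (Push j (inl false))).

Lemma runs_bit_move i j m b s : get_reg i m = inl b :: s ->
  runs (bit_move i j) m 4 (set_reg j (inl b :: get_reg j (set_reg i s m)) (set_reg i s m)).
Proof.
move=> h; apply: runs_if; rewrite h /is_bit /=.
have -> : set_reg i s m = set_reg i (behead (get_reg i m)) m by rewrite h.
by case: b {h} => /=; apply: (@runs_seq _ _ _ _ 1 _ 2);
  apply: runs_exec; constructor.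
Qed.

Definition dump (i j : reg) : prog := While i nonempty (bit_move i j).

Lemma runs_dump i j s m : reg_index i != reg_index j -> get_reg i m = bit_stack s ->
  runs (dump i j) m (5 * size s + 1)
    (set_reg i [::] (set_reg j (rev (bit_stack s) ++ get_reg j m) m)).
Proof.
move=> hij; elim: s m => [|b s IH] m h.
  have -> : set_reg i [::] (set_reg j (rev (bit_stack [::]) ++ get_reg j m) m) = m.
    by move: h hij; case: m => ? ? ? ? ?; case: i; case: j => //= ->.
  by apply: runs_whileF; rewrite h.
have {}IH := IH
  (set_reg j (inl b :: get_reg j (set_reg i (bit_stack s) m)) (set_reg i (bit_stack s) m)).
have /IH{}IH : get_reg i (set_reg j (inl b :: get_reg j (set_reg i (bit_stack s) m))
    (set_reg i (bit_stack s) m)) = bit_stack s.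
  by rewrite get_set_reg (negbTE hij) get_set_reg eqxx.
apply: (@runs_le _ _ _ (4 + (5 * size s + 1)).+1); first by rewrite /=; lia.
apply: runs_whileT (runs_bit_move j h) _; first by rewrite h.
congr (runs _ _ _ _): IH; rewrite /= rev_cons cat_rcons.
by move: hij; case: m h => ? ? ? ? ?; case: i; case: j; rewrite ?eqxx.
Qed.

Definition pull_target (b : bool) : reg := if b then ScratchX else ScratchY.
Definition pulled_store (b : bool) (inp main u v c : seq S) : store S :=
  if b then Mem inp main u v c else Mem inp main v u c.

Definition pull_loop b : prog :=
  While Counter nonempty
    (If Main (is_bit true)
       (Seq (Pop _ Main) (Seq (Push (pull_target b) (inl true)) (Push Counter (inl true))))
       (Seq (Pop _ Main) (Seq (Push (pull_target b) (inl false)) (Pop _ Counter)))).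

Definition trees_bits (ds : seq tree) : seq bool := flatten (map tree_bits ds).

Lemma runs_pull_loop b ds r inp u v :
  runs (pull_loop b)
    (pulled_store b inp (bit_stack (trees_bits ds) ++ r) u v (nseq (size ds) (inl true)))
    (7 * size (trees_bits ds) + 1)
    (pulled_store b inp r (rev (bit_stack (trees_bits ds)) ++ u) v [::]).
Proof.
have [n] := ubnP (size (trees_bits ds)).
elim: n ds u => // n IH [|d ds] u; first by move=> _; case: b {IH}; apply: runs_whileF.
rewrite /trees_bits /= size_cat => hn.
case: d hn => [|d1 d2] /= hn.
- have {}IH := IH ds (inl false :: u) (ltac:(rewrite /trees_bits; lia)).
  apply: (@runs_le _ _ _ (5 + (7 * size (trees_bits ds) + 1)).+1).
    by rewrite /trees_bits; lia.
  apply: (runs_whileT (m' := pulled_store b inp (bit_stack (trees_bits ds) ++ r) (inl false :: u) v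
     (nseq (size ds) (inl true)))); first by case: b {IH}.
    case: b {IH}; apply: runs_if; rewrite /is_bit /=;
      apply: (@runs_seq _ _ _ _ 1 _ 3); try (by apply/runs_exec/ExecPop);
      apply: (@runs_seq _ _ _ _ 2 _ 1); try (by apply/runs_exec/ExecPush);
      by apply/runs_exec/ExecPop.
  by rewrite rev_cons cat_rcons.
- have {}IH := IH (d1 :: d2 :: ds) (inl true :: u)
    (ltac:(rewrite /trees_bits /= !size_cat; move: hn; rewrite size_cat; lia)).
  apply: (@runs_le _ _ _ (6 + (7 * size (trees_bits (d1 :: d2 :: ds)) + 1)).+1).
    by rewrite /trees_bits /= !size_cat; lia.
  apply: (runs_whileT (m' := pulled_store b inp (bit_stack (trees_bits (d1 :: d2 :: ds)) ++ r)
     (inl true :: u) v (nseq (size ds).+2 (inl true)))); first by case: b {IH}.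
    rewrite /trees_bits /= !catA.
    case: b {IH}; apply: runs_if; rewrite /is_bit /=;
      apply: (@runs_seq _ _ _ _ 1 _ 4); try (by apply/runs_exec/ExecPop);
      apply: (@runs_seq _ _ _ _ 2 _ 2); by apply/runs_exec/ExecPush.
  by congr (runs _ _ _ _): IH; rewrite /trees_bits /= rev_cons cat_rcons !catA.
Qed.

Definition pull b : prog := Seq (Push Counter (inl true)) (pull_loop b).

Lemma runs_pull b d r inp u v :
  runs (pull b) (pulled_store b inp (bit_stack (tree_bits d) ++ r) u v [::]) (7 * tree_size d + 3)
    (pulled_store b inp r (rev (bit_stack (tree_bits d)) ++ u) v [::]).
Proof.
apply: (@runs_le _ _ _ (2 + (7 * tree_size d + 1))); first by lia.
apply: (runs_seq (m' := pulled_store b inp (bit_stack (tree_bits d) ++ r) u v [:: inl true])).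
  by case: b; apply/runs_exec/ExecPush.
by have := runs_pull_loop b [:: d] r inp u v; rewrite /trees_bits /= cats0.
Qed.

Definition clean_store (main : seq S) inp : store S := Mem inp main [::] [::] [::].

Lemma runs_dump_rev i s m : reg_index i != reg_index Main -> get_reg i m = rev (bit_stack s) ->
  runs (dump i Main) m (5 * size s + 1)
    (set_reg i [::] (set_reg Main (bit_stack s ++ get_reg Main m) m)).
Proof.
move=> hi h; have hs : get_reg i m = bit_stack (rev s) by rewrite h /bit_stack map_rev.
by have := runs_dump hi hs; rewrite size_rev /bit_stack map_rev revK.
Qed.

Lemma ScratchX_neq_Main : reg_index ScratchX != reg_index Main.
Proof. by rewrite -val_eqE /= !inordK. Qed.
Lemma ScratchY_neq_Main : reg_index ScratchY != reg_index Main.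
Proof. by rewrite -val_eqE /= !inordK. Qed.
Lemma ScratchY_neq_ScratchX : reg_index ScratchY != reg_index ScratchX.
Proof. by rewrite -val_eqE /= !inordK. Qed.

Definition Swap : prog :=
  Seq (pull true) (Seq (pull false) (Seq (dump ScratchX Main) (dump ScratchY Main))).

Lemma runs_swap d1 d2 r inp :
  runs Swap (clean_store (bit_stack (tree_bits d1) ++ bit_stack (tree_bits d2) ++ r) inp)
    (12 * tree_size d1 + 12 * tree_size d2 + 8)
    (clean_store (bit_stack (tree_bits d2) ++ bit_stack (tree_bits d1) ++ r) inp).
Proof.
apply: (@runs_le _ _ _ ((7 * tree_size d1 + 3) + ((7 * tree_size d2 + 3) +
  ((5 * tree_size d1 + 1) + (5 * tree_size d2 + 1))))); first by lia.
apply: runs_seq; first exact: (runs_pull true d1).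
rewrite cats0; apply: runs_seq; first exact: (runs_pull false d2).
rewrite cats0; apply: runs_seq;
  first exact: (@runs_dump_rev ScratchX (tree_bits d1) _ ScratchX_neq_Main).
exact: (@runs_dump_rev ScratchY (tree_bits d2) _ ScratchY_neq_Main).
Qed.

Definition clear (i : reg) : prog := While i nonempty (Pop _ i).

Lemma runs_clear i m : runs (clear i) m (2 * size (get_reg i m) + 1) (set_reg i [::] m).
Proof.
move e: (get_reg i m) => s; elim: s m e => [|a s IH] m e.
  have -> : set_reg i [::] m = m by case: m e => ? ? ? ? ?; case: i => /= ->.
  by apply: runs_whileF; rewrite e.
apply: (@runs_le _ _ _ (1 + (2 * size s + 1)).+1); first by rewrite /=; lia.
have := IH (set_reg i s m); rewrite get_set_reg eqxx => /(_ erefl) rest.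
apply: (runs_whileT (m' := set_reg i s m)); first by rewrite e.
  by have := ExecPop i m; rewrite e; exact: runs_exec.
by congr (runs _ _ _ _): rest; case: m {e}; case: i {IH}.
Qed.

Definition Drop : prog := Seq (pull true) (clear ScratchX).

Lemma runs_drop d r inp :
  runs Drop (clean_store (bit_stack (tree_bits d) ++ r) inp) (9 * tree_size d + 4)
    (clean_store r inp).
Proof.
apply: (@runs_le _ _ _ ((7 * tree_size d + 3) + (2 * tree_size d + 1))); first by lia.
apply: runs_seq; first exact: (runs_pull true d).
have := runs_clear ScratchX (Mem inp r (rev (bit_stack (tree_bits d))) [::] [::]).
by rewrite cats0 /= size_rev size_map.
Qed.

Definition restore_copy : prog :=
  While ScratchX nonempty
    (If ScratchX (is_bit true)
      (Seq (Pop _ ScratchX) (Seq (Push Main (inl true)) (Push ScratchY (inl true))))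
      (Seq (Pop _ ScratchX) (Seq (Push Main (inl false)) (Push ScratchY (inl false))))).

Lemma runs_restore_copy inp main s y c :
  runs restore_copy (Mem inp main (bit_stack s) y c) (7 * size s + 1)
    (Mem inp (rev (bit_stack s) ++ main) [::] (rev (bit_stack s) ++ y) c).
Proof.
elim: s main y => [|b s IH] main y; first exact: runs_whileF.
apply: (@runs_le _ _ _ (6 + (7 * size s + 1)).+1); first by rewrite /=; lia.
rewrite /= rev_cons !cat_rcons; apply: runs_whileT (IH _ _) => //.
by case: b; apply: runs_if; rewrite /is_bit /=;
  (apply: (@runs_seq _ _ _ _ 1 _ 4); first exact/runs_exec/ExecPop);
  apply: (@runs_seq _ _ _ _ 2 _ 2); apply/runs_exec/ExecPush.
Qed.

Definition Dup : prog :=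
  Seq (pull true) (Seq restore_copy (Seq (dump ScratchY ScratchX) (dump ScratchX Main))).

Lemma runs_dup d r inp :
  runs Dup (clean_store (bit_stack (tree_bits d) ++ r) inp) (24 * tree_size d + 6)
    (clean_store (bit_stack (tree_bits d) ++ bit_stack (tree_bits d) ++ r) inp).
Proof.
apply: (@runs_le _ _ _ ((7 * tree_size d + 3) + ((7 * tree_size d + 1) +
  ((5 * tree_size d + 1) + (5 * tree_size d + 1))))); first by lia.
apply: runs_seq; first exact: (runs_pull true d).
rewrite cats0; apply: runs_seq.
  have := runs_restore_copy inp r (rev (tree_bits d)) [::] [::].
  by rewrite size_rev /bit_stack map_rev revK; apply.
rewrite cats0; apply: runs_seq;
  first exact: (@runs_dump ScratchY ScratchX (tree_bits d) _ ScratchY_neq_ScratchX).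
rewrite /= cats0; exact: (@runs_dump_rev ScratchX (tree_bits d) _ ScratchX_neq_Main).
Qed.

Definition compare_bit (b : bool) : prog :=
  Seq (Pop _ ScratchX) (If ScratchY (is_bit b) (Pop _ ScratchY)
    (Seq (Pop _ ScratchY) (Push Counter (inl true)))).

Definition compare_bits : prog := If ScratchX (is_bit true) (compare_bit true) (compare_bit false).

Lemma runs_compare_bits inp main b u v c :
  runs compare_bits (Mem inp main (bit_stack (b :: u)) (bit_stack v) (nseq c (inl true))) 6
    (Mem inp main (bit_stack u) (bit_stack (behead v))
      (nseq ((ohead v != Some b) + c) (inl true))).
Proof.
have pop_Y : exec (Pop _ ScratchY)
    (Mem inp main (bit_stack u) (bit_stack v) (nseq c (inl true))) 1
    (Mem inp main (bit_stack u) (bit_stack (behead v)) (nseq c (inl true))).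
  by case: v => [|x v]; exact: ExecPop.
have compared : runs (compare_bit b)
    (Mem inp main (bit_stack (b :: u)) (bit_stack v) (nseq c (inl true))) 5
    (Mem inp main (bit_stack u) (bit_stack (behead v))
      (nseq ((ohead v != Some b) + c) (inl true))).
  apply: (@runs_seq _ _ _ _ 1 _ 4); first exact/runs_exec/ExecPop.
  have headE : is_bit b (ohead (bit_stack v)) = (ohead v == Some b).
    by case: (v) => [|[] ?]; case: (b).
  apply: runs_if; rewrite /= headE; case: eqP => _; first exact: runs_le (runs_exec pop_Y).
  by apply: (@runs_seq _ _ _ _ 1 _ 2 _ (runs_exec pop_Y)); exact/runs_exec/ExecPush.
by apply: runs_if; case: b compared.
Qed.

Definition compare_loop : prog := While ScratchX nonempty compare_bits.

(* The counter is raised by the number of positions at which v differs from u. *)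
Lemma runs_compare_loop inp main u v c : exists k,
  runs compare_loop (Mem inp main (bit_stack u) (bit_stack v) (nseq c (inl true)))
    (7 * size u + 1)
    (Mem inp main [::] (bit_stack (drop (size u) v)) (nseq (k + c) (inl true)))
  /\ (k == 0) = (take (size u) v == u) /\ k <= size u.
Proof.
elim: u v c => [|b u IH] v c.
  by exists 0; split; [rewrite drop0; apply: runs_whileF | rewrite take0 eqxx].
have [k [rest [k_eq0 le_k]]] := IH (behead v) ((ohead v != Some b) + c).
exists (k + (ohead v != Some b)); split; last split.
- apply: (@runs_le _ _ _ (6 + (7 * size u + 1)).+1); first by rewrite /=; lia.
  have -> : drop (size (b :: u)) v = drop (size u) (behead v) by case: v {rest k_eq0}.
  by rewrite -addnA; apply: runs_whileT rest => //; exact: runs_compare_bits.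
- rewrite addn_eq0 k_eq0; case: v {rest k_eq0} => [|x v] /=; first by case: u {IH le_k}.
  by rewrite eqseq_cons eqb0 negbK (inj_eq Some_inj) andbC.
- by rewrite /= -addn1 leq_add // leq_b1.
Qed.

Definition count_rest : prog :=
  While ScratchY nonempty (Seq (Pop _ ScratchY) (Push Counter (inl true))).

Lemma runs_count_rest inp main s c :
  runs count_rest (Mem inp main [::] (bit_stack s) (nseq c (inl true))) (4 * size s + 1)
    (Mem inp main [::] [::] (nseq (size s + c) (inl true))).
Proof.
elim: s c => [|x s IH] c; first exact: runs_whileF.
apply: (@runs_le _ _ _ (3 + (4 * size s + 1)).+1); first by rewrite /=; lia.
rewrite [size (x :: s)]/= [(size s).+1 + c]addSnnS; apply: runs_whileT (IH _) => //.
by apply: (@runs_seq _ _ _ _ 1 _ 2); apply: runs_exec; [exact: ExecPop | exact: ExecPush].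
Qed.

Definition push_zero_test : prog :=
  If Counter nonempty (Seq (clear Counter) (Push Main (inl false)))
    (Seq (Push Main (inl false)) (Seq (Push Main (inl false)) (Push Main (inl true)))).

Lemma runs_push_zero_test inp main c :
  runs push_zero_test (Mem inp main [::] [::] (nseq c (inl true))) (2 * c + 10)
    (clean_store (bit_stack (tree_bits (tree_bool (c == 0))) ++ main) inp).
Proof.
apply: (@runs_le _ _ _ (2 * c + 9).+1); first by lia.
apply: runs_if; case: c => [|c] /=.
  apply: (@runs_le _ _ _ (2 + (2 + 2))) => //.
  by do 2?(apply: runs_seq; first exact/runs_exec/ExecPush); exact/runs_exec/ExecPush.
apply: (@runs_le _ _ _ ((2 * c.+1 + 1) + 2)); first by lia.
apply: (runs_seq (m' := clean_store main inp)); last exact/runs_exec/ExecPush.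
by have := runs_clear Counter (Mem inp main [::] [::] (nseq c.+1 (inl true))); rewrite /= size_nseq.
Qed.

Definition Compare : prog :=
  Seq (Pop _ Main) (Seq (pull true) (Seq (pull false)
    (Seq compare_loop (Seq count_rest push_zero_test)))).

Lemma runs_compare a b r inp :
  runs Compare (clean_store (bit_stack (tree_bits (Node a b)) ++ r) inp)
    (30 * (tree_size (Node a b)) + 30)
    (clean_store (bit_stack (tree_bits (tree_bool (tree_bits a == tree_bits b))) ++ r) inp).
Proof.
have [k [looped [k_eq0 le_k]]] := runs_compare_loop inp r (rev (tree_bits a)) (rev (tree_bits b)) 0.
rewrite size_rev addn0 in looped k_eq0 le_k.
set rest := drop (size (tree_bits a)) (rev (tree_bits b)) in looped.
have equal : (size rest + k == 0) = (tree_bits a == tree_bits b).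
  rewrite addn_eq0 k_eq0 size_eq0 /rest.
  have -> : (tree_bits a == tree_bits b) = (rev (tree_bits b) == rev (tree_bits a)).
    by rewrite (inj_eq (can_inj revK)) eq_sym.
  apply/andP/eqP => [[/eqP no_rest /eqP same]|->].
    by rewrite -[rev (tree_bits b)](cat_take_drop (size (tree_bits a))) same no_rest cats0.
  by rewrite -(size_rev (tree_bits a)) drop_size take_size.
have rest_size : size rest <= tree_size b by rewrite /rest size_drop size_rev leq_subr.
apply: (@runs_le _ _ _ (1 + ((7 * tree_size a + 3) + ((7 * tree_size b + 3) +
  ((7 * tree_size a + 1) + ((4 * size rest + 1) + (2 * (size rest + k) + 10))))))).
  by rewrite tree_size_Node; move: rest_size le_k; rewrite /tree_size; lia.
apply: (runs_seq (m' := clean_store (bit_stack (tree_bits a) ++ bit_stack (tree_bits b) ++ r) inp)).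
  by rewrite /= /bit_stack map_cat -catA; apply/runs_exec/ExecPop.
apply: runs_seq; first exact: (runs_pull true a).
rewrite cats0; apply: runs_seq; first exact: (runs_pull false b).
rewrite cats0; apply: runs_seq; first by move: looped; rewrite /bit_stack !map_rev; apply.
by apply: runs_seq (runs_count_rest _ _ _ _) _; rewrite -equal; exact: runs_push_zero_test.
Qed.

End TreePrograms.

Arguments bit_stack {X} s.
Arguments Swap {X}.
Arguments Drop {X}.
Arguments Dup {X}.
Arguments Compare {X}.
Arguments Skip {X}.
Arguments is_bit {X} b.
Arguments Pop {S} r.

Class Enc (T : Type) := enc : T -> tree.

#[export] Instance enc_unit : Enc unit := fun _ => Leaf.
#[export] Instance enc_bool : Enc bool := tree_bool.
#[export] Instance enc_pair (A B : Type) `{Enc A} `{Enc B} : Enc (A * B) :=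
  fun x => Node (enc x.1) (enc x.2).
#[export] Instance enc_seq (A : Type) `{Enc A} : Enc (seq A) :=
  fix f s := if s is x :: s' then Node (enc x) (f s') else Leaf.
#[export] Instance enc_nat : Enc nat :=
  fix f n := if n is m.+1 then Node Leaf (f m) else Leaf.
Definition enc_fin (F : finType) : Enc F := fun x => enc (index x (enum F)).
Arguments enc_fin : clear implicits.

Class EncInj (T : Type) {eT : Enc T} := enc_inj : injective (enc (T := T)).
Arguments EncInj T {eT}.

#[export] Instance enc_bool_inj : EncInj bool.
Proof. by case; case. Qed.

#[export] Instance enc_pair_inj (A B : Type) `{EncInj A} `{EncInj B} :
  EncInj (A * B).
Proof.
move=> [a b] [c d] h; congr pair; apply: enc_inj.
  exact: (congr1 tree_left h).
exact: (congr1 tree_right h).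
Qed.

#[export] Instance enc_seq_inj (A : Type) `{EncInj A} : EncInj (seq A).
Proof.
elim=> [|x s IH] [|y t] //= h; congr cons; last exact: IH (congr1 tree_right h).
by apply: enc_inj; exact: (congr1 tree_left h).
Qed.

#[export] Instance enc_nat_inj : EncInj nat.
Proof. by elim=> [|m IH] [|n] //= [/IH ->]. Qed.

Lemma enc_fin_inj (F : finType) : @EncInj F (enc_fin F).
Proof.
move=> x y /(@enc_nat_inj (index x (enum F)) (index y (enum F))).
by apply: (index_inj x); rewrite mem_enum.
Qed.

Definition enc_size (A : Type) `{Enc A} (x : A) : nat := tree_size (enc x).

Lemma enc_size_gt0 (A : Type) `{Enc A} (x : A) : 0 < enc_size x.
Proof. by rewrite /enc_size /tree_size; case: (enc x). Qed.

Lemma enc_size_pair (A B : Type) `{Enc A} `{Enc B} (x : A) (y : B) :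
  enc_size (x, y) = (enc_size x + enc_size y).+1.
Proof. exact: tree_size_Node. Qed.

Lemma enc_size_cons (A : Type) `{Enc A} (x : A) (s : seq A) :
  enc_size (x :: s) = (enc_size x + enc_size s).+1.
Proof. exact: tree_size_Node. Qed.

Lemma enc_size_nat (n : nat) : enc_size n = (2 * n).+1.
Proof.
elim: n => // n IH; have -> : enc_size n.+1 = (1 + enc_size n).+1 by exact: tree_size_Node.
by rewrite IH; lia.
Qed.

Lemma enc_size_bool (b : bool) : enc_size b = (2 * b).+1.
Proof. by case: b. Qed.

Lemma enc_size_nil (A : Type) `{Enc A} : enc_size (Nil A) = 1.
Proof. by []. Qed.

Lemma size_lt_enc_size (A : Type) `{Enc A} (s : seq A) : size s < enc_size s.
Proof.
elim: s => // x s IH; rewrite enc_size_cons /= !ltnS.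
by apply: leq_trans IH _; apply: leq_addl.
Qed.

Lemma enc_size_cat (A : Type) `{Enc A} (s t : seq A) :
  (enc_size (s ++ t)).+1 = enc_size s + enc_size t.
Proof. by elim: s => [|x s IH] //=; rewrite !enc_size_cons; lia. Qed.

Lemma enc_size_rev (A : Type) `{Enc A} (s : seq A) : enc_size (rev s) = enc_size s.
Proof.
elim: s => // x s IH; rewrite rev_cons -cats1.
have : (enc_size (rev s ++ [:: x])).+1 = enc_size (rev s) + enc_size [:: x].
  exact: enc_size_cat.
by rewrite IH !enc_size_cons enc_size_nil; lia.
Qed.

(** * Polynomial-time functions on encoded data *)

Definition ptime (A B : Type) `{Enc A} `{Enc B} (f : A -> B) : Prop :=
  exists k, (forall x, enc_size (f x) <= (enc_size x + 2) ^ k) /\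
  forall X : finType, exists p : prog (bool + X)%type, forall x r inp,
    runs p (clean_store (bit_stack (tree_bits (enc x)) ++ r) inp) ((enc_size x + 2) ^ k)
           (clean_store (bit_stack (tree_bits (enc (f x))) ++ r) inp).

Lemma ptime_intro (A B : Type) `{Enc A} `{Enc B} (f : A -> B) t t' :
  poly_bounded t -> poly_bounded t' -> (forall x, enc_size (f x) <= t (enc_size x)) ->
  (forall X : finType, exists p : prog (bool + X)%type, forall x r inp,
    runs p (clean_store (bit_stack (tree_bits (enc x)) ++ r) inp) (t' (enc_size x))
           (clean_store (bit_stack (tree_bits (enc (f x))) ++ r) inp)) ->
  ptime f.
Proof.
move=> [k hk] [l hl] hs hp; exists (maxn k l); split=> [x|X].
  exact: leq_trans (hs x) (leq_trans (hk _) (leq_expn_addn2 _ (leq_maxl _ _))).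
have [p h] := hp X; exists p => x r inp; apply: runs_le (h _ _ _).
exact: leq_trans (hl _) (leq_expn_addn2 _ (leq_maxr _ _)).
Qed.

Ltac poly_bound := repeat first
  [ exact: poly_bounded_cst | exact: poly_bounded_id | apply: poly_boundedD | apply: poly_boundedM
  | apply: poly_boundedX ].

Lemma ptime_id (A : Type) `{Enc A} : ptime (fun x : A => x).
Proof.
apply: (@ptime_intro _ _ _ _ _ id (fun _ => 1)); try by poly_bound.
by move=> X; exists Skip => x r inp; apply: runs_skip.
Qed.

Arguments ptime_id {A H}.

Lemma ptime_comp (A B C : Type) `{Enc A} `{Enc B} `{Enc C} (g : B -> C)
  (f : A -> B) : ptime g -> ptime f -> ptime (fun x => g (f x)).
Proof.
move=> [l [hg pg]] [k [hf pf]].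
have h n x : ((enc_size (f x) + 2) ^ n <= ((enc_size x + 2) ^ k + 2) ^ n).
  by case: n => // n; rewrite leq_exp2r // leq_add2r.
apply: (@ptime_intro _ _ _ _ _ (fun n => ((n + 2) ^ k + 2) ^ l)
   (fun n => (n + 2) ^ k + ((n + 2) ^ k + 2) ^ l)); try by poly_bound.
  by move=> x; apply: leq_trans (hg _) (h _ _).
move=> X; have [p hp] := pf X; have [q hq] := pg X; exists (Seq p q) => x r inp.
apply: runs_seq (hp _ _ _) _; exact: runs_le (h _ _) (hq _ _ _).
Qed.

Lemma ptime_pair (A B C : Type) `{Enc A} `{Enc B} `{Enc C} (f : A -> B)
  (g : A -> C) : ptime f -> ptime g -> ptime (fun x => (f x, g x)).
Proof.
move=> [k [hf pf]] [l [hg pg]].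
apply: (@ptime_intro _ _ _ _ _ (fun n => (n + 2) ^ k + (n + 2) ^ l + 1)
  (fun n => (24 * n + 6) + ((n + 2) ^ l + ((12 * (n + 2) ^ l + 12 * n + 8) +
     ((n + 2) ^ k + 2))))); try by poly_bound.
  by move=> x; rewrite enc_size_pair addn1 ltnS leq_add.
move=> X; have [p hp] := pf X; have [q hq] := pg X.
exists (Seq Dup (Seq q (Seq Swap (Seq p (Push Main (inl true)))))) => x r inp.
apply: runs_seq (runs_dup _ _ _) _; apply: runs_seq (hq _ _ _) _.
apply: (runs_seq (m' := clean_store (bit_stack (tree_bits (enc x)) ++
   bit_stack (tree_bits (enc (g x))) ++ r) inp)).
  apply: runs_le (runs_swap _ _ _ _); rewrite -!/(enc_size _) leq_add2r leq_add2r.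
  by rewrite leq_mul2l hg orbT.
apply: runs_seq (hp _ _ _) _; rewrite /= /bit_stack map_cat -catA.
exact/runs_exec/ExecPush.
Qed.

Lemma ptime_fst (A B C : Type) `{Enc A} `{Enc B} `{Enc C} (f : A -> B * C) :
  ptime f -> ptime (fun x => (f x).1).
Proof.
apply: (ptime_comp (g := fst)).
apply: (@ptime_intro _ _ _ _ _ id (fun n => 1 + ((12 * n + 8) + (9 * n + 4))));
  try by poly_bound.
  by case=> x y; rewrite enc_size_pair -addnS leq_addr.
move=> X; exists (Seq (Pop Main) (Seq Swap Drop)) => -[x y] r inp.
apply: (runs_seq (m' :=
  clean_store (bit_stack (tree_bits (enc x)) ++ bit_stack (tree_bits (enc y)) ++ r)
  inp)).
  by rewrite /= /bit_stack map_cat -catA; apply/runs_exec/ExecPop.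
apply: runs_seq; first by
  apply: runs_le (runs_swap _ _ _ _); rewrite enc_size_pair -!/(enc_size _); lia.
by apply: runs_le (runs_drop _ _ _); rewrite enc_size_pair -!/(enc_size _); lia.
Qed.

Lemma ptime_snd (A B C : Type) `{Enc A} `{Enc B} `{Enc C} (f : A -> B * C) :
  ptime f -> ptime (fun x => (f x).2).
Proof.
apply: (ptime_comp (g := snd)).
apply: (@ptime_intro _ _ _ _ _ id (fun n => 1 + (9 * n + 4))); try by poly_bound.
  by case=> x y; rewrite enc_size_pair -addSn leq_addl.
move=> X; exists (Seq (Pop Main) Drop) => -[x y] r inp.
apply: (runs_seq (m' :=
  clean_store (bit_stack (tree_bits (enc x)) ++ bit_stack (tree_bits (enc y)) ++ r)
  inp)).
  by rewrite /= /bit_stack map_cat -catA; apply/runs_exec/ExecPop.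
by apply: runs_le (runs_drop _ _ _); rewrite enc_size_pair -!/(enc_size _); lia.
Qed.

Fixpoint push_bits (X : finType) (s : seq bool) : prog (bool + X)%type :=
  if s is b :: s' then Seq (push_bits X s') (Push Main (inl b)) else Skip.

Lemma runs_push_bits (X : finType) s r inp :
  runs (push_bits X s) (clean_store r inp) (2 * size s + 1)
    (clean_store (bit_stack s ++ r) inp).
Proof.
elim: s => [|b s IH] /=; first exact: runs_skip.
apply: (@runs_le _ _ _ ((2 * size s + 1) + 2)); first by lia.
by apply: runs_seq IH _; apply/runs_exec/ExecPush.
Qed.

Lemma ptime_const (A B : Type) `{Enc A} `{Enc B} (b : B) :
  ptime (fun _ : A => b).
Proof.
apply: (@ptime_intro _ _ _ _ _ (fun _ => enc_size b)
  (fun n => (9 * n + 4) + (2 * enc_size b + 1))); try by poly_bound.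
move=> X; exists (Seq Drop (push_bits X (tree_bits (enc b)))) => x r inp.
by apply: runs_seq; [exact: runs_drop | exact: runs_push_bits].
Qed.

Lemma ptime_if_node (A B C : Type) `{Enc A} `{Enc B} `{Enc C} (c : A -> B)
  (f g : A -> C) : ptime c -> ptime f -> ptime g ->
  ptime (fun x => if enc (c x) is Node _ _ then f x else g x).
Proof.
move=> [m [hc pc]] [k [hf pf]] [l [hg pg]].
apply: (@ptime_intro _ _ _ _ _ (fun n => (n + 2) ^ k + (n + 2) ^ l)
  (fun n => (24 * n + 6) + ((n + 2) ^ m + ((9 * (n + 2) ^ m + 4) +
    ((n + 2) ^ k + (n + 2) ^ l) + 1)))); try by poly_bound.
  move=> x; case: (enc (c x)) => [|? ?].
    exact: leq_trans (hg x) (leq_addl _ _).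
  exact: leq_trans (hf x) (leq_addr _ _).
move=> X; have [p hp] := pf X; have [q hq] := pg X; have [u hu] := pc X.
exists (Seq Dup (Seq u (If Main (is_bit true) (Seq Drop p) (Seq Drop q)))).
move=> x r inp; apply: runs_seq (runs_dup _ _ _) _.
apply: runs_seq (hu _ _ _) _; rewrite addn1; apply: runs_if.
have hd : runs Drop
  (clean_store (bit_stack (tree_bits (enc (c x))) ++ bit_stack (tree_bits (enc x)) ++ r)
   inp) (9 * (enc_size x + 2) ^ m + 4) (@clean_store X (bit_stack (tree_bits (enc x)) ++ r) inp).
  by apply: runs_le (runs_drop _ _ _); rewrite leq_add2r leq_mul2l hc orbT.
rewrite /is_bit /=; case: (enc (c x)) hd => [|a b] hd /=; apply: runs_seq hd _.
  by apply: runs_le (hq _ _ _); apply: leq_addl.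
by apply: runs_le (hp _ _ _); apply: leq_addr.
Qed.

Lemma ptime_eq_enc (A B C : Type) `{Enc A} `{Enc B} `{Enc C} (f : A -> B)
  (g : A -> C) : (forall x, enc (f x) = enc (g x)) -> ptime f -> ptime g.
Proof.
move=> e [k [hf pf]]; exists k; split=> [x|X]; first by rewrite /enc_size -e; apply: hf.
by have [p hp] := pf X; exists p => x r inp; rewrite -e.
Qed.

Lemma ptime_ext (A B : Type) `{Enc A} `{Enc B} (f g : A -> B) :
  f =1 g -> ptime f -> ptime g.
Proof. by move=> e; apply: ptime_eq_enc => x; rewrite e. Qed.

Lemma ptime_if (A C : Type) `{Enc A} `{Enc C} (c : A -> bool) (f g : A -> C) :
  ptime c -> ptime f -> ptime g -> ptime (fun x => if c x then f x else g x).
Proof.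
move=> hc hf hg; apply: ptime_ext (ptime_if_node hc hf hg) => x.
by case: (c x).
Qed.

Lemma ptime_eq (A : Type) (B : eqType) `{Enc A} `{EncInj B} (f g : A -> B) :
  ptime f -> ptime g -> ptime (fun x => f x == g x).
Proof.
move=> hf hg.
apply: (ptime_comp (g := fun p : B * B => p.1 == p.2) (f := fun x => (f x, g x)));
  last exact: ptime_pair.
apply: (@ptime_intro _ _ _ _ _ (fun n => 3) (fun n => 30 * n + 30)); try by poly_bound.
  by move=> [a b]; rewrite /enc_size /= /enc /enc_bool; case: (a == b).
move=> X; exists Compare => -[a b] r inp.
have -> : enc ((a, b).1 == (a, b).2) = tree_bool (tree_bits (enc a) == tree_bits (enc b)).
  congr tree_bool; apply/eqP/eqP => [/= -> //|/tree_bits_inj h]; exact: enc_inj.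
exact: runs_compare.
Qed.

Lemma ptime_cons (A B : Type) `{Enc A} `{Enc B} (f : A -> B) (g : A -> seq B) :
  ptime f -> ptime g -> ptime (fun x => f x :: g x).
Proof. by move=> hf hg; apply: ptime_eq_enc (ptime_pair hf hg). Qed.

Lemma ptime_succ (A : Type) `{Enc A} (f : A -> nat) :
  ptime f -> ptime (fun x => (f x).+1).
Proof. by move=> hf; apply: ptime_eq_enc (ptime_pair (ptime_const tt) hf). Qed.

Lemma ptime_seq_case (A B C : Type) `{Enc A} `{Enc B} `{Enc C} (l : A -> seq B)
  (n : A -> C) (c : A * (B * seq B) -> C) : ptime l -> ptime n -> ptime c ->
  ptime (fun x => if l x is y :: s then c (x, (y, s)) else n x).
Proof.
move=> [m [hl pl]] [k [hn pn]] [j [hc pc]].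
pose N n := n + (n + 2) ^ m + 1.
have hN i x y s : l x = y :: s ->
    (enc_size (x, (y, s)) + 2) ^ i <= (N (enc_size x) + 2) ^ i.
  move=> e; case: i => // i; rewrite leq_exp2r // leq_add2r /N enc_size_pair addn1 ltnS.
  by rewrite leq_add2l; have := hl x; rewrite e.
apply: (@ptime_intro _ _ _ _ _ (fun n => (n + 2) ^ k + (N n + 2) ^ j)
  (fun n => (24 * n + 6) + ((n + 2) ^ m + ((12 * (n + 2) ^ m + 12 * n + 8) +
    ((n + 2) ^ k + (2 + (N n + 2) ^ j)) + 1)))); rewrite /N; try by poly_bound.
  move=> x; case E: (l x) => [|y s].
    exact: leq_trans (hn x) (leq_addr _ _).
  exact: leq_trans (hc _) (leq_trans (hN _ _ _ _ E) (leq_addl _ _)).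
move=> X; have [p hp] := pl X; have [q hq] := pn X; have [u hu] := pc X.
exists (Seq Dup (Seq p (If Main (is_bit true)
  (Seq Swap (Seq (Push Main (inl true)) u)) (Seq Drop q)))).
move=> x r inp; apply: runs_seq (runs_dup _ _ _) _.
apply: runs_seq (hp _ _ _) _; rewrite addn1; apply: runs_if.
rewrite /is_bit; case E: (l x) => [|y s].
  rewrite /=; apply: runs_seq; last first.
    by apply: runs_le (hq _ _ _); apply: leq_addr.
  apply: runs_le (runs_drop Leaf _ _); rewrite /tree_size /=.
  by have := expn_gt0 (enc_size x + 2) m; rewrite {1}addn2; lia.
apply: (runs_seq (m' := clean_store (bit_stack (tree_bits (enc x)) ++
   bit_stack (tree_bits (enc (y, s))) ++ r) inp)).
  apply: runs_le (runs_swap (enc (y, s)) _ _ _); rewrite leq_add2r leq_add2r.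
  by rewrite leq_mul2l; have := hl x; rewrite E => ->.
apply: (@runs_le _ _ _ (2 + (enc_size (x, (y, s)) + 2) ^ j)).
  by apply: leq_trans (leq_addl _ _); rewrite leq_add2l; apply: hN.
apply: runs_seq; first exact/runs_exec/ExecPush.
by have := hu (x, (y, s)) r inp; rewrite /= /bit_stack map_cat -catA.
Qed.

Lemma ptime_nat_case (A C : Type) `{Enc A} `{Enc C} (f : A -> nat)
  (n : A -> C) (c : A * nat -> C) : ptime f -> ptime n -> ptime c ->
  ptime (fun x => if f x is m.+1 then c (x, m) else n x).
Proof.
move=> hf hn hc.
have e k : enc (nseq k tt) = enc k.
  by elim: k => // k IH; rewrite -[RHS]/(Node Leaf (enc k)) -IH.
apply: ptime_ext (ptime_seq_case (l := fun x => nseq (f x) tt)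
  (c := fun p => c (p.1, size p.2.2)) _ hn _) => [x||].
- by case: (f x) => //= k; rewrite size_nseq.
- by apply: ptime_eq_enc hf => x; rewrite e.
- apply: (ptime_comp (g := c)) => //; apply: ptime_pair; first exact: ptime_fst ptime_id.
  have hs : ptime (fun s : seq unit => size s).
    apply: ptime_eq_enc (ptime_id (A := seq unit)) => s.
    by rewrite -e; congr enc; elim: s => // [[] s /= {1}->].
  exact: ptime_comp hs (ptime_snd (ptime_snd ptime_id)).
Qed.

Section Foldl.
Variables (E A X : Type).
Context `{Enc E} `{Enc A} `{Enc X}.
Variable step : E -> A -> X -> A.

Definition growth_bounded := exists2 q, poly_bounded q &
  forall e a x, enc_size (step e a x) <= enc_size a + q (enc_size e + enc_size x).

Definition grows_within (k : nat) := forall e a x n, enc_size e + enc_size x <= n ->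
  enc_size (step e a x) <= enc_size a + (n + 2) ^ k.

Lemma growth_boundedP : growth_bounded -> exists k, grows_within k.
Proof.
case=> q [k le_q] growth; exists k => e a x n le_n; apply: leq_trans (growth _ _ _) _.
rewrite leq_add2l; apply: leq_trans (le_q _) _.
by case: (k) => // k'; rewrite leq_exp2r // leq_add2r.
Qed.

Lemma enc_size_foldl k n e s a : grows_within k -> enc_size e + enc_size s <= n ->
  enc_size (foldl (step e) a s) <= enc_size a + size s * (n + 2) ^ k.
Proof.
move=> growth; elim: s a => [|x s IH] a /=; first by rewrite mul0n addn0.
rewrite enc_size_cons => le_n; apply: leq_trans (IH _ _) _; first by lia.
by have := growth e a x n (ltac:(lia)); rewrite mulSn; lia.
Qed.

Definition foldl_step (p : (X * seq X) * (E * A)) : seq X * (E * A) :=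
  (p.1.2, (p.2.1, step p.2.1 p.2.2 p.1.1)).

Lemma ptime_foldl_step : ptime (fun p : E * (A * X) => step p.1 p.2.1 p.2.2) -> ptime foldl_step.
Proof.
move=> step_ptime.
have left_part : ptime (fun p : (X * seq X) * (E * A) => p.1) by exact: ptime_fst ptime_id.
have right_part : ptime (fun p : (X * seq X) * (E * A) => p.2) by exact: ptime_snd ptime_id.
apply: ptime_pair (ptime_snd left_part) (ptime_pair (ptime_fst right_part) _).
exact: ptime_comp step_ptime (ptime_pair (ptime_fst right_part)
  (ptime_pair (ptime_snd right_part) (ptime_fst left_part))).
Qed.

Definition foldl_loop (Y : finType) (p : prog (bool + Y)%type) : prog (bool + Y)%type :=
  While Main (is_bit true) (Seq (Push Main (inl true)) (Seq p (Pop Main))).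

Lemma runs_foldl_loop (Y : finType) (p : prog (bool + Y)%type) k l n n' e t b r inp :
  grows_within k ->
  (forall q r inp, runs p (clean_store (bit_stack (tree_bits (enc q)) ++ r) inp)
    ((enc_size q + 2) ^ l) (clean_store (bit_stack (tree_bits (enc (foldl_step q))) ++ r) inp)) ->
  enc_size e + enc_size t <= n -> enc_size b + enc_size e + size t * (n + 2) ^ k <= n' ->
  runs (foldl_loop p)
    (clean_store (bit_stack (tree_bits (enc t)) ++ bit_stack (tree_bits (enc (e, b))) ++ r) inp)
    (size t * ((n + n' + 4) ^ l + 4) + 1)
    (clean_store (bit_stack (tree_bits (enc (Nil X))) ++
      bit_stack (tree_bits (enc (e, foldl (step e) b t))) ++ r) inp).
Proof.
move=> growth p_runs; elim: t b => [|x t IH] b; first by move=> _ _; apply: runs_whileF.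
rewrite enc_size_cons /= => le_n le_n'.
have next_size := growth e b x n (ltac:(lia)).
apply: (@runs_le _ _ _ ((2 + ((n + n' + 4) ^ l + 1)) + (size t * ((n + n' + 4) ^ l + 4) + 1)).+1).
  by rewrite mulSn; lia.
apply: runs_whileT (IH (step e b x) _ _) => //; try lia.
apply: runs_seq; first exact/runs_exec/ExecPush.
apply: (runs_seq (m' := clean_store (inl true :: bit_stack (tree_bits (enc t)) ++
  bit_stack (tree_bits (enc (e, step e b x))) ++ r) inp)); last exact/runs_exec/ExecPop.
have := p_runs ((x, t), (e, b)) r inp;
  rewrite /foldl_step /= /bit_stack !map_cat /= !map_cat -!catA.
rewrite /= -!catA; apply: runs_le; case: (l) => // l'; rewrite leq_exp2r //.
by rewrite !enc_size_pair; lia.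
Qed.

Lemma ptime_foldl_uncurried : ptime (fun p : E * (A * X) => step p.1 p.2.1 p.2.2) ->
  growth_bounded ->
  ptime (fun p : seq X * (E * A) => foldl (step p.2.1) p.2.2 p.1).
Proof.
move=> /ptime_foldl_step[l [_ step_prog]] /growth_boundedP[k growth].
pose bound n := n + n * (n + 2) ^ k.
apply: (@ptime_intro _ _ _ _ _ bound
  (fun n => 1 + ((n * ((n + bound n + 4) ^ l + 4) + 1) + (1 + (1 + (9 * n + 4))))));
  rewrite /bound; try by poly_bound.
  move=> [s [e a]] /=; have lt_s : size s < enc_size s by exact: size_lt_enc_size.
  apply: leq_trans (@enc_size_foldl k (enc_size (s, (e, a))) _ _ _ growth _) _.
    by rewrite !enc_size_pair; lia.
  rewrite leq_add //; first by rewrite !enc_size_pair; lia.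
  by apply: leq_mul => //; rewrite !enc_size_pair; lia.
move=> Y; have [p p_runs] := step_prog Y.
exists (Seq (Pop Main) (Seq (foldl_loop p) (Seq (Pop Main) (Seq (Pop Main) Drop)))).
move=> [s [e a]] r inp; set n := enc_size (s, (e, a)); rewrite -/(bound _).
have nE : n = (enc_size s + (enc_size e + enc_size a).+1).+1 by rewrite /n !enc_size_pair.
have lt_s : size s < enc_size s by exact: size_lt_enc_size.
apply: (runs_seq (m' := clean_store (bit_stack (tree_bits (enc s)) ++
  bit_stack (tree_bits (enc (e, a))) ++ r) inp)).
  by rewrite /= /bit_stack map_cat -catA; apply/runs_exec/ExecPop.
apply: runs_seq.
  apply: runs_le (@runs_foldl_loop _ p k l n (bound n) e s a r inp growth p_runs _ _).
  - by rewrite leq_add2r leq_mul2r; lia.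
  - by lia.
  - by rewrite /bound leq_add ?leq_mul2r; lia.
apply: runs_seq; first exact/runs_exec/ExecPop.
apply: runs_seq; first exact/runs_exec/ExecPop.
rewrite /= /bit_stack map_cat -catA.
by apply: runs_le (runs_drop (enc e) _ _); rewrite -/(enc_size _); lia.
Qed.

Lemma ptime_foldl (l : E -> seq X) (a : E -> A) :
  ptime (fun p : E * (A * X) => step p.1 p.2.1 p.2.2) -> growth_bounded ->
  ptime l -> ptime a -> ptime (fun e => foldl (step e) (a e) (l e)).
Proof.
move=> hs hg hl ha.
exact: ptime_comp (ptime_foldl_uncurried hs hg) (ptime_pair hl (ptime_pair ptime_id ha)).
Qed.

End Foldl.

Section Reversal.
Variables (E X : Type).
Context `{Enc E} `{Enc X}.

Lemma ptime_catrev (f g : E -> seq X) : ptime f -> ptime g -> ptime (fun e => catrev (f e) (g e)).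
Proof.
move=> hf hg.
apply: ptime_ext (ptime_foldl (step := fun (_ : E) (a : seq X) x => x :: a) _ _ hf hg) => [e||].
- by elim: (f e) (g e) => //= x s IH t; rewrite IH.
- exact: ptime_cons (ptime_snd (ptime_snd ptime_id)) (ptime_fst (ptime_snd ptime_id)).
- by exists (fun m => m + 1); [poly_bound | move=> e a x; rewrite enc_size_cons; lia].
Qed.

Lemma ptime_rev (f : E -> seq X) : ptime f -> ptime (fun e => rev (f e)).
Proof. by move=> hf; exact: ptime_catrev hf (ptime_const [::]). Qed.

End Reversal.

Lemma ptime_nth_fun (E C : Type) `{Enc E} `{Enc C} (g0 : E -> C) (gs : seq (E -> C)) :
  ptime g0 -> (forall i, ptime (nth g0 gs i)) ->
  ptime (fun p : E * nat => nth g0 gs p.2 p.1).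
Proof.
move=> h0; elim: gs => [|g gs IH] hgs.
  apply: ptime_ext (ptime_comp h0 (ptime_fst ptime_id)) => -[e n].
  by rewrite nth_nil.
apply: ptime_ext (ptime_nat_case (ptime_snd ptime_id) (ptime_comp (hgs 0) (ptime_fst ptime_id))
  (ptime_comp (IH (fun i => hgs i.+1)) (ptime_pair (ptime_fst (ptime_fst ptime_id))
    (ptime_snd ptime_id)))).
by case=> e [|n].
Qed.

Lemma ptime_fin_case (E C : Type) (F : finType) `{Enc E} `{Enc C} (f : E -> F)
  (g : F -> E -> C) :
  @ptime E F _ (enc_fin F) f -> (forall y, ptime (g y)) -> ptime (fun e => g (f e) e).
Proof.
move=> hf hg.
have [y0 _|no] := pickP (@predT F); last first.
  have e0 (e : E) : False by have := no (f e).
  exists 0; split=> [x|X]; first by case: (e0 x).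
  by exists Skip => x; case: (e0 x).
have hi : ptime (fun e => index (f e) (enum F)) by apply: ptime_eq_enc hf.
have hl : ptime (fun p : E * nat => nth (g y0) [seq g y | y <- enum F] p.2 p.1).
  apply: ptime_nth_fun (hg y0) _ => i.
  have [hi'|hi'] := ltnP i (size (enum F)); first by rewrite (nth_map y0).
  by rewrite nth_default // size_map.
have h : ptime (fun e => nth (g y0) [seq g y | y <- enum F] (index (f e) (enum F)) e).
  exact: ptime_comp hl (ptime_pair ptime_id hi).
apply: ptime_ext h => e /=.
by rewrite (nth_map y0) ?index_mem ?mem_enum // nth_index ?mem_enum.
Qed.

(** * Turing machines for polynomial-time functions *)

Lemma poly_bounded_horner t : poly_bounded t ->
  exists p : {poly nat}, forall n, t n <= p.[n]%R.
Proof.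
move=> [k hk]; exists (('X + 2%:P) ^+ k)%R => n; apply: leq_trans (hk n) _.
have -> : (('X + 2%:P) ^+ k : {poly nat})%R.[n]%R = (n + 2) ^ k; last by [].
elim: k {hk} => [|k IH]; first by rewrite expr0 hornerC.
by rewrite exprS hornerM IH hornerD hornerX hornerC expnS.
Qed.

Section ReadInput.
Variables (A X : finType) (e : A -> X).
Local Notation S := (bool + X)%type.
Local Existing Instance enc_fin.

Definition read_letter (a : A) : seq bool := true :: tree_bits (enc a).

Definition read_body : prog S :=
  foldr (fun a p => If Inp (fun o => o == Some (inr (e a)))
           (Seq (Pop Inp) (push_bits X (read_letter a))) p) Skip (enum A).

Definition read_input : prog S :=
  Seq (push_bits X [:: false]) (While Inp isSome read_body).

Lemma runs_read_body c a w main : injective e ->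
  (forall a, 2 * size (read_letter a) + 2 <= c) ->
  runs read_body (clean_store main [seq inr (e a) | a <- a :: w]) (c + #|A|)
    (clean_store (bit_stack (read_letter a) ++ main) [seq inr (e a) | a <- w]).
Proof.
move=> he hc; rewrite /read_body cardE.
have : a \in enum A by rewrite mem_enum.
elim: (enum A) => // b s IH; rewrite inE /= => ha.
rewrite addnS; apply: runs_if => /=.
case: eqP => [[/he <-]|hab].
  apply: (@runs_le _ _ _ (1 + (2 * size (read_letter a) + 1))).
    by have := hc a; lia.
  apply: runs_seq; [exact/runs_exec/ExecPop | exact: runs_push_bits].
apply: IH; case/orP: ha => // /eqP ab.
by case: hab; rewrite ab.
Qed.

Lemma runs_read_input : injective e -> exists2 t, poly_bounded t &
  forall w, runs read_input (clean_store [::] [seq inr (e a) | a <- w]) (t (size w))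
    (clean_store (bit_stack (tree_bits (enc (rev w)))) [::]).
Proof.
move=> he; pose c := \max_(a : A) (2 * size (read_letter a) + 2).
have hc a : 2 * size (read_letter a) + 2 <= c by apply: leq_bigmax.
exists (fun n => 3 + (n * (c + #|A|).+1 + 1)); first by poly_bound.
move=> w; apply: runs_seq; first exact: runs_push_bits.
have -> : bit_stack [:: false] ++ [::] = bit_stack (tree_bits (enc (Nil A))) :> seq S by [].
rewrite -[rev w]cats0; elim: w (Nil A) => [|a w IH] u; first exact: runs_whileF.
rewrite rev_cons cat_rcons.
apply: (@runs_le _ _ _ ((c + #|A|) + (size w * (c + #|A|).+1 + 1)).+1).
  by rewrite /= mulSn; lia.
apply: runs_whileT (IH (a :: u)) => //.
have := runs_read_body a w (bit_stack (tree_bits (enc u))) he hc.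
by rewrite /read_letter /= /bit_stack map_cat.
Qed.

End ReadInput.

Section WriteOutput.
Variables (B X : finType) (e : B -> X).
Local Notation S := (bool + X)%type.
Local Existing Instance enc_fin.

Definition write_body (s : seq B) : prog S :=
  foldr (fun b p => If Main (is_bit false) (Seq (Pop Main) (Push Inp (inr (e b))))
           (Seq (Pop Main) (Seq (Pop Main) p))) Skip s.

Definition write_output : prog S :=
  While Main (is_bit true) (Seq (Pop Main) (write_body (enum B))).

Lemma runs_write_body s b0 i main out : i < size s ->
  runs (write_body s) (clean_store (bit_stack (tree_bits (enc i)) ++ main) out) (4 * (i + 1))
    (clean_store main (inr (e (nth b0 s i)) :: out)).
Proof.
elim: s i => // b s IH [|i] hi.
  apply: runs_if => /=; apply: (@runs_seq _ _ _ _ 1 _ 2).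
    exact/runs_exec/ExecPop.
  exact/runs_exec/ExecPush.
apply: (@runs_le _ _ _ (1 + (1 + (4 * (i + 1)))).+1); first by lia.
apply: runs_if => /=; apply: runs_seq; first exact/runs_exec/ExecPop.
apply: runs_seq; first exact/runs_exec/ExecPop.
exact: IH.
Qed.

Lemma runs_write_output (s : seq B) out :
  runs write_output (clean_store (bit_stack (tree_bits (enc s))) out)
    (size s * (4 * #|B| + 2) + 1) (clean_store [:: inl false] (rev [seq inr (e b)
      | b <- s] ++ out)).
Proof.
elim: s out => [|b s IH] out; first exact: runs_whileF.
apply: (@runs_le _ _ _ ((1 + 4 * #|B|) + (size s * (4 * #|B| + 2) + 1)).+1).
  by rewrite /= mulSn; lia.
rewrite [map _ _]/= rev_cons cat_rcons; apply: runs_whileT (IH _) => //.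
apply: runs_seq; first exact/runs_exec/ExecPop.
have hb : index b (enum B) < size (enum B) by rewrite index_mem mem_enum.
have := runs_write_body b (bit_stack (tree_bits (enc s))) out hb.
rewrite nth_index ?mem_enum // => h; rewrite /= /bit_stack map_cat.
by apply: runs_le (h _); rewrite leq_mul2l /= addn1 cardE.
Qed.

End WriteOutput.

Lemma represents_store_init (S : finType) (w : seq S) :
  represents_store (Mem w [::] [::] [::] [::])
    (fun i => if i == ord0 then ([::], map Some w) else ([::], [::])).
Proof.
move=> r; exists 0; rewrite cats0 -reg_index_Inp.
case: eqP => [/(can_inj reg_indexK) -> //|]; by case: r.
Qed.

Lemma exec_steps (S : finType) (p : prog S) m n m' : exec p m n m' ->
  forall T, represents_store m T -> exists2 T', represents_store m' T' &
  @steps (machine_of p) n (Some (entry p), T) (None, T').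
Proof.
move=> h T /(exec_prog_steps h)[T' hT' r]; exists T' => //; exact: prog_steps_steps.
Qed.

Lemma take_index_None (S : eqType) (s : seq S) j :
  let r := map Some s ++ nseq j None in take (index None r) r = map Some s.
Proof.
rewrite /= index_cat; have /negbTE -> : None \notin map Some s.
  by apply/mapP => -[].
have -> : index None (nseq j (@None S)) = 0 by case: j.
by rewrite addn0 take_size_cat.
Qed.

Section WordPrograms.
Local Existing Instance enc_fin.

Lemma enc_size_word_le (A : finType) (w : seq A) : enc_size w <= size w * (2 * #|A| + 2) + 1.
Proof.
elim: w => // a w IH; rewrite enc_size_cons [size _]/= mulSn.
have -> : enc_size a = enc_size (index a (enum A)) by [].
rewrite enc_size_nat; have : index a (enum A) < #|A|.
  by rewrite cardE index_mem mem_enum.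
by lia.
Qed.

Lemma ptime_word_prog (A X : finType) (e : A -> X) (B : Type) (eB : Enc B) (f : seq A -> B) :
  injective e -> ptime f ->
  exists (p : prog (bool + X)%type) (t : nat -> nat), poly_bounded t /\
    forall w, enc_size (f w) <= t (size w) /\
    runs p (clean_store [::] [seq inr (e a) | a <- w]) (t (size w))
      (clean_store (bit_stack (tree_bits (enc (f w)))) [::]).
Proof.
move=> e_inj f_ptime.
have [k [f_size f_prog]] := ptime_comp f_ptime (ptime_rev ptime_id).
have [p p_runs] := f_prog X; have [t t_poly read_runs] := runs_read_input e_inj.
pose N n := n * (2 * #|A| + 2) + 1.
have le_N (w : seq A) : (enc_size (rev w) + 2) ^ k <= (N (size w) + 2) ^ k.
  by case: (k) => // k'; rewrite leq_exp2r // leq_add2r enc_size_rev enc_size_word_le.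
exists (Seq (read_input e) p), (fun n => t n + (N n + 2) ^ k); split.
  by apply: poly_boundedD => //; rewrite /N; poly_bound.
move=> w; split.
  by apply: leq_trans (leq_addl _ _); apply: leq_trans (le_N w); rewrite -{1}[w]revK.
apply: runs_seq (read_runs w) _; apply: runs_le (le_N w) _.
by have := p_runs (rev w) [::] [::]; rewrite !cats0 revK.
Qed.

Lemma ptime_polytime (A B : finType) (f : seq A -> seq B) : ptime f -> polytime f.
Proof.
move=> f_ptime; pose X := (A + B)%type : finType.
have [p [t [t_poly p_runs]]] := @ptime_word_prog A X inl _ _ _ (fun x y => fun '(erefl) => erefl)
  (ptime_rev f_ptime).
pose P := Seq p (@write_output B X inr).
have [q le_q] : exists q : {poly nat}, forall n, t n + (t n * (4 * #|B| + 2) + 1) <= q.[n]%R.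
  by apply: poly_bounded_horner; do !apply: poly_boundedD => //; try apply: poly_boundedM => //;
    poly_bound.
exists (machine_of P), (fun a => Some (inr (inl a))), (fun b => Some (inr (inr b))), q.
split; [exact: machine_of_deterministic | by split=> [x y [->]|] | by split=> [x y [->]|] |].
move=> w; have [out_size p_run] := p_runs w.
have [n le_n run] : runs P (clean_store [::] [seq inr (inl a) | a <- w]) q.[size w]%R
    (clean_store [:: inl false] [seq inr (inr b) | b <- f w]).
  apply: runs_le (le_q _) _; apply: runs_seq p_run _.
  have := @runs_write_output B X inr (rev (f w)) [::].
  rewrite cats0 -map_rev revK; apply: runs_le; rewrite leq_add2r leq_mul2r.
  by rewrite (leq_trans (ltnW (size_lt_enc_size _)) out_size) orbT.
have [T' T'_store T_steps] := exec_steps run (represents_store_init _).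
exists n, (None, T'); split=> //; first by move: T_steps; rewrite /init -!map_comp.
by have [j eT'] := T'_store Inp; rewrite /output -reg_index_Inp eT' /= take_index_None -map_comp.
Qed.

End WordPrograms.

Section Outcome.
Variable M : tm.

Definition outcome (c : config M) (t : nat) (b : Prop) :=
  (forall n c', steps n c c' -> n <= t) /\
  ((exists n c', [/\ steps n c c', halted c' & c'.1 \in accept M]) <-> b).

Implicit Types (c d : config M) (s : state M).

Definition config_after c s (a : {ffun 'I_(ntapes M).+1 -> symb M * move}) : config M :=
  (s, fun i => update (c.2 i) (a i)).

Lemma stepE_set1 c s' a : delta c.1 (reads c) = [set (s', a)]%SET ->
  forall d, step c d <-> d = config_after c s' a.
Proof.
move=> one_choice [s T]; split=> [[a']|[-> ->]].
  rewrite one_choice /= => /finset.set1P[-> ->] tapes; congr pair; exact/funext.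
by exists a; rewrite // one_choice finset.set11.
Qed.

Lemma outcome_set1 c s' a t b : delta c.1 (reads c) = [set (s', a)]%SET ->
  outcome (config_after c s' a) t b -> outcome c t.+1 b.
Proof.
move=> one_choice [bounded accepts]; split.
  by move=> [|n] c' //= [d /(stepE_set1 one_choice) ->]; apply: bounded.
rewrite -accepts; split=> -[n [c' [run halted_c' accept_c']]].
  case: n run => [|n] /= run.
    move: halted_c'; rewrite -run /halted one_choice => no_choice.
    by have := finset.set11 (s', a); rewrite no_choice finset.inE.
  by case: run => d /(stepE_set1 one_choice) -> ?; exists n, c'.
exists n.+1, c'; split=> //; exists (config_after c s' a) => //.
exact/(stepE_set1 one_choice).
Qed.

Lemma outcome_halt c b : halted c -> (c.1 \in accept M <-> b) -> outcome c 0 b.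
Proof.
move=> halted_c accepts; have no_step n c' : steps n c c' -> n = 0 /\ c = c'.
  by case: n => [|n] //= [d [a]]; rewrite halted_c finset.inE.
split=> [n c' /no_step[-> //]|].
by rewrite -accepts; split=> [[n [c' [/no_step[_ <-] _]]]//|accept_c]; exists 0, c.
Qed.

Lemma outcome_branch (I : Type) c (d : I -> config M) t (b : I -> Prop) :
  (forall c', step c c' <-> exists i, c' = d i) -> (~ halted c \/ c.1 \notin accept M) ->
  (forall i, outcome (d i) t (b i)) ->
  outcome c t.+1 (exists i, b i).
Proof.
move=> branches not_accepting outcomes; split.
  by move=> [|n] c' //= [e /branches[i ->]]; apply: (proj1 (outcomes i)).
split=> [[n [c' [run halted_c' accept_c']]]|[i /(proj2 (outcomes i))[n [c' [run ? ?]]]]].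
  case: n run => [|n] /= run; first by case: not_accepting; rewrite run => // /negP.
  by case: run => e /branches[i ->] run; exists i; apply/(proj2 (outcomes i)); exists n, c'.
by exists n.+1, c'; split=> //; exists (d i) => //; apply/branches; exists i.
Qed.

End Outcome.

Section Guess.
Variables A C : finType.
Local Notation X := (A + A * C)%type.
Local Notation S := (bool + X)%type.
Variable p : prog S.

Local Notation st := (prog_state p + (bool + option bool))%type.
Local Notation st_guess := (inr (inl true) : st).
Local Notation st_rewind := (inr (inl false) : st).
Local Notation st_exit := (inr (inr None) : st).

Definition guess_delta (s : st) (r : {ffun 'I_5 -> option S}) :
    {set st * {ffun 'I_5 -> option S * move}} :=
  match s with
  | inl s0 => let x := prog_next s0 (fun i => r (reg_index i)) in
      [set (if x.1 is Some s' then inl s' else st_exit, tape_actions x.2 r)]%SET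
  | inr (inl true) =>
      match r (reg_index Inp) with
      | None => [set (st_rewind, tape_actions (Some (Inp, (None, MoveL))) r)]%SET
      | Some (inr (inl a)) =>
          [set (st_guess, tape_actions (Some (Inp, (Some (inr (inr (a, c))), MoveR))) r)
             | c : C]%SET
      | _ => finset.set0
      end
  | inr (inl false) =>
      if r (reg_index Inp) is Some x
      then [set (st_rewind, tape_actions (Some (Inp, (Some x, MoveL))) r)]%SET
      else [set (inl (entry p), tape_actions (Some (Inp, (None, MoveR))) r)]%SET
  | inr (inr None) =>
      [set (inr (inr (Some (r (reg_index Main) == Some (inl true)))), tape_actions None r)]%SET
  | _ => finset.set0
  end.

Definition guess_machine : tm :=
  @TM 4 st (option S) None st_guess [set inr (inr (Some true))]%SET guess_delta.

Local Notation M := guess_machine.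

Lemma guess_reads (s : st) T i : @reads M (s, T) i = scan_top (T i).
Proof. by rewrite ffunE. Qed.

Lemma guess_move (s s' : st) T a :
  @config_after M (s, T) s' (tape_actions a (@reads M (s, T))) = (s', apply_action a T).
Proof.
congr pair; apply/funext => i; rewrite /apply_action; congr (update_tape _ (tape_actions _ _ _)).
by apply/funext => j; rewrite ffunE.
Qed.

Lemma outcome_exit T : @outcome M (st_exit, T) 1 (scan_top (T (reg_index Main)) == Some (inl true)).
Proof.
apply: outcome_set1; first by [].
by apply: outcome_halt; rewrite //= finset.inE guess_reads; case: (scan_top _ == _).
Qed.

Lemma outcome_prog_steps n s T T' : prog_steps n (Some s) T None T' ->
  @outcome M (inl s, T) n.+1 (scan_top (T' (reg_index Main)) == Some (inl true)).
Proof.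
elim: n s T => [|n IH] s T /=; first by case.
set x := prog_next _ _ => h; apply: outcome_set1; first by [].
have <- : x = prog_next s (fun i => @reads M (inl s, T) (reg_index i)).
  by congr prog_next; apply/funext => i; rewrite guess_reads.
rewrite guess_move; case: x.1 h => [s'|] h; first exact: IH.
by case: n h {IH} => //= [[_ <-]]; apply: outcome_exit.
Qed.

Definition others_blank (T : 'I_5 -> prog_tape S) :=
  forall r, reg_index r != reg_index Inp -> represents [::] (T (reg_index r)).

Lemma others_blank_move T x : others_blank T -> others_blank (apply_action (Some (Inp, x)) T).
Proof.
move=> h r hr; rewrite /apply_action /tape_actions ffunE (negbTE hr).
by apply: represents_stay; apply: h.
Qed.

Lemma apply_action_Inp (T : 'I_5 -> prog_tape S) x :
  apply_action (Some (Inp, x)) T (reg_index Inp) = update_tape (T (reg_index Inp)) x.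
Proof. by rewrite /apply_action /tape_actions ffunE eqxx. Qed.

Lemma outcome_rewind (b : Prop) t l r T : others_blank T ->
  T (reg_index Inp) = (behead (map Some l), head None (map Some l) :: map Some r ++ [:: None]) ->
  (forall T, others_blank T -> represents (rev l ++ r) (T (reg_index Inp)) ->
     @outcome M (inl (entry p), T) t b) ->
  @outcome M (st_rewind, T) (size l + t).+1 b.
Proof.
elim: l r T => [|y l IH] r T blank_T T_inp entered.
  apply: (@outcome_set1 M (st_rewind, T) (inl (entry p))
    (tape_actions (Some (Inp, (None, MoveR))) (@reads M (st_rewind, T)))).
    by rewrite /= guess_reads T_inp.
  rewrite guess_move; apply: entered; first exact: others_blank_move.
  by rewrite apply_action_Inp T_inp /=; exists 1.
apply: (@outcome_set1 M (st_rewind, T) st_rewind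
  (tape_actions (Some (Inp, (Some y, MoveL))) (@reads M (st_rewind, T)))).
  by rewrite /= guess_reads T_inp.
rewrite guess_move; apply: (IH (y :: r)); first exact: others_blank_move.
  by rewrite apply_action_Inp T_inp.
by rewrite -cat_rcons -rev_cons.
Qed.

Lemma guess_step a w l T c' :
  T (reg_index Inp) = (l, Some (inr (inl a)) :: w) ->
  @step M (st_guess, T) c' <->
  exists c : C, c' = (st_guess, apply_action (Some (Inp, (Some (inr (inr (a, c))), MoveR))) T).
Proof.
move=> T_inp; rewrite /step /= guess_reads T_inp /=; case: c' => s' T'; split.
  case=> a' /finset.imsetP[c _ [-> ->]] updated; exists c.
  by rewrite -(guess_move st_guess); congr pair; exact/funext.
case=> c; rewrite -(guess_move st_guess) => -[-> ->].
by eexists; first by apply/finset.imsetP; exists c.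
Qed.

Lemma outcome_guess (V : seq (A * C) -> Prop) t z w T : others_blank T ->
  T (reg_index Inp) = (map Some (rev [seq inr (inr x) | x <- z]),
                 [seq Some (inr (inl a)) | a <- w]) ->
  (forall v T, size v = size z + size w -> others_blank T ->
    represents [seq inr (inr x) | x <- v] (T (reg_index Inp)) ->
     @outcome M (inl (entry p), T) t (V v)) ->
  @outcome M (st_guess, T) (2 * size w + size z + t + 2)
    (exists2 c, size c = size w & V (z ++ zip w c)).
Proof.
elim: w z T => [|a w IH] z T blank_T T_inp entered.
  have -> : (exists2 c : seq C, size c = size (Nil A) & V (z ++ zip [::] c)) = V z.
    apply/propext; split=> [[[|//] _]|Vz]; first by rewrite cats0.
    by exists [::]; rewrite ?cats0.
  rewrite muln0 add0n addn2.
  apply: (@outcome_set1 M (st_guess, T) st_rewind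
    (tape_actions (Some (Inp, (None, MoveL))) (@reads M (st_guess, T)))).
    by rewrite /= guess_reads T_inp.
  rewrite guess_move -(size_map (fun x => inr (inr x) : S)) -size_rev.
  apply: (@outcome_rewind _ t _ [::]); first exact: others_blank_move.
    by rewrite apply_action_Inp T_inp.
  by move=> T' blank_T'; rewrite revK cats0; apply: entered; rewrite //= addn0.
have -> : (exists2 c, size c = size (a :: w) & V (z ++ zip (a :: w) c)) =
    (exists c0 : C, exists2 c, size c = size w & V (rcons z (a, c0) ++ zip w c)).
  apply/propext; split=> [[[//|c0 c] [size_c] Vc]|[c0 [c size_c Vc]]].
    by exists c0, c => //; rewrite cat_rcons.
  by exists (c0 :: c); rewrite /= ?size_c // -cat_rcons.
have -> : 2 * size (a :: w) + size z + t + 2 = (2 * size w + (size z).+1 + t + 2).+1.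
  by rewrite /=; lia.
apply: (outcome_branch (fun c' => guess_step c' T_inp)); first by right; rewrite finset.inE.
move=> c; rewrite -(size_rcons z (a, c)); apply: IH; first exact: others_blank_move.
  by rewrite apply_action_Inp T_inp /= map_rcons rev_rcons.
by move=> v T' size_v; apply: entered; rewrite size_v size_rcons /= addnS.
Qed.

End Guess.

Lemma others_blank_init (A C : finType) (p : prog (bool + (A + A * C))%type) (w : seq A) :
  others_blank (@init (guess_machine p) [seq Some (inr (inl a)) | a <- w]).2.
Proof. by move=> r not_inp; exists 0; rewrite /init /= -reg_index_Inp (negbTE not_inp). Qed.

(* Given a program deciding V on the annotated words, the machine guesses the
   annotations of the letters, rewinds the tape and runs the program. *)
Lemma NP_guess (A C : finType) (L : language A) (V : seq (A * C) -> bool) :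
  @ptime _ _ (@enc_seq _ (enc_fin (A * C)%type)) enc_bool V ->
  (forall w, L w <-> exists2 c, size c = size w & V (zip w c)) -> NP L.
Proof.
move=> V_ptime L_iff.
have [p [t [t_poly p_runs]]] := @ptime_word_prog (A * C)%type (A + A * C)%type inr _ _ _
  (fun x y => fun '(erefl) => erefl) V_ptime.
have [q le_q] : exists q : {poly nat}, forall n, 2 * n + 0 + (t n + 1) + 2 <= q.[n]%R.
  by apply: poly_bounded_horner; do !apply: poly_boundedD => //; poly_bound.
exists (guess_machine p), (fun a => Some (inr (inl a))), q; split; first by split=> [x y [->]|].
move=> w; set T0 := (@init (guess_machine p) [seq Some (inr (inl a)) | a <- w]).2.
have T0_inp : T0 (reg_index Inp) = ([::], [seq Some (inr (inl a)) | a <- w]).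
  by rewrite reg_index_Inp.
have accepts v T : size v = 0 + size w -> others_blank T ->
    represents [seq inr (inr x) | x <- v] (T (reg_index Inp)) ->
    @outcome (guess_machine p) (inl (entry p), T) (t (size w) + 1) (V v).
  rewrite add0n addn1 => size_v blank_T T_inp; have [_ [n le_n run]] := p_runs v.
  have T_store : represents_store (Mem [seq inr (inr x) | x <- v] [::] [::] [::] [::]) T.
    by case=> //; apply: blank_T; rewrite -val_eqE /= !inordK.
  have [T' T'_store T_steps] := exec_prog_steps run T_store.
  have [halts accepted] := outcome_prog_steps T_steps; split=> [m c /halts le_m|].
    by apply: leq_trans le_m _; rewrite ltnS -size_v.
  rewrite accepted (represents_top (T'_store Main)) /=.
  by split=> [|->//]; case: (V v).
have [halts accepted] := outcome_guess (z := [::]) (others_blank_init p w) T0_inp accepts.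
split=> [n c /halts le_n|]; last by rewrite L_iff -accepted.
exact: leq_trans le_n (le_q _).
Qed.


(** * The staircase region *)

Definition col_width (k : nat) : nat := if odd k then 7 else 5.
Definition col_start (k : nat) : nat := 12 * (k %/ 2) + 5 * (k %% 2).
Definition col_of (u : nat) : nat := 2 * (u %/ 12) + (5 <= u %% 12).

Lemma col_startS k : col_start k.+1 = col_start k + col_width k.
Proof.
rewrite /col_start /col_width; case E: (odd k); move: E;
  rewrite -(odd_mod k (erefl : odd 2 = false)); lia.
Qed.

Lemma col_start0 : col_start 0 = 0. Proof. by []. Qed.

Lemma col_width57 k : col_width k = 5 \/ col_width k = 7.
Proof. by rewrite /col_width; case: odd; [right | left]. Qed.

Lemma leq_col_start k l : k <= l -> col_start k <= col_start l.
Proof. by rewrite /col_start; lia. Qed.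

Lemma col_ofP u : col_start (col_of u) <= u < col_start (col_of u).+1.
Proof.
rewrite col_startS /col_width /col_start /col_of; case: (leqP 5 (u %% 12)) => [late|early] /=.
  have -> : odd (2 * (u %/ 12) + 1) by rewrite oddD oddM.
  by lia.
have -> : odd (2 * (u %/ 12) + 0) = false by rewrite oddD oddM.
by lia.
Qed.

Lemma col_of_eq u k : col_start k <= u < col_start k.+1 -> col_of u = k.
Proof.
move=> in_col; have := col_ofP u; case: (ltngtP (col_of u) k) => // lt_k.
  by have := leq_col_start lt_k; lia.
by have := leq_col_start lt_k; lia.
Qed.

Lemma ltn_col_of u n : (col_of u < n) = (u < col_start n).
Proof.
have := col_ofP u; case: (ltnP (col_of u) n) => le_col.
  by have := leq_col_start le_col; lia.
by have := leq_col_start le_col; lia.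
Qed.

Section Staircase.
Variables (m n : nat) (Y : nat -> nat -> nat).

Definition tile_left (i k : nat) : nat := col_start k + 4 * (m.-1 - i).
Definition region_width : nat := col_start n + 4 * m.

Definition frontier (i x : nat) : nat :=
  if x < 4 * (m - i) then Y (m.-1 - x %/ 4) 0
  else if x - 4 * (m - i) < col_start n then Y i (col_of (x - 4 * (m - i)))
  else Y (m.-1 - (x - col_start n) %/ 4) n.

Lemma frontier_left i j x : i <= j < m -> tile_left j 0 <= x < tile_left j 0 + 4 ->
  frontier i x = Y j 0.
Proof.
rewrite /tile_left /frontier col_start0 => lt_jm in_x; have -> : x < 4 * (m - i) by lia.
by congr (Y _ 0); lia.
Qed.

Lemma frontier_mid i k x : i <= m -> k < n ->
  col_start k + 4 * (m - i) <= x < col_start k.+1 + 4 * (m - i) ->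
  frontier i x = Y i k.
Proof.
rewrite /frontier => le_im lt_kn in_x; have le_start := leq_col_start lt_kn.
have -> : x < 4 * (m - i) = false by lia.
have -> : x - 4 * (m - i) < col_start n by lia.
by congr (Y i _); apply: col_of_eq; lia.
Qed.

Lemma frontier_right i j x : j < i <= m -> tile_left j n <= x < tile_left j n + 4 ->
  frontier i x = Y j n.
Proof.
rewrite /tile_left /frontier => lt_ji in_x.
have -> : x < 4 * (m - i) = false by lia.
have -> : x - 4 * (m - i) < col_start n = false by lia.
by congr (Y _ n); lia.
Qed.

(* all grid points of the boundary but the corner (m, n) *)
Definition on_boundary (i k : nat) : bool :=
  [|| (i == 0) && (k < n), (k == 0) && (i < m), (i == m) && (k < n) | (k == n) && (i < m)].

Definition in_staircase (x y : nat) : bool := (x < region_width) &&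
  (frontier 0 x <= y < frontier m x).

End Staircase.

Section Tiled.
Variable G : nat -> nat -> bool.
Variables tile_x tile_y tile_w tile_h : nat -> nat -> nat.

Definition tiled := forall x y, G x y ->
  [/\ tile_x x y <= x < tile_x x y + tile_w x y, tile_y x y <= y < tile_y x y + tile_h x y
    & forall x' y', tile_x x y <= x' < tile_x x y + tile_w x y ->
        tile_y x y <= y' < tile_y x y + tile_h x y ->
        [/\ G x' y', tile_x x' y' = tile_x x y, tile_y x' y' = tile_y x y,
            tile_w x' y' = tile_w x y & tile_h x' y' = tile_h x y]].

Hypothesis tiling : tiled.

Lemma tile_starts_right x1 y1 x2 y : G x1 y1 -> tile_y x1 y1 <= y < tile_y x1 y1 + tile_h x1 y1 ->
  x2 = tile_x x1 y1 + tile_w x1 y1 -> G x2 y -> tile_x x2 y = x2.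
Proof.
move=> g1 in_y ex2 g2; have [in_x1 _ sub1] := tiling g1; have [in_x2 in_y2 sub2] := tiling g2.
have [//|lt] : tile_x x2 y = x2 \/ tile_x x2 y < x2 by lia.
have [_ left1 _ width1 _] := sub1 x2.-1 y (ltac:(lia)) in_y.
have [_ left2 _ width2 _] := sub2 x2.-1 y (ltac:(lia)) in_y2.
lia.
Qed.

Lemma tile_starts_above x1 y1 x y2 : G x1 y1 -> tile_x x1 y1 <= x < tile_x x1 y1 + tile_w x1 y1 ->
  y2 = tile_y x1 y1 + tile_h x1 y1 -> G x y2 -> tile_y x y2 = y2.
Proof.
move=> g1 in_x ey2 g2; have [_ in_y1 sub1] := tiling g1; have [in_x2 in_y2 sub2] := tiling g2.
have [//|lt] : tile_y x y2 = y2 \/ tile_y x y2 < y2 by lia.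
have [_ _ bottom1 _ height1] := sub1 x y2.-1 in_x (ltac:(lia)).
have [_ _ bottom2 _ height2] := sub2 x y2.-1 in_x2 (ltac:(lia)).
lia.
Qed.

Lemma wall_stops x1 x2 y : G x1 y -> (G x2 y -> tile_x x2 y = x2) -> x1 < x2 ->
  tile_x x1 y + tile_w x1 y <= x2.
Proof.
move=> g1 wall lt; have [in_x in_y sub] := tiling g1; rewrite leqNgt; apply/negP => crosses.
have [g2 left2 _ _ _] := sub x2 y (ltac:(lia)) in_y.
by have := wall g2; lia.
Qed.

End Tiled.

(** * Rigidity of the tilings of the staircase region *)

Section Rigidity.
Variables (m n : nat) (boundary : nat -> nat -> nat) (base : nat -> nat -> nat).
Variables (slack small_h big_h : nat).
Hypotheses (m_gt0 : 0 < m) (n_gt0 : 0 < n).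
Hypotheses (slack_gt0 : 0 < slack) (small_h_gt : 20 * slack < small_h)
  (big_h_gt : small_h + 20 * slack < big_h).
Hypotheses (baseSl : forall i k, base i.+1 k = base i k + big_h)
           (baseSr : forall i k, base i k.+1 = base i k + small_h).
Hypothesis boundary_near : forall i k, (i == 0) || (i == m) || (k == 0) || (k == n) ->
  base i k <= boundary i k <= base i k + slack.

Variables (small : nat -> Prop) (big : bool -> nat -> Prop).
Hypothesis small_near : forall h, small h -> small_h <= h + slack /\ h <= small_h + slack.
Hypothesis big_near : forall b h, big b h -> big_h <= h + slack /\ h <= big_h + slack.
Variable admissible : nat -> nat -> nat -> Prop.
Hypothesis admissible_near : forall i k y, admissible i k y -> base i k <= y <= base i k + slack.
Hypothesis admissible_bottom : forall k, admissible 0 k (boundary 0 k).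
Hypothesis admissible_left : forall i, admissible i 0 (boundary i 0).
Hypothesis admissible_step : forall i k a b y, admissible i k.+1 a -> admissible i.+1 k b ->
  big (odd k.+1) (y - a) -> small (y - b) -> a <= y -> b <= y -> admissible i.+1 k.+1 y.

Local Notation G := (in_staircase m n boundary).
Local Notation X := (tile_left m).
Local Notation lo := (frontier m n boundary 0).
Local Notation hi := (frontier m n boundary m).

Variables tile_x tile_y tile_w tile_h : nat -> nat -> nat.
Hypothesis tiling : tiled G tile_x tile_y tile_w tile_h.
Hypothesis dims : forall x y, G x y ->
  tile_w x y = 4 /\ small (tile_h x y) \/ exists b : bool, tile_w x y = (if b then 7 else 5) /\
    big b (tile_h x y).

Lemma tile_width x y : G x y -> [\/ tile_w x y = 4, tile_w x y = 5 | tile_w x y = 7].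
Proof.
by move=> /dims[[-> _]|[[] [-> _]]]; [constructor 1|constructor 3|constructor 2].
Qed.

Lemma tile_height_ge x y : G x y -> small_h <= tile_h x y + slack.
Proof. by move=> /dims[[_ /small_near]|[b [_ /big_near]]]; lia. Qed.

Lemma tile_small x y : G x y -> tile_w x y = 4 -> small (tile_h x y).
Proof. by move=> /dims[[_ //]|[[] [-> _]]]. Qed.

Lemma tile_big x y k : G x y -> tile_w x y = col_width k -> big (odd k) (tile_h x y).
Proof.
move=> /dims[[width _]|[b [width height]]]; rewrite /col_width width; first by case: (odd k).
by move: height; case: b {width}; case: (odd k).
Qed.

Lemma leq_base i j k l : i <= j -> k <= l -> base i k <= base j l.
Proof.
move=> le_ij le_kl; apply: (@leq_trans (base j k)).
  by rewrite -(subnKC le_ij); elim: (j - i) => [|d IH]; rewrite ?addn0 // addnS baseSl; lia.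
by rewrite -(subnKC le_kl); elim: (l - k) => [|d IH]; rewrite ?addn0 // addnS baseSr; lia.
Qed.

Lemma lo_le_base i k x : i < m -> k < n -> X i k <= x < X i k.+1 -> lo x <= base i k + slack.
Proof.
rewrite /tile_left => lt_im lt_kn hx; have le_kn := leq_col_start lt_kn.
have [left_x|mid_x] := ltnP x (4 * m).
  have := @frontier_left m n boundary 0 (m.-1 - x %/ 4) x (ltac:(lia)).
  rewrite /tile_left col_start0 => -> //; last by lia.
  have := @boundary_near (m.-1 - x %/ 4) 0 (ltac:(by rewrite eqxx !orbT)).
  by have := @leq_base (m.-1 - x %/ 4) i 0 k (ltac:(lia)) (ltac:(lia)); lia.
set u := x - 4 * m; have u_col := col_ofP u.
have lt_un : col_of u < n by rewrite ltn_col_of /u; lia.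
have le_uk : col_of u <= k by rewrite -ltnS ltn_col_of /u; lia.
rewrite (@frontier_mid m n boundary 0 (col_of u)) //; last by rewrite /u in u_col *; lia.
have := @boundary_near 0 (col_of u) (ltac:(by rewrite eqxx)).
by have := @leq_base 0 i (col_of u) k (ltac:(lia)) le_uk; lia.
Qed.

Lemma hi_ge_base i k x : i < m -> k < n -> X i k <= x < X i k.+1 -> base i.+1 k <= hi x.
Proof.
rewrite /tile_left => lt_im lt_kn hx; have le_kn := leq_col_start lt_kn.
have [mid_x|right_x] := ltnP x (col_start n).
  have x_col := col_ofP x.
  have lt_xn : col_of x < n by rewrite ltn_col_of.
  have le_kx : k <= col_of x by rewrite leqNgt ltn_col_of; lia.
  rewrite (@frontier_mid m n boundary m (col_of x)) //; last by rewrite subnn; lia.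
  have := @boundary_near m (col_of x) (ltac:(by rewrite eqxx orbT)).
  by have := @leq_base i.+1 m k (col_of x) lt_im le_kx; lia.
rewrite (@frontier_right m n boundary m (m.-1 - (x - col_start n) %/ 4)); last 2 first.
- by lia.
- by rewrite /tile_left; lia.
have := @boundary_near (m.-1 - (x - col_start n) %/ 4) n (ltac:(by rewrite eqxx !orbT)).
by have := @leq_base i.+1 (m.-1 - (x - col_start n) %/ 4) k n (ltac:(lia)) (ltac:(lia)); lia.
Qed.

Lemma mid_range i k x : i < m -> k < n -> X i k <= x < X i k.+1 ->
  [/\ x < region_width m n, lo x <= base i k + slack & base i.+1 k <= hi x].
Proof.
move=> lt_im lt_kn hx; split; [|exact: lo_le_base|exact: hi_ge_base].
by have := leq_col_start lt_kn; move: hx; rewrite /tile_left /region_width; lia.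
Qed.

Lemma tile_starts_lo x : G x (lo x) -> tile_y x (lo x) = lo x.
Proof.
move=> g; have [in_x in_y sub] := tiling g.
have [//|lt] : tile_y x (lo x) = lo x \/ tile_y x (lo x) < lo x by lia.
have [below _ _ _ _] := sub x (lo x).-1 in_x (ltac:(lia)).
by move: below; rewrite /in_staircase; lia.
Qed.

(* A tile on top of it would stick out of the region. *)
Lemma tile_reaches_hi x y : G x y -> hi x + slack < tile_y x y + tile_h x y + small_h ->
  tile_y x y + tile_h x y = hi x.
Proof.
move=> g close; have [in_x in_y sub] := tiling g.
have [z ez] : {z | z = tile_y x y + tile_h x y} by eexists.
have [g_top _ _ _ _] := sub x z.-1 in_x (ltac:(lia)).
move: g_top close; rewrite -ez /in_staircase => g_top close.
have [//|lt] : z = hi x \/ z < hi x by lia.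
have gz : G x z by rewrite /in_staircase; lia.
have start := tile_starts_above tiling g in_x ez gz.
have [in_x' in_z sub'] := tiling gz; have := tile_height_ge gz.
have [top _ _ _ _] := sub' x (z + tile_h x z).-1 in_x' (ltac:(lia)).
by move: top; rewrite /in_staircase; lia.
Qed.

Section Row.
Variables (i : nat) (t : nat -> nat).
Hypothesis i_lt : i < m.
Let right_level := boundary i n.
Let right_level_near : base i n <= right_level <= base i n + slack.
Proof. by apply: boundary_near; rewrite eqxx !orbT. Qed.

Hypothesis t_near : forall k, k < n -> base i k <= t k + slack /\ t k <= base i k + 2 * slack.
Hypothesis t_floor : forall k x, k < n -> X i k + 4 <= x < X i k.+1 + 4 ->
  lo x <= t k /\ (G x (t k) -> tile_y x (t k) = t k).
Hypothesis t_wall : forall k y, k < n -> base i k <= y + small_h + 5 * slack -> y < t k ->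
  G (X i k + 4) y -> tile_x (X i k + 4) y = X i k + 4.

Lemma tile_leftS k : X i k.+1 = X i k + col_width k.
Proof. by rewrite /tile_left col_startS; lia. Qed.

Lemma hi_right_side x : X i n <= x < X i n + 4 -> hi x = right_level.
Proof. by move=> in_x; apply: frontier_right in_x; rewrite i_lt leqnn. Qed.

Lemma last_wall y : base i n <= y + small_h + 5 * slack -> ~~ G (X i n + 4) y.
Proof.
move=> high; apply/negP; rewrite /in_staircase /region_width => /andP[lt_x /andP[_ below]].
case: i i_lt below lt_x high => [|j] lt_jm below lt_x high.
  by move: lt_x; rewrite /tile_left; lia.
rewrite (@frontier_right m n boundary m j) in below; [|lia|by rewrite /tile_left; lia].
have := @boundary_near j n (ltac:(by rewrite eqxx !orbT)).
by rewrite baseSl in high; lia.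
Qed.

Lemma in_plateau k x y : k < n -> X i k + 4 <= x < X i k.+1 + 4 ->
  t k <= y -> y < base i k + small_h -> G x y.
Proof.
move=> lt_kn in_x above below; have [lo_le _] := t_floor lt_kn in_x.
have [left_x|right_x] := ltnP x (X i k.+1).
  have [lt_x _ le_hi] := @mid_range i k x i_lt lt_kn (ltac:(lia)).
  by rewrite /in_staircase lt_x; rewrite baseSl in le_hi; lia.
have [eSk|lt_Sk] : k.+1 = n \/ k.+1 < n by lia.
  rewrite /in_staircase; rewrite eSk in in_x right_x; rewrite hi_right_side; last by lia.
  have -> : x < region_width m n by move: in_x; rewrite /tile_left /region_width; lia.
  have base_n : base i n = base i k + small_h by rewrite -eSk baseSr.
  by have := right_level_near; lia.
have step := tile_leftS k.+1; have w57 := col_width57 k.+1.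
have [lt_x _ le_hi] := @mid_range i k.+1 x i_lt lt_Sk (ltac:(lia)).
by rewrite /in_staircase lt_x; rewrite baseSl baseSr in le_hi; lia.
Qed.

Lemma right_wall k y : k < n -> t k <= y -> (k.+1 < n -> y < t k.+1) ->
  G (X i k.+1 + 4) y -> tile_x (X i k.+1 + 4) y = X i k.+1 + 4.
Proof.
move=> lt_kn above below; have near := t_near lt_kn; have base_step := baseSr i k.
have [eSk|lt_Sk] : k.+1 = n \/ k.+1 < n by lia.
  by rewrite eSk => g; case/negP: (@last_wall y (ltac:(rewrite -eSk; lia))).
by apply: t_wall => //; [lia | apply: below].
Qed.

Lemma bad_plateau k : k < n -> tile_x (X i k + 4) (t k) = X i k + 4 -> False.
Proof.
have [d] := ubnP (n - k); elim: d k => // d IH k lt_d lt_kn start.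
have near := t_near lt_kn; have step := tile_leftS k; have base_step := baseSr i k.
have w57 := col_width57 k.
have g : G (X i k + 4) (t k) by apply: (in_plateau lt_kn); lia.
have t_lt : k.+1 < n -> t k < t k.+1 by move=> lt_Sk; have := t_near lt_Sk; lia.
have [_ /(_ g) bottom] := t_floor lt_kn (ltac:(lia) : X i k + 4 <= X i k + 4 < X i k.+1 + 4).
have [in_x in_y sub] := tiling g.
have wall : tile_x (X i k + 4) (t k) + tile_w (X i k + 4) (t k) <= X i k.+1 + 4.
  by apply: (wall_stops tiling g); [exact: right_wall | lia].
have width : tile_w (X i k + 4) (t k) = col_width k.
  have [//|lt] : tile_w (X i k + 4) (t k) = col_width k \/ tile_w (X i k + 4) (t k) < col_width k
    by lia.
  have [x2 ex2] : {x2 | x2 = X i k + 4 + tile_w (X i k + 4) (t k)} by eexists.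
  have g2 : G x2 (t k) by apply: (in_plateau lt_kn); lia.
  have start2 : tile_x x2 (t k) = x2.
    by apply: (tile_starts_right tiling g); rewrite ?start ?bottom //; lia.
  have wall2 : tile_x x2 (t k) + tile_w x2 (t k) <= X i k.+1 + 4.
    by apply: (wall_stops tiling g2); [exact: right_wall | lia].
  by case: (tile_width g); case: (tile_width g2); case: w57; lia.
have height := big_near (tile_big g width).
have [eSk|lt_Sk] : k.+1 = n \/ k.+1 < n by lia.
  have [] := sub (X i n + 3) right_level.
  - by rewrite -eSk; lia.
  - by move: right_level_near; rewrite -eSk; lia.
  by rewrite /in_staircase hi_right_side; lia.
have near' := t_near lt_Sk; apply: (IH k.+1) => //; first by lia.
apply: (tile_starts_right tiling g); rewrite ?start ?bottom; [lia | lia |].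
by apply: (in_plateau lt_Sk); case: (col_width57 k.+1); rewrite ?tile_leftS ?baseSr; lia.
Qed.

Definition clear_from (k z : nat) :=
  [/\ forall x, X i k <= x < X i k + 4 -> lo x <= z /\ (G x z -> tile_y x z = z),
      G (X i k) z -> tile_x (X i k) z = X i k,
      t k < z -> G (X i k + 4) (t k) -> tile_x (X i k + 4) (t k) = X i k + 4
    & base i k <= z + 3 * slack /\ z <= base i k + 3 * slack].

Lemma in_corner k x z : k < n -> clear_from k z -> X i k <= x < X i k + 4 -> G x z.
Proof.
move=> lt_kn [floor _ _ near] in_x; have [lo_le _] := floor x in_x.
have step := tile_leftS k; have w57 := col_width57 k.
have [lt_x _ le_hi] := @mid_range i k x i_lt lt_kn (ltac:(lia)).
by rewrite /in_staircase lt_x; rewrite baseSl in le_hi; lia.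
Qed.

Lemma flush k z : k < n -> clear_from k z -> z = t k.
Proof.
move=> lt_kn clear; have [floor left_wall right_wall [near_le near_ge]] := clear.
have near := t_near lt_kn; have step := tile_leftS k; have w57 := col_width57 k.
have plateau : G (X i k + 4) (t k) by apply: (in_plateau lt_kn); lia.
case: (ltngtP z (t k)) => // [lt_zt|gt_zt]; last first.
  by case: (bad_plateau lt_kn (right_wall gt_zt plateau)).
have g : G (X i k) z by apply: (in_corner lt_kn clear); lia.
have [_ /(_ g) bottom] := floor (X i k) (ltac:(lia)); have start := left_wall g.
have wall : tile_x (X i k) z + tile_w (X i k) z <= X i k + 4.
  by apply: (wall_stops tiling g); [apply: t_wall => //; lia | lia].
have width : tile_w (X i k) z = 4 by have := tile_width g; case=> ?; lia.
have height := tile_height_ge g.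
case: (bad_plateau lt_kn); apply: (tile_starts_right tiling g) => //.
all: by rewrite ?start ?bottom; lia.
Qed.

Definition placed_row k :=
  [/\ G (X i k) (t k), tile_x (X i k) (t k) = X i k, tile_y (X i k) (t k) = t k
    & tile_w (X i k) (t k) = col_width k].

Section Floor.
Variable k : nat.
Hypotheses (lt_kn : k < n) (floor_clear : clear_from k (t k)).

Lemma floor_cell x : X i k <= x < X i k.+1 + 4 -> G x (t k) /\ tile_y x (t k) = t k.
Proof.
have [corner _ _ _] := floor_clear; have near := t_near lt_kn => hx.
have [in_x|in_x] := ltnP x (X i k + 4).
  have g : G x (t k) by apply: (in_corner lt_kn floor_clear); lia.
  by have [_ /(_ g)] := corner x (ltac:(lia)).
have g : G x (t k) by apply: (in_plateau lt_kn); lia.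
by have [_ /(_ g)] := t_floor lt_kn (ltac:(lia) : X i k + 4 <= x < X i k.+1 + 4).
Qed.

Lemma floor_wall x : X i k <= x < X i k.+1 + 4 -> tile_x x (t k) + tile_w x (t k) <= X i k.+1 + 4.
Proof.
move=> hx; have [g _] := floor_cell hx; apply: (wall_stops tiling g); last by lia.
apply: right_wall => // lt; have := t_near lt; have := t_near lt_kn.
by have := baseSr i k; lia.
Qed.

Lemma floor_next x : X i k <= x < X i k.+1 + 4 -> tile_x x (t k) = x ->
  x + tile_w x (t k) < X i k.+1 + 4 -> tile_x (x + tile_w x (t k)) (t k) = x + tile_w x (t k).
Proof.
move=> hx start lt; have [g _] := floor_cell hx; have [_ in_y _] := tiling g.
have width := tile_width g.
by apply: (tile_starts_right tiling g) => //; [lia | apply: (proj1 (floor_cell _)); lia].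
Qed.

Lemma floor_start : tile_x (X i k) (t k) = X i k.
Proof.
have [_ start _ _] := floor_clear; apply: start; apply: (proj1 (floor_cell _)).
by rewrite tile_leftS; lia.
Qed.

(* The floor has width 9 or 11 and no tile of width 4 comes first, as this would
   start a tile on the plateau; so it is the sum of col_width k and 4. *)
Lemma floor_width : tile_w (X i k) (t k) = col_width k.
Proof.
have step := tile_leftS k; have w57 := col_width57 k.
have hx1 : X i k <= X i k < X i k.+1 + 4 by lia.
have [g1 _] := floor_cell hx1; have wall1 := floor_wall hx1; have width1 := tile_width g1.
have next1 := floor_next hx1 floor_start; rewrite floor_start in wall1.
have [w4|ne4] : tile_w (X i k) (t k) = 4 \/ tile_w (X i k) (t k) <> 4 by lia.
  by rewrite w4 in next1; case: (bad_plateau lt_kn (next1 (ltac:(lia)))).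
have [//|ne] : tile_w (X i k) (t k) = col_width k \/ tile_w (X i k) (t k) <> col_width k by lia.
have [x2 ex2] : {x2 | x2 = X i k + tile_w (X i k) (t k)} by eexists.
have lt2 : x2 < X i k.+1 + 4 by case: width1; lia.
rewrite -ex2 in next1; have start2 := next1 lt2.
have hx2 : X i k <= x2 < X i k.+1 + 4 by lia.
have [g2 _] := floor_cell hx2; have width2 := tile_width g2; have wall2 := floor_wall hx2.
have [lt3|ge3] := ltnP (x2 + tile_w x2 (t k)) (X i k.+1 + 4); last first.
  by case: width1; case: width2; case: w57; lia.
have [x3 ex3] : {x3 | x3 = x2 + tile_w x2 (t k)} by eexists.
have start3 := floor_next hx2 start2 lt3; rewrite -ex3 in lt3 start3.
have hx3 : X i k <= x3 < X i k.+1 + 4 by lia.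
have [g3 _] := floor_cell hx3; have width3 := tile_width g3; have wall3 := floor_wall hx3.
by case: width1; case: width2; case: width3; case: w57; lia.
Qed.

Lemma floor_placed : placed_row k.
Proof.
have [|g bottom] := @floor_cell (X i k); first by rewrite tile_leftS; lia.
by split=> //; [exact: floor_start | exact: floor_width].
Qed.

Lemma floor_corner : [/\ G (X i k.+1) (t k), tile_x (X i k.+1) (t k) = X i k.+1,
  tile_y (X i k.+1) (t k) = t k & tile_w (X i k.+1) (t k) = 4].
Proof.
have step := tile_leftS k; have w57 := col_width57 k.
have hx : X i k <= X i k.+1 < X i k.+1 + 4 by lia.
have [g bottom] := floor_cell hx; have wall := floor_wall hx.
have start : tile_x (X i k.+1) (t k) = X i k.+1.
  have := @floor_next (X i k) (ltac:(lia)) floor_start.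
  by rewrite floor_width -step; apply; lia.
by split=> //; have := tile_width g; case; lia.
Qed.

Lemma corner_small : small (tile_h (X i k.+1) (t k)).
Proof. by have [g _ _ width] := floor_corner; apply: tile_small width. Qed.

Lemma corner_clear : k.+1 < n -> clear_from k.+1 (t k + tile_h (X i k.+1) (t k)).
Proof.
move=> lt_Sk; have near := t_near lt_kn; have near' := t_near lt_Sk; have base_step := baseSr i k.
have [g start bottom width] := floor_corner; have height := small_near corner_small.
have [in_x in_y sub] := tiling g; have [g0 start0 bottom0 width0] := floor_placed.
have big_height := big_near (tile_big g0 width0); have step := tile_leftS k.
split.
- move=> x hx; have [gx _ _ _ _] := sub x (t k) (ltac:(lia)) (ltac:(lia)).
  split; first by move: gx; rewrite /in_staircase; lia.
  by apply: (tile_starts_above tiling g); rewrite ?start ?width ?bottom; lia.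
- by apply: (tile_starts_right tiling g0); rewrite ?start0 ?bottom0 ?width0; lia.
- by move=> lt; apply: (tile_starts_right tiling g); rewrite ?start ?bottom ?width; lia.
- by lia.
Qed.

Lemma corner_top : k.+1 = n -> right_level = t k + tile_h (X i k.+1) (t k).
Proof.
move=> ek; have near := t_near lt_kn; have base_step := baseSr i k.
have [g _ bottom _] := floor_corner; have height := small_near corner_small.
have top : hi (X i k.+1) = right_level by rewrite ek; apply: hi_right_side; lia.
have := tile_reaches_hi g; rewrite top bottom => ->; have := right_level_near.
all: by rewrite -ek; lia.
Qed.

End Floor.

Lemma fill_floor k : k < n -> clear_from k (t k) ->
  placed_row k /\
  exists h, [/\ small h, k.+1 < n -> clear_from k.+1 (t k + h) & k.+1 = n -> right_level = t k + h].
Proof.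
move=> lt_kn floor_clear; split; first exact: floor_placed.
by exists (tile_h (X i k.+1) (t k)); split;
  [exact: corner_small | exact: corner_clear | exact: corner_top].
Qed.

Lemma left_clear : clear_from 0 (boundary i 0).
Proof.
have left_near := @boundary_near i 0 (ltac:(by rewrite eqxx !orbT)).
have lo_left x : X i 0 <= x < X i 0 + 4 -> lo x = boundary i 0.
  by move=> hx; rewrite (@frontier_left m n boundary 0 i) ?i_lt.
split; last by lia.
- by move=> x hx; rewrite -(lo_left x hx); split=> //; exact: tile_starts_lo.
- move=> g; have [in_x in_y sub] := tiling g.
  have [//|lt] : tile_x (X i 0) (boundary i 0) = X i 0 \/ tile_x (X i 0) (boundary i 0) < X i 0
    by lia.
  have [left_g _ _ _ _] := sub (X i 0).-1 (boundary i 0) (ltac:(lia)) in_y.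
  have left_x : tile_left m i.+1 0 <= (X i 0).-1 < tile_left m i.+1 0 + 4.
    by move: lt; rewrite /tile_left col_start0; lia.
  move: left_g; rewrite /in_staircase (@frontier_left m n boundary 0 i.+1) //; last first.
    by move: lt; rewrite /tile_left col_start0; lia.
  by have := @boundary_near i.+1 0 (ltac:(by rewrite eqxx !orbT)); rewrite baseSl; lia.
- move=> above g; have [in_x in_y sub] := tiling g.
  have [//|lt] : tile_x (X i 0 + 4) (t 0) = X i 0 + 4 \/ tile_x (X i 0 + 4) (t 0) < X i 0 + 4
    by lia.
  have [below _ _ _ _] := sub (X i 0 + 3) (t 0) (ltac:(lia)) in_y.
  by move: below; rewrite /in_staircase lo_left; lia.
Qed.

Lemma row_levels : [/\ boundary i 0 = t 0, forall k, k < n -> placed_row k,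
    forall k, k.+1 < n -> t k < t k.+1 /\ small (t k.+1 - t k)
  & t n.-1 <= right_level /\ small (right_level - t n.-1)].
Proof.
have left0 := flush n_gt0 left_clear.
have clear k : k < n -> clear_from k (t k).
  elim: k => [_|k IH lt_Sk]; first by rewrite -left0; exact: left_clear.
  have [_ [h [_ /(_ lt_Sk) next _]]] := fill_floor (ltnW lt_Sk) (IH (ltnW lt_Sk)).
  by have tE := flush lt_Sk next; rewrite -tE in next *.
split=> // [k lt_kn|k lt_Sk|].
- by have [] := fill_floor lt_kn (clear k lt_kn).
- have [_ [h [small_step /(_ lt_Sk) next _]]] := fill_floor (ltnW lt_Sk) (clear k (ltnW lt_Sk)).
  rewrite -(flush lt_Sk next) addKn; split=> //.
  by have := small_near small_step; lia.
- have lt_n : n.-1 < n by lia.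
  have [_ [h [small_step _ right_end]]] := fill_floor lt_n (clear _ lt_n).
  by rewrite right_end ?prednK // addKn leq_addr.
Qed.

End Row.

Fixpoint level (i k : nat) : nat :=
  if i is j.+1 then level j k + tile_h (X j k) (level j k) else boundary 0 k.

Definition ready (i : nat) :=
  [/\ forall k, k < n -> base i k <= level i k + slack /\ level i k <= base i k + 2 * slack,
      forall k x, k < n -> col_start k + 4 * (m - i) <= x < col_start k.+1 + 4 * (m - i) ->
        lo x <= level i k /\ (G x (level i k) -> tile_y x (level i k) = level i k)
    & forall k y, k < n -> base i k <= y + small_h + 5 * slack -> y < level i k ->
        G (col_start k + 4 * (m - i)) y ->
          tile_x (col_start k + 4 * (m - i)) y = col_start k + 4 * (m - i)].

Definition row_done (i : nat) :=
  [/\ boundary i 0 = level i 0, forall k, k < n -> placed_row i (level i) k,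
    forall k, k.+1 < n -> level i k < level i k.+1 /\ small (level i k.+1 - level i k)
  & level i n.-1 <= boundary i n /\ small (boundary i n - level i n.-1)].

Lemma ready_done i : i < m -> ready i -> row_done i.
Proof.
move=> lt_im [near floor wall].
have leftE k : col_start k + 4 * (m - i) = X i k + 4 by rewrite /tile_left; lia.
by apply: row_levels => // [k x|k y]; rewrite -!leftE; [exact: floor | exact: wall].
Qed.

Lemma ready0 : ready 0.
Proof.
have lo_mid k x : k < n -> col_start k + 4 * (m - 0) <= x < col_start k.+1 + 4 * (m - 0) ->
  lo x = boundary 0 k.
  by move=> lt_kn in_x; rewrite (@frontier_mid m n boundary 0 k).
split=> [k lt_kn|k x lt_kn in_x|k y lt_kn _ /= below].
- by have := @boundary_near 0 k (ltac:(by rewrite eqxx)); rewrite /=; lia.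
- by rewrite /= -(lo_mid k x lt_kn in_x); split=> //; exact: tile_starts_lo.
- rewrite /in_staircase (lo_mid k) //; first by lia.
  by rewrite col_startS; case: (col_width57 k); lia.
Qed.

Lemma ready_next i : i < m -> row_done i -> (forall k, k < n -> admissible i k (level i k)) ->
  ready i.+1 /\ (forall k, k < n -> big (odd k) (level i.+1 k - level i k)).
Proof.
move=> lt_im [_ placed _ _] adm.
have leftE k : col_start k + 4 * (m - i.+1) = X i k by rewrite /tile_left; lia.
have big_step k : k < n -> big (odd k) (tile_h (X i k) (level i k)).
  by move=> lt_kn; have [g _ _ width] := placed k lt_kn; apply: tile_big.
have levelS k : level i.+1 k = level i k + tile_h (X i k) (level i k) by [].
split; last by move=> k lt_kn; rewrite levelS addKn; apply: big_step.
split=> [k lt_kn|k x lt_kn|k y lt_kn]; rewrite ?leftE levelS.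
all: have height := big_near (big_step k lt_kn); have near := admissible_near (adm k lt_kn).
all: have [g start bottom width] := placed k lt_kn; have [in_x in_y sub] := tiling g.
- by rewrite baseSl; lia.
- move=> above; have in_x' :
    tile_x (X i k) (level i k) <= x < tile_x (X i k) (level i k) + tile_w (X i k) (level i k).
    by rewrite start width; move: above; rewrite /tile_left col_startS; lia.
  split; last by apply: (tile_starts_above tiling g) => //; rewrite bottom.
  have [g' _ _ _ _] := sub x (level i k) in_x' in_y.
  by move: g'; rewrite /in_staircase; lia.
- by rewrite baseSl => high below _; have [_ -> _ _ _] := sub (X i k) y in_x (ltac:(lia)).
Qed.

Lemma ready_all i : i <= m -> ready i /\ (forall j, j < i -> row_done j /\
  (forall k, k < n -> admissible j k (level j k) /\ big (odd k) (level j.+1 k - level j k))).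
Proof.
elim: i => [_|i IH lt_im]; first by split=> //; exact: ready0.
have [ready_i below] := IH (ltnW lt_im); have done_i := ready_done lt_im ready_i.
have adm k : k < n -> admissible i k (level i k).
  case: i lt_im ready_i below done_i {IH} => [|i] lt_im _ below.
    by move=> _ _; apply: admissible_bottom.
  case=> left_end _ right_steps _; elim: k => [_|k IHk lt_Sk].
    by rewrite -left_end; apply: admissible_left.
  have [lt_level small_step] := right_steps k lt_Sk.
  have [_ /(_ k.+1 lt_Sk)[adm_below big_step]] := below i (ltnSn i).
  have adm_left := IHk (ltnW lt_Sk).
  exact: admissible_step adm_below adm_left big_step small_step (leq_addr _ _) (ltnW lt_level).
have [ready_Si big_steps] := ready_next lt_im done_i adm.
split=> // j; rewrite ltnS leq_eqVlt => /orP[/eqP ->|/below//].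
by split=> // k lt_kn; split; [apply: adm | apply: big_steps].
Qed.

Lemma level_top k : k < n -> level m k = boundary m k.
Proof.
move=> lt_kn; have [j em] : exists j, m = j.+1 by exists m.-1; lia.
have lt_jm : j < m by lia.
have [[near _ _] done] := ready_all (leqnn m); have [[_ placed _ _] levels] := done j lt_jm.
have [g _ bottom width] := placed k lt_kn; have level_near := near k lt_kn.
have top_near := @boundary_near m k (ltac:(by rewrite eqxx orbT)).
have top : hi (X j k) = boundary m k.
  by rewrite (@frontier_mid m n boundary m k) // /tile_left em col_startS; case: (col_width57 k);
    lia.
have levelE : level m k = level j k + tile_h (X j k) (level j k) by rewrite {1}em.
by have := tile_reaches_hi g; rewrite top bottom -levelE; apply; lia.
Qed.

Theorem staircase_rigid : exists Yf : nat -> nat -> nat,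
  [/\ forall i k, i <= m -> k <= n -> on_boundary m n i k -> Yf i k = boundary i k,
      forall i k, i < m -> k < n -> admissible i k (Yf i k),
      forall i k, i < m -> k < n -> Yf i k <= Yf i.+1 k /\ big (odd k) (Yf i.+1 k - Yf i k)
    & forall i k, i < m -> k < n -> Yf i k <= Yf i k.+1 /\ small (Yf i k.+1 - Yf i k)].
Proof.
exists (fun i k => if k < n then level i k else boundary i k).
have [_ done] := ready_all (leqnn m).
split=> [i k le_im le_kn|i k lt_im lt_kn|i k lt_im lt_kn|i k lt_im lt_kn].
- case: ltnP => [lt|ge]; last by [].
  case/or4P => /andP[/eqP e lt_ik]; first by rewrite e.
  + by rewrite e; have [[]] := done i lt_ik.
  + by rewrite e; apply: level_top.
  + by rewrite e ltnn in lt.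
- by rewrite lt_kn; have [_ /(_ k lt_kn)[]] := done i lt_im.
- by rewrite lt_kn; split; [rewrite /= leq_addr | have [_ /(_ k lt_kn)[]] := done i lt_im].
- rewrite lt_kn; have [[_ _ right_steps last_step] _] := done i lt_im.
  have [lt|e] : k.+1 < n \/ k.+1 = n by lia.
    by rewrite lt; have [/ltnW] := right_steps k lt.
  by rewrite e ltnn; have <- : n.-1 = k by lia.
Qed.

End Rigidity.

(** * Tiling the staircase region *)

Section StaircaseTiling.
Variables (m n : nat) (Y : nat -> nat -> nat).
Hypothesis n_gt0 : 0 < n.
Hypothesis Yv : forall i k, i < m -> k < n -> Y i k < Y i.+1 k.
Hypothesis Yh : forall i k, i < m -> k < n -> Y i k < Y i k.+1.

Local Notation X := (tile_left m).
Local Notation E := (frontier m n Y).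

Definition row_of (x y : nat) : nat := find (fun i => y < E i.+1 x) (iota 0 m).

Definition staircase_tile (x y : nat) : (nat * nat) * (nat * nat) :=
  let i := row_of x y in
  let k := col_of (x - 4 * (m.-1 - i)) in
  if (k < n) && (Y i k <= y)
  then ((X i k, Y i k), (col_width k, Y i.+1 k - Y i k))
  else ((X i k, Y i k.-1), (4, Y i k - Y i k.-1)).

Lemma col_of_sub4 u :
  col_of (u - 4) = if u < col_start (col_of u) + 4 then (col_of u).-1 else col_of u.
Proof.
have u_col := col_ofP u; case: ltnP => [start_u|far_u]; apply: col_of_eq; last by lia.
case: (col_of u) start_u u_col => [|k]; rewrite /= ?col_startS ?col_start0.
  by case: (col_width57 0); lia.
by case: (col_width57 k); lia.
Qed.

Lemma frontier_cases i x : i < m -> x < region_width m n ->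
  let u := x - 4 * (m.-1 - i) in let k := col_of u in
  (x < 4 * (m.-1 - i) \/ col_start n + 4 <= u) /\ E i x = E i.+1 x \/
  4 * (m.-1 - i) <= x /\
  [\/ [/\ k < n, E i x = Y i k & E i.+1 x = Y i.+1 k],
      [/\ 0 < k < n, u < col_start k + 4, E i x = Y i k.-1 & E i.+1 x = Y i.+1 k]
    | [/\ k = n, u < col_start n + 4, E i x = Y i n.-1 & E i.+1 x = Y i n]].
Proof.
move=> lt_im in_x; rewrite /frontier.
have [left_x|mid_x] := ltnP x (4 * (m - i.+1)).
  have -> : x < 4 * (m - i) by lia.
  by left; split=> //; left; lia.
have eSi : 4 * (m - i.+1) = 4 * (m.-1 - i) by lia.
have ei : 4 * (m - i) = 4 * (m.-1 - i) + 4 by lia.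
rewrite eSi ei in mid_x *; have [u eu] : {u | u = x - 4 * (m.-1 - i)} by eexists.
have -> : x - (4 * (m.-1 - i) + 4) = u - 4 by lia.
have u_col := col_ofP u; have col_sub4 := col_of_sub4 u.
rewrite -eu; have [lt_u|ge_u] := ltnP u (col_start n).
  have lt_kn : col_of u < n by rewrite ltn_col_of.
  right; split=> //; have [first_x|later_x] := ltnP x (4 * (m.-1 - i) + 4).
    have col0 : col_of u = 0 by apply: col_of_eq; rewrite /col_start /=; lia.
    have -> : m.-1 - x %/ 4 = i by lia.
    by constructor 1; rewrite col0.
  have -> : u - 4 < col_start n by lia.
  rewrite col_sub4; have [start_u|_] := ltnP u (col_start (col_of u) + 4); last by constructor 1.
  constructor 2; split=> //; rewrite lt_kn andbT lt0n; apply/eqP => col0.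
  by move: start_u; rewrite col0 col_start0; lia.
have n_start : 5 <= col_start n := leq_col_start n_gt0.
have -> : x < 4 * (m.-1 - i) + 4 = false by lia.
have [near_u|far_u] := ltnP (u - 4) (col_start n); last by left; split=> //; right; lia.
have -> : m.-1 - (x - col_start n) %/ 4 = i by lia.
have kn : col_of u = n by apply: col_of_eq; rewrite col_startS; case: (col_width57 n); lia.
have close_u : u < col_start n + 4 by lia.
by rewrite col_sub4 kn close_u; right; split=> //; constructor 3; split=> //; lia.
Qed.

Lemma frontier_leS i x : i < m -> x < region_width m n -> E i x <= E i.+1 x.
Proof.
move=> lt_im in_x; have := frontier_cases lt_im in_x; rewrite /=; set k := col_of _.
case=> [[_ -> //]|[_ [[lt_kn -> ->]|[/andP[k_gt0 lt_kn] _ -> ->]|[_ _ -> ->]]]].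
- exact: ltnW (Yv lt_im lt_kn).
- have := Yv lt_im lt_kn; have := @Yh i k.-1 lt_im; rewrite prednK //; lia.
- by have := @Yh i n.-1 lt_im; rewrite prednK //; lia.
Qed.

Lemma leq_frontier i j x : i <= j <= m -> x < region_width m n -> E i x <= E j x.
Proof.
move=> /andP[le_ij]; rewrite -(subnKC le_ij); elim: (j - i) => [|d IH]; rewrite ?addn0 //.
by rewrite addnS => lt_m lt_xw; apply: leq_trans (IH (ltnW lt_m) lt_xw) (frontier_leS lt_m lt_xw).
Qed.

Lemma row_of_eq i x y : i < m -> x < region_width m n -> E i x <= y < E i.+1 x -> row_of x y = i.
Proof.
move=> lt_im lt_xw /andP[above below]; rewrite /row_of; set p := fun i => _.
have has_p : has p (iota 0 m) by apply/hasP; exists i; rewrite ?mem_iota.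
case: (ltngtP (find p (iota 0 m)) i) => // [lt_find|gt_find].
  have := nth_find 0 has_p; rewrite nth_iota; last by lia.
  rewrite {1}/p add0n => below'.
  by have := @leq_frontier (find p (iota 0 m)).+1 i x (ltac:(lia)) lt_xw; lia.
by have := before_find 0 gt_find; rewrite nth_iota // /p add0n below.
Qed.

Lemma in_staircase_row i x y : i < m -> x < region_width m n -> E i x <= y < E i.+1 x ->
  in_staircase m n Y x y.
Proof.
move=> lt_im in_x in_y; rewrite /in_staircase in_x; have := @leq_frontier 0 i x (ltac:(lia)) in_x.
by have := @leq_frontier i.+1 m x (ltac:(lia)) in_x; lia.
Qed.

Lemma staircase_tile_big i k x y : i < m -> k < n -> X i k <= x < X i k.+1 ->
  Y i k <= y < Y i.+1 k ->
  in_staircase m n Y x y /\ staircase_tile x y = ((X i k, Y i k), (col_width k, Y i.+1 k - Y i k)).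
Proof.
move=> lt_im lt_kn in_x in_y; have le_start := leq_col_start lt_kn.
have lt_xw : x < region_width m n by move: in_x; rewrite /tile_left /region_width; lia.
have col_x : col_of (x - 4 * (m.-1 - i)) = k.
  by apply: col_of_eq; move: in_x; rewrite /tile_left; lia.
have in_band : E i x <= y < E i.+1 x.
  have := frontier_cases lt_im lt_xw; rewrite /= col_x.
  case=> [[outside _]|[_ [[_ -> ->]//|[/andP[k_gt0 _] _ -> ->]|[eq_kn _ _ _]]]].
  - by move: outside in_x; rewrite /tile_left; lia.
  - by have := @Yh i k.-1 lt_im; rewrite prednK //; lia.
  - by lia.
have row_xy : row_of x y = i by apply: row_of_eq.
split; last by rewrite /staircase_tile row_xy col_x lt_kn; case: leqP => //; lia.
exact: in_staircase_row in_band.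
Qed.

Lemma staircase_tile_small i k x y : i < m -> k < n -> X i k.+1 <= x < X i k.+1 + 4 ->
  Y i k <= y < Y i k.+1 ->
  in_staircase m n Y x y /\ staircase_tile x y = ((X i k.+1, Y i k), (4, Y i k.+1 - Y i k)).
Proof.
move=> lt_im lt_kn in_x in_y; have le_start := leq_col_start lt_kn.
have lt_xw : x < region_width m n by move: in_x; rewrite /tile_left /region_width; lia.
have col_x : col_of (x - 4 * (m.-1 - i)) = k.+1.
  by apply: col_of_eq; move: in_x; rewrite /tile_left [col_start k.+2]col_startS;
    case: (col_width57 k.+1); lia.
have in_band : E i x <= y < E i.+1 x.
  have := frontier_cases lt_im lt_xw; rewrite /= col_x.
  case=> [[outside _]|[_ [[lt_Sk _ top]|[lt_Sk _ -> ->]|[eq_Sk _ -> ->]]]].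
  - by move: outside in_x; rewrite /tile_left; lia.
  - have := @frontier_mid m n Y i k x (ltnW lt_im) lt_kn; rewrite top => -> //.
      by have := Yv lt_im lt_Sk; lia.
    by move: in_x; rewrite /tile_left col_startS; case: (col_width57 k); lia.
  - by have := @Yv i k.+1 lt_im (ltac:(lia)); rewrite /=; lia.
  - by rewrite -eq_Sk.
have row_xy : row_of x y = i by apply: row_of_eq.
split; first exact: in_staircase_row in_band.
rewrite /staircase_tile row_xy col_x /=; have -> : Y i k.+1 <= y = false by lia.
by rewrite andbF.
Qed.

Lemma in_staircase_rowP x y : in_staircase m n Y x y ->
  exists2 i, i < m & E i x <= y < E i.+1 x.
Proof.
move=> /andP[_ /andP[above below]].
suff bands j : j <= m -> y < E j x -> exists2 i, i < j & E i x <= y < E i.+1 x.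
  exact: bands (leqnn m) below.
elim: j => [|j IH] le_jm lt_y; first by lia.
have [le|lt] := leqP (E j x) y; first by exists j; rewrite // le.
by have [i lt_ij in_band] := IH (ltnW le_jm) lt; exists i => //; apply: ltnW.
Qed.

Lemma in_staircase_tileP x y : in_staircase m n Y x y -> exists i k, [/\ i < m, k < n &
  (X i k <= x < X i k.+1 /\ Y i k <= y < Y i.+1 k) \/
  (X i k.+1 <= x < X i k.+1 + 4 /\ Y i k <= y < Y i k.+1)].
Proof.
move=> g; have [i lt_im in_y] := in_staircase_rowP g.
have lt_xw : x < region_width m n by case/andP: g.
have := frontier_cases lt_im lt_xw; rewrite /=; set u := x - _; have ku := col_ofP u.
case=> [[_ flat]|[right_x cases]]; first by rewrite flat in in_y; lia.
case: cases => [[lt_kn bot top]|[/andP[k_gt0 lt_kn] start_u bot top]|[eq_kn start_u bot top]].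
- exists i, (col_of u); split=> //; left; rewrite -bot -top; split=> //.
  by rewrite /tile_left /u in ku *; lia.
- have [le|lt] := leqP (Y i (col_of u)) y.
    exists i, (col_of u); split=> //; left; split; last by lia.
    by rewrite /tile_left /u in ku *; lia.
  exists i, (col_of u).-1; split=> //; first by lia.
  right; rewrite prednK //; split; last by lia.
  by rewrite /tile_left /u in ku start_u *; lia.
- exists i, n.-1; split=> //; first by lia.
  right; rewrite prednK //; split; last by lia.
  by rewrite /tile_left; rewrite eq_kn /u in ku start_u *; lia.
Qed.

Theorem staircase_tile_tiled :
  tiled (in_staircase m n Y)
    (fun x y => (staircase_tile x y).1.1) (fun x y => (staircase_tile x y).1.2)
    (fun x y => (staircase_tile x y).2.1) (fun x y => (staircase_tile x y).2.2) /\
  forall x y, in_staircase m n Y x y -> exists i k, [/\ i < m, k < n &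
    (staircase_tile x y).2 = (col_width k, Y i.+1 k - Y i k) \/
    (staircase_tile x y).2 = (4, Y i k.+1 - Y i k)].
Proof.
have XS i k : X i k.+1 = X i k + col_width k by rewrite /tile_left col_startS; lia.
split=> x y g; have [i [k [lt_im lt_kn [[in_x in_y]|[in_x in_y]]]]] := in_staircase_tileP g.
- have [_ ->] := staircase_tile_big lt_im lt_kn in_x in_y; rewrite /= -XS.
  have lt_Y := Yv lt_im lt_kn; split=> // [|x' y' in_x' in_y']; first by lia.
  by have [g' ->] := @staircase_tile_big i k x' y' lt_im lt_kn in_x' (ltac:(lia)).
- have [_ ->] := staircase_tile_small lt_im lt_kn in_x in_y => /=.
  have lt_Y := Yh lt_im lt_kn; split=> // [|x' y' in_x' in_y']; first by lia.
  by have [g' ->] := @staircase_tile_small i k x' y' lt_im lt_kn in_x' (ltac:(lia)).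
- by exists i, k; split=> //; left; have [_ ->] := staircase_tile_big lt_im lt_kn in_x in_y.
- by exists i, k; split=> //; right; have [_ ->] := staircase_tile_small lt_im lt_kn in_x in_y.
Qed.

End StaircaseTiling.

Arguments unit_square : clear implicits.
Arguments realize : clear implicits.

(** * Combinatorial description of tilings *)

Section CellTopology.
Variable R : realType.
Local Open Scope ring_scope.
Local Open Scope classical_set_scope.
Implicit Types (S A B : cells) (c d : square) (z : R * R).

Lemma unit_squareP c z : unit_square R c z <->
  [/\ c.1%:~R <= z.1, z.1 <= c.1%:~R + 1, c.2%:~R <= z.2 & z.2 <= c.2%:~R + 1].
Proof.
rewrite /unit_square /setX /= !in_itv /=.
by split=> [[/andP[-> ->] /andP[-> ->]]//|[-> -> -> ->]].
Qed.

Definition open_cell c : set (R * R) := [set z |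
  [/\ c.1%:~R < z.1, z.1 < c.1%:~R + 1, c.2%:~R < z.2 & z.2 < c.2%:~R + 1]].

Lemma open_cell_sub c : open_cell c `<=` unit_square R c.
Proof. by move=> z [/ltW ? /ltW ? /ltW ? /ltW ?]; apply/unit_squareP. Qed.

Lemma int_between (a b : int) (r : R) :
  a%:~R < r -> r < a%:~R + 1 -> b%:~R <= r -> r <= b%:~R + 1 -> a = b.
Proof.
move=> lt_ar lt_ra le_br le_rb.
have ab : a < b + 1 by rewrite -(ltr_int R) rmorphD; apply: lt_le_trans lt_ar le_rb.
have ba : b < a + 1 by rewrite -(ltr_int R) rmorphD; apply: le_lt_trans le_br lt_ra.
by lia.
Qed.

Lemma open_cell_square c d z : open_cell c z -> unit_square R d z -> c = d.
Proof.
case: c d => [a b] [a' b'] [gt_a lt_a gt_b lt_b] /unit_squareP[? ? ? ?].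
by congr pair; [apply: (int_between gt_a lt_a) | apply: (int_between gt_b lt_b)].
Qed.

Lemma open_cell_realize c S z : open_cell c z -> realize R S z <-> c \in S.
Proof.
move=> cz; split=> [[d /= dS dz]|cS]; first by rewrite (open_cell_square cz dz).
by exists c => //; apply: open_cell_sub.
Qed.

Lemma nbhs_pairP z (A : set (R * R)) : nbhs z A <->
  exists2 e : R, 0 < e & forall w, `|z.1 - w.1| < e -> `|z.2 - w.2| < e -> A w.
Proof.
split=> [/nbhs_ballP[e e_gt0 ballA]|[e e_gt0 boxA]].
  by exists e => // w near1 near2; apply: ballA; split; rewrite /= -ball_normE.
apply/nbhs_ballP; exists e => // w [near1 near2]; apply: boxA.
  by move: near1; rewrite -ball_normE.
by move: near2; rewrite -ball_normE.
Qed.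

Lemma open_cell_nbhs c z : open_cell c z -> nbhs z (open_cell c).
Proof.
move=> [gt1 lt1 gt2 lt2]; apply/nbhs_pairP.
pose e := Num.min (Num.min (z.1 - c.1%:~R) (c.1%:~R + 1 - z.1))
                  (Num.min (z.2 - c.2%:~R) (c.2%:~R + 1 - z.2)).
exists e; first by rewrite /e !lt_min !subr_gt0 gt1 lt1 gt2 lt2.
move=> w; rewrite /e !lt_min !ltr_norml.
by move=> /andP[/andP[/andP[? ?] /andP[? ?]] _] /andP[_ /andP[/andP[? ?] /andP[? ?]]];
  split; lra.
Qed.

Definition center c : R * R := (c.1%:~R + 2^-1, c.2%:~R + 2^-1).

Lemma center_open c : open_cell c (center c).
Proof. by rewrite /open_cell /center /=; split; lra. Qed.

Lemma center_realize c S : realize R S (center c) <-> c \in S.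
Proof. exact: open_cell_realize (center_open c). Qed.

Lemma open_cell_interior c S z : c \in S -> open_cell c z -> (realize R S)° z.
Proof.
move=> cS cz; apply: filterS (open_cell_nbhs cz) => w cw.
by apply/(open_cell_realize _ cw).
Qed.

Lemma near_open_cell z e : 0 < e -> exists c w,
  [/\ open_cell c w, `|z.1 - w.1| < e & `|z.2 - w.2| < e].
Proof.
move=> e_gt0.
have near_open_unit (r : R) :
    exists (a : int) (s : R), [/\ a%:~R < s, s < a%:~R + 1 & `|r - s| < e].
  pose a := Num.floor r; have /andP[le_ar lt_ra] := @real_floor_itv R r (num_real r).
  pose t := Num.min (e / 2) ((a%:~R + 1 - r) / 2).
  have t_gt0 : 0 < t.
    rewrite /t lt_min divr_gt0 //= divr_gt0 // subr_gt0.
    by move: lt_ra; rewrite rmorphD.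
  exists a, (r + t); split.
  - by apply: le_lt_trans le_ar _; rewrite ltrDl.
  - have : t <= (a%:~R + 1 - r) / 2 by rewrite /t ge_min lexx orbT.
    by move: lt_ra; rewrite rmorphD /= -/a; lra.
  - rewrite opprD addNKr normrN gtr0_norm //.
    by apply: (@le_lt_trans _ _ (e / 2)); [rewrite /t ge_min lexx | lra].
have [a [s [? ? ?]]] := near_open_unit z.1; have [b [t [? ? ?]]] := near_open_unit z.2.
by exists (a, b), (s, t).
Qed.

Lemma realize_interior_disjoint A B :
  (realize R A)° `&` (realize R B)° = set0 <-> [disjoint A & B]%fset.
Proof.
split=> disjAB.
  apply/fdisjointP => c cA; apply/negP => cB.
  suff : set0 (center c) by [].
  by rewrite -disjAB; split; apply: (open_cell_interior (c := c)) (center_open c).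
apply/seteqP; split=> // z [/nbhs_pairP[e e_gt0 boxA] /nbhs_pairP[e' e'_gt0 boxB]].
have min_gt0 : 0 < Num.min e e' by rewrite lt_min e_gt0.
have [c [w [cw]]] := near_open_cell z min_gt0.
rewrite !lt_min => /andP[near1 near1'] /andP[near2 near2'].
have /(open_cell_realize _ cw) cA := boxA w near1 near2.
have /(open_cell_realize _ cw) cB := boxB w near1' near2'.
by have /fdisjointP/(_ _ cA)/negP := disjAB.
Qed.

Definition fun_tiling (T : {fset cells}) (G : cells)
    (f : square -> cells * (int * int)) : Prop :=
  forall c, c \in G -> [/\ (f c).1 \in T, c \in translate (f c).2 (f c).1
    & forall c', c' \in translate (f c).2 (f c).1 -> c' \in G /\ f c' = f c].

Lemma tileableP T G : tileable R T G <-> exists f, fun_tiling T G f.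
Proof.
split=> [[P [P_T P_disjoint P_cover]]|[f tiling]].
  have covered c : exists p, c \in G -> p \in P /\ c \in translate p.2 p.1.
    have [cG|_] := boolP (c \in G); last by exists (fset0, (0, 0)).
    have /center_realize : c \in G by [].
    by rewrite -P_cover => -[p /= pP /center_realize cp]; exists p.
  have [f f_covers] := choice covered; exists f => c cG; have [fP cf] := f_covers c cG.
  split; [exact: P_T | by [] |] => c' c'_in.
  have c'G : c' \in G.
    apply/center_realize; rewrite -P_cover; exists (f c) => //; exact/center_realize.
  split=> //; have [fP' cf'] := f_covers c' c'G.
  apply/eqP; apply: contraT => ne.
  have /realize_interior_disjoint/fdisjointP/(_ c' cf') := P_disjoint _ _ fP' fP ne.
  by rewrite c'_in.
exists [fset f c | c in G]%fset; split.
- by move=> p /imfsetP[c /= /tiling[in_T _ _] ->].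
- move=> p q /imfsetP[c /= cG ->] /imfsetP[d /= dG ->] ne.
  apply/realize_interior_disjoint/fdisjointP => c' in_fc; apply/negP => in_fd.
  have [_ _ /(_ c' in_fc)[_ fc]] := tiling c cG; have [_ _ /(_ c' in_fd)[_ fd]] := tiling d dG.
  by move: ne; rewrite -fc -fd eqxx.
- apply/seteqP; split=> [z [p /= /imfsetP[c /= cG ->] [d /= d_in dz]]|z [c /= cG cz]].
    by have [_ _ /(_ d d_in)[dG _]] := tiling c cG; exists d.
  exists (f c) => /=; first by apply/imfsetP; exists c.
  by have [_ c_in _] := tiling c cG; exists c.
Qed.

End CellTopology.

Lemma mem_rectangle a b (x y : nat) :
  ((Posz x, Posz y) \in rectangle a b) = (x < a) && (y < b).
Proof.
apply/imfset2P/andP => [[i /= in_i [j /= in_j [-> ->]]]|[lt_x lt_y]].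
  by move: in_i in_j; rewrite !mem_iota.
by exists x; rewrite ?mem_iota //; exists y; rewrite ?mem_iota.
Qed.

Lemma mem_rectangleN a b c : c \in rectangle a b ->
  exists x y : nat, [/\ c = (Posz x, Posz y), x < a & y < b].
Proof.
case/imfset2P => i /= in_i [j /= in_j ->]; exists i, j.
by move: in_i in_j; rewrite !mem_iota.
Qed.

Lemma rectangle_inj a b a' b' : 0 < a -> 0 < b -> rectangle a b = rectangle a' b' ->
  a = a' /\ b = b'.
Proof.
move=> a_gt0 b_gt0 e.
have same x y : (x < a) && (y < b) = (x < a') && (y < b') by rewrite -!mem_rectangle e.
have := same a.-1 b.-1; have := same a'.-1 b'.-1; have := same a 0; have := same 0 b.
by have := same a' 0; have := same 0 b'; lia.
Qed.

Lemma mem_translate v (S : cells) (c : square) :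
  (c \in translate v S) = (((c.1 - v.1)%R, (c.2 - v.2)%R) \in S).
Proof.
apply/imfsetP/idP => [[d /= dS ->] /=|in_S].
  by rewrite !addrK -surjective_pairing.
by exists ((c.1 - v.1)%R, (c.2 - v.2)%R); rewrite //= !subrK -surjective_pairing.
Qed.

Definition shift_cell (c : square) (dx dy : int) : square := ((c.1 + dx)%R, (c.2 + dy)%R).

Lemma shift_cell0 c : shift_cell c 0 0 = c.
Proof. by rewrite /shift_cell !addr0; case: c. Qed.

Lemma shift_cellD c dx dy dx' dy' :
  shift_cell (shift_cell c dx dy) dx' dy' = shift_cell c (dx + dx')%R (dy + dy')%R.
Proof. by rewrite /shift_cell /= !addrA. Qed.

Lemma shift_cellK c dx dy : shift_cell (shift_cell c dx dy) (- dx)%R (- dy)%R = c.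
Proof. by rewrite shift_cellD !addrN shift_cell0. Qed.

Lemma mem_translate_rectangleP a b (v c : square) : c \in translate v (rectangle a b) <->
  exists i j : nat, [/\ i < a, j < b & c = shift_cell v i j].
Proof.
rewrite mem_translate; split=> [in_rect|[i [j [lt_i lt_j ->]]]].
  have [i [j [e lt_i lt_j]]] := mem_rectangleN in_rect; exists i, j; split=> //.
  by move: e; rewrite /shift_cell; case: (c) => c1 c2 [e1 e2]; congr pair; lia.
by rewrite /= (addrC v.1) addrK (addrC v.2) addrK mem_rectangle lt_i lt_j.
Qed.

Lemma mem_translate_rectangle (vx vy a b x y : nat) :
  ((Posz x, Posz y) \in translate (Posz vx, Posz vy) (rectangle a b)) =
  (vx <= x < vx + a) && (vy <= y < vy + b).
Proof.
apply/idP/idP => [/mem_translate_rectangleP[i [j [lt_i lt_j [ex ey]]]]|in_box]; first by lia.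
apply/mem_translate_rectangleP; exists (x - vx), (y - vy).
by split; [lia | lia | rewrite /shift_cell /=; congr pair; lia].
Qed.

Section NatTilings.
Variables (T : {fset cells}) (S : cells) (G : nat -> nat -> bool).
Hypothesis mem_S : forall c, c \in S <-> exists x y : nat, c = (Posz x, Posz y) /\ G x y.

Lemma mem_S_nat x y : ((Posz x, Posz y) \in S) = G x y.
Proof. by apply/idP/idP => [/mem_S[x' [y' [[-> ->]]]]|g] //; apply/mem_S; exists x, y. Qed.

Lemma tiled_fun_tiling tile_x tile_y tile_w tile_h : tiled G tile_x tile_y tile_w tile_h ->
  (forall x y, G x y -> rectangle (tile_w x y) (tile_h x y) \in T) -> exists f, fun_tiling T S f.
Proof.
move=> tiling in_T.
exists (fun c => let x := `|c.1|%N in let y := `|c.2|%N in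
  (rectangle (tile_w x y) (tile_h x y), (Posz (tile_x x y), Posz (tile_y x y)))).
move=> c /mem_S[x [y [-> g]]] /=; have [in_x in_y sub] := tiling x y g.
split; [exact: in_T | by rewrite mem_translate_rectangle in_x in_y |].
move=> _ /mem_translate_rectangleP[i [j [lt_i lt_j ->]]]; rewrite /shift_cell /= -!PoszD /=.
by have [|| g' -> -> -> ->] := sub (tile_x x y + i) (tile_y x y + j);
  [lia | lia | rewrite mem_S_nat].
Qed.

Lemma fun_tiling_tiled f : (forall t, t \in T -> rectangular t) -> fun_tiling T S f ->
  exists tile_x tile_y tile_w tile_h, tiled G tile_x tile_y tile_w tile_h /\
    forall x y, G x y ->
      [/\ 0 < tile_w x y, 0 < tile_h x y & rectangle (tile_w x y) (tile_h x y) \in T].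
Proof.
move=> rect tiling.
have boxes (p : nat * nat) : exists t : (nat * nat) * (nat * nat), G p.1 p.2 ->
    [/\ f (Posz p.1, Posz p.2) = (rectangle t.2.1 t.2.2, (Posz t.1.1, Posz t.1.2)),
      0 < t.2.1 & 0 < t.2.2].
  case: p => x y /=; have [g|_] := boolP (G x y); last by exists ((0, 0), (0, 0)).
  have := tiling (Posz x, Posz y); rewrite mem_S_nat => /(_ g).
  case: (f _) => [t v] /= [/rect[a [b [a_gt0 b_gt0 ->]]] _ sub].
  have [|/mem_S[vx [vy [ev _]]] _] := sub v; last by exists ((vx, vy), (a, b)); rewrite ev.
  by apply/mem_translate_rectangleP; exists 0, 0; split=> //; rewrite /shift_cell !addr0; case: (v).
have [t tP] := choice boxes.
exists (fun x y => (t (x, y)).1.1), (fun x y => (t (x, y)).1.2).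
exists (fun x y => (t (x, y)).2.1), (fun x y => (t (x, y)).2.2).
split=> x y g; have [ef w_gt0 h_gt0] := tP (x, y) g; have := tiling (Posz x, Posz y).
  all: rewrite mem_S_nat => /(_ g); rewrite ef => -[in_T in_tile sub] //.
move: in_tile; rewrite mem_translate_rectangle => /andP[in_x in_y]; split=> // x' y' in_x' in_y'.
have [] := sub (Posz x', Posz y'); first by rewrite mem_translate_rectangle /= in_x'.
rewrite mem_S_nat => g'; have [ef' w'_gt0 h'_gt0] := tP (x', y') g'.
by rewrite ef' => -[/(rectangle_inj w'_gt0 h'_gt0)[-> ->] -> ->].
Qed.

End NatTilings.

(** * Grid colorings as tilings *)

Lemma digit_inj q a b a' b' : a < q -> a' < q -> a + q * b = a' + q * b' -> a = a' /\ b = b'.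
Proof.
move=> lt_a lt_a' e; have := edivn_eq b lt_a.
by rewrite mulnC addnC e addnC mulnC edivn_eq // => -[-> ->].
Qed.

Section Digits.
Variable q : nat.

Definition digits4 a b c d : nat := a + q * (b + q * (c + q * d)).

Lemma digits4D a b c d a' b' c' d' :
  digits4 a b c d + digits4 a' b' c' d' = digits4 (a + a') (b + b') (c + c') (d + d').
Proof. by rewrite /digits4 !mulnDr; lia. Qed.

Lemma digits4_inj a b c d a' b' c' d' : a < q -> b < q -> c < q -> a' < q ->
  b' < q -> c' < q -> digits4 a b c d = digits4 a' b' c' d' ->
  [/\ a = a', b = b', c = c' & d = d'].
Proof.
move=> lt_a lt_b lt_c lt_a' lt_b' lt_c'.
by move=> /(digit_inj lt_a lt_a')[-> /(digit_inj lt_b lt_b')[-> /(digit_inj lt_c lt_c')[-> ->]]].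
Qed.

Lemma leq_digits4 a b c d a' b' c' d' : a <= a' -> b <= b' -> c <= c' -> d <= d' ->
  digits4 a b c d <= digits4 a' b' c' d'.
Proof.
by move=> *; rewrite !leq_add // leq_mul // leq_add // leq_mul // leq_add // leq_mul.
Qed.

Definition digit_if (b : bool) (r : nat) : nat := if b then r else 0.

Definition parity_digits (i k r : nat) : nat :=
  digits4 (digit_if (~~ odd i && ~~ odd k) r) (digit_if (odd i && ~~ odd k) r)
       (digit_if (~~ odd i && odd k) r) (digit_if (odd i && odd k) r).

End Digits.

Section DigitEquations.
Variable N : nat.
Local Notation pdigits := (parity_digits (4 * N + 1)).
Implicit Types (i k r s u v : nat) (j l : bool).

Lemma digits_eq a b c d a' b' c' d' :
  digits4 (4 * N + 1) a b c d = digits4 (4 * N + 1) a' b' c' d' ->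
  [&& a <= 3 * N, b <= 3 * N, c <= 3 * N, a' <= 3 * N, b' <= 3 * N
    & c' <= 3 * N] -> [/\ a = a', b = b', c = c' & d = d'].
Proof. by move=> e small; apply: (digits4_inj _ _ _ _ _ _ e); lia. Qed.

Ltac digits := rewrite /parity_digits /= ?oddb ?digits4D => /digits_eq; rewrite /digit_if.
Ltac solve_digits := rewrite /=; match goal with |- (is_true ?small -> _) -> _ =>
  let small_digits := fresh in (have small_digits : small by lia);
  move=> /(_ small_digits); clear small_digits;
  case=> ? ? ? ?; first [split; lia | lia | by split=> //; lia] end.

Lemma parity_digits_inj i k r s : 0 < r <= N -> 0 < s <= N -> pdigits i k r = pdigits i k s ->
  r = s.
Proof.
by move=> r_small s_small; digits; case: (odd i); case: (odd k); solve_digits.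
Qed.

Lemma parity_digits_edge_v i k j r s u v : 0 < r <= N -> 0 < s <= N -> 0 < u <= N ->
  0 < v <= N -> pdigits i.+1 k v + pdigits j (odd k) r = pdigits i k u + pdigits (~~ j) (odd k) s ->
  r = u /\ s = v.
Proof.
move=> r_small s_small u_small v_small; digits.
by case: j; case: (odd i); case: (odd k); solve_digits.
Qed.

Lemma parity_digits_edge_h i k j l r s u v : 0 < r <= N -> 0 < s <= N -> 0 < u <= N ->
  0 < v <= N -> pdigits i k.+1 v + pdigits j l r = pdigits i k u + pdigits j (~~ l) s ->
  r = u /\ s = v.
Proof.
move=> r_small s_small u_small v_small; digits.
by case: j; case: l; case: (odd i); case: (odd k); solve_digits.
Qed.

Lemma parity_digits_corner i k (j j' l : bool) r s u r1 s1 u1 : 0 < r <= N -> 0 < s <= N ->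
  0 < u <= N -> 0 < r1 <= N -> 0 < s1 <= N -> 0 < u1 <= N ->
  pdigits i k.+1 r + pdigits (~~ j) (odd k.+1) s + pdigits j' l u1 =
  pdigits i.+1 k u + pdigits j' (~~ l) s1 + pdigits j (odd k.+1) r1 ->
  [/\ j' = ~~ odd i, l = odd k & u = u1].
Proof.
move=> r_small s_small u_small r1_small s1_small u1_small; digits.
by case: j; case: j'; case: l; case: (odd i); case: (odd k); solve_digits.
Qed.

End DigitEquations.

Section Coloring.
Variables (C : finType) (hcompat vcompat : rel C).

Definition color_rank (c : C) : nat := (enum_rank c).+1.
Local Notation N := #|C|.
Local Notation q := (4 * N + 1).
Local Notation pdigits := (parity_digits q).

Lemma color_rank_le c : 0 < color_rank c <= N.
Proof. exact: ltn_ord. Qed.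

Lemma color_rank_inj : injective color_rank.
Proof. by move=> c d [] /ord_inj/enum_rank_inj. Qed.

Definition slack : nat := (digits4 q N N N N).+1.
Definition small_base : nat := 21 * slack.
Definition big_base : nat := 42 * slack.
Definition base_level (i k : nat) : nat := big_base * i + small_base * k.
Definition color_level (i k : nat) (c : C) : nat := base_level i k + pdigits i k (color_rank c).

Lemma parity_digits_lt i k c : pdigits i k (color_rank c) < slack.
Proof.
have /andP[_ le_N] := color_rank_le c; rewrite ltnS.
by apply: leq_digits4; rewrite /digit_if; case: ifP => _; lia.
Qed.

Definition small_heights : seq nat :=
  [seq small_base + pdigits ik.1 ik.2.+1 (color_rank p.2) - pdigits ik.1 ik.2 (color_rank p.1)
     | ik <- [:: (0, 0); (0, 1); (1, 0); (1, 1)],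
       p <- [seq p <- enum {: C * C} | hcompat p.1 p.2]].

Definition big_heights (b : bool) : seq nat :=
  [seq big_base + pdigits i.+1 b (color_rank p.2) - pdigits i b (color_rank p.1)
     | i <- [:: 0; 1], p <- [seq p <- enum {: C * C} | vcompat p.1 p.2]].

Definition tile_seq : seq cells :=
  [seq rectangle 4 h | h <- small_heights] ++
  [seq rectangle 5 h | h <- big_heights false] ++
  [seq rectangle 7 h | h <- big_heights true].

Definition tile_set : {fset cells} := [fset t in tile_seq]%fset.

Lemma mem_tile_set t : (t \in tile_set) = (t \in tile_seq).
Proof. by apply/imfsetP/idP => [[x /= in_x ->]//|in_t]; exists t. Qed.

Lemma parity_digits_odd i k r : pdigits i k r = pdigits (odd i) (odd k) r.
Proof. by rewrite /parity_digits !oddb. Qed.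

Lemma small_heightP h : h \in small_heights <-> exists (i k : bool) c d,
  hcompat c d /\ h + pdigits i k (color_rank c) = small_base + pdigits i (~~ k) (color_rank d).
Proof.
have digits_le i k c : pdigits i k (color_rank c) <= small_base.
  by have := parity_digits_lt i k c; rewrite /small_base; lia.
split.
  case/allpairsP => -[[i k] [c d]] /= [_]; rewrite mem_filter /= => /andP[cd _] ->.
  exists (odd i), (odd k), c, d; split=> //; rewrite -(parity_digits_odd i k) subnK.
    by congr addn; apply: parity_digits_odd.
  exact: leq_trans (digits_le _ _ _) (leq_addr _ _).
case=> i [k [c [d [cd height]]]]; apply/allpairsP; exists ((i : nat, k : nat), (c, d)).
split; [by case: i {height}; case: k | by rewrite mem_filter mem_enum cd |].
have -> : pdigits i k.+1 (color_rank d) = pdigits i (~~ k) (color_rank d) by case: (i); case: (k).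
by rewrite -height addnK.
Qed.

Lemma big_heightP b h : h \in big_heights b <-> exists (i : bool) c d,
  vcompat c d /\ h + pdigits i b (color_rank c) = big_base + pdigits (~~ i) b (color_rank d).
Proof.
have digits_le i k c : pdigits i k (color_rank c) <= big_base.
  by have := parity_digits_lt i k c; rewrite /big_base; lia.
split.
  case/allpairsP => -[i [c d]] /= [_]; rewrite mem_filter /= => /andP[cd _] ->.
  exists (odd i), c, d; split=> //.
  have -> : pdigits (odd i) b (color_rank c) = pdigits i b (color_rank c).
    by rewrite parity_digits_odd [RHS]parity_digits_odd oddb.
  rewrite subnK; last by apply: leq_trans (digits_le _ _ _) (leq_addr _ _).
  by congr addn; rewrite parity_digits_odd [RHS]parity_digits_odd /= !oddb.
case=> i [c [d [cd height]]]; apply/allpairsP; exists (i : nat, (c, d)).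
split; [by case: i {height} | by rewrite mem_filter mem_enum cd |].
have -> : pdigits i.+1 b (color_rank d) = pdigits (~~ i) b (color_rank d) by case: (i).
by rewrite -height addnK.
Qed.

Lemma small_near h : h \in small_heights -> small_base <= h + slack /\ h <= small_base + slack.
Proof.
move/small_heightP => [i [k [c [d [_ height]]]]].
by have := parity_digits_lt i k c; have := parity_digits_lt i (~~ k) d; lia.
Qed.

Lemma big_near b h : h \in big_heights b -> big_base <= h + slack /\ h <= big_base + slack.
Proof.
move/big_heightP => [i [c [d [_ height]]]].
by have := parity_digits_lt i b c; have := parity_digits_lt (~~ i) b d; lia.
Qed.

Lemma slack_gt0 : 0 < slack. Proof. by []. Qed.

Lemma color_level_base i k c : base_level i k <= color_level i k c <= base_level i k + slack.
Proof. by rewrite /color_level; have := parity_digits_lt i k c; lia. Qed.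

Lemma color_level_inj i k c d : color_level i k c = color_level i k d -> c = d.
Proof.
move=> same_level.
have same_digits : pdigits i k (color_rank c) = pdigits i k (color_rank d).
  by move: same_level; rewrite /color_level; lia.
apply: color_rank_inj; exact: parity_digits_inj (color_rank_le c) (color_rank_le d) same_digits.
Qed.

Lemma vcompat_decode i k c d : color_level i k c <= color_level i.+1 k d ->
  color_level i.+1 k d - color_level i k c \in big_heights (odd k) -> vcompat c d.
Proof.
move=> le_level /big_heightP[j [a [b [ab height]]]].
have digits_balance : pdigits i.+1 k (color_rank d) + pdigits j (odd k) (color_rank a) =
    pdigits i k (color_rank c) + pdigits (~~ j) (odd k) (color_rank b).
  by move: height le_level; rewrite /color_level /base_level mulnS; lia.
have [/color_rank_inj <- /color_rank_inj <- //] := parity_digits_edge_v (color_rank_le a)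
  (color_rank_le b) (color_rank_le c) (color_rank_le d) digits_balance.
Qed.

Lemma hcompat_decode i k c d : color_level i k c <= color_level i k.+1 d ->
  color_level i k.+1 d - color_level i k c \in small_heights -> hcompat c d.
Proof.
move=> le_level /small_heightP[j [l [a [b [ab height]]]]].
have digits_balance : pdigits i k.+1 (color_rank d) + pdigits j l (color_rank a) =
    pdigits i k (color_rank c) + pdigits j (~~ l) (color_rank b).
  by move: height le_level; rewrite /color_level /base_level mulnS; lia.
have [/color_rank_inj <- /color_rank_inj <- //] := parity_digits_edge_h (color_rank_le a)
  (color_rank_le b) (color_rank_le c) (color_rank_le d) digits_balance.
Qed.

(* The vertex above [b] and right of [d] is reached by a big and by a small
   tile; comparing digits forces both to end in the same color. *)
Lemma corner_decode i k (b d : C) y : color_level i k.+1 b <= y -> color_level i.+1 k d <= y ->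
  y - color_level i k.+1 b \in big_heights (odd k.+1) ->
    y - color_level i.+1 k d \in small_heights ->
  exists c, y = color_level i.+1 k.+1 c.
Proof.
move=> le_b le_d /big_heightP[j [b' [c [_ big_step]]]].
move=> /small_heightP[j' [l [d' [c' [_ small_step]]]]].
suff [digits_c digits_d] : pdigits i.+1 k.+1 (color_rank c') = pdigits j' (~~ l) (color_rank c') /\
    pdigits i.+1 k (color_rank d) = pdigits j' l (color_rank d').
  exists c'; move: small_step le_d.
  by rewrite /color_level /base_level !mulnS digits_c digits_d; lia.
have digits_balance :
    pdigits i k.+1 (color_rank b) + pdigits (~~ j) (odd k.+1) (color_rank c) +
      pdigits j' l (color_rank d') =
    pdigits i.+1 k (color_rank d) + pdigits j' (~~ l) (color_rank c') +
      pdigits j (odd k.+1) (color_rank b').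
  by move: big_step small_step le_b le_d; rewrite /color_level /base_level !mulnS; lia.
have [-> -> ->] := parity_digits_corner (color_rank_le b) (color_rank_le c) (color_rank_le d)
  (color_rank_le b') (color_rank_le c') (color_rank_le d') digits_balance.
by split; rewrite parity_digits_odd /= [in RHS]parity_digits_odd !oddb.
Qed.

Lemma color_level_ltSl i k c d : color_level i k c < color_level i.+1 k d.
Proof.
have := color_level_base i k c; have := color_level_base i.+1 k d; have := slack_gt0.
by rewrite /base_level mulnS /big_base; lia.
Qed.

Lemma color_level_ltSr i k c d : color_level i k c < color_level i k.+1 d.
Proof.
have := color_level_base i k c; have := color_level_base i k.+1 d; have := slack_gt0.
by rewrite /base_level mulnS /small_base; lia.
Qed.

Lemma big_tile_in_set i k c d : vcompat c d ->
  rectangle (col_width k) (color_level i.+1 k d - color_level i k c) \in tile_set.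
Proof.
move=> cd; have height : color_level i.+1 k d - color_level i k c \in big_heights (odd k).
  apply/big_heightP; exists (odd i), c, d; split=> //; have := color_level_ltSl i k c d.
  rewrite /color_level [pdigits i k _]parity_digits_odd [pdigits i.+1 k _]parity_digits_odd /=.
  by rewrite [pdigits (~~ odd i) (odd k) _]parity_digits_odd /base_level mulnS !oddb; lia.
rewrite mem_tile_set !mem_cat /col_width; apply/or3P; case: (odd k) height => height.
  by constructor 3; apply: map_f.
by constructor 2; apply: map_f.
Qed.

Lemma small_tile_in_set i k c d : hcompat c d ->
  rectangle 4 (color_level i k.+1 d - color_level i k c) \in tile_set.
Proof.
move=> cd; rewrite mem_tile_set !mem_cat; apply/or3P; constructor 1; apply: map_f.
apply/small_heightP; exists (odd i), (odd k), c, d; split=> //; have := color_level_ltSr i k c d.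
rewrite /color_level [pdigits i k _]parity_digits_odd [pdigits i k.+1 _]parity_digits_odd /=.
by rewrite [pdigits (odd i) (~~ odd k) _]parity_digits_odd /base_level mulnS !oddb; lia.
Qed.

Lemma tile_setP t : t \in tile_set -> exists a b, [/\ t = rectangle a b, 0 < a, 0 < b &
  a = 4 /\ b \in small_heights \/
  exists f : bool, a = (if f then 7 else 5) /\ b \in big_heights f].
Proof.
rewrite mem_tile_set !mem_cat => /or3P[] /mapP[h height ->].
- exists 4, h; split=> //; last by left.
  by have := small_near height; have := slack_gt0; rewrite /small_base; lia.
- exists 5, h; split=> //; last by right; exists false.
  by have := big_near height; have := slack_gt0; rewrite /big_base; lia.
- exists 7, h; split=> //; last by right; exists true.
  by have := big_near height; have := slack_gt0; rewrite /big_base; lia.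
Qed.

Lemma tile_set_rectangular t : t \in tile_set -> rectangular t.
Proof. by move=> /tile_setP[a [b [-> a_gt0 b_gt0 _]]]; exists a, b. Qed.

Lemma card_tile_set : #|` tile_set|%fset <= 8 * N ^ 2.
Proof.
apply: (@leq_trans (size tile_seq)).
  apply: uniq_leq_size; first exact: fset_uniq.
  by move=> t; rewrite mem_tile_set.
have pairs_le (r : rel C) : size [seq p <- enum {: C * C} | r p.1 p.2] <= N ^ 2.
  by rewrite size_filter; apply: leq_trans (count_size _ _) _; rewrite -cardE card_prod mulnn.
rewrite !size_cat !size_map !size_allpairs /=.
move: (pairs_le hcompat) (pairs_le vcompat); move: (size _) (size _) (N ^ 2) => a b c; lia.
Qed.

Section Instance.
Variables (R : realType) (m n : nat) (boundary : nat -> nat -> C).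
Hypotheses (m_gt0 : 0 < m) (n_gt0 : 0 < n).

Definition boundary_level (i k : nat) : nat := color_level i k (boundary i k).

Definition grid_cells : seq square :=
  [seq (Posz x, Posz y) | x <- iota 0 (region_width m n),
     y <- iota (frontier m n boundary_level 0 x)
       (frontier m n boundary_level m x - frontier m n boundary_level 0 x)].

Lemma mem_grid_cells c : c \in grid_cells <->
  exists x y, c = (Posz x, Posz y) /\ in_staircase m n boundary_level x y.
Proof.
split=> [/allpairsPdep[x [y [in_x in_y ->]]]|[x [y [-> /andP[lt_x in_y]]]]].
  by exists x, y; split=> //; move: in_x in_y; rewrite !mem_iota /in_staircase /= => ->; lia.
by apply/allpairsPdep; exists x, y; rewrite !mem_iota; split=> //; lia.
Qed.

Lemma uniq_grid_cells : uniq grid_cells.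
Proof.
apply: allpairs_uniq_dep => [|x _|[x y] [x' y'] _ _ /= [-> ->] //]; exact: iota_uniq.
Qed.

Definition colorable := exists col : nat -> nat -> C,
  [/\ forall i k, i <= m -> k <= n -> on_boundary m n i k -> col i k = boundary i k,
      forall i k, i < m -> k < n -> vcompat (col i k) (col i.+1 k)
    & forall i k, i < m -> k < n -> hcompat (col i k) (col i k.+1)].

Local Notation G := (in_staircase m n boundary_level).

Lemma mem_grid_region c : c \in [fset c in grid_cells]%fset <->
  exists x y, c = (Posz x, Posz y) /\ G x y.
Proof. by rewrite inE; exact: mem_grid_cells. Qed.

Lemma tiled_levels tile_x tile_y tile_w tile_h : tiled G tile_x tile_y tile_w tile_h ->
  (forall x y, G x y -> [/\ 0 < tile_w x y, 0 < tile_h x y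
    & rectangle (tile_w x y) (tile_h x y) \in tile_set]) ->
  exists Y : nat -> nat -> nat,
  [/\ forall i k, i <= m -> k <= n -> on_boundary m n i k -> Y i k = boundary_level i k,
      forall i k, i < m -> k < n -> exists c, Y i k = color_level i k c,
      forall i k, i < m -> k < n -> Y i k <= Y i.+1 k /\ Y i.+1 k - Y i k \in big_heights (odd k)
    & forall i k, i < m -> k < n -> Y i k <= Y i k.+1 /\ Y i k.+1 - Y i k \in small_heights].
Proof.
move=> tiling in_T.
apply: (@staircase_rigid m n boundary_level base_level slack small_base big_base m_gt0 n_gt0
  slack_gt0 _ _ _ _ _ (fun h => h \in small_heights) (fun b h => h \in big_heights b) _ _
  (fun i k y => exists c, y = color_level i k c) _ _ _ _ tile_x tile_y tile_w tile_h tiling).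
- by rewrite /small_base; have := slack_gt0; lia.
- by rewrite /small_base /big_base; have := slack_gt0; lia.
- by move=> i k; rewrite /base_level mulnS; lia.
- by move=> i k; rewrite /base_level mulnS; lia.
- by move=> i k _; apply: color_level_base.
- exact: small_near.
- exact: big_near.
- by move=> i k y [c ->]; apply: color_level_base.
- by move=> k; exists (boundary 0 k).
- by move=> i; exists (boundary i 0).
- by move=> i k a b y [c ->] [d ->] big_step small_step le_a le_b;
    exact: corner_decode le_a le_b big_step small_step.
- move=> x y g; have [w_gt0 h_gt0 /tile_setP[a [b [e _ _ dims]]]] := in_T x y g.
  by have [-> ->] := rectangle_inj w_gt0 h_gt0 e.
Qed.

Lemma tileable_colorable : tileable R tile_set [fset c in grid_cells]%fset -> colorable.
Proof.
move=> /tileableP[f /(fun_tiling_tiled mem_grid_region tile_set_rectangular)].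
case=> [tile_x [tile_y [tile_w [tile_h [tiling in_T]]]]].
have [Y [Y_boundary Y_color Y_up Y_right]] := tiled_levels tiling in_T.
have colors (p : nat * nat) : exists c, p.1 <= m -> p.2 <= n -> ~~ ((p.1 == m) && (p.2 == n)) ->
    Y p.1 p.2 = color_level p.1 p.2 c.
  case: p => i k /=; have [/andP[lt_i lt_k]|not_inside] := boolP ((i < m) && (k < n)).
    by have [c] := Y_color i k lt_i lt_k; exists c.
  exists (boundary i k) => le_i le_k not_corner; rewrite Y_boundary // /on_boundary.
  by move: not_inside not_corner; lia.
have [col colP] := choice colors; exists (fun i k => col (i, k)).
split=> [i k le_i le_k edge|i k lt_i lt_k|i k lt_i lt_k].
- apply: (@color_level_inj i k); rewrite -(colP (i, k)) //=; first by rewrite Y_boundary.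
  by move: edge; rewrite /on_boundary; lia.
- have [le height] := Y_up i k lt_i lt_k; move: le height.
  rewrite (colP (i, k)) ?(colP (i.+1, k)) /=; try lia; exact: vcompat_decode.
- have [le height] := Y_right i k lt_i lt_k; move: le height.
  rewrite (colP (i, k)) ?(colP (i, k.+1)) /=; try lia; exact: hcompat_decode.
Qed.

Lemma eq_frontier_boundary (Y Y' : nat -> nat -> nat) x : x < region_width m n ->
  (forall i k, i <= m -> k <= n -> on_boundary m n i k -> Y i k = Y' i k) ->
  frontier m n Y 0 x = frontier m n Y' 0 x /\ frontier m n Y m x = frontier m n Y' m x.
Proof.
rewrite /region_width => lt_x eqY; rewrite /frontier subn0 subnn muln0 subn0 ltn0.
split.
  case: ltnP => [left_x|mid_x]; first by apply: eqY; rewrite /on_boundary; lia.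
  have -> : x - 4 * m < col_start n by lia.
  have lt_col : col_of (x - 4 * m) < n by rewrite ltn_col_of; lia.
  by apply: eqY; rewrite /on_boundary; lia.
case: ltnP => [mid_x|right_x]; last by apply: eqY; rewrite /on_boundary; lia.
have lt_col : col_of x < n by rewrite ltn_col_of.
by apply: eqY; rewrite /on_boundary; lia.
Qed.

Lemma colorable_tileable : colorable -> tileable R tile_set [fset c in grid_cells]%fset.
Proof.
move=> [col [col_boundary col_v col_h]]; pose Y i k := color_level i k (col i k).
have in_staircaseE x y : G x y = in_staircase m n Y x y.
  rewrite /in_staircase; case hx: (x < region_width m n) => //=.
  have [|-> -> //] := @eq_frontier_boundary boundary_level Y x hx.
  by move=> i k le_i le_k edge; rewrite /boundary_level /Y col_boundary.
have [tiling dims] := @staircase_tile_tiled m n Y n_gt0 (fun i k _ _ => color_level_ltSl i k _ _)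
  (fun i k _ _ => color_level_ltSr i k _ _).
have mem_region c : c \in [fset c in grid_cells]%fset <->
    exists x y, c = (Posz x, Posz y) /\ in_staircase m n Y x y.
  by rewrite mem_grid_region; split=> -[x [y [-> g]]]; exists x, y; rewrite in_staircaseE in g *.
apply/tileableP; apply: (tiled_fun_tiling mem_region tiling) => x y g.
have [i [k [lt_i lt_k [->|->]]]] := dims x y g => /=.
  by apply: big_tile_in_set; apply: col_v.
by apply: small_tile_in_set; apply: col_h.
Qed.

End Instance.
End Coloring.

(** * Satisfiability as a grid coloring *)

Definition literal : Type := (nat * bool)%type.
Definition cnf : Type := seq (seq literal).

Definition lit_true (x : nat -> bool) (l : literal) : bool := x l.1 (+) l.2.
Definition satisfies (x : nat -> bool) (F : cnf) : bool := all (has (lit_true x)) F.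

(* check row?, horizontal bit, content of the column, trigger, trigger of the
   left neighbour; a column is blank ([None]), a clause end ([Some None]) or
   carries the value of a literal *)
Definition inner_color : finType :=
  (bool * bool * option (option bool) * option bool * option bool)%type.
Definition color_check (c : inner_color) : bool := c.1.1.1.1.
Definition color_bit (c : inner_color) : bool := c.1.1.1.2.
Definition color_content (c : inner_color) : option (option bool) := c.1.1.2.
Definition color_trigger (c : inner_color) : option bool := c.1.2.
Definition color_left_trigger (c : inner_color) : option bool := c.2.

(* trigger, trigger of the left neighbour, kind of the column: blank, clause
   end ([Some false]) or literal ([Some true]) *)
Definition bottom_color : finType := (option bool * option bool * option bool)%type.
Definition color : finType := (inner_color + (bottom_color + (bool + bool)))%type.

Definition inner_vertex (c : inner_color) : color := inl c.
Definition bottom_vertex (c : bottom_color) : color := inr (inl c).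
Definition left_vertex (check : bool) : color := inr (inr (inl check)).
Definition top_vertex : color := inr (inr (inr true)).
Definition right_vertex : color := inr (inr (inr false)).

Definition scan_ok (acc : bool) (v : option (option bool)) (acc' : bool) : bool :=
  match v with
  | None => acc' == acc
  | Some None => acc && ~~ acc'
  | Some (Some b) => acc' == acc || b
  end.

Definition row_ok (check : bool) (h : bool) (v : option (option bool)) (h' : bool) :=
  if check then scan_ok h v h' else h' == h.

Definition crossing_ok (c : inner_color) : bool :=
  match color_trigger c, color_content c with
  | Some s, Some (Some b) => color_check c || (color_bit c == b (+) s)
  | _, _ => true
  end.

Definition kind_ok (k : option bool) (v : option (option bool)) : bool :=
  match k, v with
  | None, None => true
  | Some false, Some None => true
  | Some true, Some (Some _) => true
  | _, _ => false
  end.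

Definition hcompat (a b : color) : bool :=
  match a, b with
  | inl a, inl c =>
      [&& color_check a == color_check c, color_left_trigger c == color_trigger a
        & row_ok (color_check a) (color_bit a) (color_content c) (color_bit c)]
  | inr (inr (inl check)), inl c =>
      [&& check == color_check c, color_left_trigger c == None
        & check ==> scan_ok false (color_content c) (color_bit c)]
  | inl _, inr (inr (inr false)) => true
  | inr (inr (inl _)), inr (inl (_, tl', _)) => tl' == None
  | inr (inl (tr, _, _)), inr (inl (_, tl', _)) => tl' == tr
  | inr (inl _), inr (inr (inr false)) => true
  | inr (inr (inl _)), inr (inr (inr false)) => true
  | _, _ => false
  end.

Definition vcompat (a b : color) : bool :=
  match a, b with
  | inr (inl (_, tl, kd)), inl c =>
      [&& crossing_ok c, color_trigger c == tl & kind_ok kd (color_content c)]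
  | inl a, inl c => [&& crossing_ok c, color_trigger c == color_left_trigger a
                      & color_content c == color_content a]
  | inl _, inr (inr (inr true)) => true
  | inr (inr (inl _)), inr (inr (inl _)) => true
  | _, _ => false
  end.

Lemma card_color : 8 * #|color| ^ 2 <= 10 ^ 6.
Proof.
by rewrite /color /inner_color /bottom_color !card_sum !card_prod !card_option !card_bool.
Qed.

(* trigger, kind, value of the literal *)
Definition letter_value : Type := (option bool * option bool * bool)%type.

Definition content (w : letter_value) : option (option bool) :=
  match w.1.2 with
  | None => None
  | Some false => Some None
  | Some true => Some (Some w.2)
  end.

Definition blank_value : letter_value := (None, None, false).

Section Word.
Variables (V : nat) (x : nat -> bool).

Definition block (l : literal) : seq letter_value :=
  [seq (if p == V - l.1.+1 then Some l.2 else None,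
        if p == V then Some true else None, lit_true x l) | p <- iota 0 V.+1].

Definition literal_block (o : option literal) : seq letter_value :=
  if o is Some l then block l else [:: (None, Some false, false)].

Definition cnf_pieces (F : cnf) : seq (option literal) :=
  flatten [seq rcons (map Some cl) None | cl <- F].

Definition word_values (pieces : seq (option literal)) : seq letter_value :=
  flatten (map literal_block pieces).

Lemma word_values_some l pieces : word_values (Some l :: pieces) = block l ++ word_values pieces.
Proof. by []. Qed.

Lemma word_values_none pieces : word_values (None :: pieces) =
  (None, Some false, false) :: word_values pieces.
Proof. by []. Qed.

Fixpoint scan_word (acc : bool) (ws : seq letter_value) : bool :=
  match ws with
  | [::] => true
  | (_, None, _) :: ws' => scan_word acc ws'
  | (_, Some false, _) :: ws' => acc && scan_word false ws'
  | (_, Some true, b) :: ws' => scan_word (acc || b) ws'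
  end.

Lemma scan_word_cons acc w ws :
  scan_word acc (w :: ws) <-> exists2 acc', scan_ok acc (content w) acc' & scan_word acc' ws.
Proof.
case: w => [[tr [[]|]] b] /=; rewrite /content /=; split.
- by exists (acc || b).
- by case=> acc' /eqP ->.
- by case/andP => ->; exists false.
- by case=> acc' /andP[-> /negbTE ->].
- by exists acc.
- by case=> acc' /eqP ->.
Qed.

Lemma scan_wordP a ws : scan_word a ws <-> exists2 acc : nat -> bool, acc 0 = a &
  forall j, j < size ws -> scan_ok (acc j) (content (nth blank_value ws j)) (acc j.+1).
Proof.
elim: ws a => [|w ws IH] a; first by split=> // _; exists (fun=> a).
rewrite scan_word_cons; split=> [[a' first_ok /IH[acc acc0 ok]]|[acc <- ok]].
  exists (fun j => if j is j'.+1 then acc j' else a) => // -[|j] lt_j; first by rewrite acc0.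
  exact: ok.
exists (acc 1); first exact: (ok 0).
by apply/IH; exists (fun j => acc j.+1) => // j; apply: (ok j.+1).
Qed.

Lemma scan_block acc l ws :
  scan_word acc (block l ++ ws) = scan_word (acc || lit_true x l) ws.
Proof.
rewrite /block -[V.+1]addn1 iotaD map_cat -catA add0n.
rewrite [X in _ ++ (X ++ _)]/= eqxx /=.
have : forall p, p \in iota 0 V -> p != V by move=> p; rewrite mem_iota; lia.
elim: (iota 0 V) => //= p s IH h; rewrite (negbTE (h p (mem_head _ _))).
by apply: IH => q hq; apply: h; rewrite inE hq orbT.
Qed.

Lemma scan_clause acc cl ws :
  scan_word acc (word_values (rcons (map Some cl) None) ++ ws) =
  (acc || has (lit_true x) cl) && scan_word false ws.
Proof.
elim: cl acc => [|l cl IH] acc; first by rewrite /= orbF.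
by rewrite map_cons rcons_cons word_values_some -catA scan_block IH orbA.
Qed.

Lemma scan_cnf_pieces F : scan_word false (word_values (cnf_pieces F)) = satisfies x F.
Proof.
elim: F => //= cl F IH; rewrite /cnf_pieces /= /word_values map_cat flatten_cat.
by rewrite -/(word_values _) scan_clause -IH.
Qed.

Lemma nth_block l p : p <= V -> nth blank_value (block l) p =
  (if p == V - l.1.+1 then Some l.2 else None,
   if p == V then Some true else None, lit_true x l).
Proof. by move=> h; rewrite (nth_map 0) ?size_iota // nth_iota. Qed.

Lemma size_block l : size (block l) = V.+1.
Proof. by rewrite size_map size_iota. Qed.

Lemma no_early_literal pieces j : j < V ->
  (nth blank_value (word_values pieces) j).1.2 != Some true.
Proof.
elim: pieces j => [|[l|] pieces IH] j hj; first by rewrite nth_nil.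
  rewrite word_values_some nth_cat size_block ltnS (ltnW hj) nth_block ?(ltnW hj) //=.
  by case: (eqVneq j V) => // e; move: hj; rewrite e ltnn.
by case: j hj => //= j hj; apply: IH; apply: ltnW.
Qed.

Definition vars_lt (pieces : seq (option literal)) :=
  all (fun o => if o is Some l then l.1 < V else true) pieces.

(* Triggers are at least [V + 1] columns away from all literal columns but
   their own. *)
Lemma trigger_literal pieces a b s : vars_lt pieces -> a < b <= a + V ->
  (nth blank_value (word_values pieces) a).1.1 = Some s ->
    (nth blank_value (word_values pieces) b).1.2 = Some true ->
  (nth blank_value (word_values pieces) b).2 = x (b - a).-1 (+) s.
Proof.
elim: pieces a b => [|[l|] pieces IH] a b; first by rewrite !nth_nil.
  rewrite word_values_some => /andP[hl hps] hab; rewrite !nth_cat size_block.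
  have [ha|ha] := ltnP a V.+1.
    rewrite nth_block //=; case: eqP => // ea [<-].
    have [hb|hb] := ltnP b V.+1.
      rewrite nth_block //=; case: eqP => // eb _; rewrite /lit_true.
      by congr (x _ (+) _); lia.
    move=> h; by have := @no_early_literal pieces (b - V.+1) (ltac:(lia)); rewrite h.
  have -> : b < V.+1 = false by lia.
  have -> : b - a = b - V.+1 - (a - V.+1) by lia.
  by apply: IH => //; lia.
rewrite word_values_none; case: a b => [|a] [|b] //= hps hab.
by rewrite subSS; apply: IH => //; lia.
Qed.

Lemma own_trigger pieces b : vars_lt pieces ->
  (nth blank_value (word_values pieces) b).1.2 = Some true ->
  exists v s, [/\ v < V, v < b, (nth blank_value (word_values pieces) (b - v.+1)).1.1 = Some s
    & (nth blank_value (word_values pieces) b).2 = x v (+) s].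
Proof.
elim: pieces b => [|[l|] pieces IH] b; first by rewrite nth_nil.
  rewrite word_values_some => /andP[hl hps]; rewrite !nth_cat size_block.
  have [hb|hb] := ltnP b V.+1.
    rewrite nth_block //; case: (eqVneq b V) => // eb _; exists l.1, l.2.
    have hb' : b - l.1.+1 < V.+1 by lia.
    rewrite nth_cat size_block hb' nth_block //; split=> //; first by lia.
    by rewrite /= eb eqxx.
  move=> trigger; have [v [s [? ? ? ?]]] := IH _ hps trigger; exists v, s; split=> //; first by lia.
  rewrite nth_cat size_block; have -> : b - v.+1 < V.+1 = false by lia.
  by rewrite subnAC.
rewrite word_values_none; case: b => //= b hps trigger.
have [v [s [? ? ? ?]]] := IH _ hps trigger; exists v, s; split=> //; first by lia.
by have -> : b.+1 - v.+1 = (b - v.+1).+1 by lia.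
Qed.

End Word.

Section Sat.
Variables (V : nat) (F : cnf).
Hypothesis F_vars : all (all (fun l : literal => l.1 < V)) F.

Let pieces := cnf_pieces F.
Lemma pieces_vars_lt : vars_lt V pieces.
Proof.
apply/allP => o /flattenP[s /mapP[cl hcl ->]]; rewrite mem_rcons inE.
case/orP => [/eqP -> //|/mapP[l hl ->]].
by have /allP/(_ _ hcl)/allP/(_ _ hl) := F_vars.
Qed.

Definition cnf_word : seq (option bool * option bool) := unzip1 (word_values V xpred0 pieces).

Lemma unzip1_word_values x : unzip1 (word_values V x pieces) = cnf_word.
Proof.
rewrite /cnf_word; elim: pieces => // -[l|] s IH; last by rewrite !word_values_none /= IH.
by rewrite !word_values_some /unzip1 !map_cat -!/(unzip1 _) IH /block /unzip1 -!map_comp.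
Qed.

Definition trigger_at (k : nat) : option bool :=
  if k is j.+1 then (nth (None, None) cnf_word j).1 else None.
Definition kind_at (k : nat) : option bool := (nth (None, None) cnf_word k.-1).2.

Definition grid_height : nat := V.+2.
Definition grid_width : nat := (size cnf_word).+1.

Definition grid_border (i k : nat) : color :=
  if k == 0 then left_vertex (i == V.+1) else if k == grid_width then right_vertex
  else if i == 0 then bottom_vertex (trigger_at k, trigger_at k.-1, kind_at k) else top_vertex.

Lemma nth_cnf_word x j : nth (None, None) cnf_word j =
  (nth blank_value (word_values V x pieces) j).1.
Proof.
have [h|h] := ltnP j (size cnf_word).
  by rewrite -(unzip1_word_values x) (nth_map blank_value) //; move: h;
    rewrite -(unzip1_word_values x) size_map.
by rewrite !nth_default //; move: h; rewrite -(unzip1_word_values x) size_map.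
Qed.

Lemma kind_atE x k : kind_at k = (nth blank_value (word_values V x pieces) k.-1).1.2.
Proof. by rewrite /kind_at (nth_cnf_word x). Qed.

Lemma size_word_values x : size (word_values V x pieces) = size cnf_word.
Proof. by rewrite -(unzip1_word_values x) size_map. Qed.

Definition content_at (x : nat -> bool) (k : nat) : option (option bool) :=
  content (nth blank_value (word_values V x pieces) k.-1).

Lemma kind_ok_content x k : kind_ok (kind_at k) (content_at x k).
Proof. by rewrite (kind_atE x) /content_at /content; case: (nth _ _ _).1.2 => [[]|]. Qed.

Lemma satisfiesP x : satisfies x F <-> exists2 acc : nat -> bool, acc 0 = false &
  forall k, k.+1 < grid_width -> scan_ok (acc k) (content_at x k.+1) (acc k.+1).
Proof. by rewrite -(scan_cnf_pieces V) scan_wordP size_word_values. Qed.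

Section Coloring.
Variables (x acc : nat -> bool).
Hypothesis acc0 : acc 0 = false.
Hypothesis acc_ok : forall k, k.+1 < grid_width -> scan_ok (acc k) (content_at x k.+1) (acc k.+1).

(* The row of variable v starts with the bit x v; the bits of the check row V.+1
   record whether the current clause has been satisfied so far. *)
Definition inner_at (i k : nat) : inner_color :=
  (i == V.+1, if i == V.+1 then acc k else x i.-1, content_at x k,
   trigger_at (k - i), trigger_at (k.-1 - i)).

Definition grid_coloring (i k : nat) : color :=
  if (0 < i < grid_height) && (0 < k < grid_width) then inner_vertex (inner_at i k)
  else grid_border i k.

Lemma inner_at_crossing i k : 0 < i < grid_height -> 0 < k < grid_width ->
  crossing_ok (inner_at i k).
Proof.
move=> hi hk; rewrite /crossing_ok /color_trigger /color_content /color_bit /color_check /=.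
case trigger: (trigger_at (k - i)) => [s|] //; case value: (content_at x k) => [[b|]|] //.
case: eqP => //= not_check; apply/eqP.
have lt : i < k by move: trigger; case: ltnP => // le; have -> : k - i = 0 by lia.
have := @trigger_literal V x pieces (k - i).-1 k.-1 s pieces_vars_lt.
move: value; rewrite /content_at /content.
case: (nth _ _ k.-1) => [[tr [[]|]] b'] //= [->] -> //.
- by rewrite addbK; congr x; lia.
- by move: hi; rewrite /grid_height; lia.
- by move: trigger; rewrite /trigger_at; case: (k - i) => //= j; rewrite (nth_cnf_word x).
Qed.

Lemma grid_coloring_vcompat i k : i < grid_height -> k < grid_width ->
  vcompat (grid_coloring i k) (grid_coloring i.+1 k).
Proof.
rewrite /grid_coloring => hi hk; have [->|k_gt0] := posnP k; first by rewrite !andbF.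
have inner_k : 0 < k < grid_width by rewrite k_gt0.
rewrite hk /= !andbT hi andbT.
have neq_width : (k == grid_width) = false by lia.
have neq_0 : (k == 0) = false by lia.
have [->|i_gt0] := posnP i.
  rewrite [1 < grid_height]/= /grid_border neq_width neq_0 eqxx.
  apply/and3P; split; [exact: inner_at_crossing | | exact: kind_ok_content].
  by apply/eqP; congr trigger_at; lia.
have [lt|ge] := ltnP i.+1 grid_height; last by rewrite /grid_border neq_width neq_0.
apply/and3P; split; [by apply: inner_at_crossing; lia | | exact: eqxx].
by apply/eqP; congr trigger_at; lia.
Qed.

Lemma grid_coloring_hcompat i k : i < grid_height -> k < grid_width ->
  hcompat (grid_coloring i k) (grid_coloring i k.+1).
Proof.
rewrite /grid_coloring => hi hk; have [->|i_gt0] := posnP i.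
  rewrite /grid_border /=; have [->|k_gt0] := posnP k; first by case: (1 == grid_width) => /=.
  have -> : (k == grid_width) = false by lia.
  by rewrite /=; case: (k.+1 == grid_width) => /=.
rewrite hi /=; have [lt|ge] := ltnP k.+1 grid_width; last first.
  have -> : k.+1 = grid_width by lia.
  rewrite /grid_border eqxx; have [->//|k_gt0] := posnP k.
  by rewrite leqnn.
have [k0|k_gt0] := posnP k.
  rewrite k0 /grid_border; apply/and3P; split=> //; apply/implyP => /eqP check.
  by rewrite /color_bit /= check eqxx -acc0; apply: acc_ok; rewrite k0 in lt.
rewrite hk; apply/and3P; split; [by apply/eqP | by apply/eqP |].
by rewrite /row_ok /color_check /color_bit /=; case: (i == V.+1) => //; exact: acc_ok.
Qed.

End Coloring.

Lemma sat_colorable x : satisfies x F ->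
  colorable hcompat vcompat grid_height grid_width grid_border.
Proof.
case/satisfiesP => acc acc0 acc_ok; exists (grid_coloring x acc); split.
- move=> i k _ _; rewrite /on_boundary /grid_coloring => edge.
  by have -> : (0 < i < grid_height) && (0 < k < grid_width) = false by move: edge; lia.
- exact: grid_coloring_vcompat.
- exact: grid_coloring_hcompat.
Qed.

Section Decoding.
Variable col : nat -> nat -> color.
Hypothesis col_border : forall i k, i <= grid_height -> k <= grid_width ->
  on_boundary grid_height grid_width i k -> col i k = grid_border i k.
Hypothesis col_v : forall i k, i < grid_height -> k < grid_width -> vcompat (col i k) (col i.+1 k).
Hypothesis col_h : forall i k, i < grid_height -> k < grid_width -> hcompat (col i k) (col i k.+1).

Lemma col_bottom k : 0 < k < grid_width ->
  col 0 k = bottom_vertex (trigger_at k, trigger_at k.-1, kind_at k).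
Proof.
move=> hk; rewrite col_border //; [|lia|by rewrite /on_boundary; lia].
rewrite /grid_border; have -> : (k == 0) = false by lia.
by have -> : (k == grid_width) = false by lia.
Qed.

Lemma col_left i : i < grid_height -> col i 0 = left_vertex (i == V.+1).
Proof.
move=> hi; rewrite col_border //; first by lia.
by rewrite /on_boundary hi /= orbT.
Qed.

Definition decoded (i k : nat) : inner_color :=
  if col i k is inl c then c else (false, false, None, None, None).

Lemma col_inner i k : 0 < i < grid_height -> 0 < k < grid_width ->
  col i k = inner_vertex (decoded i k).
Proof.
move=> hi hk; have := col_v (ltac:(lia) : i < grid_height) (ltac:(lia) : k < grid_width).
have := col_h (ltac:(lia) : i < grid_height) (ltac:(lia) : k < grid_width).
have := col_v (ltac:(lia) : i.-1 < grid_height) (ltac:(lia) : k < grid_width).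
have := col_h (ltac:(lia) : i < grid_height) (ltac:(lia) : k.-1 < grid_width).
rewrite /decoded !prednK; try lia.
case: (col i k) => [c|[b|[l|[]]]] //; first by case: (col i.-1 k) => [?|[[[? ?] ?]|[?|[]]]].
by case: (col i k.-1) => [?|[[[? ?] ?]|[?|[]]]].
Qed.

Lemma decoded_first_row k : 0 < k < grid_width ->
  [/\ crossing_ok (decoded 1 k), color_trigger (decoded 1 k) = trigger_at k.-1
    & kind_ok (kind_at k) (color_content (decoded 1 k))].
Proof.
move=> hk; have := @col_v 0 k (ltac:(by [])) (ltac:(lia)).
by rewrite col_bottom // col_inner // => /and3P[? /eqP ? ?].
Qed.

Lemma decoded_up i k : 0 < i -> i.+1 < grid_height -> 0 < k < grid_width ->
  [/\ crossing_ok (decoded i.+1 k),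
      color_trigger (decoded i.+1 k) = color_left_trigger (decoded i k)
    & color_content (decoded i.+1 k) = color_content (decoded i k)].
Proof.
move=> i_gt0 lt_i hk; have := @col_v i k (ltac:(lia)) (ltac:(lia)).
by rewrite !col_inner //; [case/and3P => ? /eqP ? /eqP ? | lia].
Qed.

Lemma decoded_first_col i : 0 < i < grid_height -> 1 < grid_width ->
  [/\ color_check (decoded i 1) = (i == V.+1), color_left_trigger (decoded i 1) = None &
     i == V.+1 -> scan_ok false (color_content (decoded i 1)) (color_bit (decoded i 1))].
Proof.
move=> hi wide; have := @col_h i 0 (ltac:(lia)) (ltac:(lia)).
by rewrite col_left ?col_inner //; [case/and3P => /eqP <- /eqP -> /implyP | lia].
Qed.

Lemma decoded_right i k : 0 < i < grid_height -> 0 < k -> k.+1 < grid_width ->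
  [/\ color_check (decoded i k.+1) = color_check (decoded i k),
      color_left_trigger (decoded i k.+1) = color_trigger (decoded i k)
    & row_ok (color_check (decoded i k)) (color_bit (decoded i k))
        (color_content (decoded i k.+1)) (color_bit (decoded i k.+1))].
Proof.
move=> hi k_gt0 lt_k; have := @col_h i k (ltac:(lia)) (ltac:(lia)).
by rewrite !col_inner //; [case/and3P => /eqP -> /eqP -> ? | lia].
Qed.

Lemma decoded_check i k : 0 < i < grid_height -> 0 < k < grid_width ->
  color_check (decoded i k) = (i == V.+1).
Proof.
move=> hi; elim: k => // k IH hk; have [->|k_gt0] := posnP k.
  by case: (decoded_first_col hi (ltac:(lia))).
by have [-> _ _] := decoded_right hi k_gt0 (ltac:(lia)); apply: IH; lia.
Qed.

Lemma decoded_left_trigger i k : 0 < i < grid_height -> 0 < k < grid_width ->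
  color_left_trigger (decoded i k) = if k == 1 then None else color_trigger (decoded i k.-1).
Proof.
move=> hi hk; case: k hk => // -[|k] hk; first by case: (decoded_first_col hi (ltac:(lia))).
by case: (@decoded_right i k.+1 hi (ltac:(lia)) (ltac:(lia))).
Qed.

Lemma decoded_trigger i k : 0 < i < grid_height -> 0 < k < grid_width ->
  color_trigger (decoded i k) = trigger_at (k - i).
Proof.
elim: i k => // i IH k hi hk; have [->|i_gt0] := posnP i.
  by have [_ -> _] := decoded_first_row hk; congr trigger_at; lia.
have [_ -> _] := @decoded_up i k i_gt0 (ltac:(lia)) hk; rewrite decoded_left_trigger //;
  last by lia.
case: eqP => eq_k; first by have -> : k - i.+1 = 0 by lia.
by rewrite IH; [congr trigger_at; lia | lia | lia].
Qed.

Lemma decoded_content i k : 0 < i < grid_height -> 0 < k < grid_width ->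
  color_content (decoded i k) = color_content (decoded 1 k).
Proof.
elim: i => // i IH hi hk; have [->//|i_gt0] := posnP i.
by have [_ _ ->] := @decoded_up i k i_gt0 (ltac:(lia)) hk; apply: IH; lia.
Qed.

Lemma decoded_crossing i k : 0 < i < grid_height -> 0 < k < grid_width ->
  crossing_ok (decoded i k).
Proof.
case: i => // -[|i] hi hk; first by case: (decoded_first_row hk).
by case: (@decoded_up i.+1 k (ltac:(lia)) (ltac:(lia)) hk).
Qed.

Definition decoded_assignment (v : nat) : bool := color_bit (decoded v.+1 1).
Local Notation x := decoded_assignment.

Lemma decoded_bit i k : 0 < i <= V -> 0 < k < grid_width -> color_bit (decoded i k) = x i.-1.
Proof.
move=> hi; elim: k => // k IH hk; have [->|k_gt0] := posnP k.
  by rewrite /decoded_assignment prednK //; lia.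
have hi' : 0 < i < grid_height by rewrite /grid_height; lia.
have [_ _] := decoded_right hi' k_gt0 (ltac:(lia)); rewrite decoded_check //; last by lia.
have -> : (i == V.+1) = false by lia.
by move=> /eqP ->; apply: IH; lia.
Qed.

Lemma decoded_value k : 0 < k < grid_width -> color_content (decoded 1 k) = content_at x k.
Proof.
move=> hk; have [_ _] := decoded_first_row hk; rewrite (kind_atE x) /content_at /content.
case kind: (nth _ _ k.-1).1.2 => [[]|]; case E: (color_content _) => [[b|]|] // _.
have [v [s [lt_v lt_vk trigger ->]]] := own_trigger pieces_vars_lt kind.
have hi : 0 < v.+1 < grid_height by rewrite /grid_height; lia.
have := decoded_crossing hi hk; rewrite /crossing_ok decoded_trigger // decoded_content // E.
have -> : trigger_at (k - v.+1) = Some s.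
  have -> : k - v.+1 = (k.-1 - v.+1).+1 by lia.
  by rewrite /= (nth_cnf_word x).
rewrite decoded_check //; have -> /= : (v.+1 == V.+1) = false by lia.
by rewrite decoded_bit // => /eqP ->; rewrite addbK.
Qed.

Lemma decoded_satisfies : satisfies x F.
Proof.
have check_row : 0 < V.+1 < grid_height by rewrite /grid_height; lia.
apply/satisfiesP;
  exists (fun k => if k == 0 then false else color_bit (decoded V.+1 k)) => // k lt_k.
rewrite -decoded_value // -(decoded_content check_row) //=; have [k0|k_gt0] := posnP k.
  by rewrite k0 in lt_k *; have [_ _] := decoded_first_col check_row lt_k; apply.
have [_ _] := decoded_right check_row k_gt0 lt_k; rewrite decoded_check //; last by lia.
by rewrite eqxx.
Qed.

End Decoding.

Lemma colorable_sat :
  colorable hcompat vcompat grid_height grid_width grid_border -> exists x, satisfies x F.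
Proof.
case=> col [col_border col_v col_h].
by exists (decoded_assignment col); exact: decoded_satisfies.
Qed.

End Sat.

(** * The Cook-Levin formula *)

Section CookLevin.
Variables (M : tm) (w : seq (symb M)) (T : nat).
Local Notation Q := (state M).
Local Notation S := (symb M).
Local Notation K := 'I_(ntapes M).+1.
Local Notation rd := {ffun K -> S}.
Local Notation ac := (Q * {ffun K -> S * move})%type.
(* a pair of state and scanned symbols, with the chosen transition, or [None]
   once the machine has halted in an accepting state *)
Definition choice_of : finType := (Q * rd * option ac)%type.
Local Notation U := choice_of.

Definition valid_choice (u : U) : bool :=
  if u.2 is Some y then y \in delta u.1.1 u.1.2
  else (delta u.1.1 u.1.2 == finset.set0) && (u.1.1 \in accept M).

Definition effect (u : U) : ac :=
  if u.2 is Some y then y else (u.1.1, [ffun j => (u.1.2 j, Stay)]).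

Variables (state_var : nat -> Q -> nat) (choice_var : nat -> U -> nat)
  (cell_var : nat -> nat -> K -> S -> nat).

Local Notation B := T.+1.

Definition pos_lit (v : nat) : literal := (v, false).
Definition neg_lit (v : nat) : literal := (v, true).

Definition init_cell (j : K) (o : nat) : S :=
  if j == ord0 then if o < B then blank M else nth (blank M) w (o - B)
  else blank M.

Definition moved_offset (mv : move) (o : nat) : nat :=
  match mv with MoveL => o.+1 | MoveR => o.-1 | Stay => o end.

Definition offsets : seq nat := iota 0 (2 * B).+1.

Lemma mem_offsets o : (o \in offsets) = (o <= 2 * B).
Proof. by rewrite mem_iota add0n ltnS. Qed.

Local Opaque offsets.

Definition init_clauses : cnf :=
  [:: [:: pos_lit (state_var 0 (start M))]] ++
    flatten [seq [seq [:: pos_lit (cell_var 0 o j (init_cell j o))] | o <- offsets]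
          | j <- enum K].

Definition choose_clauses (t : nat) : cnf :=
  [:: [seq pos_lit (choice_var t u) | u <- [seq u <- enum U | valid_choice u]]].

Definition final_clauses : cnf :=
  [:: [seq pos_lit (choice_var T u) | u <- [seq u <- enum U | valid_choice u && (u.2 == None)]]].

Definition read_clauses (t : nat) : cnf :=
  flatten [seq [:: neg_lit (choice_var t u); pos_lit (state_var t u.1.1)] ::
     [seq [:: neg_lit (choice_var t u); pos_lit (cell_var t B j (u.1.2 j))] | j <- enum K]
       | u <- enum U].

Definition unique_clauses (t : nat) : cnf :=
  [seq [:: neg_lit (state_var t p.1); neg_lit (state_var t p.2)]
    | p <- [seq p <- enum {: Q * Q} | p.1 != p.2]] ++
  flatten [seq [seq [:: neg_lit (cell_var t B j p.1); neg_lit (cell_var t B j p.2)]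
          | p <- [seq p <- enum {: S * S} | p.1 != p.2]] | j <- enum K].

Definition move_clauses (t : nat) : cnf :=
  flatten [seq [:: neg_lit (choice_var t u); pos_lit (state_var t.+1 (effect u).1)] ::
    flatten [seq [:: neg_lit (choice_var t u);
        pos_lit (cell_var t.+1 (moved_offset ((effect u).2 j).2 B) j ((effect u).2 j).1)] ::
      flatten [seq [seq
           if (o == B) || (o == 0) || (o == 2 * B)
           then [:: neg_lit (choice_var t u); pos_lit (choice_var t u)]
           else [:: neg_lit (choice_var t u); neg_lit (cell_var t o j x);
                    pos_lit (cell_var t.+1 (moved_offset ((effect u).2 j).2 o) j x)]
         | o <- offsets] | x <- enum S] | j <- enum K] | u <- enum U].

Definition formula : cnf :=
  init_clauses ++ final_clauses ++
  flatten [seq choose_clauses t ++ read_clauses t ++ unique_clauses t | t <- iota 0 T.+1] ++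
  flatten [seq move_clauses t | t <- iota 0 T].

Definition cell (tp : tape M) (o : nat) : S :=
  if o < B then nth (blank M) tp.1 (T - o) else nth (blank M) tp.2 (o - B).

Lemma cell_head tp : cell tp B = scan tp.
Proof. by rewrite /cell ltnn subnn /scan; case: tp.2. Qed.

Lemma cell_write tp a : cell (update tp a) (moved_offset a.2 B) = a.1.
Proof.
case: tp a => l r [b []] /=; rewrite /cell.
- by rewrite ltnNge leqnSn /= subSnn.
- by rewrite ltnSn subnn.
- by rewrite ltnn subnn.
Qed.

Lemma cell_keep tp a o : o != B -> 0 < o < 2 * B ->
  cell (update tp a) (moved_offset a.2 o) = cell tp o.
Proof.
case: tp a => l r [b mv] hB ho; rewrite /cell /update /=.
have [lt|ge] := ltnP o B.
  case: mv => /=.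
  - have [lt2|ge2] := ltnP o.+1 B.
      by rewrite nth_behead; congr nth; lia.
    have -> : o.+1 - B = 0 by lia.
    by rewrite /=; have -> : T - o = 0 by lia; case: l.
  - have -> : o.-1 < B by lia.
    by have -> : T - o.-1 = (T - o).+1 by lia.
  - by rewrite lt.
case: mv => /=.
- have -> : o.+1 < B = false by lia.
  have -> : o.+1 - B = (o - B.+1).+2 by lia.
  have -> : o - B = (o - B.+1).+1 by lia.
  by rewrite /= nth_behead.
- have -> : o.-1 < B = false by lia.
  have -> : o - B = (o.-1 - B).+1 by lia.
  by rewrite nth_behead.
- have -> : o < B = false by lia.
  have -> : o - B = (o - B.+1).+1 by lia.
  by rewrite /= nth_behead.
Qed.

Lemma cell_init j o : cell ((init w).2 j) o = init_cell j o.
Proof.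
rewrite /cell /init /init_cell /=; case: eqP => _ /=; rewrite ?nth_nil //.
by case: ltnP.
Qed.

Lemma satisfies_cat x F G : satisfies x (F ++ G) = satisfies x F && satisfies x G.
Proof. exact: all_cat. Qed.

Lemma satisfies_flatten (I : eqType) x (s : seq I) (f : I -> cnf) :
  satisfies x (flatten (map f s)) <-> {in s, forall i, satisfies x (f i)}.
Proof.
elim: s => [|i s IH] /=; first by split.
rewrite satisfies_cat; split=> [/andP[h /IH h'] k|h].
  by rewrite inE => /orP[/eqP ->|/h'].
rewrite h ?mem_head //=; apply/IH => k hk; apply: h; by rewrite inE hk orbT.
Qed.

Lemma satisfies_map (I : eqType) x (s : seq I) (f : I -> seq literal) :
  satisfies x (map f s) <-> {in s, forall i, has (lit_true x) (f i)}.
Proof. by rewrite /satisfies all_map; split=> [/allP|h]; [|apply/allP]. Qed.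

Lemma moved_offset_inv mv t o' : t.+1 < o' -> o' + t.+1 < 2 * B ->
  exists o, [/\ o' = moved_offset mv o, t < o, o + t < 2 * B & 0 < o < 2 * B].
Proof.
move=> gt_o' lt_o'; exists (match mv with MoveL => o'.-1 | MoveR => o'.+1 | Stay => o' end).
by case: mv; split=> /=; lia.
Qed.

Lemma lit_true_pos x v : lit_true x (pos_lit v) = x v.
Proof. exact: addbF. Qed.

Lemma lit_true_neg x v : lit_true x (neg_lit v) = ~~ x v.
Proof. exact: addbT. Qed.

Let lit_trueE := (lit_true_pos, lit_true_neg, orbF).

Lemma init_clausesP x : satisfies x init_clauses <-> x (state_var 0 (start M)) /\
  forall j o, o <= 2 * B -> x (cell_var 0 o j (init_cell j o)).
Proof.
rewrite satisfies_cat /= !lit_trueE andbT; split=> [/andP[-> /satisfies_flatten sat]|[-> sat] /=].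
  split=> // j o le_o; have /satisfies_map/(_ o) := sat j (mem_enum _ _).
  by rewrite mem_offsets /= !lit_trueE; apply.
apply/satisfies_flatten => j _; apply/satisfies_map => o; rewrite mem_offsets => le_o /=.
by rewrite !lit_trueE sat.
Qed.

Lemma choose_clausesP x t :
  satisfies x (choose_clauses t) <-> exists2 u, valid_choice u & x (choice_var t u).
Proof.
rewrite /choose_clauses /= andbT has_map; split=> [/hasP[u]|[u valid chosen]].
  by rewrite mem_filter => /andP[valid _] /=; rewrite !lit_trueE; exists u.
by apply/hasP; exists u; [rewrite mem_filter valid mem_enum | rewrite /= !lit_trueE].
Qed.

Lemma final_clausesP x : satisfies x final_clauses <->
  exists u, [/\ valid_choice u, u.2 = None & x (choice_var T u)].
Proof.
rewrite /final_clauses /= andbT has_map; split=> [/hasP[u]|[u [valid stop chosen]]].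
  by rewrite mem_filter => /andP[/andP[valid /eqP stop] _] /=; rewrite !lit_trueE; exists u.
by apply/hasP; exists u; [rewrite mem_filter valid stop mem_enum | rewrite /= !lit_trueE].
Qed.

Lemma read_clausesP x t : satisfies x (read_clauses t) <-> forall u, x (choice_var t u) ->
  x (state_var t u.1.1) /\ forall j, x (cell_var t B j (u.1.2 j)).
Proof.
split=> [/satisfies_flatten sat u chosen|sat].
  have := sat u (mem_enum _ _); rewrite /= !lit_trueE chosen /= => /andP[-> /satisfies_map cells].
  by split=> // j; have := cells j (mem_enum _ _); rewrite /= !lit_trueE chosen.
apply/satisfies_flatten => u _; rewrite /= !lit_trueE.
case chosen: (x (choice_var t u)) => /=; last first.
  by apply/satisfies_map => j _; rewrite /= !lit_trueE chosen.
have [-> cells] := sat u chosen; apply/satisfies_map => j _.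
by rewrite /= !lit_trueE cells orbT.
Qed.

Lemma unique_clausesP x t : satisfies x (unique_clauses t) <->
  (forall p q, x (state_var t p) -> x (state_var t q) -> p = q) /\
  (forall j a b, x (cell_var t B j a) -> x (cell_var t B j b) -> a = b).
Proof.
rewrite satisfies_cat;
  split=> [/andP[/satisfies_map states /satisfies_flatten cells]|[states cells]].
  split=> [p q|j a b] true1 true2; apply/eqP; apply: contraT => ne.
    by have := states (p, q); rewrite mem_filter mem_enum /= !lit_trueE ne true1 true2 => /(_ isT).
  have /satisfies_map/(_ (a, b)) := cells j (mem_enum _ _).
  by rewrite mem_filter mem_enum /= !lit_trueE ne true1 true2 => /(_ isT).
apply/andP; split; [|apply/satisfies_flatten => j _]; apply/satisfies_map => -[p q].
  rewrite mem_filter /= !lit_trueE -negb_and => /andP[ne _]; apply: contraNN ne.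
  by case/andP => true1 true2; rewrite (states p q).
rewrite mem_filter /= !lit_trueE -negb_and => /andP[ne _]; apply: contraNN ne.
by case/andP => true1 true2; rewrite (cells j p q).
Qed.

Lemma move_clausesP x t : satisfies x (move_clauses t) <-> forall u, x (choice_var t u) ->
  x (state_var t.+1 (effect u).1) /\ forall j, let a := (effect u).2 j in
  x (cell_var t.+1 (moved_offset a.2 B) j a.1) /\
  forall o s, o != B -> 0 < o < 2 * B -> x (cell_var t o j s) ->
    x (cell_var t.+1 (moved_offset a.2 o) j s).
Proof.
split=> [/satisfies_flatten sat u chosen|sat].
  have := sat u (mem_enum _ _);
    rewrite /= !lit_trueE chosen /= => /andP[-> /satisfies_flatten tapes].
  split=> // j; have := tapes j (mem_enum _ _).
  rewrite /= !lit_trueE chosen /= => /andP[-> /satisfies_flatten kept];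
    split=> // o s ne_o in_o true_o.
  have /satisfies_map/(_ o) := kept s (mem_enum _ _); rewrite mem_offsets (negbTE ne_o).
  have -> : (o == 0) || (o == 2 * B) = false by lia.
  by rewrite /= !lit_trueE chosen true_o; apply; lia.
apply/satisfies_flatten => u _; rewrite /= !lit_trueE.
case chosen: (x (choice_var t u)) => /=; last first.
  apply/satisfies_flatten => j _; rewrite /= !lit_trueE chosen /=.
  apply/satisfies_flatten => s _; apply/satisfies_map => o _.
  by case: ifP => _; rewrite /= !lit_trueE chosen.
have [-> tapes] := sat u chosen; apply/satisfies_flatten => j _.
have [written kept] := tapes j; rewrite /= !lit_trueE written orbT /=.
apply/satisfies_flatten => s _; apply/satisfies_map => o; rewrite mem_offsets => le_o.
case: ifP => [_|/negbT inner_o]; rewrite /= !lit_trueE chosen //=.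
by case true_o: (x (cell_var t o j s)) => //=; apply: kept true_o; lia.
Qed.

Lemma formulaP x : satisfies x formula <->
  [/\ satisfies x init_clauses, satisfies x final_clauses,
      forall t, t <= T -> [/\ satisfies x (choose_clauses t), satisfies x (read_clauses t)
                            & satisfies x (unique_clauses t)]
    & forall t, t < T -> satisfies x (move_clauses t)].
Proof.
rewrite /formula 3!satisfies_cat; split.
  case/and4P => -> -> /satisfies_flatten times /satisfies_flatten moves; split=> // t lt_t.
    have := times t; rewrite mem_iota ltnS => /(_ lt_t).
    by rewrite 2!satisfies_cat => /and3P[].
  by apply: moves; rewrite mem_iota.
case=> init_ok final_ok times moves; apply/and4P; split=> //; apply/satisfies_flatten => t;
  rewrite mem_iota.
  by rewrite ltnS => /times[choose read unique]; rewrite 2!satisfies_cat choose read.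
exact: moves.
Qed.

Definition perform (u : U) (c : config M) : config M :=
  ((effect u).1, fun j => update (c.2 j) ((effect u).2 j)).

(* After t steps only the cells with offsets in ]t, 2 * B - t[ are determined
   by the initial ones. *)
Definition encodes x t (c : config M) : Prop :=
  x (state_var t c.1) /\
  forall j o, t < o -> o + t < 2 * B -> x (cell_var t o j (cell (c.2 j) o)).

Lemma encodes_init x : satisfies x init_clauses -> encodes x 0 (init w).
Proof.
case/init_clausesP => state_ok cells_ok; split=> // j o _ lt_o.
by rewrite cell_init; apply: cells_ok; lia.
Qed.

Lemma encodes_choice x t c u : t <= T -> satisfies x (read_clauses t) ->
  satisfies x (unique_clauses t) -> encodes x t c -> x (choice_var t u) -> u.1 = (c.1, reads c).
Proof.
move=> le_t /read_clausesP read /unique_clausesP[unique_state unique_cell] [state_ok cells_ok].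
move=> /read[state_u cells_u]; rewrite [LHS]surjective_pairing; congr pair.
  exact: unique_state state_ok.
apply/ffunP => j; rewrite ffunE -cell_head; apply: (unique_cell j) (cells_u j) _.
by apply: cells_ok; lia.
Qed.

Lemma encodes_perform x t c u : satisfies x (move_clauses t) -> x (choice_var t u) ->
  encodes x t c -> encodes x t.+1 (perform u c).
Proof.
move=> /move_clausesP move_ok /move_ok[state_u tapes_u] [_ cells_ok]; split=> // j o' lt_o' gt_o'.
have [o [-> lt_o gt_o in_o]] := moved_offset_inv ((effect u).2 j).2 lt_o' gt_o'.
have [written kept] := tapes_u j; have [->|ne_o] := eqVneq o B; first by rewrite cell_write.
by rewrite cell_keep //; apply: kept => //; apply: cells_ok.
Qed.

Lemma steps_snoc n (a b d : config M) : steps n a b -> step b d -> steps n.+1 a d.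
Proof.
elim: n a => [|n IH] a /=; first by move=> ->; exists d.
by case=> e step_e steps_n /(IH _ steps_n); exists e.
Qed.

Lemma step_perform c u y : valid_choice u -> u.1 = (c.1, reads c) -> u.2 = Some y ->
  step c (perform u c).
Proof.
case: u => u [y'|] //= valid eu [ey]; exists y.2; rewrite /perform /effect /= ey //.
by move: valid; rewrite /valid_choice /= eu ey /=; case: (y).
Qed.

Lemma halted_choice c u : valid_choice u -> u.1 = (c.1, reads c) -> u.2 = None ->
  halted c /\ c.1 \in accept M.
Proof.
by case: u => u [y|] //=; rewrite /valid_choice /= => /[swap] -> /= /andP[/eqP halts acc].
Qed.

Lemma formula_sound x : satisfies x formula -> exists n c,
  [/\ steps n (init w) c, halted c & c.1 \in accept M].
Proof.
case/formulaP => init_ok /final_clausesP[u [valid stop chosen]] times moves.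
have runs t : t <= T -> (exists n c, [/\ steps n (init w) c, halted c & c.1 \in accept M]) \/
    exists c, steps t (init w) c /\ encodes x t c.
  elim: t => [_|t IH lt_t].
    by right; exists (init w); split=> //; exact: encodes_init.
  have [?|[c [run enc]]] := IH (ltnW lt_t); first by left.
  have [/choose_clausesP[v valid_v chosen_v] read unique] := times t (ltnW lt_t).
  have ev := encodes_choice (ltnW lt_t) read unique enc chosen_v.
  case action: v.2 => [y|]; last first.
    by have [halts acc] := halted_choice valid_v ev action; left; exists t, c.
  right; exists (perform v c); split; last by apply: encodes_perform enc; first exact: moves.
  exact: steps_snoc run (step_perform valid_v ev action).
have [//|[c [run enc]]] := runs T (leqnn T).
have [_ read unique] := times T (leqnn T).
have eu := encodes_choice (leqnn T) read unique enc chosen.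
by have [halts acc] := halted_choice valid eu stop; exists T, c.
Qed.

Lemma scan_stay (tp : tape M) a : scan (update tp (a, Stay)) = a.
Proof. by case: tp. Qed.

Lemma accepting_choices n c0 c : steps n c0 c -> halted c -> c.1 \in accept M ->
  exists (g : nat -> config M) (u : nat -> U), g 0 = c0 /\
  [/\ forall t, valid_choice (u t), forall t, (u t).1 = ((g t).1, reads (g t)),
      forall t, g t.+1 = perform (u t) (g t) & forall t, n <= t -> (u t).2 = None].
Proof.
elim: n c0 => [|n IH] c0 /=.
  move=> -> halts acc; pose u : U := (c.1, reads c, None).
  exists (fun t => iter t (perform u) c), (fun=> u); split=> //.
  have same t : (iter t (perform u) c).1 = c.1 /\ reads (iter t (perform u) c) = reads c.
    by elim: t => //= t _; split=> //; apply/ffunP => j; rewrite [LHS]ffunE /= ffunE scan_stay.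
  split=> // t; first by rewrite /valid_choice /= halts eqxx acc.
  by have [-> ->] := same t.
case=> d [a in_delta tapes] run halts acc.
have [g [u [g0 [valid read next stop]]]] := IH d run halts acc.
exists (fun t => if t is t'.+1 then g t' else c0).
exists (fun t => if t is t'.+1 then u t' else (c0.1, reads c0, Some (d.1, a))).
split=> //; split=> -[|t] //=; last exact: stop.
by rewrite g0 [d]surjective_pairing; congr pair; apply/funext.
Qed.

Lemma formula_complete n c :
  steps n (init w) c -> halted c -> c.1 \in accept M -> n <= T ->
  (forall (states : nat -> Q -> bool) (choices : nat -> U -> bool)
    (contents : nat -> nat -> K -> S -> bool), exists x, forall t, t <= T ->
     [/\ forall q, x (state_var t q) = states t q, forall u, x (choice_var t u) = choices t u
       & forall o j s, o <= 2 * B -> x (cell_var t o j s) = contents t o j s]) ->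
  exists x, satisfies x formula.
Proof.
move=> run halts acc le_n interp.
have [g [u [g0 [valid read next stop]]]] := accepting_choices run halts acc.
have [x xE] := interp (fun t q => q == (g t).1) (fun t v => v == u t)
  (fun t o j s => s == cell ((g t).2 j) o).
exists x; apply/formulaP; split=> [||t le_t|t lt_t].
- have [states _ contents] := xE 0 (leq0n _); apply/init_clausesP; split=> [|j o le_o].
    by rewrite states g0.
  by rewrite contents // g0 cell_init.
- have [_ choices _] := xE T (leqnn _); apply/final_clausesP; exists (u T).
  by rewrite choices eqxx valid stop.
- have [states choices contents] := xE t le_t; split.
  + by apply/choose_clausesP; exists (u t); rewrite ?choices.
  + apply/read_clausesP => v; rewrite choices => /eqP ->; rewrite states read; split=> // j.
    by rewrite contents /= ?ffunE ?cell_head //; lia.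
  + apply/unique_clausesP; split=> [p q|j a b]; first by rewrite !states => /eqP -> /eqP ->.
    by rewrite !contents; [move=> /eqP -> /eqP -> | lia | lia].
- have [_ choices contents] := xE t (ltnW lt_t); have [states' _ contents'] := xE t.+1 lt_t.
  apply/move_clausesP => v; rewrite choices => /eqP ->; rewrite states' next; split=> // j a.
  have inside o mv : 0 < o < 2 * B -> moved_offset mv o <= 2 * B by case: mv => /=; lia.
  rewrite contents' ?next /= ?cell_write; last by apply: inside; lia.
  split=> // o s ne_o in_o; rewrite contents; last by lia.
  by rewrite contents' ?next /= ?cell_keep //; exact: inside.
Qed.

End CookLevin.

(** * Arithmetic and list functions in polynomial time *)

Lemma ptime_comp2 (Z E X Y : Type) (eZ : Enc Z) (eE : Enc E) (eX : Enc X) (eY : Enc Y)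
    (f : E -> X -> Y) (g : Z -> E) (h : Z -> X) :
  ptime (fun p : E * X => f p.1 p.2) -> ptime g -> ptime h -> ptime (fun z => f (g z) (h z)).
Proof.
move=> hf hg hh.
exact: (ptime_comp (g := fun p : E * X => f p.1 p.2) (f :=
  fun z => (g z, h z)) hf (ptime_pair hg hh)).
Qed.

Section Iteration.
Variables (E : Type) (eE : Enc E).

Lemma ptime_iter (A : Type) (eA : Enc A) (step : E -> A -> A) (n : E -> nat) (a : E -> A) q :
  ptime (fun p : E * A => step p.1 p.2) -> poly_bounded q ->
  (forall e x, enc_size (step e x) <= enc_size x + q (enc_size e)) ->
  ptime n -> ptime a -> ptime (fun e => iter (n e) (step e) (a e)).
Proof.
move=> hs hq hg hn ha.
have hn' : ptime (fun e => nseq (n e) tt).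
  apply: ptime_eq_enc hn => e; elim: (n e) => // k IH; rewrite -[LHS]/(Node Leaf (enc k)) IH //.
have hs' : ptime (fun p : E * (A * unit) => step p.1 p.2.1).
  by apply: (ptime_comp2 hs); [exact: ptime_fst ptime_id | exact: ptime_fst (ptime_snd ptime_id)].
apply: ptime_ext (ptime_foldl (step := fun e a (_ : unit) => step e a) hs' _ hn' ha) => [e|].
  by elim: (n e) (a e) => //= k IH x; rewrite IH -iterSr.
case: hq => k hk; exists (fun m => (m + 2) ^ k); first by poly_bound.
move=> e x y; apply: leq_trans (hg e x) _; rewrite leq_add2l; apply: leq_trans (hk _) _.
by case: k {hk} => // k; rewrite leq_exp2r // leq_add2r leq_addr.
Qed.

Lemma ptime_add (f g : E -> nat) : ptime f -> ptime g -> ptime (fun e => f e + g e).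
Proof.
move=> hf hg; have h : ptime (fun e => iter (f e) S (g e)).
  apply: (ptime_iter (step := fun _ => S) (q := fun=> 2)) => //.
  - by apply: ptime_succ; exact: ptime_snd ptime_id.
  - by poly_bound.
  - by move=> e x; rewrite !enc_size_nat; lia.
by apply: ptime_ext h => e; elim: (f e) => //= k ->.
Qed.

Lemma ptime_pred (f : E -> nat) : ptime f -> ptime (fun e => (f e).-1).
Proof.
move=> hf; have := ptime_nat_case (c := fun p => p.2) hf (ptime_const 0) (ptime_snd ptime_id).
by apply: ptime_ext => e; case: (f e).
Qed.

End Iteration.

Section Arithmetic.
Variables (E : Type) (eE : Enc E).

Lemma ptime_mul (f g : E -> nat) : ptime f -> ptime g -> ptime (fun e => f e * g e).
Proof.
move=> hf hg.
have h : ptime (fun e => iter (f e) (fun a => a + g e) 0).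
  have [k [hk _]] := hg.
  apply: (ptime_iter (step := fun e a => a + g e) (q := fun m => (m + 2) ^ k)) => //.
  - apply: ptime_add; [exact: ptime_snd ptime_id | exact: ptime_comp hg (ptime_fst ptime_id)].
  - by poly_bound.
  - move=> e x; have := hk e; rewrite !enc_size_nat; lia.
  - exact: ptime_const.
apply: ptime_ext h => e; elim: (f e) => //= k ->; by rewrite mulSn addnC.
Qed.

Lemma ptime_sub (f g : E -> nat) : ptime f -> ptime g -> ptime (fun e => f e - g e).
Proof.
move=> hf hg.
have h : ptime (fun e => iter (g e) predn (f e)).
  apply: (ptime_iter (step := fun _ => predn) (q := fun=> 0)) => //.
  - by apply: ptime_pred; exact: ptime_snd ptime_id.
  - by poly_bound.
  - by move=> e x; rewrite !enc_size_nat; lia.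
apply: ptime_ext h => e; elim: (g e) => [|k IH]; first by rewrite subn0.
by rewrite iterS IH subnS.
Qed.

Lemma ptime_leq (f g : E -> nat) : ptime f -> ptime g -> ptime (fun e => f e <= g e).
Proof. by move=> hf hg; apply: ptime_eq; [exact: ptime_sub | exact: ptime_const]. Qed.

Lemma ptime_negb (f : E -> bool) : ptime f -> ptime (fun e => ~~ f e).
Proof.
by move=> hf; apply: ptime_ext (ptime_if hf (ptime_const false) (ptime_const true)) => e;
  case: (f e).
Qed.

Lemma ptime_andb (f g : E -> bool) : ptime f -> ptime g -> ptime (fun e => f e && g e).
Proof. by move=> hf hg; exact: ptime_if hf hg (ptime_const false). Qed.

Lemma ptime_orb (f g : E -> bool) : ptime f -> ptime g -> ptime (fun e => f e || g e).
Proof. by move=> hf hg; exact: ptime_if hf (ptime_const true) hg. Qed.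

Lemma ptime_divmod (d : nat) (f : E -> nat) : ptime f ->
  ptime (fun e => (f e %/ d.+1, f e %% d.+1)).
Proof.
move=> hf; pose step (p : nat * nat) := if p.2 == d then (p.1.+1, 0) else (p.1, p.2.+1).
have h : ptime (fun e => iter (f e) step (0, 0)).
  apply: (ptime_iter (step := fun _ => step) (q := fun=> 2)) => //.
  - rewrite /step; apply: ptime_if.
    + by apply: ptime_eq; [exact: ptime_snd (ptime_snd ptime_id) | exact: ptime_const].
    + apply: ptime_pair; [|exact: ptime_const]; apply: ptime_succ;
        exact: ptime_fst (ptime_snd ptime_id).
    + apply: ptime_pair; [exact: ptime_fst (ptime_snd ptime_id) |].
      by apply: ptime_succ; exact: ptime_snd (ptime_snd ptime_id).
  - by poly_bound.
  - by move=> e [a b]; rewrite /step /=; case: eqP => _; rewrite !enc_size_pair !enc_size_nat; lia.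
  - exact: ptime_const.
apply: ptime_ext h => e; elim: (f e) => [|k IH]; first by rewrite div0n mod0n.
rewrite iterS IH /step /=; have := ltn_pmod k (ltn0Sn d); have := divn_eq k d.+1.
set a := k %/ d.+1; set b := k %% d.+1 => e1 lt; case: eqP => [bd|nd].
  have -> : k.+1 = a.+1 * d.+1 + 0 by rewrite e1 bd; lia.
  by rewrite divnMDl // modnMDl div0n mod0n addn0.
have hb : b.+1 < d.+1 by lia.
have -> : k.+1 = a * d.+1 + b.+1 by rewrite {1}e1; lia.
by rewrite divnMDl // modnMDl divn_small // modn_small // addn0.
Qed.

Lemma ptime_div (d : nat) (f : E -> nat) : ptime f -> ptime (fun e => f e %/ d.+1).
Proof. by move=> /(ptime_divmod d)/ptime_fst. Qed.

Lemma ptime_mod (d : nat) (f : E -> nat) : ptime f -> ptime (fun e => f e %% d.+1).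
Proof. by move=> /(ptime_divmod d)/ptime_snd. Qed.

Lemma ptime_odd (f : E -> nat) : ptime f -> ptime (fun e => odd (f e)).
Proof.
move=> hf; apply: ptime_ext (ptime_eq (ptime_mod 1 hf) (ptime_const 1)) => e.
by rewrite modn2; case: (odd _).
Qed.

End Arithmetic.

Section Lists.
Variables (E X Y : Type) (eE : Enc E) (eX : Enc X) (eY : Enc Y).

Lemma ptime_cat (f g : E -> seq X) : ptime f -> ptime g -> ptime (fun e => f e ++ g e).
Proof.
move=> hf hg; apply: ptime_ext (ptime_catrev (ptime_rev hf) hg) => e.
by rewrite catrevE revK.
Qed.

Lemma ptime_size (f : E -> seq X) : ptime f -> ptime (fun e => size (f e)).
Proof.
move=> hf.
apply: ptime_ext (ptime_foldl (step :=
  fun (_ : E) (a : nat) (_ : X) => a.+1) _ _ hf (ptime_const 0)) => [e||].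
- by rewrite -[RHS]addn0; elim: (f e) 0 => //= x s IH t; rewrite IH addnS.
- by apply: ptime_succ; exact: ptime_fst (ptime_snd ptime_id).
- by exists (fun=> 2); [poly_bound | move=> e a x; rewrite !enc_size_nat; lia].
Qed.

Lemma ptime_flatmap (f : E -> X -> seq Y) (l : E -> seq X) :
  ptime (fun p : E * X => f p.1 p.2) -> ptime l -> ptime (fun e => flatten [seq f e x | x <- l e]).
Proof.
move=> hf hl; have [k [hk _]] := hf.
have h : ptime (fun e => foldl (fun a x => catrev (f e x) a) [::] (l e)).
  apply: (ptime_foldl (step := fun e a x => catrev (f e x) a)) => //; last exact: ptime_const.
    apply: ptime_catrev; last exact: ptime_fst (ptime_snd ptime_id).
    by apply: (ptime_comp2 hf); [exact: ptime_fst ptime_id | exact: ptime_snd (ptime_snd ptime_id)].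
  exists (fun m => (m + 3) ^ k); first by poly_bound.
  move=> e a x; rewrite catrevE; have := @enc_size_rev Y eY (f e x);
    have := @enc_size_cat Y eY (rev (f e x)) a.
  have := hk (e, x); rewrite enc_size_pair /=.
  have -> : (enc_size e + enc_size x).+1 + 2 = enc_size e + enc_size x + 3 by lia.
  by move: ((_ + 3) ^ k) => u; have := @enc_size_gt0 _ _ a; lia.
apply: ptime_ext (ptime_rev h) => e.
suff folded s : foldl (fun a x => catrev (f e x) a) s (l e) =
    rev (flatten [seq f e x | x <- l e]) ++ s.
  by rewrite folded cats0 revK.
by elim: (l e) s => //= x t IH s; rewrite IH catrevE rev_cat -catA.
Qed.

Lemma ptime_map (f : E -> X -> Y) (l : E -> seq X) :
  ptime (fun p : E * X => f p.1 p.2) -> ptime l -> ptime (fun e => [seq f e x | x <- l e]).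
Proof.
move=> hf hl; apply: ptime_ext (ptime_flatmap (f := fun e x => [:: f e x]) _ hl) => [e|].
  by elim: (l e) => //= x s ->.
by apply: ptime_cons => //; exact: ptime_const.
Qed.

Lemma ptime_has (P : E -> X -> bool) (l : E -> seq X) :
  ptime (fun p : E * X => P p.1 p.2) -> ptime l -> ptime (fun e => has (P e) (l e)).
Proof.
move=> hP hl.
apply: ptime_ext (ptime_foldl (step := fun e (b : bool) x => b ||
  P e x) _ _ hl (ptime_const false)) => [e||].
- by rewrite -[RHS]orbF orbC; elim: (l e) false => [|x s IH] b /=; rewrite ?orbF // IH orbA.
- apply: ptime_if; [exact: ptime_fst (ptime_snd ptime_id) | exact: ptime_const |].
  by apply: (ptime_comp2 hP); [exact: ptime_fst ptime_id | exact: ptime_snd (ptime_snd ptime_id)].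
- exists (fun=> enc_size true + enc_size false); first by poly_bound.
  by move=> e a x; case: (_ || _); lia.
Qed.

Lemma ptime_all (P : E -> X -> bool) (l : E -> seq X) :
  ptime (fun p : E * X => P p.1 p.2) -> ptime l -> ptime (fun e => all (P e) (l e)).
Proof.
move=> hP hl; apply: ptime_ext (ptime_negb (ptime_has (P := fun e x => ~~ P e x) _ hl)) => [e|].
  by rewrite -all_predC; apply: eq_all => x /=; rewrite negbK.
by apply: ptime_ext (ptime_if hP (ptime_const false) (ptime_const true)) => p; case: (P _ _).
Qed.

Lemma ptime_nth (d : E -> X) (l : E -> seq X) (i : E -> nat) :
  ptime d -> ptime l -> ptime i -> ptime (fun e => nth (d e) (l e) (i e)).
Proof.
move=> hd hl hi.
have h : ptime (fun e => iter (i e) behead (l e)).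
  apply: (ptime_iter (step := fun _ => behead) (q := fun=> 0)) => //.
  - apply: ptime_ext (ptime_seq_case (l := fun p : E * seq X => p.2) (c := fun p => p.2.2)
      (ptime_snd ptime_id) (ptime_const [::]) (ptime_snd (ptime_snd ptime_id))) => -[e s] /=.
    by case: s.
  - by poly_bound.
  - by move=> e [|x s] //; rewrite [behead _]/= enc_size_cons; lia.
apply: ptime_ext (ptime_seq_case (c := fun p => p.2.1) h hd (ptime_fst (ptime_snd ptime_id))) => e.
have -> : iter (i e) behead (l e) = drop (i e) (l e).
  elim: (i e) (l e) => [|k IH] s; first by rewrite drop0.
  by rewrite iterSr IH; case: s => //; case: k {IH}.
by rewrite -[i e in RHS]addn0 -nth_drop; case: (drop _ _).
Qed.

End Lists.

Section FiniteData.
Variables (E : Type) (eE : Enc E).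

Lemma ptime_iota (f g : E -> nat) : ptime f -> ptime g -> ptime (fun e => iota (f e) (g e)).
Proof.
move=> hf hg; have [k [hk _]] := ptime_pair hf hg.
have h : ptime (fun e => iter (g e) (fun s => (f e + (g e - (size s).+1)) :: s) [::]).
  apply: (ptime_iter (step := fun e s => (f e + (g e - (size s).+1)) :: s)
    (q := fun m => 2 * (m + 2) ^ k + 2)) => //; last exact: ptime_const.
  - have hf' : ptime (fun p : E * seq nat => f p.1) by exact: ptime_comp hf (ptime_fst ptime_id).
    have hg' : ptime (fun p : E * seq nat => g p.1) by exact: ptime_comp hg (ptime_fst ptime_id).
    apply: ptime_cons; last exact: ptime_snd ptime_id.
    by apply: ptime_add hf' (ptime_sub hg' (ptime_succ (ptime_size (ptime_snd ptime_id)))).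
  - by poly_bound.
  - move=> e s; rewrite enc_size_cons; have := hk e; rewrite enc_size_pair !enc_size_nat; lia.
apply: ptime_ext h => e; move: (f e) (g e) => a b.
suff iterated j : j <= b ->
    iter j (fun s => (a + (b - (size s).+1)) :: s) [::] = iota (a + (b - j)) j.
  by rewrite iterated // subnn addn0.
elim: j => // j IH hj; rewrite iterS IH ?(ltnW hj) // size_iota /=.
by congr (_ :: iota _ _); lia.
Qed.

Lemma ptime_fin_const (F : finType) (Y : Type) (eY : Enc Y) (f : E -> F) (g : F -> Y) :
  @ptime E F _ (enc_fin F) f -> ptime (fun e => g (f e)).
Proof. by move=> hf; apply: (ptime_fin_case (g := fun y _ => g y)) => // y; exact: ptime_const. Qed.

Lemma ptime_map_const (U Y : Type) (eY : Enc Y) (us : seq U) (g : U -> E -> Y) :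
  (forall u, ptime (g u)) -> ptime (fun e => [seq g u e | u <- us]).
Proof.
move=> hg; elim: us => [|u us IH] /=; first exact: ptime_const.
exact: ptime_cons.
Qed.

Lemma ptime_flatmap_const (U Y : Type) (eY : Enc Y) (us : seq U) (g : U -> E -> seq Y) :
  (forall u, ptime (g u)) -> ptime (fun e => flatten [seq g u e | u <- us]).
Proof.
move=> hg; elim: us => [|u us IH] /=; first exact: ptime_const.
exact: ptime_cat.
Qed.

End FiniteData.

Ltac prove_ptime := lazymatch goal with
  | |- ptime (fun _ => ?c) => apply: ptime_const
  | |- ptime (fun x => x) => apply: ptime_id
  | |- ptime (fun x => (_, _)) => apply: ptime_pair; prove_ptime
  | |- ptime (fun x => fst _) => apply: ptime_fst; prove_ptime
  | |- ptime (fun x => snd _) => apply: ptime_snd; prove_ptime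
  | |- ptime (fun x => if _ then _ else _) => apply: ptime_if; prove_ptime
  | |- ptime (fun x => _.+1) => apply: ptime_succ; prove_ptime
  | |- ptime (fun x => _.-1) => apply: ptime_pred; prove_ptime
  | |- ptime (fun x => addn _ _) => apply: ptime_add; prove_ptime
  | |- ptime (fun x => muln _ _) => apply: ptime_mul; prove_ptime
  | |- ptime (fun x => subn _ _) => apply: ptime_sub; prove_ptime
  | |- ptime (fun x => leq _ _) => apply: ptime_leq; prove_ptime
  | |- ptime (fun x => divn _ ?d.+1) => apply: ptime_div; prove_ptime
  | |- ptime (fun x => modn _ ?d.+1) => apply: ptime_mod; prove_ptime
  | |- ptime (fun x => odd _) => apply: ptime_odd; prove_ptime
  | |- ptime (fun x => andb _ _) => apply: ptime_andb; prove_ptime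
  | |- ptime (fun x => orb _ _) => apply: ptime_orb; prove_ptime
  | |- ptime (fun x => negb _) => apply: ptime_negb; prove_ptime
  | |- ptime (fun x => eq_op _ _) => apply: ptime_eq; prove_ptime
  | |- ptime (fun x => cons _ _) => apply: ptime_cons; prove_ptime
  | |- ptime (fun x => cat _ _) => apply: ptime_cat; prove_ptime
  | |- ptime (fun x => rev _) => apply: ptime_rev; prove_ptime
  | |- ptime (fun x => size _) => apply: ptime_size; prove_ptime
  | |- ptime (fun x => nth _ _ _) => apply: ptime_nth; prove_ptime
  | |- ptime (fun x => iota _ _) => apply: ptime_iota; prove_ptime
  | |- ptime (fun x => flatten (map (@?f x) (@?l x))) =>
      apply: (@ptime_flatmap _ _ _ _ _ _ f l); cbv beta; prove_ptime
  | |- ptime (fun x => map (@?f x) (@?l x)) =>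
      apply: (@ptime_map _ _ _ _ _ _ f l); cbv beta; prove_ptime
  | |- ptime (fun x => has (@?f x) (@?l x)) => apply: (@ptime_has _ _ _ _ f l); cbv beta;
    prove_ptime
  | |- ptime (fun x => all (@?f x) (@?l x)) => apply: (@ptime_all _ _ _ _ f l); cbv beta;
    prove_ptime
  | |- _ => first [ exact: (ptime_fst ptime_id) | exact: (ptime_snd ptime_id) | exact: ptime_id
      | exact: (ptime_succ ptime_id) | eassumption | idtac ]
  end.

(** * Binary numbers *)

Fixpoint incr_bits (s : seq bool) : seq bool :=
  if s is b :: s' then if b then false :: incr_bits s' else true :: s' else [:: true].

Definition bits (n : nat) : seq bool := iter n incr_bits [:: false].

Definition binary_digits (n : nat) : seq bool :=
  [seq odd (n %/ 2 ^ i) | i <- iota 0 (trunc_log 2 n).+1].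

Lemma binary_digitsS n : 1 < n -> binary_digits n = odd n :: binary_digits n./2.
Proof.
move=> n1; rewrite /binary_digits.
have -> : trunc_log 2 n = (trunc_log 2 n./2).+1.
  by rewrite trunc_log2S.
have -> k : iota 0 k.+1 = 0 :: [seq i.+1 | i <- iota 0 k].
  by rewrite -[iota 0 _]/(0 :: iota (1 + 0) k) iotaDl.
rewrite map_cons expn0 divn1 -map_comp; congr cons; apply/eq_map => i /=.
by rewrite expnS -divn2 divnMA.
Qed.

Lemma incr_bits_cons b s : incr_bits (b :: s) = if b then false :: incr_bits s else true :: s.
Proof. by []. Qed.

Lemma incr_binary_digits n : incr_bits (binary_digits n) = binary_digits n.+1.
Proof.
have [m] := ubnP n; elim: m n => // m IH [|[|n]] hn //.
rewrite binary_digitsS // [RHS]binary_digitsS // incr_bits_cons.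
have := odd_double_half n.+2; have := odd_double_half n.+3; rewrite (_ : odd n.+3 = ~~ odd n.+2) //.
case: (boolP (odd n.+2)) => _ half_SS half_S.
  rewrite IH; last by move: half_S hn; rewrite -muln2; lia.
  by congr (_ :: binary_digits _); move: half_SS half_S; rewrite -!muln2; lia.
by congr (_ :: binary_digits _); move: half_SS half_S; rewrite -!muln2; lia.
Qed.

Lemma bits_binary_digits n : bits n = binary_digits n.
Proof. by elim: n => // n IH; rewrite /bits iterS -/(bits n) IH incr_binary_digits. Qed.

Lemma encode_natE n : encode_nat n = rev [seq Bit b | b <- bits n].
Proof. by rewrite bits_binary_digits /binary_digits -map_comp. Qed.

Lemma ptime_incr_bits (E : Type) (eE : Enc E) (f : E -> seq bool) :
  ptime f -> ptime (fun e => incr_bits (f e)).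
Proof.
apply: (ptime_comp (g := incr_bits)).
pose step (a : bool * seq bool) (b : bool) :=
  if a.1 then (b, ~~ b :: a.2) else (false, b :: a.2).
pose carried (a : bool * seq bool) := rev (if a.1 then true :: a.2 else a.2).
have folded : ptime (fun s : seq bool => foldl step (true, [::]) s).
  apply: (ptime_foldl (E := seq bool) (step := fun _ => step)); try by prove_ptime.
    by rewrite /step; prove_ptime.
  exists (fun=> 10); first by poly_bound.
  move=> e [c a] b; rewrite /step /=; case: c; case: b;
    by rewrite /= !enc_size_pair !enc_size_cons !enc_size_bool; lia.
apply: ptime_ext (ptime_comp (g := carried) _ folded) => [s|]; last by rewrite /carried;
  prove_ptime.
suff carriedE c t : carried (foldl step (c, t) s) = rev t ++ (if c then incr_bits s else s).
  by rewrite carriedE.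
elim: s c t => [|b s IH] c t /=; first by case: c; rewrite /carried ?rev_cons ?cats1 ?cats0.
by case: c => /=; rewrite IH rev_cons -cats1 -catA; case: b.
Qed.

Lemma ptime_bits (E : Type) (eE : Enc E) (f : E -> nat) : ptime f -> ptime (fun e => bits (f e)).
Proof.
move=> hf; apply: (ptime_iter (step := fun _ => incr_bits) (q := fun=> 4)) => //.
- exact: ptime_incr_bits (ptime_snd ptime_id).
- by poly_bound.
- by move=> _; elim=> [|[] s IH]; rewrite /= !enc_size_cons ?enc_size_nil !enc_size_bool; lia.
- exact: ptime_const.
Qed.

(** * Contractible sets *)

Section Continuity.
Variable R : realType.
Local Open Scope ring_scope.
Local Open Scope classical_set_scope.
Local Notation I := (@unit_itv R).

Lemma within_comp (X Y Z : topologicalType) (B : set X) (A : set Y)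
    (f : Y -> Z) (r : X -> Y) :
  {within A, continuous f} -> {within B, continuous r} ->
  (forall x, B x -> A (r x)) -> {within B, continuous (f \o r)}.
Proof.
move=> /subspace_continuousP f_cont /subspace_continuousP r_cont rBA.
apply/subspace_continuousP => x Bx.
apply: (@cvg_comp _ _ _ r f _ (within A (nbhs (r x)))); last exact: f_cont (rBA x Bx).
move=> P near_P.
have near_r : nbhs x [set y | B y -> A (r y) -> P (r y)] := r_cont x Bx _ near_P.
change (nbhs x [set y | B y -> P (r y)]).
by apply: filterS near_r => y P_ry By; apply: P_ry => //; apply: rBA.
Qed.

Lemma continuous_comp_within (X Y Z : topologicalType) (A : set Y) (f : Y -> Z)
    (r : X -> Y) :
  {within A, continuous f} -> continuous r -> (forall x, A (r x)) ->
  continuous (f \o r).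
Proof.
move=> f_cont r_cont rA; apply/continuous_subspace_setT.
by apply: (within_comp f_cont) => //; exact: continuous_subspaceT.
Qed.

Definition clamp (t : R) : R := Num.max 0 (Num.min 1 t).

Lemma clampP t : 0 <= clamp t <= 1.
Proof. by rewrite /clamp le_max lexx /= ge_max ler01 /= ge_min lexx. Qed.

Lemma unit_itvP t : I t <-> 0 <= t <= 1.
Proof. by rewrite /unit_itv /= in_itv. Qed.

Lemma unit_itv0 : I 0.
Proof. by apply/unit_itvP; rewrite lexx ler01. Qed.

Lemma clamp_unit_itv t : I (clamp t).
Proof. by apply/unit_itvP; exact: clampP. Qed.

Lemma clamp_id t : 0 <= t <= 1 -> clamp t = t.
Proof. by move=> /andP[t0 t1]; rewrite /clamp min_r // max_r. Qed.

Lemma clamp0 t : t <= 0 -> clamp t = 0.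
Proof. by move=> t0; rewrite /clamp min_r ?max_l //; lra. Qed.

Lemma clamp1 t : 1 <= t -> clamp t = 1.
Proof. by move=> t1; rewrite /clamp min_l // max_r. Qed.

End Continuity.

Ltac prove_continuous :=
  let binary f g close :=
    (let f_cont := fresh in let g_cont := fresh in
     have f_cont : continuous f; [cbv beta; prove_continuous |];
     have g_cont : continuous g; [cbv beta; prove_continuous |];
     by move=> ?; close f_cont g_cont) in
  lazymatch goal with
  | |- continuous (fun _ => ?c) => exact: cst_continuous
  | |- continuous (fun x => x) => by move=> ?; exact: cvg_id
  | |- continuous (fun x => x.1) => by move=> ?; exact: cvg_fst
  | |- continuous (fun x => x.2) => by move=> ?; exact: cvg_snd
  | |- continuous (fun x => clamp (@?f x)) => rewrite /clamp; prove_continuous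
  | |- continuous (fun x => (@?f x, @?g x)) =>
      binary f g ltac:(fun hf hg => exact: cvg_pair (hf _) (hg _))
  | |- continuous (fun x => Num.max (@?f x) (@?g x)) =>
      binary f g ltac:(fun hf hg => exact: (@continuous_max _ _ f g _ (hf _) (hg _)))
  | |- continuous (fun x => Num.min (@?f x) (@?g x)) =>
      binary f g ltac:(fun hf hg => exact: (@continuous_min _ _ f g _ (hf _) (hg _)))
  | |- continuous (fun x => GRing.scale (@?f x) (@?g x)) =>
      binary f g ltac:(fun hf hg => exact: cvgZ (hf _) (hg _))
  | |- continuous (fun x => GRing.mul (@?f x) (@?g x)) =>
      binary f g ltac:(fun hf hg => exact: cvgM (hf _) (hg _))
  | |- continuous (fun x => GRing.add (@?f x) (@?g x)) =>
      binary f g ltac:(fun hf hg => exact: cvgD (hf _) (hg _))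
  | |- continuous (fun x => GRing.opp (@?f x)) =>
      let f_cont := fresh in
      have f_cont : continuous f; [cbv beta; prove_continuous |];
      by move=> ?; exact: cvgN (f_cont _)
  | |- _ => try assumption
  end.

Section Contractible.
Variables (R : realType) (V : normedModType R).
Local Open Scope ring_scope.
Local Open Scope classical_set_scope.
Local Notation I := (@unit_itv R).
Implicit Types (A Q : set V) (x y : V).

Definition contractible A : Prop := exists (K : R * V -> V) (p : V),
  [/\ {within I `*` A, continuous K}, A p,
      forall s x, 0 <= s <= 1 -> A x -> A (K (s, x)),
      forall x, A x -> K (0, x) = x & forall x, A x -> K (1, x) = p].

Definition line x y (t : R) : V := (1 - t) *: x + t *: y.

Lemma line0 x y : line x y 0 = x.
Proof. by rewrite /line subr0 scale1r scale0r addr0. Qed.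

Lemma line1 x y : line x y 1 = y.
Proof. by rewrite /line subrr scale1r scale0r add0r. Qed.

Lemma line_xx x t : line x x t = x.
Proof. by rewrite /line -scalerDl subrK scale1r. Qed.

Lemma line_continuous x y : continuous (line x y).
Proof. by rewrite /line; prove_continuous. Qed.

Definition convex Q : Prop := convex_set (Q : set (convex_lmodType V)).

Lemma convexP Q : convex Q <->
  forall x y t, Q x -> Q y -> 0 <= t <= 1 -> Q (line x y t).
Proof.
split=> [cQ x y t Qx Qy /andP[t0 t1]|cQ x y t /set_mem Qx /set_mem Qy].
  have := cQ y x (Itv01 t0 t1); rewrite !inE => /(_ Qy Qx).
  by rewrite /line addrC.
rewrite inE; have := cQ y x t%:num Qy Qx; rewrite /line addrC; apply.
by rewrite ge0 le1.
Qed.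

Lemma convex_contractible Q p : convex Q -> Q p -> contractible Q.
Proof.
move=> /convexP cQ Qp; exists (fun z => line z.2 p z.1), p; split=> //.
- by apply: continuous_subspaceT; rewrite /line; prove_continuous.
- by move=> s x s01 Qx; apply: cQ.
- by move=> x _; rewrite line0.
- by move=> x _; rewrite line1.
Qed.

Section Attach.
Variables (A Q : set V) (rho : V -> V).
Hypotheses (Q_convex : convex Q) (rho_cont : {within A `|` Q, continuous rho}).
Hypothesis rho_id : forall x, A x -> rho x = x.
Hypothesis rho_Q : forall x, Q x -> A (rho x) /\ Q (rho x).

Lemma attach_retract x : (A `|` Q) x -> A (rho x).
Proof. by case=> [Ax|/rho_Q[]//]; rewrite rho_id. Qed.

(* First move straight to [rho x], then contract [A]; the two halves are glued
   by adding them and subtracting their common point. *)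
Definition attach_contraction (K : R * V -> V) (z : R * V) : V :=
  line z.2 (rho z.2) (clamp (2 * z.1)) + K (clamp (2 * z.1 - 1), rho z.2) - rho z.2.

Variable K : R * V -> V.
Hypothesis K_cont : {within I `*` A, continuous K}.
Hypothesis K_start : forall x, A x -> K (0, x) = x.

Lemma attach_contraction_first s x : s <= 1/2 -> (A `|` Q) x ->
  attach_contraction K (s, x) = line x (rho x) (clamp (2 * s)).
Proof.
move=> s_le AQx; rewrite /attach_contraction (@clamp0 _ (2 * s - 1)); last by lra.
by rewrite K_start ?addrK //; exact: attach_retract.
Qed.

Lemma attach_contraction_second s x : 1/2 <= s ->
  attach_contraction K (s, x) = K (clamp (2 * s - 1), rho x).
Proof.
move=> s_ge; rewrite /attach_contraction /= clamp1; last by lra.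
by rewrite line1 addrC addKr.
Qed.

Lemma attach_contraction_continuous :
  {within I `*` (A `|` Q), continuous (attach_contraction K)}.
Proof.
have rho2_cont : {within I `*` (A `|` Q), continuous (fun z : R * V => rho z.2)}.
  apply: (within_comp rho_cont (r := snd)); last by move=> z [].
  by apply: continuous_subspaceT => z; exact: cvg_snd.
have time_cont (f : R * V -> R) : continuous f -> {within I `*` (A `|` Q), continuous f}.
  exact: continuous_subspaceT.
have K_rho_cont : {within I `*` (A `|` Q),
    continuous (K \o (fun z => (clamp (2 * z.1 - 1), rho z.2)))}.
  apply: (within_comp K_cont); last first.
    by move=> z [_ AQz]; split; [exact: clamp_unit_itv | exact: attach_retract].
  have late_cont := time_cont (fun z => clamp (2 * z.1 - 1)) ltac:(prove_continuous).
  by move=> z; exact: cvg_pair (late_cont z) (rho2_cont z).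
move=> z; apply: cvgB; last exact: rho2_cont.
apply: cvgD; last exact: K_rho_cont.
have early_cont := time_cont (fun z => clamp (2 * z.1)) ltac:(prove_continuous).
have rest_cont := time_cont (fun z => 1 - clamp (2 * z.1)) ltac:(prove_continuous).
apply: cvgD; apply: cvgZ; [exact: rest_cont | | exact: early_cont | exact: rho2_cont].
by apply: continuous_subspaceT => ?; exact: cvg_snd.
Qed.

End Attach.

Lemma contractible_attach A Q rho : contractible A -> convex Q ->
  {within A `|` Q, continuous rho} -> (forall x, A x -> rho x = x) ->
  (forall x, Q x -> A (rho x) /\ Q (rho x)) -> contractible (A `|` Q).
Proof.
move=> [K [p [K_cont Ap K_in K_start K_end]]] Q_convex rho_cont rho_id rho_Q.
have first_half := attach_contraction_first rho_id rho_Q K_start.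
have second_half := attach_contraction_second rho K.
have rho_A := attach_retract rho_id rho_Q.
exists (attach_contraction rho K), p; split.
- exact: (attach_contraction_continuous rho_cont rho_id rho_Q K_cont).
- by left.
- move=> s x s01 AQx; have [s_le|s_gt] := lerP s (1/2); last first.
    by left; rewrite second_half; [apply: K_in (rho_A _ AQx); exact: clampP | lra].
  rewrite first_half //; case: AQx => [Ax|Qx]; first by left; rewrite rho_id ?line_xx.
  by right; apply: (convexP Q).1 => //; [exact: (rho_Q x Qx).2 | exact: clampP].
- by move=> x AQx; rewrite first_half ?mulr0 ?clamp0 ?line0 //; lra.
- by move=> x AQx; rewrite second_half ?clamp1 ?K_end //; [exact: rho_A | lra | lra].
Qed.

End Contractible.

Section Paths.
Variable R : realType.
Local Open Scope ring_scope.
Local Open Scope classical_set_scope.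
Local Notation I := (@unit_itv R).
Implicit Types (A B Q : set (R * R)) (g h : R -> R * R).

Lemma line_pairE (x y : R * R) t :
  line x y t = ((1 - t) * x.1 + t * y.1, (1 - t) * x.2 + t * y.2).
Proof. by []. Qed.

Lemma is_path_comp A g (X : topologicalType) (b : X -> R) : is_path A g ->
  continuous b -> (forall x, 0 <= b x <= 1) -> continuous (fun x => g (b x)).
Proof.
move=> [g_cont _] b_cont b01.
by apply: (continuous_comp_within g_cont b_cont) => x; apply/unit_itvP.
Qed.

Lemma is_path_in A g t : is_path A g -> 0 <= t <= 1 -> A (g t).
Proof. by move=> [_ gA] t01; apply: gA; exists t => //; apply/unit_itvP. Qed.

Lemma is_pathI A g : continuous g -> (forall t, 0 <= t <= 1 -> A (g t)) ->
  is_path A g.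
Proof.
move=> g_cont gA; split; first exact: continuous_subspaceT.
by move=> _ [t /unit_itvP t01 <-]; apply: gA.
Qed.

Lemma is_path_sub A B g : A `<=` B -> is_path A g -> is_path B g.
Proof. by move=> AB [g_cont gA]; split=> // z /gA/AB. Qed.

Lemma line_is_path Q x y : convex Q -> Q x -> Q y -> is_path Q (line x y).
Proof.
move=> /convexP cQ Qx Qy; apply: is_pathI; first exact: line_continuous.
by move=> t t01; apply: cQ.
Qed.

(* Two paths are concatenated by adding them and subtracting their common point. *)
Lemma is_path_cat A g h : is_path A g -> is_path A h -> g 1 = h 0 ->
  exists k, [/\ is_path A k, k 0 = g 0, k 1 = h 1,
    forall t, 0 <= t <= 1/2 -> k t = g (2 * t) &
    forall t, 1/2 <= t <= 1 -> k t = h (2 * t - 1)].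
Proof.
move=> g_path h_path gh.
pose k t := g (clamp (2 * t)) + h (clamp (2 * t - 1)) - h 0.
have first_half t : 0 <= t <= 1/2 -> k t = g (2 * t).
  move=> t_range; rewrite /k (@clamp0 _ (2 * t - 1)) ?addrK; last by lra.
  by rewrite clamp_id //; lra.
have second_half t : 1/2 <= t <= 1 -> k t = h (2 * t - 1).
  move=> t_range; rewrite /k (@clamp1 _ (2 * t)) ?gh 1?addrC ?addKr; last by lra.
  by rewrite clamp_id //; lra.
exists k; split=> //.
- apply: is_pathI => [|t t01].
    have clamp_path f (l : R -> R) : is_path A f -> continuous l ->
      continuous (fun t => f (clamp (l t))).
      move=> f_path l_cont.
      apply: (is_path_comp (b := fun t => clamp (l t)) f_path) => [|t]; last exact: clampP.
      by prove_continuous.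
    have g_cont := clamp_path g (fun t => 2 * t) g_path ltac:(prove_continuous).
    have h_cont := clamp_path h (fun t => 2 * t - 1) h_path ltac:(prove_continuous).
    by move=> t; apply: cvgB (cvgD (g_cont t) (h_cont t)) (cvg_cst _).
  have [t_le|t_gt] := lerP t (1/2).
    by rewrite first_half; [apply: (is_path_in g_path); lra | lra].
  by rewrite second_half; [apply: (is_path_in h_path); lra | lra].
- by rewrite first_half ?mulr0 //; lra.
- by rewrite second_half; [congr h; lra | lra].
Qed.

Section Contraction.
Variables (A : set (R * R)) (K : R * (R * R) -> R * R) (p : R * R).
Hypothesis K_cont : {within I `*` A, continuous K}.
Hypothesis K_in : forall s x, 0 <= s <= 1 -> A x -> A (K (s, x)).
Hypothesis K_start : forall x, A x -> K (0, x) = x.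
Hypothesis K_end : forall x, A x -> K (1, x) = p.

Lemma contraction_comp_continuous (X : topologicalType) (a : X -> R) (f : X -> R * R) :
  continuous a -> continuous f -> (forall x, 0 <= a x <= 1) -> (forall x, A (f x)) ->
  continuous (fun x => K (a x, f x)).
Proof.
move=> a_cont f_cont a01 fA.
have af_cont : continuous (fun x => (a x, f x)) by prove_continuous.
by apply: (continuous_comp_within K_cont af_cont) => x; split=> //=; apply/unit_itvP.
Qed.

Lemma contraction_path_connected : path_connected A.
Proof.
have trace_path x (l : R -> R) : A x -> continuous l -> is_path A (fun t => K (clamp (l t), x)).
  move=> Ax l_cont; apply: is_pathI; last by move=> t _; apply: K_in => //; exact: clampP.
  apply: contraction_comp_continuous => //; first by prove_continuous.
    by prove_continuous.
  by move=> t; exact: clampP.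
move=> x y Ax Ay.
have id_cont : continuous (fun t : R => t) by prove_continuous.
have rev_cont : continuous (fun t : R => 1 - t) by prove_continuous.
have [|k [k_path k0 k1 _ _]] :=
  is_path_cat (trace_path x _ Ax id_cont) (trace_path y _ Ay rev_cont).
  by rewrite subr0 clamp1 ?K_end.
exists k; split=> //; first by rewrite k0 clamp0 ?K_start.
by rewrite k1 subrr clamp0 ?K_start.
Qed.

Section Loop.
Variable g : R -> R * R.
Hypotheses (g_path : is_path A g) (g_loop : g 0 = g 1).

Definition tent (t : R) : R := Num.min (clamp (3 * t)) (clamp (3 - 3 * t)).

(* The point of the loop visited at time [z.2]: while [z.1] grows to 1/2, the
   traversal is squeezed into the middle third of the time interval. *)
Definition squeeze (z : R * R) : R :=
  (1 - clamp (2 * z.1)) * clamp z.2 + clamp (2 * z.1) * clamp (3 * z.2 - 1).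

(* At [z.1 = 1/2] the loop has become the path that follows the contraction of
   the base point and returns, which is pulled back in the second half. *)
Definition loop_homotopy (z : R * R) : R * R :=
  K (Num.min (tent z.2) (clamp (2 * z.1)), g (squeeze z)) +
  K (Num.min (tent z.2) (clamp (2 - 2 * z.1)), g 0) - K (tent z.2, g 0).

Lemma tentP t : 0 <= tent t <= 1.
Proof.
by rewrite /tent le_min ge_min; have := clampP (3 * t); have := clampP (3 - 3 * t); lra.
Qed.

Lemma tent0 : tent 0 = 0.
Proof. by rewrite /tent mulr0 clamp0 // min_l // (andP (clampP _)).1. Qed.

Lemma tent1 : tent 1 = 0.
Proof. by rewrite /tent mulr1 subrr (@clamp0 _ 0) // min_r // (andP (clampP _)).1. Qed.

Lemma min_tent_clampP t u : 0 <= Num.min (tent t) (clamp u) <= 1.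
Proof. by rewrite le_min ge_min; have := tentP t; have := clampP u; lra. Qed.

Lemma squeezeP z : 0 <= squeeze z <= 1.
Proof.
have := clampP z.2; have := clampP (3 * z.2 - 1); have := clampP (2 * z.1).
by rewrite /squeeze; nra.
Qed.

Lemma base_point_in : A (g 0).
Proof. by apply: (is_path_in g_path); rewrite lexx ler01. Qed.

Lemma squeezed_loop_contracted t : K (tent t, g (clamp (3 * t - 1))) = K (tent t, g 0).
Proof.
have [t_le|t_gt] := lerP t (1/3); first by rewrite clamp0 //; lra.
have [t_ge|t_lt] := lerP (2/3) t; first by rewrite clamp1 -?g_loop //; lra.
have -> : tent t = 1 by rewrite /tent !clamp1 ?minxx //; lra.
by rewrite (K_end (is_path_in g_path (clampP _))) (K_end base_point_in).
Qed.

Lemma loop_homotopy_first z : 0 <= z.1 <= 1/2 ->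
  loop_homotopy z = K (Num.min (tent z.2) (clamp (2 * z.1)), g (squeeze z)).
Proof.
move=> z_range; rewrite /loop_homotopy (@clamp1 _ (2 - 2 * z.1)); last by lra.
by rewrite (min_l (y := 1)) ?addrK // (andP (tentP _)).2.
Qed.

Lemma loop_homotopy_second z : 1/2 <= z.1 <= 1 ->
  loop_homotopy z = K (Num.min (tent z.2) (clamp (2 - 2 * z.1)), g 0).
Proof.
move=> z_range; rewrite /loop_homotopy /squeeze (@clamp1 _ (2 * z.1)); last by lra.
rewrite subrr mul0r add0r mul1r (min_l (y := 1)) ?(andP (tentP _)).2 //.
by rewrite squeezed_loop_contracted addrC addKr.
Qed.

Lemma loop_homotopy_in z : 0 <= z.1 <= 1 -> A (loop_homotopy z).
Proof.
move=> z01; have [z_le|z_gt] := lerP z.1 (1/2).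
  rewrite loop_homotopy_first; last by lra.
  by apply: K_in; [exact: min_tent_clampP | apply: (is_path_in g_path); exact: squeezeP].
rewrite loop_homotopy_second; last by lra.
by apply: K_in; [exact: min_tent_clampP | exact: base_point_in].
Qed.

Lemma loop_homotopy_continuous : continuous loop_homotopy.
Proof.
have squeeze_cont : continuous (fun z => g (squeeze z)).
  by apply: (is_path_comp g_path); [rewrite /squeeze; prove_continuous | exact: squeezeP].
have K_min_cont (u : R * R -> R) (f : R * R -> R * R) : continuous u -> continuous f ->
    (forall z, A (f z)) -> continuous (fun z => K (Num.min (tent z.2) (clamp (u z)), f z)).
  move=> u_cont f_cont fA; apply: contraction_comp_continuous => //.
    by rewrite /tent; prove_continuous.
  by move=> z; exact: min_tent_clampP.
have loop_inA z : A (g (squeeze z)) by apply: (is_path_in g_path); exact: squeezeP.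
have base_inA (z : R * R) : A (g 0) by exact: base_point_in.
move=> z; apply: cvgB; [apply: cvgD|].
- by apply: (K_min_cont (fun z => 2 * z.1)) => //; prove_continuous.
- by apply: (K_min_cont (fun z => 2 - 2 * z.1)) => //; prove_continuous.
- apply: (contraction_comp_continuous (a := fun z : R * R => tent z.2)) => //.
  + by rewrite /tent; prove_continuous.
  + by prove_continuous.
  + by move=> ?; exact: tentP.
Qed.

Lemma loop_homotopy_base s t : tent t = 0 -> g (squeeze (s, t)) = g 0 ->
  loop_homotopy (s, t) = g 0.
Proof.
move=> tent_t squeeze_st; rewrite /loop_homotopy /= tent_t squeeze_st.
by rewrite !min_l ?K_start ?addrK //; try exact: base_point_in;
  rewrite (andP (clampP _)).1.
Qed.

Lemma contraction_null_homotopic : null_homotopic A g.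
Proof.
exists loop_homotopy; split.
- by apply: continuous_subspaceT; exact: loop_homotopy_continuous.
- by move=> _ [z [/unit_itvP z01 _] <-]; apply: loop_homotopy_in.
- move=> t /unit_itvP t01; split.
    rewrite loop_homotopy_first /=; last by lra.
    rewrite mulr0 clamp0 // min_r ?(andP (tentP _)).1 // K_start;
      last by apply: (is_path_in g_path); exact: squeezeP.
    by rewrite /squeeze /= mulr0 (@clamp0 _ 0) // subr0 mul1r mul0r addr0 clamp_id.
  rewrite loop_homotopy_second /=; last by lra.
  rewrite mulr1 subrr (@clamp0 _ 0) // min_r ?(andP (tentP _)).1 // K_start //.
  exact: base_point_in.
- move=> s _; split; apply: loop_homotopy_base; rewrite ?tent0 ?tent1 //.
    by rewrite /squeeze /= !(@clamp0 _ (_ - 1), @clamp0 _ 0) ?mulr0 ?addr0 //; lra.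
  by rewrite /squeeze /= !(@clamp1 _ 1, @clamp1 _ (_ - 1)) ?mulr1 ?subrK //; lra.
Qed.

End Loop.
End Contraction.

Lemma contractible_simply_connected A : contractible A -> simply_connected A.
Proof.
move=> [K [p [K_cont Ap K_in K_start K_end]]]; split; first by exists p.
  exact: contraction_path_connected K_cont K_in K_start K_end.
move=> g g_path g_loop.
exact: contraction_null_homotopic K_cont K_in K_start K_end _ g_path g_loop.
Qed.

Lemma simply_connected_retract A B rho : simply_connected A -> B !=set0 -> B `<=` A ->
  {within A, continuous rho} -> (forall x, A x -> B (rho x)) ->
  (forall x, B x -> rho x = x) -> simply_connected B.
Proof.
move=> [_ A_path A_loop] B_nonempty BA rho_cont rho_B rho_id; split=> //.
  move=> x y Bx By; have [g [[g_cont gA] g0 g1]] := A_path x y (BA _ Bx) (BA _ By).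
  exists (rho \o g); split; [|by rewrite /= g0 rho_id|by rewrite /= g1 rho_id].
  split; first by apply: (within_comp rho_cont g_cont) => t It; apply: gA; exists t.
  by move=> _ [t It <-]; apply: rho_B; apply: gA; exists t.
move=> g [g_cont gB] g_loop.
have [] := A_loop g; [by split=> // z /gB/BA|by []|].
have I0 := unit_itv0 R.
move=> H [H_cont HA H_ends H_base]; exists (rho \o H); split.
- by apply: (within_comp rho_cont H_cont) => z Iz; apply: HA; exists z.
- by move=> _ [z Iz <-]; apply: rho_B; apply: HA; exists z.
- move=> t It; have [H0 H1] := H_ends t It; rewrite /= H0 H1.
  by rewrite !rho_id //; apply: gB; [exists 0 | exists t].
- move=> s Is; have [H0 H1] := H_base s Is; rewrite /= H0 H1.
  by rewrite !rho_id //; apply: gB; exists 0.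
Qed.

End Paths.

(** * Shellable regions *)

Definition arc_pattern (e w n s ne nw se sw : bool) : bool :=
  match e, w, n, s with
  | true, false, false, false => ~~ nw && ~~ sw
  | false, true, false, false => ~~ ne && ~~ se
  | false, false, true, false => ~~ se && ~~ sw
  | false, false, false, true => ~~ ne && ~~ nw
  | true, false, true, false => ~~ sw
  | true, false, false, true => ~~ nw
  | false, true, true, false => ~~ se
  | false, true, false, true => ~~ ne
  | true, true, true, false | true, true, false, true
  | true, false, true, true | false, true, true, true => true
  | _, _, _, _ => false
  end.

Definition neighbor (P : square -> bool) c dx dy : bool := P (shift_cell c dx dy).

(* the cells satisfying [P] meet the boundary of [c] in an arc made of one to
   three of its sides *)
Definition arc (P : square -> bool) (c : square) : bool :=
  let n := neighbor P c in
  arc_pattern (n 1 0)%R (n (-1) 0)%R (n 0 1)%R (n 0 (-1))%R (n 1 1)%R (n (-1) 1)%R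
    (n 1 (-1))%R (n (-1) (-1))%R.

Lemma eq_arc P Q c : P =1 Q -> arc P c = arc Q c.
Proof. by move=> PQ; rewrite /arc /neighbor !PQ. Qed.

Definition side_directions : seq (int * int) :=
  [:: (1, 0); (-1, 0); (0, 1); (0, -1)]%R.

Lemma arc_side P c : arc P c ->
  exists2 d, d \in side_directions & neighbor P c d.1 d.2.
Proof.
rewrite /arc; case east: (neighbor P c 1 0); first by exists (1, 0)%R.
case west: (neighbor P c (-1) 0); first by exists (-1, 0)%R.
case north: (neighbor P c 0 1); first by exists (0, 1)%R.
by case south: (neighbor P c 0 (-1)); first by exists (0, -1)%R.
Qed.

Fixpoint shelled (s : seq square) : bool :=
  if s is c :: s' then
    (s' == [::]) || [&& c \notin s', arc (mem s') c & shelled s']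
  else false.

Lemma shelled_uniq s : shelled s -> uniq s.
Proof. by elim: s => // c s IH /= /orP[/eqP -> //|/and3P[-> _ /IH]]. Qed.

Section Shelling.
Variable R : realType.
Local Open Scope ring_scope.
Local Open Scope classical_set_scope.
Implicit Types (S : cells) (c d : square) (u z : R * R).

Definition in_unit u : Prop := [/\ 0 <= u.1, u.1 <= 1, 0 <= u.2 & u.2 <= 1].

Definition on_sides (e w n s : bool) u : Prop :=
  [\/ e /\ u.1 = 1, w /\ u.1 = 0, n /\ u.2 = 1 | s /\ u.2 = 0].

Definition side_retract e w n s : Prop := exists2 r : R * R -> R * R, continuous r &
  forall u, in_unit u -> [/\ in_unit (r u), on_sides e w n s (r u)
    & on_sides e w n s u -> r u = u].

Lemma side_retract_conj e w n s e' w' n' s' (f : R * R -> R * R) :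
  continuous f -> (forall u, f (f u) = u) -> (forall u, in_unit u -> in_unit (f u)) ->
  (forall u, on_sides e w n s u -> on_sides e' w' n' s' (f u)) ->
  (forall u, on_sides e' w' n' s' u -> on_sides e w n s (f u)) ->
  side_retract e w n s -> side_retract e' w' n' s'.
Proof.
move=> f_cont fK f_unit f_sides f_sides' [r r_cont r_retract].
exists (f \o r \o f) => [u|u u_unit].
  by apply: continuous_comp; [exact: f_cont | apply: continuous_comp;
    [exact: r_cont | exact: f_cont]].
have [ru_unit ru_sides ru_id] := r_retract _ (f_unit _ u_unit).
split=> [||u_sides]; [exact: f_unit | exact: f_sides |].
by rewrite /= ru_id ?fK //; exact: f_sides'.
Qed.

Lemma side_retract_flip_ew e w n s : side_retract e w n s -> side_retract w e n s.
Proof.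
have flip_sides e' w' u : on_sides e' w' n s u -> on_sides w' e' n s (1 - u.1, u.2).
  by case=> -[side coord]; [constructor 2|constructor 1|constructor 3|constructor 4];
    split=> //=; lra.
apply: side_retract_conj (flip_sides e w) (flip_sides w e) => [|u|u [*]].
- by prove_continuous.
- by rewrite /= subKr; case: u.
- by split=> //=; lra.
Qed.

Lemma side_retract_swap e w n s : side_retract e w n s -> side_retract n s e w.
Proof.
have swap_sides e' w' n' s' u : on_sides e' w' n' s' u -> on_sides n' s' e' w' (u.2, u.1).
  by case=> side; [constructor 3|constructor 4|constructor 1|constructor 2].
apply: side_retract_conj (swap_sides e w n s) (swap_sides n s e w) => [|[] //|u [*] //].
by prove_continuous.
Qed.

Lemma side_retract_flip_ns e w n s : side_retract e w n s -> side_retract e w s n.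
Proof. by move=> /side_retract_swap/side_retract_flip_ew/side_retract_swap. Qed.

Lemma side_retract_s : side_retract false false false true.
Proof.
exists (fun u => (u.1, 0)); first by prove_continuous.
move=> u [x_ge0 x_le1 y_ge0 y_le1]; split=> /=; first by split=> //=; lra.
  by constructor 4.
by case=> -[// _]; case: u {x_ge0 x_le1 y_ge0 y_le1} => a b /= ->.
Qed.

Lemma side_retract_ws : side_retract false true false true.
Proof.
exists (fun u => (Num.max (u.1 - u.2) 0, Num.max (u.2 - u.1) 0)); first by prove_continuous.
move=> [x y] [/= x_ge0 x_le1 y_ge0 y_le1]; split=> /=.
- by split=> /=; rewrite ?le_max ?ge_max ?lexx ?orbT //; apply/andP; split; lra.
- have [x_le_y|x_gt_y] := lerP x y.
    by constructor 2; split=> //=; rewrite max_r //; lra.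
  by constructor 4; split=> //=; rewrite max_r //; lra.
- case=> -[//= _ coord]; rewrite coord in x_ge0 x_le1 y_ge0 y_le1 *.
    by rewrite subr0 sub0r (max_r (x := - y)) ?(max_l (x := y)) //; lra.
  by rewrite subr0 sub0r (max_r (x := - x)) ?(max_l (x := x)) //; lra.
Qed.

(* [along] parametrizes the three sides by arc length measured from the middle
   of the bottom. *)
Lemma side_retract_ews : side_retract true true false true.
Proof.
pose along u : R := (2 * u.1 - 1) * (1/2 + u.2).
exists (fun u => (clamp (along u + 1/2),
                  Num.max 0 (Num.max (along u - 1/2) (- along u - 1/2)))).
  by rewrite /along; prove_continuous.
move=> [x y] [/= x_ge0 x_le1 y_ge0 y_le1].
have [a_ge a_le] : - (3/2) <= along (x, y) /\ along (x, y) <= 3/2.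
  by rewrite /along /=; split; nra.
have a_east : x = 1 -> along (x, y) = 1/2 + y by rewrite /along /= => ->; lra.
have a_west : x = 0 -> along (x, y) = - (1/2 + y) by rewrite /along /= => ->; lra.
have a_south : y = 0 -> along (x, y) = x - 1/2 by rewrite /along /= => ->; lra.
move: (along (x, y)) a_ge a_le a_east a_west a_south => a a_ge a_le a_east a_west a_south.
split=> /=.
- have /andP[? ?] := clampP (a + 1/2); split=> //=; first by rewrite le_max lexx.
  by rewrite !ge_max ler01 /=; apply/andP; split; lra.
- have [?|?] := lerP (a + 1/2) 0; first by constructor 2; split=> //=; exact: clamp0.
  have [?|?] := lerP 1 (a + 1/2); first by constructor 1; split=> //=; exact: clamp1.
  by constructor 4; split=> //=; apply: max_l; rewrite ge_max; apply/andP; split; lra.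
- case=> -[//= _ coord].
  + rewrite (a_east coord) coord clamp1; last by lra.
    by congr pair; rewrite (max_l (y := - _ - _)) ?(max_r (x := 0)); lra.
  + rewrite (a_west coord) coord clamp0; last by lra.
    by congr pair; rewrite (max_r (x := _ - 1/2)) ?(max_r (x := 0)); lra.
  + rewrite (a_south coord) coord clamp_id; last by apply/andP; split; lra.
    by congr pair; [lra | apply: max_l; rewrite ge_max; apply/andP; split; lra].
Qed.

Lemma arc_side_retract e w n s ne nw se sw : arc_pattern e w n s ne nw se sw ->
  side_retract e w n s.
Proof.
have south := side_retract_s; have west_south := side_retract_ws.
have not_north := side_retract_ews.
have flip_ew := side_retract_flip_ew; have flip_ns := side_retract_flip_ns.
have swap := side_retract_swap.
case: e w n s => [] [] [] [] //= _;
  first [ exact: south | exact: flip_ns south | exact: swap south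
  | exact: swap (flip_ns _ _ _ _ south) | exact: flip_ew (swap _ _ _ _ south)
  | exact: west_south | exact: flip_ew west_south | exact: flip_ns west_south
  | exact: flip_ns (flip_ew _ _ _ _ west_south)
  | exact: not_north | exact: flip_ns not_north | exact: swap not_north
  | exact: swap (flip_ns _ _ _ _ not_north) | exact: flip_ew (swap _ _ _ _ not_north) ].
Qed.

Definition corner c : R * R := (c.1%:~R, c.2%:~R).

Lemma in_unit_square c z : unit_square R c z <-> in_unit (z - corner c).
Proof. by rewrite unit_squareP /in_unit /=; split=> -[? ? ? ?]; split; lra. Qed.

Lemma corner_in_square c : unit_square R c (corner c).
Proof. by apply/unit_squareP => /=; split; lra. Qed.

(* [t] is the coordinate, relative to a unit interval, of a point that also
   belongs to the interval at offset [d]. *)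
Definition touches (d : int) (t : R) : Prop := [\/ d = 0, d = 1 /\ t = 1 | d = -1 /\ t = 0].

Lemma int_meet (a b : int) (r : R) : a%:~R <= r -> r <= a%:~R + 1 ->
  b%:~R <= r -> r <= b%:~R + 1 -> exists2 d : int, b = a + d & touches d (r - a%:~R).
Proof.
move=> a_le le_a b_le le_b.
have ab : a <= b + 1 by rewrite -(ler_int R) rmorphD; apply: le_trans a_le le_b.
have ba : b <= a + 1 by rewrite -(ler_int R) rmorphD; apply: le_trans b_le le_a.
exists (b - a); first by lia.
have [e|[e|e]] : b = a \/ b = a + 1 \/ b = a - 1 by lia.
- by constructor 1; lia.
- by constructor 2; split; [lia | move: b_le; rewrite e rmorphD /=; lra].
- by constructor 3; split; [lia | move: le_b; rewrite e rmorphB /=; lra].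
Qed.

Lemma square_meet c d z : unit_square R c z -> unit_square R d z ->
  exists dx dy, [/\ d = shift_cell c dx dy,
    touches dx (z - corner c).1 & touches dy (z - corner c).2].
Proof.
move=> /unit_squareP[cx_le le_cx cy_le le_cy] /unit_squareP[dx_le le_dx dy_le le_dy].
have [dx ex touch_x] := int_meet cx_le le_cx dx_le le_dx.
have [dy ey touch_y] := int_meet cy_le le_cy dy_le le_dy.
by exists dx, dy; split=> //; rewrite /shift_cell -ex -ey; case: (d).
Qed.

Lemma on_sides_realize (P : square -> bool) S c z : (forall d, P d -> d \in S) ->
  unit_square R c z ->
  on_sides (neighbor P c 1 0) (neighbor P c (-1) 0) (neighbor P c 0 1)
    (neighbor P c 0 (-1)) (z - corner c) ->
  realize R S z.
Proof.
move=> PS /unit_squareP[? ? ? ?].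
by case=> -[/PS dS /= coord]; [exists (shift_cell c 1 0)|exists (shift_cell c (-1) 0)|
  exists (shift_cell c 0 1)|exists (shift_cell c 0 (-1))] => //=; apply/unit_squareP;
  rewrite /= ?rmorphD ?addr0 /=; split=> //; lra.
Qed.

Lemma arc_on_sides S c z : c \notin S -> arc (mem S) c -> unit_square R c z ->
  realize R S z ->
  let n := neighbor (mem S) c in
  on_sides (n 1 0) (n (-1) 0) (n 0 1) (n 0 (-1)) (z - corner c).
Proof.
move=> cS; rewrite /arc; set n := neighbor _ c => c_arc cz [d /= dS dz].
have [dx [dy [ed touch_x touch_y]]] := square_meet cz dz.
have nd : n dx dy by rewrite /n /neighbor -ed.
have n00 : n 0 0 = false by rewrite /n /neighbor shift_cell0; apply/negbTE.
rewrite /on_sides; move: c_arc nd.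
by case: touch_x => [->|[-> ->]|[-> ->]]; case: touch_y => [->|[-> ->]|[-> ->]];
  rewrite ?n00 //;
  case: (n 1 0); case: (n (-1) 0); case: (n 0 1); case: (n 0 (-1));
  case: (n 1 1); case: (n (-1) 1); case: (n 1 (-1)); case: (n (-1) (-1)) => //= _ _;
  first [by constructor 1 | by constructor 2 | by constructor 3 | by constructor 4].
Qed.

Lemma closed_square c : closed (unit_square R c).
Proof.
rewrite -[X in closed X]setCK; apply: open_closedC; rewrite openE => z z_out.
apply/nbhs_pairP; apply: contrapT => not_near; apply: z_out; apply/unit_squareP.
split; rewrite leNgt; apply/negP => z_lt; apply: not_near.
- exists (c.1%:~R - z.1); first by lra.
  by move=> w; rewrite ltr_norml => /andP[? ?] _ /unit_squareP[*]; lra.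
- exists (z.1 - c.1%:~R - 1); first by lra.
  by move=> w; rewrite ltr_norml => /andP[? ?] _ /unit_squareP[*]; lra.
- exists (c.2%:~R - z.2); first by lra.
  by move=> w _; rewrite ltr_norml => /andP[? ?] /unit_squareP[*]; lra.
- exists (z.2 - c.2%:~R - 1); first by lra.
  by move=> w _; rewrite ltr_norml => /andP[? ?] /unit_squareP[*]; lra.
Qed.

Lemma realize_fset1U c S : realize R (c |` S)%fset = realize R S `|` unit_square R c.
Proof.
apply/seteqP; split=> z.
  by case=> d /=; rewrite !inE => /orP[/eqP ->|dS] dz; [right | left; exists d].
by case=> [[d /= dS dz]|cz]; [exists d|exists c] => //=; rewrite !inE ?eqxx ?dS ?orbT.
Qed.

Lemma realize0 : realize R fset0 = set0.
Proof. by apply/seteqP; split=> z // -[d]; rewrite /= inE. Qed.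

Lemma closed_realize S : closed (realize R S).
Proof.
elim/finmap.finSet_rect: S => S IH; have [->|[c cS]] := fset_0Vmem S.
  by rewrite realize0; exact: closed0.
rewrite -(fsetD1K cS) realize_fset1U; apply: closedU; last exact: closed_square.
by apply: IH; rewrite fproperD1.
Qed.

Lemma convex_square c : convex (unit_square R c).
Proof.
apply/convexP => x y t /unit_squareP[? ? ? ?] /unit_squareP[? ? ? ?] /andP[? ?].
by apply/unit_squareP; rewrite line_pairE /=; split; nra.
Qed.

Lemma arc_retraction S c : c \notin S -> arc (mem S) c ->
  exists rho, [/\ {within realize R S `|` unit_square R c, continuous rho},
    forall z, realize R S z -> rho z = z &
    forall z, unit_square R c z -> realize R S (rho z) /\ unit_square R c (rho z)].
Proof.
move=> cS c_arc; have [r r_cont r_retract] := arc_side_retract c_arc.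
pose f z := corner c + r (z - corner c).
pose rho z := if `[< unit_square R c z >] then f z else z.
have f_cont : continuous f.
  have sub_cont : continuous (fun z : R * R => z - corner c) by prove_continuous.
  move=> z; apply: cvgD; first exact: cvg_cst.
  by apply: (cvg_comp _ _ (sub_cont z)); exact: r_cont.
have rho_id z : realize R S z -> rho z = z.
  move=> Sz; rewrite /rho; case: asboolP => // cz; rewrite /f.
  have [_ _ ->] := r_retract _ ((in_unit_square c z).1 cz); first by rewrite addrC subrK.
  exact: arc_on_sides.
exists rho; split=> // [|z cz].
- apply: withinU_continuous; [exact: closed_realize | exact: closed_square | |].
    have id_cont : {within realize R S, continuous (fun z : R * R => z)}.
      by apply: continuous_subspaceT; prove_continuous.
    by apply: subspace_eq_continuous id_cont => z; rewrite inE => /rho_id.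
  have f_within : {within unit_square R c, continuous f} by exact: continuous_subspaceT.
  have f_rho z : unit_square R c z -> f z = rho z by move=> cz; rewrite /rho asboolT.
  by apply: subspace_eq_continuous f_within => z; rewrite inE => /f_rho.
- rewrite /rho asboolT //; have [f_unit f_sides _] := r_retract _ ((in_unit_square c z).1 cz).
  have cf : unit_square R c (f z) by apply/in_unit_square; rewrite /f addrAC subrr add0r.
  by split=> //; apply: (@on_sides_realize (mem S) _ c) => //; rewrite /f addrAC subrr add0r.
Qed.

Lemma seq_fset_cons c (s : seq square) : [fset x in c :: s]%fset = (c |` [fset x in s])%fset.
Proof. by apply/fsetP => x; rewrite !inE. Qed.

Lemma arc_seq (s : seq square) c : arc (mem [fset x in s]%fset) c = arc (mem s) c.
Proof. by apply: eq_arc => x; rewrite /= !inE. Qed.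

Lemma shelled_contractible s : shelled s -> contractible (realize R [fset c in s]%fset).
Proof.
elim: s => // c s IH /=; rewrite seq_fset_cons realize_fset1U.
case/orP => [/eqP ->|/and3P[cs c_arc s_shelled]].
  have -> : [fset x in [::]]%fset = fset0 :> cells by apply/fsetP => x; rewrite !inE.
  rewrite realize0 set0U.
  apply: (convex_contractible (p := corner c)); first exact: convex_square.
  exact: corner_in_square.
have [|rho [rho_cont rho_id rho_c]] :=
    @arc_retraction [fset x in s]%fset c _ (etrans (arc_seq _ _) c_arc).
  by rewrite !inE.
by apply: contractible_attach rho_cont rho_id rho_c; [exact: IH | exact: convex_square].
Qed.

Definition linked S x y : Prop :=
  exists K, [/\ connected K, K `<=` (realize R S)°, K x & K y].

Lemma linked_line S x y :
  (forall t, 0 <= t <= 1 -> (realize R S)° (line x y t)) -> linked S x y.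
Proof.
move=> line_in; exists (line x y @` `[0, 1]); split.
- apply: connected_continuous_connected; first exact: segment_connected.
  by apply: continuous_subspaceT; exact: line_continuous.
- by move=> _ [t t01 <-]; apply: line_in; move: t01; rewrite /= in_itv.
- by exists 0; rewrite ?line0 //= in_itv /= lexx ler01.
- by exists 1; rewrite ?line1 //= in_itv /= lexx ler01.
Qed.

Lemma linked_sym S x y : linked S x y -> linked S y x.
Proof. by case=> K [? ? ? ?]; exists K. Qed.

Lemma linked_trans S y x z : linked S x y -> linked S y z -> linked S x z.
Proof.
case=> K [K_conn KS Kx Ky] [L [L_conn LS Ly Lz]]; exists (K `|` L).
split; [|by move=> t [/KS|/LS]|by left|by right].
by apply: connectedU => //; exists y.
Qed.

Lemma linked_mono S S' x y : {subset S <= S'} -> linked S x y -> linked S' x y.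
Proof.
move=> SS' [K [K_conn KS Kx Ky]]; exists K; split=> // z /KS.
by apply: interiorS => {}z [d /= dS dz]; exists d => //=; apply: SS'.
Qed.

Lemma linked_east S c : c \in S -> shift_cell c 1 0 \in S ->
  linked S (center R c) (center R (shift_cell c 1 0)).
Proof.
move=> cS eS; apply: linked_line => t /andP[? ?].
apply/nbhs_pairP; exists (1/2); first by lra.
move=> [x y]; rewrite line_pairE /center /= rmorphD /= addr0 !ltr_norml.
move=> /andP[? ?] /andP[? ?]; have [?|?] := lerP x (c.1%:~R + 1).
  by exists c => //; apply/unit_squareP => /=; split; nra.
by exists (shift_cell c 1 0) => //; apply/unit_squareP; rewrite /= rmorphD /= addr0; split; nra.
Qed.

Lemma linked_north S c : c \in S -> shift_cell c 0 1 \in S ->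
  linked S (center R c) (center R (shift_cell c 0 1)).
Proof.
move=> cS nS; apply: linked_line => t /andP[? ?].
apply/nbhs_pairP; exists (1/2); first by lra.
move=> [x y]; rewrite line_pairE /center /= rmorphD /= addr0 !ltr_norml.
move=> /andP[? ?] /andP[? ?]; have [?|?] := lerP y (c.2%:~R + 1).
  by exists c => //; apply/unit_squareP => /=; split; nra.
by exists (shift_cell c 0 1) => //; apply/unit_squareP; rewrite /= rmorphD /= addr0; split; nra.
Qed.

Lemma linked_side S c d : d \in side_directions -> c \in S -> shift_cell c d.1 d.2 \in S ->
  linked S (center R c) (center R (shift_cell c d.1 d.2)).
Proof.
rewrite !inE => /or4P[] /eqP -> /= cS dS.
- exact: linked_east.
- apply: linked_sym; have := @linked_east S (shift_cell c (-1) 0) dS.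
  by have := shift_cellK c (-1) 0; rewrite opprK oppr0 => ->; apply.
- exact: linked_north.
- apply: linked_sym; have := @linked_north S (shift_cell c 0 (-1)) dS.
  by have := shift_cellK c 0 (-1); rewrite opprK oppr0 => ->; apply.
Qed.

Lemma linked_center S c z : c \in S -> unit_square R c z -> (realize R S)° z ->
  linked S (center R c) z.
Proof.
move=> cS /unit_squareP[? ? ? ?] Sz; apply: linked_line => t /andP[t0 t1].
have [->|t_neq1] := eqVneq t 1; first by rewrite line1.
have {}t1 : t < 1 by rewrite lt_neqAle t_neq1.
by apply: (@open_cell_interior _ c) => //; rewrite line_pairE /center; split=> /=; nra.
Qed.

Lemma shelled_linked s : shelled s -> exists c0, {in s, forall c,
  linked [fset x in s]%fset (center R c0) (center R c)}.
Proof.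
elim: s => // c s IH /= /orP[/eqP ->|/and3P[cs c_arc /IH[c0 c0_linked]]].
  exists c => d; rewrite inE => /eqP ->; apply: (@linked_center _ c).
  - by rewrite !inE eqxx.
  - by apply: open_cell_sub; exact: center_open.
  - by apply: (@open_cell_interior _ c); [rewrite !inE eqxx | exact: center_open].
exists c0 => d.
have mono : {subset [fset x in s]%fset <= [fset x in c :: s]%fset}.
  by move=> x; rewrite !inE => ->; rewrite orbT.
have [v v_side vs] := arc_side c_arc.
rewrite inE => /orP[/eqP ->|ds]; last by apply: linked_mono mono _; apply: c0_linked.
apply: (@linked_trans _ (center R (shift_cell c v.1 v.2))).
  by apply: linked_mono mono _; apply: c0_linked.
apply/linked_sym/linked_side; rewrite // !inE ?eqxx //.
by rewrite (_ : shift_cell _ _ _ \in s) ?orbT.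
Qed.

Lemma shelled_region s : shelled s -> region R [fset c in s]%fset.
Proof.
move=> /shelled_linked[c0 c0_linked]; rewrite /region; set A := (X in connected X).
have -> : A = \bigcup_(K in [set K | [/\ connected K, K `<=` A & K (center R c0)]]) K.
  apply/seteqP; split=> z; last by case=> K /= [_ KA _] /KA.
  move=> Az; have [c /= cS cz] := interior_subset Az.
  have [K [K_conn KA K0 Kz]] : linked [fset x in s]%fset (center R c0) z.
    apply: (@linked_trans _ (center R c)); last exact: linked_center.
    by apply: c0_linked; move: cS; rewrite !inE.
  by exists K.
apply: bigcup_connected; first by exists (center R c0) => K /= [].
by move=> K /= [].
Qed.

End Shelling.

(** * Simply connected regions are shellable *)

Lemma fset_argmax (K : choiceType) (disp : Order.disp_t) (T : orderType disp)
    (D : {fset K}) (f : K -> T) : D != fset0 ->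
  exists2 d, d \in D & forall e, e \in D -> (f e <= f d)%O.
Proof.
case/fset0Pn => c cD; case: (@arg_maxP _ _ D [` cD]%fset predT (f \o val) isT) => d _ d_max.
by exists (val d) => [|e eD]; [exact: valP | exact: (d_max [` eD]%fset)].
Qed.

Section Peeling.
Variable R : realType.
Local Open Scope ring_scope.
Local Open Scope classical_set_scope.
Implicit Types (S C D K : cells) (c d q : square) (u z : R * R).

Definition adjacent c d : bool := d \in [seq shift_cell c v.1 v.2 | v <- side_directions].

Lemma adjacentP c d :
  reflect (exists2 v, v \in side_directions & d = shift_cell c v.1 v.2) (adjacent c d).
Proof. exact: mapP. Qed.

Lemma adjacent_sym c d : adjacent c d = adjacent d c.
Proof.
rewrite /adjacent !inE /shift_cell; case: c d => [a b] [a' b']; rewrite !xpair_eqE /=.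
by apply/idP/idP; lia.
Qed.

Definition edge_closed S C : Prop :=
  forall c d, c \in C -> d \in S -> adjacent c d -> d \in C.

Definition edge_connected S : Prop := forall C, C != fset0 -> {subset C <= S} ->
  edge_closed S C -> {subset S <= C}.

Lemma interior_square S z c : (realize R S)° z -> unit_square R c z -> c \in S.
Proof.
move=> /nbhs_pairP[r r0 near_S] /unit_squareP[? ? ? ?].
pose t := Num.min (1/2) r; have t0 : 0 < t by rewrite lt_min r0 andbT; lra.
have t_le : t <= 1/2 by rewrite ge_min lexx.
have t_le_r : t <= r by rewrite ge_min lexx orbT.
pose w : R * R := (z.1 + t * (c.1%:~R + 2^-1 - z.1), z.2 + t * (c.2%:~R + 2^-1 - z.2)).
have cw : @open_cell R c w by rewrite /w; split=> /=; nra.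
apply/(open_cell_realize _ cw); apply: near_S; rewrite /w /= opprD addrA subrr add0r normrN.
  by rewrite ltr_norml; apply/andP; split; nra.
by rewrite ltr_norml; apply/andP; split; nra.
Qed.

(* Two cells of a region that meet at an interior point only diagonally are
   joined by the two other cells around that point. *)
Lemma edge_closed_interior S C c d z : edge_closed S C -> c \in C -> d \in S ->
  (realize R S)° z -> unit_square R c z -> unit_square R d z -> d \in C.
Proof.
move=> C_closed cC dS Sz cz dz; have [dx [dy [ed touch_x touch_y]]] := square_meet cz dz.
have step v c' : v \in side_directions -> c' \in C -> shift_cell c' v.1 v.2 \in S ->
    shift_cell c' v.1 v.2 \in C.
  by move=> v_side c'C vS; apply: C_closed c'C vS _; apply/adjacentP; exists v.
have diagonal : (dx = 1 \/ dx = -1) -> (dy = 1 \/ dy = -1) -> d \in C.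
  move=> x_side y_side.
  have fz : unit_square R (shift_cell c dx 0) z.
    move: cz dz => /unit_squareP[? ? ? ?]; rewrite ed => /unit_squareP[/= ? ? _ _].
    by apply/unit_squareP; rewrite /= addr0; split.
  have fC : shift_cell c dx 0 \in C.
    apply: (step (dx, 0)) => //=; last exact: interior_square Sz fz.
    by case: x_side => ->; rewrite !inE.
  have ed' : d = shift_cell (shift_cell c dx 0) 0 dy by rewrite ed /shift_cell /= !addr0.
  rewrite ed'; apply: (step (0, dy)) => //=; last by rewrite -ed'.
  by case: y_side => ->; rewrite !inE.
rewrite {d dz}ed in dS diagonal *; case: touch_x touch_y diagonal dS =>
    [->|[-> _]|[-> _]] [->|[-> _]|[-> _]] diagonal dS;
  first [ by rewrite shift_cell0 | by apply: diagonal; auto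
        | by apply: (step (1, 0)) | by apply: (step (-1, 0)) | by apply: (step (0, 1))
        | by apply: (step (0, -1)) ].
Qed.

Lemma region_edge_connected S : region R S -> edge_connected S.
Proof.
move=> S_region C /fset0Pn[c0 c0C] CS C_closed d dS; apply: contraT => dC.
pose A := (realize R S)°; pose D := (S `\` C)%fset.
have center_in c : c \in S -> A (center R c).
  by move=> cS; apply: (@open_cell_interior _ c) => //; exact: center_open.
have covered z : A z -> realize R C z \/ realize R D z.
  move=> /interior_subset[c /= cS cz]; have [cC|cC] := boolP (c \in C).
    by left; exists c.
  by right; exists c => //=; rewrite inE cC.
have A_in_C : A `&` realize R C = A.
  apply: S_region.
  - by exists (center R c0); split; [exact/center_in/CS | apply/center_realize].
  - exists (~` realize R D); first by apply: closed_openC; exact: closed_realize.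
    apply/seteqP; split=> z [Az z_in]; split=> //; last by case: (covered z Az).
    move=> [e eD ez]; case: z_in => c cC cz; move: eD; rewrite /D /= inE => /andP[/negP eC eS].
    exact/eC/(edge_closed_interior C_closed cC eS Az cz ez).
  - by exists (realize R C) => //; exact: closed_realize.
have := center_in d dS.
by rewrite -/A -A_in_C => -[_ /center_realize]; rewrite (negbTE dC).
Qed.

Lemma edge_connected_add K c d : edge_connected K -> c \in K -> adjacent c d ->
  edge_connected (d |` K)%fset.
Proof.
move=> K_conn cK cd C C_nonempty C_sub C_closed.
have K_sub x : x \in K -> x \in (d |` K)%fset by rewrite !inE => ->; rewrite orbT.
have [[k kC kK]|no_common] := pselect (exists2 k, k \in C & k \in K).
  have KC : {subset K <= C}.
    move=> x xK; have : x \in (C `&` K)%fset.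
      apply: (K_conn (C `&` K)%fset) => //; first by apply/fset0Pn; exists k; rewrite inE kC.
        by move=> y; rewrite inE => /andP[].
      move=> y y'; rewrite inE => /andP[yC yK] y'K yy'; rewrite inE y'K andbT.
      by apply: C_closed yy' => //; exact: K_sub.
    by rewrite inE => /andP[].
  move=> x; rewrite !inE => /orP[/eqP ->|/KC //].
  by apply: (C_closed c d) => //; [exact: KC | rewrite !inE eqxx].
case/fset0Pn: C_nonempty => x xC; have := C_sub x xC; rewrite !inE => /orP[/eqP ex|xK].
  case: no_common; exists c => //; rewrite adjacent_sym in cd.
  by apply: (C_closed d c); [rewrite -ex | exact: K_sub |].
by case: no_common; exists x.
Qed.

Lemma edge_connected1 c : edge_connected [fset c]%fset.
Proof.
move=> C /fset0Pn[x xC] C_sub _ d; rewrite inE => /eqP ->.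
by have := C_sub x xC; rewrite inE => /eqP <-.
Qed.

Definition exposed S c := ~~ neighbor (mem S) c 0 1 || ~~ neighbor (mem S) c 0 (-1).

Section PeelPairs.
Variable S : cells.
Hypothesis S_conn : edge_connected S.

Definition peel_pair q K : Prop :=
  [/\ q \in S, exposed S q & q \notin K] /\
  [/\ K != fset0, edge_connected K & {subset K <= S}].

Lemma peel_pair_extend q q' K c d : peel_pair q K -> c \in K -> d \in S -> d \notin K ->
  adjacent c d -> q' \in S -> exposed S q' -> q' \notin (d |` K)%fset ->
  peel_pair q' (d |` K)%fset /\ (#|` K| < #|` (d |` K)%fset|)%N.
Proof.
move=> [_ [_ K_conn KS]] cK dS dK cd q'S q'_exposed q'K; split; last by rewrite cardfsU1 dK.
split=> //; split; first by apply/fset0Pn; exists d; rewrite !inE eqxx.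
  exact: edge_connected_add cd.
by move=> x; rewrite !inE => /orP[/eqP ->|/KS].
Qed.

Lemma exists_max_peel_pair q K : peel_pair q K -> exists q' K', peel_pair q' K' /\
  forall q'' K'', peel_pair q'' K'' -> (#|` K''| <= #|` K'|)%N.
Proof.
move=> qK; pose realized n := `[< exists q K, peel_pair q K /\ #|` K| = n >].
have some_realized : exists n, realized n by exists #|` K|; apply/asboolP; exists q, K.
have realized_le n : realized n -> (n <= #|` S|)%N.
  by move=> /asboolP[q1 [K1 [[_ [_ _ K1S]] <-]]]; apply: fsubset_leq_card; apply/fsubsetP.
have [_ /asboolP[q' [K' [qK' <-]]] K'_max] := ex_maxnP some_realized realized_le.
by exists q', K'; split=> // q'' K'' qK''; apply: K'_max; apply/asboolP; exists q'', K''.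
Qed.

Variables (q : square) (K : cells).
Hypothesis qK : peel_pair q K.
Hypothesis qK_max : forall q' K', peel_pair q' K' -> (#|` K'| <= #|` K|)%N.

Lemma max_peel_pair_outside c d : c \in K -> d \in S -> d \notin K -> adjacent c d -> d = q.
Proof.
have [[qS q_exposed q_out] _] := qK.
move=> cK dS dK cd; apply/eqP; apply: contraT => dq.
have [|/qK_max] := peel_pair_extend qK cK dS dK cd qS q_exposed; last by rewrite leqNgt => /negP.
by rewrite !inE negb_or eq_sym dq.
Qed.

Lemma max_peel_pair_adjacent : exists2 c, c \in K & adjacent c q.
Proof.
have [[qS _ q_out] [K_nonempty K_conn KS]] := qK.
apply: contrapT => no_neighbor; move/negP: q_out; apply; apply: S_conn qS => // c d cK dS cd.
apply: contraT => dK; case: no_neighbor.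
by exists c => //; rewrite -(max_peel_pair_outside cK dS dK cd).
Qed.

(* The topmost and the bottommost cell of a nonempty rest are next to [q] or
   exposed, and cannot both be next to [q]. *)
Lemma exists_exposed_rest : (S `\` (q |` K))%fset != fset0 ->
  exists2 d, d \in (S `\` (q |` K))%fset & exposed S d.
Proof.
set D := (S `\` _)%fset => D_nonempty.
have memD d : d \in D = [&& d != q, d \notin K & d \in S] by rewrite !inE negb_or -andbA.
have outside d x : d \in D -> adjacent d x -> x \notin D -> x \notin S \/ x = q.
  rewrite !memD => /and3P[dq dK dS] dx; have [->|xq] := eqVneq x q; first by right.
  have [xK|xK] := boolP (x \in K); last by left.
  by rewrite adjacent_sym in dx; rewrite (max_peel_pair_outside xK dS dK dx) eqxx in dq.
have [top topD top_max] := fset_argmax (fun c => c.2) D_nonempty.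
have [bot botD bot_min] := fset_argmax (fun c => - c.2) D_nonempty.
have top_adj : adjacent top (shift_cell top 0 1) by apply/adjacentP; exists (0, 1).
have bot_adj : adjacent bot (shift_cell bot 0 (-1)) by apply/adjacentP; exists (0, -1).
have top_out : shift_cell top 0 1 \notin D by apply/negP => /top_max /=; rewrite gerDl.
have bot_out : shift_cell bot 0 (-1) \notin D by apply/negP => /bot_min /=; rewrite lerN2 lerDl.
have [n_out|n_q] := outside _ _ topD top_adj top_out.
  by exists top => //; apply/orP; left.
have [s_out|s_q] := outside _ _ botD bot_adj bot_out.
  by exists bot => //; apply/orP; right.
have bot_le_top : bot.2 <= top.2 := top_max bot botD.
have top_q : top.2 + 1 = q.2 by rewrite -n_q.
have bot_q : bot.2 - 1 = q.2 by rewrite -s_q.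
by exfalso; move: bot_le_top top_q bot_q; clear; case: top bot q => [? ?] [? ?] [? ?] /=; lia.
Qed.

Lemma max_peel_pair_rest : (S `\ q)%fset = K.
Proof.
have [[_ _ q_out] [_ _ KS]] := qK.
have [rest0|/exists_exposed_rest[d]] := eqVneq (S `\` (q |` K))%fset fset0; last first.
  rewrite in_fsetD => /andP[d_out dS] d_exposed; have [c cK cq] := max_peel_pair_adjacent.
  have [[qS _ _] _] := qK.
  have [/qK_max] := peel_pair_extend qK cK qS q_out cq dS d_exposed d_out.
  by rewrite leqNgt => /negP.
apply/fsetP => x; rewrite !inE; apply/idP/idP => [/andP[xq xS]|xK].
  apply: contraT => xK; have : x \in (S `\` (q |` K))%fset by rewrite !inE negb_or xq xK.
  by rewrite rest0 inE.
by rewrite KS // andbT; apply: contraNneq q_out => <-.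
Qed.

End PeelPairs.

(* Among the pairs of an exposed cell [q] and a connected [K] avoiding [q], the
   one with the largest [K] exhausts the region. *)
Lemma exists_peel S : edge_connected S -> (1 < #|` S|)%N ->
  exists q, [/\ q \in S, exposed S q & edge_connected (S `\ q)%fset].
Proof.
move=> S_conn S_card; have S_nonempty : S != fset0 by rewrite -cardfs_gt0; exact: ltnW.
have [q qS q_top] := fset_argmax (fun c => c.2) S_nonempty.
have [k] : exists k, k \in (S `\ q)%fset.
  by apply/fset0Pn; rewrite -cardfs_gt0; move: S_card; rewrite (cardfsD1 q S) qS.
rewrite !inE => /andP[kq kS].
have : peel_pair S q [fset k]%fset.
  split; split=> //.
  - by apply/orP; left; apply/negP => /q_top /=; rewrite gerDl.
  - by rewrite inE eq_sym.
  - by apply/fset0Pn; exists k; rewrite inE.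
  - exact: edge_connected1.
  - by move=> x; rewrite inE => /eqP ->.
move=> /(exists_max_peel_pair)[q' [K' [qK' K'_max]]].
exists q'; rewrite (max_peel_pair_rest S_conn qK' K'_max).
by case: qK' => -[? ? _] [].
Qed.

Lemma adjacent_meet c d : adjacent c d -> exists p, unit_square R c p /\ unit_square R d p.
Proof.
have meet (x y : R) d' : unit_square R c (x, y) -> unit_square R d' (x, y) ->
  exists p, unit_square R c p /\ unit_square R d' p by exists (x, y).
move=> /adjacentP[v]; rewrite !inE => /or4P[] /eqP -> ->;
  [apply: (meet (c.1%:~R + 1) c.2%:~R) | apply: (meet c.1%:~R c.2%:~R)
  | apply: (meet c.1%:~R (c.2%:~R + 1)) | apply: (meet c.1%:~R c.2%:~R)];
  by apply/unit_squareP; rewrite /= ?rmorphD ?addr0 /=; split; lra.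
Qed.

Lemma edge_connected_path_connected S : edge_connected S -> path_connected (realize R S).
Proof.
move=> S_conn x y [c /= cS cx] [d /= dS dy].
pose reached e := `[< forall p, unit_square R e p ->
  exists g, [/\ is_path (realize R S) g, g 0 = x & g 1 = p] >].
have line_in e p p' : e \in S -> unit_square R e p -> unit_square R e p' ->
    is_path (realize R S) (line p p').
  move=> eS ep ep'; apply: (is_path_sub (A := unit_square R e)) => [z ez|]; first by exists e.
  by apply: line_is_path => //; exact: convex_square.
suff /(_ d dS) : {subset S <= [fset e in S | reached e]%fset}.
  by rewrite !inE => /andP[_ /asboolP]; apply.
apply: S_conn => [|e|e f].
- apply/fset0Pn; exists c; rewrite !inE cS; apply/asboolP => p cp; exists (line x p).
  by rewrite line0 line1; split=> //; exact: line_in cx cp.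
- by rewrite !inE => /andP[].
- rewrite !inE => /andP[eS /asboolP e_reached] fS /adjacent_meet[p [ep fp]].
  rewrite fS; apply/asboolP => z fz; have [g [g_path g0 g1]] := e_reached p ep.
  have [|k [k_path k0 k1 _ _]] := is_path_cat g_path (line_in f p z fS fp fz).
    by rewrite line0.
  by exists k; rewrite k0 k1 line1.
Qed.

End Peeling.

Section CrossingParity.
Variables (X : Type) (cr : X -> X -> bool).

Definition crossing_parity (f : nat -> X) (n : nat) : bool :=
  \big[addb/false]_(k < n) cr (f k) (f k.+1).

Lemma crossing_parity0 f : crossing_parity f 0 = false.
Proof. exact: big_ord0. Qed.

Lemma crossing_parityS f n : crossing_parity f n.+1 = crossing_parity f n (+) cr (f n) (f n.+1).
Proof. exact: big_ord_recr. Qed.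

Lemma crossing_parityD f a b :
  crossing_parity f (a + b) = crossing_parity f a (+) crossing_parity (fun j => f (a + j)) b.
Proof.
elim: b => [|b IH]; first by rewrite addn0 crossing_parity0 addbF.
by rewrite addnS !crossing_parityS IH addnS addbA.
Qed.

Lemma crossing_parity_grid (h : nat -> nat -> X) (M : nat) (p : X) :
  (forall i j, i < M -> j < M -> cr (h i j) (h i j.+1) (+) cr (h i j.+1) (h i.+1 j.+1) =
     cr (h i j) (h i.+1 j) (+) cr (h i.+1 j) (h i.+1 j.+1)) ->
  cr p p = false -> (forall i, i <= M -> h i 0 = p /\ h i M = p) ->
  (forall j, j <= M -> h M j = p) -> crossing_parity (h 0) M = false.
Proof.
move=> square_eq pp ends last_row.
have strip i n : i < M -> n <= M -> crossing_parity (h i) n (+) crossing_parity (h i.+1) n =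
    cr (h i 0) (h i.+1 0) (+) cr (h i n) (h i.+1 n).
  move=> iM; elim: n => [|n IH] nM; first by rewrite !crossing_parity0 !addbb.
  have := IH (ltnW nM); have := square_eq i n iM nM; rewrite !crossing_parityS.
  move=> square row; rewrite addbACA row -addbA.
  by rewrite [X in _ (+) X]addbA; move: square; do 5!case: (cr _ _).
have same_row i : i <= M -> crossing_parity (h i) M = crossing_parity (h 0) M.
  elim: i => // i IH iM; rewrite -IH; last exact: ltnW.
  have := strip i M iM (leqnn M).
  have [-> ->] := ends i (ltnW iM); have [-> ->] := ends i.+1 iM; rewrite pp.
  by case: (crossing_parity _ M) (crossing_parity _ M) => [] [].
rewrite -(same_row M (leqnn M)) /crossing_parity big1 // => j _.
by rewrite !last_row // ltnW.
Qed.

End CrossingParity.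

Section Discretization.
Variable R : realType.
Local Open Scope ring_scope.
Local Open Scope classical_set_scope.
Implicit Types (A : set (R * R)) (k : R -> R * R).

Lemma compact_uniform_continuity (X Y : pseudoMetricType R) (K : set X) (H : X -> Y) e :
  compact K -> continuous H -> 0 < e ->
  exists N : nat, forall z w, K z -> ball z N.+1%:R^-1 w -> ball (H z) e (H w).
Proof.
move=> K_compact H_cont e0.
pose P (n : nat) (z : X) := forall w, ball z n.+1%:R^-1 w -> ball (H z) e (H w).
have P_near z : K z -> \forall z' \near z & n \near \oo, P n z'.
  move=> _; have e2 : 0 < e / 2 by rewrite divr_gt0.
  have /nbhs_ballP[r r0 H_ball] := H_cont z _ (nbhsx_ballx (H z) (e / 2) e2).
  have r2 : 0 < r / 2 by rewrite divr_gt0.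
  exists (ball z (r / 2), [set n | n.+1%:R^-1 < r / 2]) => [|[z' n] [/= zz' n_large] w z'w].
    by split; [exact: nbhsx_ballx | exact: (near_infty_natSinv_lt (PosNum r2))].
  have zw : ball z r w.
    by rewrite (splitr r); apply: ball_triangle zz' (le_ball (ltW n_large) z'w).
  apply: (ball_splitr (z := H z)); last exact: H_ball.
  by apply: H_ball; apply: le_ball zz'; lra.
have [N _ N_uniform] := (compact_near_coveringP _).1 K_compact _ _ _ _ P_near.
by exists N => z w Kz; apply: (N_uniform N (leqnn N)).
Qed.

Lemma null_homotopic_grid A k e : null_homotopic A k -> 0 < e ->
  exists (N : nat) (h : nat -> nat -> R * R), let M := (2 * N.+1)%N in
    [/\ forall i j, (i <= M)%N -> (j <= M)%N -> A (h i j),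
        forall i j i' j', (i <= i' <= i.+1)%N -> (j <= j' <= j.+1)%N ->
          (i' <= M)%N -> (j' <= M)%N -> ball (h i j) e (h i' j'),
        forall j, (j <= M)%N -> h 0%N j = k (j%:R / M%:R) /\ h M j = k 0
      & forall i, (i <= M)%N -> h i 0%N = k 0 /\ h i M = k 0].
Proof.
move=> [H [H_cont HA H_ends H_base]] e0.
pose H' (z : R * R) := H (clamp z.1, clamp z.2).
have clamp_cont : continuous (fun z : R * R => (clamp z.1, clamp z.2)) by prove_continuous.
have H'_cont : continuous H'.
  by apply: (continuous_comp_within H_cont clamp_cont) => z; split; exact: clamp_unit_itv.
have square_compact : compact (`[0 : R, 1] `*` `[0 : R, 1]).
  by apply: compact_setX; exact: segment_compact.
have [N H'_uniform] := compact_uniform_continuity square_compact H'_cont e0.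
pose M := (2 * N.+1)%N; exists N, (fun i j => H (i%:R / M%:R, j%:R / M%:R)).
have M0 : 0 < M%:R :> R by rewrite ltr0n.
have frac01 i : (i <= M)%N -> 0 <= (i%:R / M%:R : R) <= 1.
  by move=> iM; rewrite divr_ge0 //= ler_pdivrMr // mul1r ler_nat.
have frac_itv i : (i <= M)%N -> unit_itv (i%:R / M%:R : R).
  by move=> iM; apply/unit_itvP; exact: frac01.
have frac_near i j : (i <= j <= i.+1)%N -> `|i%:R / M%:R - j%:R / M%:R : R| < N.+1%:R^-1.
  move=> ij; rewrite -mulrBl normrM normfV (gtr0_norm M0) ltr_pdivrMr //.
  have -> : N.+1%:R^-1 * M%:R = 2 :> R by rewrite /M natrM mulrCA mulVf ?mulr1 // pnatr_eq0.
  have [->|->] : j = i \/ j = i.+1 by lia.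
    by rewrite subrr normr0; lra.
  by rewrite -natr1 opprD addrA subrr add0r normrN normr1; lra.
have H'E i j : (i <= M)%N -> (j <= M)%N ->
    H (i%:R / M%:R, j%:R / M%:R) = H' (i%:R / M%:R, j%:R / M%:R).
  by move=> iM jM; rewrite /H' /= !clamp_id // frac01.
split=> [i j iM jM|i j i' j' ii' jj' i'M j'M|j jM|i iM].
- by apply: HA; eexists; last reflexivity; split; exact: frac_itv.
- rewrite !H'E //; try lia; apply: H'_uniform; last by split; exact: frac_near.
  by split; rewrite /= in_itv /= frac01 //; lia.
- have [e1 e2] := H_ends _ (frac_itv j jM).
  by rewrite mul0r divff ?gt_eqF.
- have [e1 e2] := H_base _ (frac_itv i iM).
  by rewrite mul0r divff ?gt_eqF.
Qed.

(* A relation that is a cocycle on nearby points is crossed an even number of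
   times by a fine subdivision of a contractible loop: its parity is the same
   along every row of the homotopy. *)
Lemma null_homotopic_crossing_parity A k e (cr : R * R -> R * R -> bool) :
  null_homotopic A k -> 0 < e ->
  (forall x y z, A x -> A y -> A z -> ball x e y -> ball y e z -> ball x e z ->
     cr x y (+) cr y z = cr x z) ->
  exists N : nat, let f (j : nat) := k (j%:R / (2 * N.+1)%:R) in
    (forall j, (j < 2 * N.+1)%N -> ball (f j) e (f j.+1)) /\
    crossing_parity cr f (2 * N.+1) = false.
Proof.
move=> k_null e0 cocycle; have [N [h [hA h_near h_rows h_ends]]] := null_homotopic_grid k_null e0.
exists N; set M := (2 * N.+1)%N in hA h_near h_rows h_ends *.
have leq_self j : (j <= j <= j.+1)%N by rewrite leqnn leqnSn.
have leq_next j : (j <= j.+1 <= j.+1)%N by rewrite leqnSn leqnn.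
split=> [j jM|].
  have [<- _] := h_rows j (ltnW jM); have [<- _] := h_rows j.+1 jM.
  by apply: h_near => //; rewrite leqnn.
have -> : crossing_parity cr (fun j => k (j%:R / M%:R)) M = crossing_parity cr (h 0%N) M.
  apply: eq_bigr => j _; have [-> _] := h_rows j (ltnW (ltn_ord j)).
  by have [-> _] := h_rows j.+1 (ltn_ord j).
apply: (crossing_parity_grid (p := k 0)) => [i j iM jM||i iM|j jM].
- have [iM' jM'] := (ltnW iM, ltnW jM).
  by rewrite !(cocycle _ _ (h i.+1 j.+1)) //; (exact: hA || exact: h_near).
- have A0 : A (k 0) by have [<- _] := h_ends 0%N (leq0n _); exact: hA.
  have near0 : ball (k 0) e (k 0) by exact: ballxx.
  by rewrite -(cocycle _ _ _ A0 A0 A0 near0 near0 near0) addbb.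
- exact: h_ends.
- by have [_ ->] := h_rows j jM.
Qed.

End Discretization.

Section Cut.
Variable R : realType.
Local Open Scope ring_scope.
Local Open Scope classical_set_scope.
Implicit Types (S : cells) (c d : square) (u x y z : R * R).

Definition cut_level (a b k : R) u : R := a * u.1 + b * u.2 + k.

Lemma common_coord (a b : int) (r q : R) : a%:~R <= r -> r <= a%:~R + 1 ->
  b%:~R <= q -> q <= b%:~R + 1 -> `|r - q| < 1/16 ->
  exists s, [/\ a%:~R <= s, s <= a%:~R + 1, b%:~R <= s, s <= b%:~R + 1 & `|r - s| <= 1/16].
Proof.
move=> a_le le_a b_le le_b; rewrite ltr_norml => /andP[near_ge near_le].
have b_lt : b < a + 1 + 1 by rewrite -(ltr_int R) !rmorphD /=; lra.
have a_lt : a < b + 1 + 1 by rewrite -(ltr_int R) !rmorphD /=; lra.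
have b_le_a1 : b%:~R <= a%:~R + 1 :> R.
  by rewrite -(rmorphD _ a 1%Z) ler_int; lia.
have a_le_b1 : a%:~R <= b%:~R + 1 :> R.
  by rewrite -(rmorphD _ b 1%Z) ler_int; lia.
have [r_lt|r_ge] := ltrP r b%:~R; first by exists b%:~R; rewrite ler_norml; split; lra.
have [r_le|r_gt] := lerP r (b%:~R + 1); first by exists r; rewrite subrr normr0; split; lra.
by exists (b%:~R + 1); rewrite ler_norml; split; lra.
Qed.

Section Crossings.
Variables (S : cells) (c : square) (a b k : R).
Hypotheses (a_le1 : `|a| <= 1) (b_le1 : `|b| <= 1).
Let Q := unit_square R c.
Let A := realize R S `|` Q.
Let level z : R := cut_level a b k (z - corner R c).
Hypothesis level_far : forall z, Q z -> realize R S z -> 1/2 <= `|level z|.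

Lemma level_lipschitz x y (e : R) : `|x.1 - y.1| <= e -> `|x.2 - y.2| <= e ->
  `|level x - level y| <= 2 * e.
Proof.
move=> dx dy.
have -> : level x - level y = a * (x.1 - y.1) + b * (x.2 - y.2).
  by rewrite /level /cut_level /=; ring.
apply: le_trans (ler_normD _ _) _; rewrite !normrM.
have := normr_ge0 (x.1 - y.1); have := normr_ge0 (x.2 - y.2).
have := normr_ge0 a; have := normr_ge0 b; move: a_le1 b_le1.
move: `|a| `|b| `|_ - _| `|_ - _| dx dy => p q u v; nra.
Qed.

Lemma level_same_sign x y : ball x (1/16) y -> 1/2 <= `|level x| -> 1/2 <= `|level y| ->
  (0 <= level x) = (0 <= level y).
Proof.
move=> [xy1 xy2]; have := level_lipschitz (ltW xy1) (ltW xy2).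
case: (lerP 0 (level x)) => ?; case: (lerP 0 (level y)) => ? //;
  by rewrite !ler_normr ler_norml => /andP[? ?] /orP[?|?] /orP[?|?]; lra.
Qed.

Definition crosses x y : bool :=
  [&& `[< Q x >], `[< Q y >] & (0 <= level x) (+) (0 <= level y)].

Lemma crosses_near x y z : ball x (1/16) y -> ball x (1/16) z -> crosses x y -> A z -> Q z.
Proof.
move=> [xy1 xy2] [xz1 xz2] /and3P[/asboolP Qx /asboolP Qy sides] [] // [d /= dS dz].
move: (Qx) (dz) => /unit_squareP[a1 a2 a3 a4] /unit_squareP[b1 b2 b3 b4].
have [s [s1 s2 s3 s4 xs]] := common_coord a1 a2 b1 b2 xz1.
have [t [t1 t2 t3 t4 xt]] := common_coord a3 a4 b3 b4 xz2.
have Qp : Q (s, t) by apply/unit_squareP.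
have Sp : realize R S (s, t) by exists d => //; apply/unit_squareP.
have := level_far Qp Sp; have := @level_lipschitz x (s, t) (1/16) xs xt.
have := @level_lipschitz x y (1/16) (ltW xy1) (ltW xy2).
move: sides; case: (lerP 0 (level x)) => ?; case: (lerP 0 (level y)) => ? // _;
  rewrite !ler_norml => /andP[? ?] /andP[? ?]; rewrite ler_normr => /orP[?|?]; lra.
Qed.

Lemma crosses_cocycle x y z : A x -> A y -> A z -> ball x (1/16) y ->
  ball y (1/16) z -> ball x (1/16) z -> crosses x y (+) crosses y z = crosses x z.
Proof.
move=> Ax Ay Az xy yz xz.
have xy_z := crosses_near xy xz; have yz_x := crosses_near yz (ball_sym xy).
have xz_y := crosses_near xz xy; move: xy_z yz_x xz_y; rewrite /crosses.
case: (asboolP (Q x)); case: (asboolP (Q y)); case: (asboolP (Q z)) => //= Qz Qy Qx;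
  case: (0 <= level x); case: (0 <= level y); case: (0 <= level z) => //= xy_z yz_x xz_y;
  by [have := xy_z isT Az | have := yz_x isT Ax | have := xz_y isT Ay].
Qed.

Lemma crossing_parity_in_cell (f : nat -> R * R) n : (forall j, (j <= n)%N -> Q (f j)) ->
  crossing_parity crosses f n = (0 <= level (f 0%N)) (+) (0 <= level (f n)).
Proof.
elim: n => [|n IH] fQ; first by rewrite crossing_parity0 addbb.
rewrite crossing_parityS IH => [|j jn]; last exact: fQ (leqW jn).
by rewrite /crosses (asboolT (fQ n (leqnSn _))) (asboolT (fQ n.+1 (leqnn _))) addbA addbK.
Qed.

Lemma crossing_parity_in_rest (f : nat -> R * R) n :
  (forall j, (j <= n)%N -> realize R S (f j)) ->
  (forall j, (j < n)%N -> ball (f j) (1/16) (f j.+1)) -> crossing_parity crosses f n = false.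
Proof.
move=> fS f_near; apply: big1 => j _; apply/negP => /and3P[/asboolP Qj /asboolP Qj'].
have far_j := level_far Qj (fS j (ltnW (ltn_ord j))).
have far_j' := level_far Qj' (fS j.+1 (ltn_ord j)).
by rewrite (level_same_sign (f_near j (ltn_ord j)) far_j far_j') addbb.
Qed.

(* The loop runs through the cell from [p1] to [p2] and back through the rest;
   it crosses the line [level = 0] inside the cell exactly once. *)
Lemma cut_not_simply_connected p1 p2 : edge_connected S ->
  Q p1 -> realize R S p1 -> Q p2 -> realize R S p2 ->
  level p1 < 0 -> 0 < level p2 -> ~ simply_connected A.
Proof.
move=> S_conn Q1 S1 Q2 S2 level1 level2 [_ _ A_loops].
have [g [g_path g0 g1]] := edge_connected_path_connected S_conn S2 S1.
have line_path : is_path Q (line p1 p2) by apply: line_is_path => //; exact: convex_square.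
have [|loop [loop_path loop0 loop1 loop_line loop_g]] :=
    is_path_cat (is_path_sub (@subsetUr _ _ _) line_path : is_path A _)
                (is_path_sub (@subsetUl _ _ _) g_path : is_path A _).
  by rewrite line1.
rewrite line0 in loop0; rewrite g1 in loop1.
have loop_null : null_homotopic A loop by apply: A_loops; rewrite // loop0 loop1.
have e0 : 0 < 1/16 :> R by lra.
have [N [f_near]] := null_homotopic_crossing_parity loop_null e0 crosses_cocycle.
set M := (2 * N.+1)%N in f_near *; set f := fun j : nat => loop _ in f_near *.
have M_half : M%:R = 2 * N.+1%:R :> R by rewrite /M natrM.
have N0 : 0 < N.+1%:R :> R by rewrite ltr0n.
have M0 : 0 < M%:R :> R by rewrite M_half mulr_gt0.
have f_in_cell j : (j <= N.+1)%N -> Q (f j).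
  rewrite -(ler_nat R) => jN; have t_range : 0 <= (j%:R / M%:R : R) <= 1/2.
    by rewrite divr_ge0 //= ler_pdivrMr // M_half; lra.
  by rewrite /f loop_line //; apply: (is_path_in line_path); lra.
have f_in_rest j : (j <= N.+1)%N -> realize R S (f (N.+1 + j)%N).
  rewrite -(ler_nat R) => jN.
  have t_range : 1/2 <= ((N.+1 + j)%:R / M%:R : R) <= 1.
    by rewrite ler_pdivlMr // ler_pdivrMr // M_half natrD; have := ler0n R j; lra.
  by rewrite /f loop_g //; apply: (is_path_in g_path); lra.
have f0 : f 0%N = p1 by rewrite /f mul0r.
have f_mid : f N.+1 = p2.
  have -> : f N.+1 = loop (1/2) by rewrite /f M_half; congr loop; field; rewrite gt_eqF.
  by rewrite loop_line; [rewrite (_ : 2 * (1/2) = 1) ?line1 //; field | lra].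
have -> : M = (N.+1 + N.+1)%N by rewrite /M mul2n addnn.
rewrite crossing_parityD (crossing_parity_in_cell f_in_cell).
rewrite (@crossing_parity_in_rest (fun j => f (N.+1 + j)%N)) => [|//|j jN].
  by rewrite f0 f_mid (ltW level2) leNgt level1.
by rewrite addnS; apply: f_near; rewrite /M mul2n -addnn ltn_add2l.
Qed.

End Crossings.

Definition directions : seq (int * int) :=
  side_directions ++ [:: (1, 1); (-1, 1); (1, -1); (-1, -1)].

(* a corner that the unit square shares with the one at offset [d] *)
Definition touch_point (d : int * int) : R * R := ((d.1 == 1)%:R, (d.2 == 1)%:R).

Lemma touch_point_realize S c d : d \in directions -> neighbor (mem S) c d.1 d.2 ->
  unit_square R c (corner R c + touch_point d) /\
  realize R S (corner R c + touch_point d).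
Proof.
move=> d_dir dS; suff [cp dp] : unit_square R c (corner R c + touch_point d) /\
    unit_square R (shift_cell c d.1 d.2) (corner R c + touch_point d).
  by split=> //; exists (shift_cell c d.1 d.2).
move: d_dir; rewrite !inE => /or4P[|||/or4P[|||/orP[]]] /eqP ->;
  by split; apply/unit_squareP; rewrite /= ?rmorphD /=; split; lra.
Qed.

(* Each entry lists two absent side neighbors and the coefficients of a line
   [a x + b y + k / 2 = 0] that meets no other neighbor of the unit square. *)
Definition separating_cuts : seq ((int * int) * (int * int) * (int * int * int)) :=
  [:: ((0, 1), (0, -1), (1, 0, -1)); ((0, 1), (1, 0), (1, 1, -3));
      ((0, 1), (-1, 0), (-1, 1, -1)); ((0, -1), (1, 0), (1, -1, -1));
      ((0, -1), (-1, 0), (-1, -1, 1))].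

Definition cut_side (cut : int * int * int) (d : int * int) : int :=
  let: (a, b, k) := cut in 2 * (a * (d.1 == 1)%:R + b * (d.2 == 1)%:R) + k.

Lemma cut_side_level a b k d :
  cut_level a%:~R b%:~R (k%:~R / 2) (touch_point d) = (cut_side (a, b, k) d)%:~R / 2 :> R.
Proof.
rewrite /cut_level /= !(rmorphD, rmorphM) /= !rmorph_nat.
by field.
Qed.

Lemma not_arc_pattern (n : int -> int -> bool) :
  ~~ n 0 1 || ~~ n 0 (-1) -> has (fun d => n d.1 d.2) side_directions ->
  ~~ arc_pattern (n 1 0) (n (-1) 0) (n 0 1) (n 0 (-1))
       (n 1 1) (n (-1) 1) (n 1 (-1)) (n (-1) (-1)) ->
  has (fun cut => [&& ~~ n cut.1.1.1 cut.1.1.2, ~~ n cut.1.2.1 cut.1.2.2,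
         has (fun d => n d.1 d.2 && (cut_side cut.2 d < 0)) directions
       & has (fun d => n d.1 d.2 && (0 < cut_side cut.2 d)) directions]) separating_cuts.
Proof.
rewrite /=; case: (n 1 0); case: (n (-1) 0); case: (n 0 1); case: (n 0 (-1)) => //= _ _;
  by case: (n 1 1); case: (n (-1) 1); case: (n 1 (-1)); case: (n (-1) (-1)).
Qed.

Lemma cut_far_from_neighbors cut dx dy u : cut \in separating_cuts ->
  (dx, dy) != (0, 0) -> (dx, dy) != cut.1.1 -> (dx, dy) != cut.1.2 ->
  in_unit u -> touches dx u.1 -> touches dy u.2 ->
  1/2 <= `|cut_level cut.2.1.1%:~R cut.2.1.2%:~R (cut.2.2%:~R / 2) u|.
Proof.
case: u => x y cut_in; rewrite -!/(is_true (_ \in _)) => d_neq0 d_neq1 d_neq2 [/= ? ? ? ?] tx ty.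
move: cut_in d_neq1 d_neq2; rewrite !inE /cut_level => /or4P[|||/orP[]] /eqP -> /=;
  case: tx d_neq0 => [->|[-> ->]|[-> ->]]; case: ty => [->|[-> ->]|[-> ->]];
  rewrite ?eqxx //= => _ _ _; rewrite ler_normr; apply/orP; (left; lra) || (right; lra).
Qed.

Lemma cut_coefficients_le1 cut : cut \in separating_cuts ->
  `|cut.2.1.1%:~R : R| <= 1 /\ `|cut.2.1.2%:~R : R| <= 1.
Proof.
by rewrite !inE => /or4P[|||/orP[]] /eqP -> /=; rewrite ?normrN ?normr0 ?normr1.
Qed.

Lemma separating_cut_not_simply_connected S c cut d1 d2 :
  edge_connected S -> c \notin S -> cut \in separating_cuts ->
  ~~ neighbor (mem S) c cut.1.1.1 cut.1.1.2 ->
  ~~ neighbor (mem S) c cut.1.2.1 cut.1.2.2 ->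
  d1 \in directions -> neighbor (mem S) c d1.1 d1.2 -> cut_side cut.2 d1 < 0 ->
  d2 \in directions -> neighbor (mem S) c d2.1 d2.2 -> 0 < cut_side cut.2 d2 ->
  ~ simply_connected (realize R S `|` unit_square R c).
Proof.
move=> S_conn cS cut_in gap1 gap2 d1_dir d1_in d1_neg d2_dir d2_in d2_pos.
have [Q1 S1] := touch_point_realize d1_dir d1_in.
have [Q2 S2] := touch_point_realize d2_dir d2_in.
have [a_le1 b_le1] := cut_coefficients_le1 cut_in.
have level_touch d : cut_level cut.2.1.1%:~R cut.2.1.2%:~R (cut.2.2%:~R / 2)
    (corner R c + touch_point d - corner R c) = (cut_side cut.2 d)%:~R / 2.
  by rewrite addrAC subrr add0r cut_side_level; case: (cut.2) => [[]].
apply: (cut_not_simply_connected (k := cut.2.2%:~R / 2) a_le1 b_le1 _ S_conn Q1 S1 Q2 S2).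
- move=> z cz [d /= dS dz]; have [dx [dy [ed touch_x touch_y]]] := square_meet cz dz.
  have nd : neighbor (mem S) c dx dy by rewrite /neighbor -ed.
  apply: cut_far_from_neighbors touch_x touch_y => //; last exact/in_unit_square.
  + by apply: contraTneq nd => -[-> ->]; rewrite /neighbor shift_cell0.
  + by apply: contraTneq nd => d_gap; rewrite -[dx]/((dx, dy).1) -[dy]/((dx, dy).2) d_gap.
  + by apply: contraTneq nd => d_gap; rewrite -[dx]/((dx, dy).1) -[dy]/((dx, dy).2) d_gap.
- by rewrite level_touch pmulr_llt0 ?ltrz0 ?invr_gt0.
- by rewrite level_touch divr_gt0 ?ltr0z.
Qed.

Lemma edge_connected_neighbor S c : edge_connected S -> c \in S -> (1 < #|` S|)%N ->
  has (fun d => neighbor (mem (S `\ c)%fset) c d.1 d.2) side_directions.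
Proof.
move=> S_conn cS S_card; apply: contraT => /hasPn isolated.
have : (#|` S| <= #|` [fset c]%fset|)%N; last by rewrite cardfs1 leqNgt S_card.
apply/fsubset_leq_card/fsubsetP; apply: S_conn => [|d|d e].
- by apply/fset0Pn; exists c; rewrite inE.
- by rewrite inE => /eqP ->.
- rewrite !inE => /eqP -> eS /adjacentP[v v_side ev]; apply: contraT => e_neq.
  by have := isolated v v_side; rewrite /neighbor -ev /= !inE e_neq eS.
Qed.

Lemma exposed_arc S c : c \in S -> edge_connected S -> edge_connected (S `\ c)%fset ->
  (1 < #|` S|)%N -> exposed S c -> simply_connected (realize R S) ->
  arc (mem (S `\ c)%fset) c.
Proof.
move=> cS S_conn rest_conn S_card c_exposed; set S' := (S `\ c)%fset.
have cS' : c \notin S' by rewrite !inE eqxx.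
rewrite (_ : realize R S = realize R S' `|` unit_square R c); last first.
  by rewrite -realize_fset1U fsetD1K.
move=> sc; rewrite /arc; apply: contraT => not_arc; exfalso; move: sc.
have gap : ~~ neighbor (mem S') c 0 1 || ~~ neighbor (mem S') c 0 (-1).
  by move: c_exposed; rewrite /exposed /neighbor /= !inE => /orP[] /negbTE ->;
    rewrite andbF ?orbT.
have /hasP[cut cut_in] := not_arc_pattern gap (edge_connected_neighbor S_conn cS S_card) not_arc.
case/and4P=> gap1 gap2 /hasP[d1 d1_dir /andP[d1_in d1_neg]] /hasP[d2 d2_dir /andP[d2_in d2_pos]].
exact: separating_cut_not_simply_connected cut_in gap1 gap2 d1_dir d1_in d1_neg d2_dir d2_in d2_pos.
Qed.

Lemma simply_connected_shelled S : edge_connected S -> simply_connected (realize R S) ->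
  exists2 s, shelled s & S = [fset c in s]%fset.
Proof.
elim/finmap.finSet_rect: S => S IH S_conn sc.
have S_nonempty : (0 < #|` S|)%N.
  rewrite cardfs_gt0; apply/fset0Pn; have [[z [c cS _]] _ _] := sc.
  by exists c.
have [S_card|S_card] := ltnP 1 #|` S|; last first.
  have /eqP/cardfs1P[c ->] : #|` S| = 1%N by apply/eqP; rewrite eqn_leq S_card.
  exists [:: c] => //.
  by rewrite seq_fset_cons; apply/fsetP => x; rewrite !inE orbF.
have [q [qS q_exposed rest_conn]] := exists_peel S_conn S_card.
have q_arc := exposed_arc qS S_conn rest_conn S_card q_exposed sc.
have q_out : q \notin (S `\ q)%fset by rewrite !inE eqxx.
have [rho [rho_cont rho_id rho_q]] := @arc_retraction R _ _ q_out q_arc.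
have S_split : realize R S = realize R (S `\ q)%fset `|` unit_square R q.
  by rewrite -realize_fset1U fsetD1K.
have [||s s_shelled es] := IH (S `\ q)%fset _ rest_conn; first by rewrite fproperD1.
  apply: (@simply_connected_retract _ (realize R S) _ rho) => //.
  - have /fset0Pn[d dS] : (S `\ q)%fset != fset0.
      by rewrite -cardfs_gt0; move: S_card; rewrite (cardfsD1 q S) qS.
    by exists (center R d); apply/center_realize.
  - by rewrite S_split; left.
  - by rewrite S_split.
  - by rewrite S_split => z [Sz|/rho_q[]//]; rewrite rho_id.
exists (q :: s); last by rewrite seq_fset_cons -es fsetD1K.
rewrite /= s_shelled andbT -arc_seq -es q_arc andbT; apply/orP; right.
by move: q_out; rewrite es !inE.
Qed.

Lemma shellableP S : (exists2 s, shelled s & S = [fset c in s]%fset) <->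
  region R S /\ simply_connected (realize R S).
Proof.
split=> [[s s_shelled ->]|[S_region sc]].
  split; first exact: shelled_region.
  by apply: contractible_simply_connected; exact: shelled_contractible.
by apply: simply_connected_shelled => //; exact: region_edge_connected S_region.
Qed.

End Cut.

(** * Numerals *)

Fixpoint bits_val (l : seq bool) : nat := if l is b :: l' then b + 2 * bits_val l' else 0.

Lemma bits_val_incr l : bits_val (incr_bits l) = (bits_val l).+1.
Proof. by elim: l => [|[] l IH] //=; rewrite ?IH; lia. Qed.

Lemma bitsK n : bits_val (bits n) = n.
Proof. by elim: n => // n IH; rewrite /bits iterS bits_val_incr IH. Qed.

Lemma bits_inj : injective bits.
Proof. exact: can_inj bitsK. Qed.

Lemma eq_bits m n : (bits m == bits n) = (m == n).
Proof. exact: (inj_eq bits_inj). Qed.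

Lemma bitsS n : bits n.+1 = incr_bits (bits n).
Proof. by []. Qed.

Definition canonical (l : seq bool) : bool := (l == [:: false]) || (last false l).

Lemma canonical_bits n : canonical (bits n).
Proof.
case: n => // n; apply/orP; right; rewrite bits_binary_digits.
have [m] := ubnP n; elim: m n => // m IH [|n] // lt_n.
have lt_half : n./2 < m by rewrite -divn2; lia.
rewrite binary_digitsS //; have := IH n./2 lt_half; have -> : n.+2./2 = n./2.+1 by [].
rewrite -[last false (_ :: _)]/(last (odd n.+2) (binary_digits n./2.+1)).
by case: (binary_digits n./2.+1).
Qed.

Lemma canonicalP l : canonical l -> exists n, l = bits n.
Proof.
case/orP => [/eqP ->|]; first by exists 0.
suff positive : last false l -> exists n, l = bits n.+1 by move=> /positive[n ->]; exists n.+1.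
elim: l => // b [|b' l] IH; first by case: b => // _; exists 0.
move=> /IH[n e]; exists (b + 2 * n.+1).-1.
have -> : (b + 2 * n.+1).-1.+1 = b + 2 * n.+1 by lia.
rewrite bits_binary_digits binary_digitsS; last by lia.
rewrite e bits_binary_digits oddD oddM addbF; congr (_ :: binary_digits _); first by case: (b).
by rewrite mul2n; case: b {IH} => /=; rewrite ?uphalf_double ?doubleK.
Qed.

(* sign, and binary digits from the least significant one *)
Definition signed_bits : Type := (bool * seq bool)%type.

Definition int_bits (z : int) : signed_bits :=
  match z with Posz n => (false, bits n) | Negz n => (true, bits n.+1) end.

Definition canonical_int (p : signed_bits) : bool := canonical p.2 &&
  ~~ (p.1 && (p.2 == [:: false])).

Lemma canonical_int_bits z : canonical_int (int_bits z).
Proof.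
case: z => n; apply/andP; split; try exact: canonical_bits; first by [].
by rewrite -[[:: false]]/(bits 0) eq_bits.
Qed.

Lemma canonical_intP p : canonical_int p -> exists z, p = int_bits z.
Proof.
case: p => s l /andP[/canonicalP[n /= ->]]; rewrite -[[:: false]]/(bits 0) eq_bits.
case: s => /=; last by exists (Posz n).
by case: n => // n _; exists (Negz n).
Qed.

Lemma int_bits_inj : injective int_bits.
Proof.
case=> m [] n // [] h; first by rewrite (bits_inj h).
by have [->] := @bits_inj m.+1 n.+1 h.
Qed.

Definition succ_int (p q : signed_bits) : bool :=
  if p.1 then if q.1 then incr_bits q.2 == p.2 else (p.2 == [:: true]) && (q.2 == [:: false])
  else ~~ q.1 && (incr_bits p.2 == q.2).

Lemma succ_int_bits (y z : int) : succ_int (int_bits y) (int_bits z) = (z == y + 1)%R.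
Proof.
rewrite /succ_int; case: y z => m [] n /=; rewrite -?bitsS ?eq_bits //.
- by apply/eqP/eqP; lia.
- rewrite -[[:: true]]/(bits 1) -[[:: false]]/(bits 0) !eq_bits.
  by apply/andP/eqP => [[/eqP ? /eqP ?]|h]; [lia | split; apply/eqP; lia].
- by apply/eqP/eqP; lia.
Qed.

Definition int_of_dir (d : option bool) : int :=
  if d is Some b then if b then 1%R else (-1)%R else 0%R.

Definition is_dir (d : option bool) (p q : signed_bits) : bool :=
  if d is Some b then if b then succ_int p q else succ_int q p else p == q.

Lemma is_dir_bits d (y z : int) : is_dir d (int_bits y) (int_bits z) = (z == y + int_of_dir d)%R.
Proof.
case: d => [[]|] /=; rewrite ?succ_int_bits //.
- by apply/eqP/eqP => ->; lia.
- by rewrite addr0 (inj_eq int_bits_inj) eq_sym.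
Qed.

Definition square_bits (c : square) : signed_bits * signed_bits := (int_bits c.1, int_bits c.2).

Lemma square_bits_inj : injective square_bits.
Proof. by move=> [a b] [c d] [/int_bits_inj -> /int_bits_inj ->]. Qed.

Definition is_shift (dx dy : option bool) (p q : signed_bits * signed_bits) : bool :=
  is_dir dx p.1 q.1 && is_dir dy p.2 q.2.

Lemma is_shift_bits dx dy c d : is_shift dx dy (square_bits c) (square_bits d) =
  (d == shift_cell c (int_of_dir dx) (int_of_dir dy)).
Proof. by rewrite /is_shift !is_dir_bits /shift_cell; case: d. Qed.

(** * Locally consistent tilings *)

(* lab c = (a, b, (x, y)) means that c is the cell in column x and row y of an
   a * b tile *)
Definition consistent_labels (T : {fset cells}) (G : cells)
    (lab : square -> nat * nat * (nat * nat)) : Prop :=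
  forall c, c \in G -> let: (a, b, (x, y)) := lab c in
  [/\ rectangle a b \in T, x < a, y < b &
   [/\ x.+1 < a -> shift_cell c 1 0 \in G /\ lab (shift_cell c 1 0) = (a, b, (x.+1, y)),
       0 < x -> shift_cell c (-1) 0 \in G /\ lab (shift_cell c (-1) 0) = (a, b, (x.-1, y)),
       y.+1 < b -> shift_cell c 0 1 \in G /\ lab (shift_cell c 0 1) = (a, b, (x, y.+1)) &
       0 < y -> shift_cell c 0 (-1) \in G /\ lab (shift_cell c 0 (-1)) = (a, b, (x, y.-1))]].

Lemma interval_fill (P : nat -> Prop) n x : x < n -> P x ->
  (forall i, i.+1 < n -> P i -> P i.+1) -> (forall i, P i.+1 -> P i) -> forall i, i < n -> P i.
Proof.
move=> lt_x Px up down i lt_i.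
have P0 : P 0 by elim: x {lt_x} Px => // x IH /down.
by elim: i lt_i => // i IH lt_i; apply: up => //; apply: IH; exact: ltnW.
Qed.

Lemma Posz_addr1 (n : nat) : (Posz n + 1)%R = Posz n.+1.
Proof. by lia. Qed.

Lemma Posz_subr1 (n : nat) : (Posz n.+1 - 1)%R = Posz n.
Proof. by lia. Qed.

Lemma consistent_labels_fill T G lab v a b (x y : nat) : consistent_labels T G lab ->
  shift_cell v x y \in G -> lab (shift_cell v x y) = (a, b, (x, y)) ->
  forall i j : nat, i < a -> j < b ->
  shift_cell v i j \in G /\ lab (shift_cell v i j) = (a, b, (i, j)).
Proof.
move=> ok in_G labE; have := ok _ in_G; rewrite labE => -[_ lt_x lt_y _].
pose filled i j := shift_cell v (Posz i) (Posz j) \in G /\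
  lab (shift_cell v (Posz i) (Posz j)) = (a, b, (i, j)).
have east i j : i.+1 < a -> filled i j -> filled i.+1 j.
  move=> lt_i [/ok ok_ij lab_ij]; move: ok_ij; rewrite lab_ij !shift_cellD !addr0 Posz_addr1.
  by case=> _ _ _ [/(_ lt_i)].
have west i j : filled i.+1 j -> filled i j.
  case=> /ok ok_ij lab_ij; move: ok_ij; rewrite lab_ij !shift_cellD !addr0 Posz_subr1.
  by case=> _ _ _ [_ /(_ isT)].
have north i j : j.+1 < b -> filled i j -> filled i j.+1.
  move=> lt_j [/ok ok_ij lab_ij]; move: ok_ij; rewrite lab_ij !shift_cellD !addr0 (Posz_addr1 j).
  by case=> _ _ _ [_ _ /(_ lt_j)].
have south i j : filled i j.+1 -> filled i j.
  case=> /ok ok_ij lab_ij; move: ok_ij; rewrite lab_ij !shift_cellD !addr0 (Posz_subr1 j).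
  by case=> _ _ _ [_ _ _ /(_ isT)].
move=> i j lt_i; have row : filled i y.
  apply: (interval_fill (P := filled^~ y) lt_x) lt_i => // [k|k]; [exact: east | exact: west].
by apply: (interval_fill (P := filled i) lt_y row) => [k|k]; [exact: north | exact: south].
Qed.

Lemma consistent_labels_tiling T G lab : consistent_labels T G lab -> exists f, fun_tiling T G f.
Proof.
move=> ok; pose f c : cells * (int * int) :=
  let: (a, b, (x, y)) := lab c in (rectangle a b, shift_cell c (- Posz x) (- Posz y)).
exists f => c cG; have := ok c cG; case labE: (lab c) => [[a b] [x y]] [in_T lt_x lt_y _].
pose v := shift_cell c (- Posz x) (- Posz y); have fE : f c = (rectangle a b, v) by rewrite /f labE.
have cE : shift_cell v x y = c by rewrite /v shift_cellD !addNr shift_cell0.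
rewrite fE; split=> //; first by apply/mem_translate_rectangleP; exists x, y.
move=> _ /mem_translate_rectangleP[i [j [lt_i lt_j ->]]].
have [|| in_G lab_ij] := @consistent_labels_fill _ _ _ v a b x y ok _ _ i j lt_i lt_j.
- by rewrite cE.
- by rewrite cE.
by split=> //; rewrite /f lab_ij shift_cellD !addrN shift_cell0.
Qed.

Definition labels_cell (p : cells * (int * int)) (c : square) (l : nat * nat * (nat * nat)) :
  Prop :=
  let: (a, b, (x, y)) := l in
  [/\ p.1 = rectangle a b, x < a, y < b & c = shift_cell p.2 (Posz x) (Posz y)].

Lemma labels_cell_uniq p c l l' : labels_cell p c l -> labels_cell p c l' -> l = l'.
Proof.
case: l l' => [[a b] [x y]] [[a' b'] [x' y']] [pE lt_x lt_y cE] [pE' _ _].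
rewrite cE => -[/addrI[->] /addrI[->]]; move: pE'; rewrite pE.
by case/(rectangle_inj (leq_ltn_trans (leq0n x) lt_x) (leq_ltn_trans (leq0n y) lt_y)) => -> ->.
Qed.

Lemma tiling_consistent_labels T G f : (forall t, t \in T -> rectangular t) -> fun_tiling T G f ->
  exists lab, consistent_labels T G lab.
Proof.
move=> rect tiling.
have labels c : exists l, c \in G -> labels_cell (f c) c l.
  have [cG|_] := boolP (c \in G); last by exists (0, 0, (0, 0)).
  have [in_T in_tile _] := tiling c cG; have [a [b [_ _ tE]]] := rect _ in_T.
  by move: in_tile; rewrite tE => /mem_translate_rectangleP[i [j [? ? ?]]]; exists (a, b, (i, j)).
have [lab labP] := choice labels; exists lab => c cG.
have := labP c cG; case: (lab c) => [[a b] [x y]] [tE lt_x lt_y cE].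
have [in_T _ covered] := tiling c cG; rewrite -tE; split=> //.
have at_ij (i j : nat) : i < a -> j < b ->
    shift_cell (f c).2 i j \in G /\ lab (shift_cell (f c).2 i j) = (a, b, (i, j)).
  move=> lt_i lt_j; have [|c'G fE] := covered (shift_cell (f c).2 i j).
    by rewrite tE; apply/mem_translate_rectangleP; exists i, j.
  by split=> //; apply: labels_cell_uniq (labP _ c'G) _; rewrite fE.
move: cE at_ij; move: (f c).2 => v -> at_ij.
rewrite !shift_cellD !addr0 !Posz_addr1; split=> [lt_Sx|x_gt0|lt_Sy|y_gt0].
- exact: at_ij.
- by case: x lt_x x_gt0 => // x lt_x _; rewrite Posz_subr1; apply: at_ij => //; exact: ltnW.
- exact: at_ij.
- by case: y lt_y y_gt0 => // y lt_y _; rewrite Posz_subr1; apply: at_ij => //; exact: ltnW.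
Qed.

(** * The verifier *)

Lemma arc_patternE e w n s ne nw se sw : arc_pattern e w n s ne nw se sw =
  [|| [&& e, ~~ w, ~~ n, ~~ s, ~~ nw & ~~ sw],
      [&& ~~ e, w, ~~ n, ~~ s, ~~ ne & ~~ se],
      [&& ~~ e, ~~ w, n, ~~ s, ~~ se & ~~ sw],
      [&& ~~ e, ~~ w, ~~ n, s, ~~ ne & ~~ nw],
      [&& e, ~~ w, n, ~~ s & ~~ sw], [&& e, ~~ w, ~~ n, s & ~~ nw],
      [&& ~~ e, w, n, ~~ s & ~~ se], [&& ~~ e, w, ~~ n, s & ~~ ne],
      [&& e, w, n & ~~ s], [&& e, w, ~~ n & s], [&& e, ~~ w, n & s] | [&& ~~ e, w, n & s]].
Proof. by case: e w n s => [] [] [] []; case: ne nw se sw => [] [] [] []. Qed.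

Local Instance enc_letter : Enc letter := enc_fin letter.
Local Instance enc_letter_inj : EncInj letter := @enc_fin_inj letter.

Section Verification.
Variable L : finType.
Local Instance enc_L : Enc L := enc_fin L.
Local Instance enc_L_inj : EncInj L := @enc_fin_inj L.

(* the x-coordinate, the y-coordinate and the label *)
Definition cell_entry : Type := (signed_bits * signed_bits * L)%type.
(* the finished entries in reverse order, and the two numbers read last *)
Definition parse_state : Type := (seq cell_entry * (signed_bits * signed_bits))%type.

Definition parse_letter (a : parse_state) (x : letter * L) : parse_state :=
  let: (done, (p, q)) := a in
  match x.1 with
  | Bit b => (done, (p, (q.1, b :: q.2)))
  | Minus => (done, (p, (true, q.2)))
  | Comma => (done, (q, (false, [::])))
  | Semicolon => ((p, q, x.2) :: done, ((false, [::]), (false, [::])))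
  end.

Definition parse (w : seq (letter * L)) : seq cell_entry :=
  rev (foldl parse_letter ([::], ((false, [::]), (false, [::]))) w).1.

Definition unparse_int (p : signed_bits) : seq letter :=
  (if p.1 then [:: Minus] else [::]) ++ rev [seq Bit b | b <- p.2].

Definition unparse (s : seq cell_entry) : seq letter :=
  flatten [seq unparse_int p.1.1 ++ Comma :: unparse_int p.1.2 ++ [:: Semicolon] | p <- s].

Lemma unparse_int_bits z : unparse_int (int_bits z) = encode_int z.
Proof. by case: z => n; rewrite /encode_int encode_natE. Qed.

Definition entries (t : seq (square * L)) : seq cell_entry := [seq (square_bits p.1, p.2) | p <- t].

Lemma unparse_entries t : unparse (entries t) = encode (unzip1 t).
Proof.
by rewrite /unparse /encode -!map_comp; congr flatten; apply/eq_map => p;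
  rewrite /= !unparse_int_bits.
Qed.

Definition label_word (lab : square -> L) (s : seq square) : seq (letter * L) :=
  flatten [seq [seq (x, lab c) | x <- encode [:: c]] | c <- s].

Lemma unzip1_label_word lab s : unzip1 (label_word lab s) = encode s.
Proof.
rewrite /unzip1 /label_word map_flatten -map_comp /encode; congr flatten; apply/eq_map => c /=.
by rewrite -map_comp map_id cats0.
Qed.

Lemma label_word_const d s : [seq (x, d) | x <- encode s] = label_word (fun=> d) s.
Proof.
rewrite /label_word /encode map_flatten -map_comp; congr flatten.
by apply/eq_map => c; rewrite /= cats0.
Qed.

Lemma label_word_cons lab c s : label_word lab (c :: s) =
  [seq (x, lab c) | x <- encode_int c.1] ++ (Comma, lab c) ::
  [seq (x, lab c) | x <- encode_int c.2] ++ (Semicolon, lab c) :: label_word lab s.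
Proof.
by rewrite /label_word /= /encode /= cats0 map_cat map_cons map_cat -catA cat_cons -catA.
Qed.

Lemma foldl_bits (l : seq bool) (d : L) done p q :
  foldl parse_letter (done, (p, q)) [seq (x, d) | x <- rev [seq Bit b | b <- l]] =
    (done, (p, (q.1, l ++ q.2))).
Proof.
elim: l q => [|b l IH] q; first by case: q.
by rewrite map_cons rev_cons map_rcons -cats1 foldl_cat IH /= .
Qed.

Lemma foldl_int (z : int) (d : L) done p :
  foldl parse_letter (done, (p, (false, [::]))) [seq (x, d) | x <- encode_int z] =
    (done, (p, int_bits z)).
Proof.
rewrite -unparse_int_bits /unparse_int map_cat foldl_cat.
by case: z => n; rewrite /= foldl_bits cats0.
Qed.

Lemma parse_label_word lab s : parse (label_word lab s) = entries [seq (c, lab c) | c <- s].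
Proof.
rewrite /parse; suff parsed done :
    foldl parse_letter (done, ((false, [::]), (false, [::]))) (label_word lab s) =
    (rev (entries [seq (c, lab c) | c <- s]) ++ done, ((false, [::]), (false, [::]))).
  by rewrite parsed cats0 revK.
elim: s done => [|c s IH] done //; rewrite label_word_cons foldl_cat foldl_int.
rewrite -[foldl _ _ (_ :: _)]/(foldl parse_letter (done, (int_bits c.1, (false, [::]))) _).
rewrite foldl_cat foldl_int.
rewrite -[foldl _ _ (_ :: _)]/(foldl parse_letter ((square_bits c, lab c) :: done, _) _) IH.
by rewrite /entries !map_cons rev_cons cat_rcons.
Qed.

Definition canonical_entry (p : cell_entry) : bool := canonical_int p.1.1 && canonical_int p.1.2.

Lemma canonical_entries t : all canonical_entry (entries t).
Proof. by apply/allP => _ /mapP[p _ ->]; rewrite /canonical_entry !canonical_int_bits. Qed.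

Lemma canonical_entriesP (s : seq cell_entry) : all canonical_entry s -> exists t, s = entries t.
Proof.
elim: s => [|[[p q] d] s IH] /=; first by exists [::].
case/andP => /andP[/canonical_intP[x /= ->] /canonical_intP[y /= ->]] /IH[t ->].
by exists ((x, y, d) :: t).
Qed.

Definition has_neighbor (s : seq cell_entry) (p : cell_entry) (dx dy : option bool) : bool :=
  has (fun q : cell_entry => is_shift dx dy p.1 q.1) s.

Definition arc_entry (s : seq cell_entry) (p : cell_entry) : bool :=
  let n := has_neighbor s p in let plus := Some true in let minus := Some false in
  arc_pattern (n plus None) (n minus None) (n None plus) (n None minus)
    (n plus plus) (n minus plus) (n plus minus) (n minus minus).

Fixpoint shelled_entries (s : seq cell_entry) : bool :=
  if s is p :: s' then
    (s' == [::]) || [&& ~~ has_neighbor s' p None None, arc_entry s' p & shelled_entries s']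
  else false.

Lemma has_neighborE t c d dx dy : has_neighbor (entries t) (square_bits c, d) dx dy =
  (shift_cell c (int_of_dir dx) (int_of_dir dy) \in unzip1 t).
Proof.
rewrite /has_neighbor has_map; elim: t => //= p t IH; rewrite inE -IH; congr (_ || _).
by rewrite is_shift_bits eq_sym.
Qed.

Lemma shelled_entriesE t : shelled_entries (entries t) = shelled (unzip1 t).
Proof.
elim: t => //= -[c d] t ->; rewrite /arc_entry !has_neighborE shift_cell0.
by congr (_ || _); case: t.
Qed.

Variables (valid_label : L -> bool) (need : nat -> L -> bool) (next_label : nat -> L -> L).

Definition dirs : seq (nat * (option bool * option bool)) :=
  [:: (0, (Some true, None)); (1, (Some false, None));
      (2, (None, Some true)); (3, (None, Some false))].

Definition label_ok (s : seq cell_entry) (p : cell_entry) : bool :=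
  valid_label p.2 && all (fun i => ~~ need i.1 p.2 ||
    has (fun q : cell_entry => is_shift i.2.1 i.2.2 p.1 q.1 && (q.2 == next_label i.1 p.2)) s) dirs.

Definition verify (d : L) (w : seq letter) (v : seq (letter * L)) : bool :=
  let s := parse [seq (x, d) | x <- w] in
  let s' := parse v in
  [&& unparse s == w, all canonical_entry s, all canonical_entry s', size s == size s',
      all (fun p => has_neighbor s p None None) s', shelled_entries s' & all (label_ok s') s'].

Lemma verify_entries d w v : verify d w v -> exists t t' : seq (square * L),
  [/\ w = encode (unzip1 t), size t = size t', {subset unzip1 t' <= unzip1 t},
      shelled (unzip1 t') & all (label_ok (entries t')) (entries t')].
Proof.
rewrite /verify; move: (parse _) (parse v) => s s'.
case/and5P => /eqP <- /canonical_entriesP[t ->] /canonical_entriesP[t' ->] sizes.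
case/and3P => covered shelled_t' labels_t'; exists t, t'; split=> //.
- exact: unparse_entries.
- by move/eqP: sizes; rewrite !size_map.
- move=> _ /mapP[p t'p ->]; have entry_p : (square_bits p.1, p.2) \in entries t'.
    by apply/mapP; exists p.
  by have /allP/(_ _ entry_p) := covered; rewrite has_neighborE shift_cell0.
- by rewrite -shelled_entriesE.
Qed.

Lemma verify_label_word d lab s s' : perm_eq s s' -> shelled s' ->
  (let t := entries [seq (c, lab c) | c <- s'] in all (label_ok t) t) ->
  verify d (encode s) (label_word lab s').
Proof.
move=> perm shelled_s' /= labels_s'.
have cells_of lab' (u : seq square) : unzip1 [seq (c, lab' c : L) | c <- u] = u.
  by rewrite /unzip1 -map_comp map_id.
rewrite /verify label_word_const !parse_label_word unparse_entries cells_of eqxx.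
rewrite !canonical_entries !size_map (perm_size perm) eqxx shelled_entriesE cells_of shelled_s'.
rewrite labels_s' !andbT; apply/allP => _ /mapP[_ /mapP[c s'c ->] ->].
by rewrite has_neighborE shift_cell0 cells_of (perm_mem perm).
Qed.

Lemma ptime_parse_letter :
  ptime (fun p : unit * (parse_state * (letter * L)) => parse_letter p.2.1 p.2.2).
Proof.
pose by_letter (x : letter) (p : unit * (parse_state * (letter * L))) : parse_state :=
  parse_letter p.2.1 (x, p.2.2.2).
apply: (ptime_ext (f := fun p => by_letter p.2.2.1 p)) => [[u [a [x d]]] //|].
apply: (ptime_fin_case (f := fun p : unit * (parse_state * (letter * L)) => p.2.2.1)).
  by prove_ptime.
pose Z := (unit * (parse_state * (letter * L)))%type.
case=> [b|||].
- apply: (ptime_ext (f := fun p : Z => (p.2.1.1, (p.2.1.2.1, (p.2.1.2.2.1, b :: p.2.1.2.2.2))))).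
    by case=> u [[done [p q]] [x d]].
  by prove_ptime.
- apply: (ptime_ext (f := fun p : Z => (p.2.1.1, (p.2.1.2.1, (true, p.2.1.2.2.2))))).
    by case=> u [[done [p q]] [x d]].
  by prove_ptime.
- apply: (ptime_ext (f := fun p : Z => (p.2.1.1, (p.2.1.2.2, (false, Nil bool))))).
    by case=> u [[done [p q]] [x d]].
  by prove_ptime.
- apply: (ptime_ext (f := fun p : Z => ((p.2.1.2.1, p.2.1.2.2, p.2.2.2) :: p.2.1.1,
    ((false, Nil bool), (false, Nil bool))))).
    by case=> u [[done [p q]] [x d]].
  by prove_ptime.
Qed.

Lemma ptime_parse : ptime parse.
Proof.
apply: ptime_rev; apply: ptime_fst.
apply: (ptime_foldl (step := fun (_ : seq (letter * L)) => parse_letter)); try by prove_ptime.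
  have tail : ptime (fun p : seq (letter * L) * (parse_state * (letter * L)) => (tt, p.2)).
    by prove_ptime.
  exact: (ptime_comp ptime_parse_letter tail).
exists (fun m => m + 20); first by poly_bound.
move=> w [done [[s p] [s' q]]] [x d]; have := @enc_size_gt0 _ _ d; have := @enc_size_gt0 _ _ x.
have := @enc_size_gt0 _ _ q; have := @enc_size_gt0 _ _ p; case: x => [b|||] /=.
all: rewrite !enc_size_pair ?enc_size_cons ?enc_size_pair ?enc_size_nil !enc_size_bool; try lia.
all: by case: s; case: s'; try case: b; lia.
Qed.

Section EntryPredicates.
Variables (E : Type) (eE : Enc E).

Lemma ptime_bit_letters (f : E -> seq bool) :
  ptime f -> ptime (fun e => rev [seq Bit b | b <- f e]).
Proof.
move=> hf; apply: ptime_rev; apply: (ptime_map (f := fun _ b => Bit b)) hf.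
apply: (ptime_ext (f := fun p : E * bool => if p.2 then Bit true else Bit false)).
  by case=> e [].
by prove_ptime.
Qed.

Lemma ptime_unparse_int (f : E -> signed_bits) : ptime f -> ptime (fun e => unparse_int (f e)).
Proof.
move=> hf; apply: ptime_cat; first by apply: ptime_if; prove_ptime.
exact: ptime_bit_letters (ptime_snd hf).
Qed.

Lemma ptime_canonical_int (f : E -> signed_bits) : ptime f -> ptime (fun e => canonical_int (f e)).
Proof.
move=> hf; rewrite /canonical_int /canonical; apply: ptime_andb; last by prove_ptime.
apply: ptime_orb; first by prove_ptime.
have folded : ptime (fun l : seq bool => foldl (fun _ b => b) false l).
  apply: (ptime_foldl (E := seq bool) (step := fun _ (_ : bool) b => b)); try by prove_ptime.
  by exists id => [|e a x]; [poly_bound | lia].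
apply: ptime_ext (ptime_comp folded (ptime_snd hf)) => e.
by elim: ((f e).2) false => //= b l IH c; rewrite IH.
Qed.

Lemma ptime_succ_int (f g : E -> signed_bits) : ptime f -> ptime g ->
  ptime (fun e => succ_int (f e) (g e)).
Proof.
move=> hf hg; rewrite /succ_int.
have hf' := ptime_incr_bits (ptime_snd hf); have hg' := ptime_incr_bits (ptime_snd hg).
apply: ptime_if; first by prove_ptime.
  by apply: ptime_if; [prove_ptime | apply: ptime_eq hg' _; prove_ptime | prove_ptime].
by apply: ptime_andb; [prove_ptime | apply: ptime_eq hf' _; prove_ptime].
Qed.

Lemma ptime_is_shift dx dy (f g : E -> signed_bits * signed_bits) : ptime f -> ptime g ->
  ptime (fun e => is_shift dx dy (f e) (g e)).
Proof.
move=> hf hg; rewrite /is_shift /is_dir; apply: ptime_andb.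
  by case: dx => [[]|]; [apply: ptime_succ_int; exact: ptime_fst
    | apply: ptime_succ_int; exact: ptime_fst | apply: ptime_eq; exact: ptime_fst].
by case: dy => [[]|]; [apply: ptime_succ_int; exact: ptime_snd
  | apply: ptime_succ_int; exact: ptime_snd | apply: ptime_eq; exact: ptime_snd].
Qed.

End EntryPredicates.

Section NeighborPredicates.
Variables (E : Type) (eE : Enc E).

Lemma ptime_has_neighbor dx dy (s : E -> seq cell_entry) (p : E -> cell_entry) : ptime s ->
  ptime p ->
  ptime (fun e => has_neighbor (s e) (p e) dx dy).
Proof.
move=> hs hp; apply: (ptime_has (P := fun e (q : cell_entry) => is_shift dx dy (p e).1 q.1)) => //.
have hp' : ptime (fun e : E * cell_entry => p e.1) by exact: ptime_comp hp (ptime_fst ptime_id).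
by apply: ptime_is_shift; [exact: ptime_fst hp' | prove_ptime].
Qed.

Lemma ptime_arc_entry (s : E -> seq cell_entry) (p : E -> cell_entry) : ptime s -> ptime p ->
  ptime (fun e => arc_entry (s e) (p e)).
Proof.
move=> hs hp; have neighbor dx dy := ptime_has_neighbor dx dy hs hp; rewrite /arc_entry.
have patternE : (fun e => _) =1 (fun e => arc_entry (s e) (p e)) :=
  fun e => esym (arc_patternE _ _ _ _ _ _ _ _).
by apply: ptime_ext patternE _; prove_ptime; exact: neighbor.
Qed.

End NeighborPredicates.

Lemma ptime_unparse : ptime unparse.
Proof.
apply: (ptime_flatmap (f := fun _ (p : cell_entry) => _)); last exact: ptime_id.
apply: ptime_cat; first by apply: ptime_unparse_int; prove_ptime.
apply: ptime_cons; first by prove_ptime.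
by apply: ptime_cat; [apply: ptime_unparse_int; prove_ptime | prove_ptime].
Qed.

Lemma ptime_shelled_entries : ptime shelled_entries.
Proof.
pose step (a : seq cell_entry * bool) (p : cell_entry) : seq cell_entry * bool :=
  (p :: a.1, (a.1 == [::]) || [&& ~~ has_neighbor a.1 p None None, arc_entry a.1 p & a.2]).
have folded : ptime (fun s => foldl step ([::], false) (rev s)).
  apply: (ptime_foldl (E := seq cell_entry) (step := fun _ => step)); try by prove_ptime.
  - rewrite /step; apply: ptime_pair; first by prove_ptime.
    apply: ptime_orb; first by prove_ptime.
    apply: ptime_andb; first by apply: ptime_negb; apply: ptime_has_neighbor; prove_ptime.
    by apply: ptime_andb; [apply: ptime_arc_entry; prove_ptime | prove_ptime].
  - exists (fun m => m + 20); first by poly_bound.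
    move=> w [s b] p; rewrite /step /= !enc_size_pair enc_size_cons !enc_size_bool.
    by case: (_ || _); lia.
  - exact: ptime_rev ptime_id.
apply: ptime_ext (ptime_snd folded) => s.
suff -> : foldl step ([::], false) (rev s) = (s, shelled_entries s) by [].
by elim: s => // p s IH; rewrite rev_cons -cats1 foldl_cat IH.
Qed.

Lemma ptime_label_ok : ptime (fun p : seq cell_entry * cell_entry => label_ok p.1 p.2).
Proof.
rewrite /label_ok; apply: ptime_andb; first by apply: ptime_fin_const; prove_ptime.
elim: dirs => [|i ds IH] /=; first exact: ptime_const.
apply: ptime_andb IH; apply: ptime_orb.
  by apply: ptime_negb; apply: ptime_fin_const; prove_ptime.
apply: (ptime_has (P := fun (p : seq cell_entry * cell_entry) (q : cell_entry) =>
   is_shift i.2.1 i.2.2 p.2.1 q.1 && (q.2 == next_label i.1 p.2.2))); last by prove_ptime.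
apply: ptime_andb; first by apply: ptime_is_shift; prove_ptime.
by apply: ptime_eq; [prove_ptime | apply: ptime_fin_const; prove_ptime].
Qed.

Lemma ptime_verify_pair d :
  ptime (fun p : seq letter * seq (letter * L) => verify d p.1 p.2).
Proof.
pose Z := (seq letter * seq (letter * L))%type.
have given : ptime (fun p : Z => parse [seq (x, d) | x <- p.1]).
  by apply: (ptime_comp ptime_parse); prove_ptime.
have guessed : ptime (fun p : Z => parse p.2) by apply: (ptime_comp ptime_parse); prove_ptime.
have all_entries (P : cell_entry -> bool) (f : Z -> seq cell_entry) :
    ptime P -> ptime f -> ptime (fun p => all P (f p)).
  by move=> hP hf; apply: (ptime_all (P := fun _ => P)) hf;
    exact: ptime_comp hP (ptime_snd ptime_id).
have canonical_ptime : ptime canonical_entry.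
  by rewrite /canonical_entry; apply: ptime_andb; apply: ptime_canonical_int; prove_ptime.
rewrite /verify; apply: ptime_andb.
  by apply: ptime_eq; [exact: ptime_comp ptime_unparse given | prove_ptime].
apply: ptime_andb; first exact: all_entries.
apply: ptime_andb; first exact: all_entries.
apply: ptime_andb; first by apply: ptime_eq; exact: ptime_size.
apply: ptime_andb.
  apply: (ptime_all (P :=
    fun (p : Z) q => has_neighbor (parse [seq (x, d) | x <- p.1]) q None None)) => //.
  apply: ptime_has_neighbor;
    [exact: ptime_comp given (ptime_fst ptime_id) | exact: ptime_snd ptime_id].
apply: ptime_andb; first exact: ptime_comp ptime_shelled_entries guessed.
apply: (ptime_all (P := fun (p : Z) q => label_ok (parse p.2) q)) => //.
by apply: (ptime_comp2 ptime_label_ok);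
  [exact: ptime_comp guessed (ptime_fst ptime_id) | exact: ptime_snd ptime_id].
Qed.

Lemma ptime_verify d : @ptime _ _ (@enc_seq _ (enc_fin (letter * (letter * L))%type)) enc_bool
  (fun i => verify d (unzip1 i) (unzip2 i)).
Proof.
pose I := (letter * (letter * L))%type; pose eI : Enc (seq I) := @enc_seq _ (enc_fin I).
have mapped (Y : Type) (eY : Enc Y) (f : I -> Y) : @ptime _ _ eI _ (fun i => [seq f x | x <- i]).
  apply: (@ptime_map _ _ _ eI (enc_fin I) _ (fun _ x => f x)); last exact: ptime_id.
  by apply: (@ptime_fin_const _ _ I _ _ _ f); exact: ptime_snd ptime_id.
by apply: (ptime_comp2 (ptime_verify_pair d)); exact: mapped.
Qed.

End Verification.

Section Membership.
Variables (R : realType) (T : {fset cells}) (N : nat).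
Hypothesis T_rect : forall t, t \in T -> rectangular t.
Hypothesis T_small : forall a b, 0 < a -> 0 < b -> rectangle a b \in T -> a < N /\ b < N.

Definition label : finType := ('I_N.+1 * 'I_N.+1 * ('I_N.+1 * 'I_N.+1))%type.
Definition label_val (l : label) : nat * nat * (nat * nat) :=
  (val l.1.1, val l.1.2, (val l.2.1, val l.2.2)).
Definition label_of (l : nat * nat * (nat * nat)) : label :=
  (inord l.1.1, inord l.1.2, (inord l.2.1, inord l.2.2)).

Definition valid_label (l : label) : bool :=
  [&& rectangle l.1.1 l.1.2 \in T, l.2.1 < l.1.1 & l.2.2 < l.1.2].
Definition need (i : nat) (l : label) : bool :=
  match i with
  | 0 => l.2.1.+1 < l.1.1 | 1 => 0 < l.2.1 | 2 => l.2.2.+1 < l.1.2 | _ => 0 < l.2.2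
  end.
Definition next_label (i : nat) (l : label) : label :=
  match i with
  | 0 => (l.1, (inord l.2.1.+1, l.2.2)) | 1 => (l.1, (inord l.2.1.-1, l.2.2))
  | 2 => (l.1, (l.2.1, inord l.2.2.+1)) | _ => (l.1, (l.2.1, inord l.2.2.-1))
  end.

Definition default_label : label := label_of (0, 0, (0, 0)).

Lemma label_valK : cancel label_val label_of.
Proof. by case=> [[a b] [x y]]; rewrite /label_of /= !inord_val. Qed.

Lemma has_entry_shift (t : seq (square * label)) c dx dy l :
  has (fun q : cell_entry label => is_shift dx dy (square_bits c) q.1 && (q.2 == l)) (entries t) =
  ((shift_cell c (int_of_dir dx) (int_of_dir dy), l) \in t).
Proof.
rewrite has_map; elim: t => //= -[d m] t IH; rewrite inE -IH; congr (_ || _).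
by rewrite /= is_shift_bits xpair_eqE ![_ == d]eq_sym (eq_sym l).
Qed.

Lemma label_okE (t : seq (square * label)) c l :
  label_ok valid_label need next_label (entries t) (square_bits c, l) =
  [&& valid_label l, need 0 l ==> ((shift_cell c 1 0, next_label 0 l) \in t),
      need 1 l ==> ((shift_cell c (-1) 0, next_label 1 l) \in t),
      need 2 l ==> ((shift_cell c 0 1, next_label 2 l) \in t)
    & need 3 l ==> ((shift_cell c 0 (-1), next_label 3 l) \in t)].
Proof. by rewrite /label_ok /= !has_entry_shift -!implybE andbT. Qed.

Definition label_at (t : seq (square * label)) (c : square) : label :=
  head default_label [seq p.2 | p <- t & p.1 == c].

Lemma label_at_mem t c l : uniq [seq p.1 | p <- t] -> (c, l) \in t -> label_at t c = l.
Proof.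
rewrite /label_at; elim: t => //= -[d m] t IH /= /andP[hd ht]; rewrite inE.
case: (eqVneq d c) => [e|ne] /=.
  by case/orP => [/eqP[_ ->]//|h]; case/negP: hd; rewrite e; apply/mapP; exists (c, l).
by case/orP => [/eqP[e _]|/IH ->//]; rewrite e eqxx in ne.
Qed.

Lemma all_label_ok_consistent (t : seq (square * label)) : uniq (unzip1 t) ->
  all (label_ok valid_label need next_label (entries t)) (entries t) ->
  consistent_labels T [fset c in unzip1 t]%fset (fun c => label_val (label_at t c)).
Proof.
move=> uniq_t /allP labels c; rewrite !inE => /mapP[[y l] t_y /= ->].
have at_mem z m : (z, m) \in t -> z \in unzip1 t /\ label_at t z = m.
  by move=> t_z; rewrite (label_at_mem uniq_t t_z); split=> //; apply/mapP; exists (z, m).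
have [_ ->] := at_mem y l t_y; case: l t_y => [[a b] [u v]] t_y.
have entry_y : (square_bits y, (a, b, (u, v))) \in entries t.
  by apply/mapP; exists (y, (a, b, (u, v))).
have := labels _ entry_y; rewrite label_okE.
case/and5P => /and3P[in_T lt_u lt_v] /implyP east /implyP west /implyP north /implyP south.
have small (k : nat) (q : 'I_N.+1) : k <= q -> k < N.+1 by move=> ?;
  apply: leq_ltn_trans (ltn_ord q).
split=> //; split=> needed.
- have [-> ->] := at_mem _ _ (east needed); split=> //.
  by rewrite /label_val /= inordK //; exact: (small _ a (ltnW needed)).
- have [-> ->] := at_mem _ _ (west needed); split=> //.
  by rewrite /label_val /= inordK //; exact: (small _ u (leq_pred _)).
- have [-> ->] := at_mem _ _ (north needed); split=> //.
  by rewrite /label_val /= inordK //; exact: (small _ b (ltnW needed)).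
- have [-> ->] := at_mem _ _ (south needed); split=> //.
  by rewrite /label_val /= inordK //; exact: (small _ v (leq_pred _)).
Qed.

Lemma label_ofK lab G c : consistent_labels T G lab -> c \in G ->
  label_val (label_of (lab c)) = lab c.
Proof.
move=> ok /ok; rewrite /label_val /label_of /=; case: (lab c) => [[a b] [x y]] [in_T lt_x lt_y _].
have [a_small b_small] :=
  T_small (leq_ltn_trans (leq0n _) lt_x) (leq_ltn_trans (leq0n _) lt_y) in_T.
by rewrite /= !inordK //; lia.
Qed.

Lemma consistent_all_label_ok (s : seq square) lab : consistent_labels T [fset c in s]%fset lab ->
  let t := entries [seq (c, label_of (lab c)) | c <- s] in
  all (label_ok valid_label need next_label t) t.
Proof.
move=> ok; apply/allP => _ /mapP[_ /mapP[c s_c ->] ->]; rewrite label_okE.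
have cG : c \in [fset c in s]%fset by rewrite !inE.
have := ok c cG; rewrite -(label_ofK ok cG) label_valK.
case: (label_of (lab c)) => [[a b] [x y]].
rewrite /label_val /= => -[in_T lt_x lt_y [east west north south]].
have mem d l : d \in [fset c in s]%fset /\ lab d = l ->
    (d, label_of l) \in [seq (c, label_of (lab c)) | c <- s].
  by rewrite !inE => -[s_d <-]; apply/mapP; exists d.
rewrite /valid_label /= in_T lt_x lt_y /=.
apply/and4P; split; apply/implyP => needed.
- by have := mem _ _ (east needed); rewrite /label_of /= !inord_val.
- by have := mem _ _ (west needed); rewrite /label_of /= !inord_val.
- by have := mem _ _ (north needed); rewrite /label_of /= !inord_val.
- by have := mem _ _ (south needed); rewrite /label_of /= !inord_val.
Qed.

Lemma verify_sound w v : verify valid_label need next_label default_label w v ->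
  tiling_problem R T w.
Proof.
case/verify_entries => t [t' [-> size_t covered shelled_t' labels]].
have uniq_t' := shelled_uniq shelled_t'.
have le_size : size (unzip1 t) <= size (unzip1 t') by rewrite !size_map size_t.
have [_ same] := uniq_min_size uniq_t' covered le_size.
have uniq_t := leq_size_uniq uniq_t' covered le_size.
have sameG : [fset c in unzip1 t]%fset = [fset c in unzip1 t']%fset :> cells.
  by apply/fsetP => c; rewrite !inE same.
have [conn simple] : region R [fset c in unzip1 t]%fset /\
    simply_connected (realize R [fset c in unzip1 t]%fset).
  by apply/shellableP; exists (unzip1 t').
exists (unzip1 t); split=> //; apply/tileableP; rewrite sameG.
exact: consistent_labels_tiling (all_label_ok_consistent uniq_t' labels).
Qed.

Lemma verify_complete w : tiling_problem R T w -> exists2 v, size v = size w &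
  verify valid_label need next_label default_label w v.
Proof.
case=> s [[uniq_s ->] conn simple /tileableP[f /(tiling_consistent_labels T_rect)[lab ok]]].
have [s' shelled_s' sameG] := (shellableP R [fset c in s]%fset).2 (conj conn simple).
have same : s =i s' by move=> c; have := congr1 (fun S : cells => c \in S) sameG; rewrite !inE.
have perm : perm_eq s s' by apply: uniq_perm => //; exact: shelled_uniq.
exists (label_word (fun c => label_of (lab c)) s').
  rewrite -(size_map fst) -/(unzip1 _) unzip1_label_word; apply: perm_size.
  by apply: perm_flatten; apply: perm_map; rewrite perm_sym.
by apply: verify_label_word => //; apply: consistent_all_label_ok; rewrite -sameG.
Qed.

Lemma tiling_NP_small : NP (tiling_problem R T).
Proof.
apply: (NP_guess (ptime_verify valid_label need next_label default_label)) => w.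
split=> [/verify_complete[v size_v verified]|[v size_v]].
  by exists v; rewrite ?unzip1_zip ?unzip2_zip ?size_v.
by rewrite unzip1_zip ?unzip2_zip ?size_v //; exact: verify_sound.
Qed.

End Membership.

Lemma rectangular_small (T : seq cells) : (forall t, t \in T -> rectangular t) ->
  exists N, forall a b, 0 < a -> 0 < b -> rectangle a b \in T -> a < N /\ b < N.
Proof.
elim: T => [|t T IH] hT; first by exists 0.
have [|N hN] := IH; first by move=> u hu; apply: hT; rewrite inE hu orbT.
have [a [b [a0 b0 e]]] := hT t (mem_head _ _).
exists (N + a.+1 + b.+1) => a' b' a0' b0'; rewrite inE => /orP[/eqP|/(hN _ _ a0' b0')[]];
  last by lia.
by rewrite e => /(rectangle_inj a0' b0')[-> ->]; lia.
Qed.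

Lemma tiling_NP (R : realType) (T : {fset cells}) : (forall t, t \in T -> rectangular t) ->
  NP (tiling_problem R T).
Proof.
move=> hT; have [N hN] := rectangular_small hT.
exact: (tiling_NP_small R hT hN).
Qed.

(** * Column-convex regions are shellable *)

(* the columns x < n in full, and the part [a, b[ of column n *)
Definition in_cols (n a b : nat) (lo hi : nat -> nat) (c : square) : bool :=
  match c with
  | (Posz x, Posz y) => (x < n) && (lo x <= y < hi x) || (x == n) && (a <= y < b)
  | _ => false
  end.

Section Columns.
Variables lo hi : nat -> nat.
Local Notation S n a b := (in_cols n a b lo hi).

Lemma in_cols_right n a b (x : nat) (y : int) : n < x -> S n a b (Posz x, y) = false.
Proof.
move=> lt_n; case: y => y //; rewrite /in_cols.
have -> : (x < n) = false by lia.
by have -> : (x == n) = false by lia.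
Qed.

Definition in_prev_col n (y : int) : bool :=
  if n is k.+1 then if y is Posz z then lo k <= z < hi k else false else false.

Lemma in_cols_left n a b (y : int) : S n a b ((Posz n - 1)%R, y) = in_prev_col n y.
Proof.
case: n => [|n]; first by case: y.
have -> : (Posz n.+1 - 1)%R = Posz n by lia.
by case: y => //= y; rewrite ltnSn /= (_ : (n == n.+1) = false) ?orbF //; lia.
Qed.

Lemma in_cols_last n a b (y : nat) : S n a b (Posz n, Posz y) = (a <= y < b).
Proof. by rewrite /= ltnn eqxx. Qed.

Lemma in_cols_below n a b (y : nat) : S n a b (Posz n, (Posz y - 1)%R) = (a < y <= b).
Proof.
case: y => [|y]; first by rewrite /=; lia.
have -> : (Posz y.+1 - 1)%R = Posz y by lia.
by rewrite in_cols_last.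
Qed.

Lemma arc_in_cols n a b (y : nat) : arc (S n a b) (Posz n, Posz y) =
  arc_pattern false (in_prev_col n y) (a <= y.+1 < b) (a < y <= b) false (in_prev_col n y.+1)
    false (in_prev_col n (Posz y - 1)%R).
Proof.
have -> : arc (S n a b) (Posz n, Posz y) = arc_pattern (S n a b (Posz n.+1, Posz y))
    (S n a b ((Posz n - 1)%R, Posz y)) (S n a b (Posz n, Posz y.+1))
    (S n a b (Posz n, (Posz y - 1)%R)) (S n a b (Posz n.+1, Posz y.+1))
    (S n a b ((Posz n - 1)%R, Posz y.+1)) (S n a b (Posz n.+1, (Posz y - 1)%R))
    (S n a b ((Posz n - 1)%R, (Posz y - 1)%R)).
  by rewrite /arc /neighbor; congr arc_pattern; congr (S n a b _); congr pair; rewrite /=; lia.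
by rewrite !(in_cols_right _ _ _ (ltnSn n)) !in_cols_left in_cols_last in_cols_below.
Qed.

Definition shelling_of_cols (s : seq square) n a b : Prop := shelled s /\
  forall c, (c \in s) = S n a b c.

Lemma shelling_of_cols_add s n a b a' b' (y : nat) : shelling_of_cols s n a b ->
  ~~ (a <= y < b) -> arc (S n a b) (Posz n, Posz y) ->
  (forall z, (a' <= z < b') = (z == y) || (a <= z < b)) ->
    shelling_of_cols ((Posz n, Posz y) :: s) n a' b'.
Proof.
move=> [s_shelled sE] y_new y_arc colE; split.
  rewrite /= s_shelled andbT (eq_arc _ (_ : mem s =1 S n a b)) ?y_arc; last by move=> c;
    rewrite -sE.
  by rewrite sE in_cols_last y_new orbT.
move=> c; rewrite inE sE; case: c => -[x|x] [z|z]; last 3 first.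
- by rewrite xpair_eqE /= ?andbF.
- by rewrite xpair_eqE /= ?andbF.
- by rewrite xpair_eqE /= ?andbF.
rewrite /in_cols colE xpair_eqE; have -> : (Posz x == Posz n) = (x == n)
  by apply/eqP/eqP => [[]|->].
have -> : (Posz z == Posz y) = (z == y) by apply/eqP/eqP => [[]|->].
by case: (x == n); case: (z == y); rewrite ?orbT ?orbF ?andbT //= ?orbT.
Qed.

Lemma shelling_of_cols_up s n a b k : shelling_of_cols s n a b -> a < b ->
  (forall j, n = j.+1 -> lo j <= b) -> exists s', shelling_of_cols s' n a (b + k).
Proof.
move=> s_ok lt_ab lo_prev; elim: k => [|k [s' s'_ok]]; first by exists s; rewrite addn0.
exists ((Posz n, Posz (b + k)) :: s'); apply: (shelling_of_cols_add s'_ok) => [||z]; try by lia.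
rewrite arc_in_cols; have -> : a <= (b + k).+1 < b + k = false by lia.
have -> : a < b + k <= b + k by lia.
case: n lo_prev {s_ok s'_ok} => [|n] lo_prev //=; have := lo_prev n erefl => le_lo.
case: (boolP (lo n <= b + k < hi n)) => //= above.
by have -> : lo n <= (b + k).+1 < hi n = false by lia.
Qed.

Lemma shelling_of_cols_down s n a b k : shelling_of_cols s n (a + k) b -> a + k < b ->
  (forall j, n = j.+1 -> a + k <= hi j) -> exists s', shelling_of_cols s' n a b.
Proof.
elim: k s => [|k IH] s s_ok lt_b hi_prev; first by exists s; rewrite addn0 in s_ok.
apply: (IH ((Posz n, Posz (a + k)) :: s)); [|by lia|by move=> j /hi_prev; lia].
apply: (shelling_of_cols_add s_ok) => [||z]; try by lia.
rewrite arc_in_cols; have -> : a + k.+1 <= (a + k).+1 < b by lia.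
have -> : a + k.+1 < a + k <= b = false by lia.
case: n hi_prev {s_ok IH} => [|n] hi_prev //=; have := hi_prev n erefl => le_hi.
case: (boolP (lo n <= a + k < hi n)) => //= below; case E: (a + k) below => [|z] below //.
have -> : (Posz z.+1 - 1)%R = Posz z by lia.
by have -> : lo n <= z < hi n = false by lia.
Qed.

Lemma shelling_of_cols_extend s n a b y : shelling_of_cols s n.+1 y y.+1 ->
  a <= y < b -> lo n <= y < hi n -> exists s', shelling_of_cols s' n.+1 a b.
Proof.
move=> s_ok /andP[le_ay lt_yb] /andP[le_lo lt_hi].
have [|s_up up_ok] := shelling_of_cols_up (b - y.+1) s_ok (ltnSn y).
  by move=> j [<-]; exact: ltnW.
rewrite subnKC // in up_ok; apply: (@shelling_of_cols_down s_up _ a b (y - a)).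
- by rewrite subnKC.
- by rewrite subnKC.
- by move=> j [<-]; rewrite subnKC // ltnW.
Qed.

Lemma shelling_of_cols_next s n : shelling_of_cols s n (lo n) (hi n) ->
  shelling_of_cols s n.+1 0 0.
Proof.
case=> s_shelled sE; split=> // c; rewrite sE.
case: c => -[x|x] [z|z] //; rewrite /in_cols ltn0 !andbF orbF.
have [->|ne] := eqVneq x n; first by rewrite ltnn ltnSn.
have -> : (x < n.+1) = (x < n) by move/eqP: ne => ne; lia.
by rewrite andFb orbF.
Qed.

Lemma columns_shelled n : (forall x, x <= n -> lo x < hi x) ->
  (forall x, x < n -> lo x < hi x.+1 /\ lo x.+1 < hi x) ->
  exists s, shelling_of_cols s n (lo n) (hi n).
Proof.
elim: n => [|n IH] col_lt next_lt.
  have -> : hi 0 = (lo 0).+1 + (hi 0 - (lo 0).+1) by have := col_lt 0 (leqnn _); lia.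
  apply: (@shelling_of_cols_up [:: (Posz 0, Posz (lo 0))]) => //; split=> // c; rewrite inE.
  case: c => -[[|x]|x] [z|z] //=; rewrite xpair_eqE.
  by apply/andP/idP => [[_ /eqP[->]]|?]; [lia | split=> //; apply/eqP; congr Posz; lia].
have [s s_ok] := IH (fun x hx => col_lt x (leqW hx)) (fun x hx => next_lt x (ltnW hx)).
have [lo_lt hi_gt] := next_lt n (ltnSn n).
have lt_n := col_lt n (leqnSn _); have lt_Sn := col_lt n.+1 (leqnn _).
pose y := maxn (lo n) (lo n.+1);
  apply: (@shelling_of_cols_extend ((Posz n.+1, Posz y) :: s) _ _ _ y).
- apply: (shelling_of_cols_add (shelling_of_cols_next s_ok)) => [//||z]; last by lia.
  rewrite arc_in_cols; have -> : (0 <= y.+1 < 0) = false by lia.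
  have -> : (0 < y <= 0) = false by lia.
  by have -> : in_prev_col n.+1 y by rewrite /= /y; lia.
- by rewrite /y; lia.
- by rewrite /y; lia.
Qed.

End Columns.

Section GridColumns.
Variables (C : finType) (m n : nat) (boundary : nat -> nat -> C).
Hypotheses (m_gt0 : 0 < m) (n_gt0 : 0 < n).
Local Notation Y := (boundary_level boundary).

Lemma boundary_level_lt i k i' k' : i <= i' -> k <= k' -> (i < i') || (k < k') ->
  Y i k < Y i' k'.
Proof.
move=> le_i le_k lt; have /andP[_ upper] := color_level_base i k (boundary i k).
have /andP[lower _] := color_level_base i' k' (boundary i' k').
rewrite /boundary_level; apply: leq_ltn_trans upper _; apply: leq_trans lower; rewrite /base_level.
have big_small : big_base C = 2 * small_base C by rewrite /big_base /small_base mulnA.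
have slack_small : slack C < small_base C by rewrite /small_base ltn_Pmull.
by have := slack_gt0 C; rewrite big_small; case/orP: lt => lt; nia.
Qed.

Lemma leq_col_of u v : u <= v -> col_of u <= col_of v.
Proof.
move=> le_uv; rewrite leqNgt ltn_col_of -leqNgt; apply: leq_trans le_uv.
by have /andP[] := col_ofP u.
Qed.

Lemma frontier_lt x x' : x < region_width m n -> x' < region_width m n -> x <= x'.+1 ->
  x' <= x.+1 -> frontier m n Y 0 x < frontier m n Y m x'.
Proof.
move=> lt_x lt_x' le_xx' le_x'x; have start_gt0 : 0 < col_start n by rewrite -ltn_col_of.
rewrite /frontier subn0 subnn muln0 ltn0 subn0; rewrite /region_width in lt_x lt_x'.
case: (ltnP x (4 * m)) => left_x; case: (ltnP x' (col_start n)) => left_x'.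
- apply: boundary_level_lt => //; first by lia.
  by have -> : m.-1 - x %/ 4 < m by lia.
- apply: boundary_level_lt => //; last by rewrite n_gt0 orbT.
  by apply: leq_sub2l; apply: leq_div2r; lia.
- have -> : x - 4 * m < col_start n by lia.
  by apply: boundary_level_lt => //; [apply: leq_col_of; lia | rewrite m_gt0].
- have lt_u : x - 4 * m < col_start n by lia.
  by rewrite lt_u; apply: boundary_level_lt; rewrite ?ltn_col_of ?lt_u ?orbT // ltnW // ltn_col_of.
Qed.

Lemma mem_grid_cells_cols c : (c \in grid_cells m n boundary) =
  let x := (region_width m n).-1 in
  in_cols x (frontier m n Y 0 x) (frontier m n Y m x) (frontier m n Y 0) (frontier m n Y m) c.
Proof.
have width_gt0 : 0 < region_width m n by rewrite /region_width; lia.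
have lt_pred x : (x < (region_width m n).-1) || (x == (region_width m n).-1) =
  (x < region_width m n).
  by lia.
apply/(sameP idP)/(iffP idP) => [|in_grid].
  case: c => -[x|x] [y|y] //= in_col; apply/(mem_grid_cells boundary m_gt0 n_gt0).
  exists x, y; split=> //; rewrite /in_staircase -lt_pred.
  by case/orP: in_col => /andP[in_x in_y]; move: in_y; rewrite in_x ?orbT // (eqP in_x).
have /(mem_grid_cells boundary m_gt0 n_gt0)[x [y [-> ]]] := in_grid.
rewrite /in_staircase -lt_pred /= => /andP[/orP[->|/eqP ->] in_y]; first by rewrite in_y.
by rewrite eqxx in_y orbT.
Qed.

Lemma grid_shelled :
  exists2 s, shelled s & [fset c in grid_cells m n boundary]%fset = [fset c in s]%fset :> cells.
Proof.
have width_gt0 : 0 < region_width m n by rewrite /region_width; lia.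
have [|x hx|s [s_shelled sE]] :=
    @columns_shelled (frontier m n Y 0) (frontier m n Y m) (region_width m n).-1.
- by move=> x hx; apply: frontier_lt; lia.
- by split; apply: frontier_lt; lia.
by exists s => //; apply/fsetP => c; rewrite !inE mem_grid_cells_cols sE.
Qed.

End GridColumns.

(** * Computing the formula *)

Lemma extend_along (I : Type) (v : I -> nat) (P : I -> Prop) (y : I -> bool) :
  (forall i j, P i -> P j -> v i = v j -> i = j) ->
  exists x : nat -> bool, forall i, P i -> x (v i) = y i.
Proof.
move=> v_inj; exists (fun k => `[< exists2 i, P i /\ v i = k & y i >]) => i Pi.
apply/asboolP/idP => [[j [Pj vj] yj]|yi]; last by exists i.
by rewrite -(v_inj j i Pj Pi vj).
Qed.

Section Numbering.
Variables (M : tm) (T : nat).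
Local Notation Q := (state M).
Local Notation U := (choice_of M).
Local Notation KS := ('I_(ntapes M).+1 * symb M)%type.

(* the variables of one time step: states, choices, and symbols at an offset of
   a tape *)
Definition var_name : Type := (Q + U + nat * KS)%type.

Definition valid_name (i : var_name) : bool := if i is inr (o, _) then o <= 2 * T.+1 else true.

Definition period : nat := #|{: Q}| + #|{: U}| + (2 * T.+1).+1 * #|{: KS}|.

Definition name_offset (i : var_name) : nat :=
  match i with
  | inl (inl q) => enum_rank q
  | inl (inr u) => #|{: Q}| + enum_rank u
  | inr (o, p) => #|{: Q}| + #|{: U}| + (enum_rank p + #|{: KS}| * o)
  end.

Lemma name_offset_lt i : valid_name i -> name_offset i < period.
Proof.
rewrite /period; case: i => [[q|u]|[o p]] /=.
- by rewrite -addnA => _; apply: leq_trans (ltn_ord _) (leq_addr _ _).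
- by rewrite -addnA ltn_add2l => _; apply: leq_trans (ltn_ord _) (leq_addr _ _).
- rewrite ltn_add2l -ltnS => lt_o; have lt_p := ltn_ord (enum_rank p).
  apply: leq_trans (_ : o.+1 * #|{: KS}| <= _); last by rewrite leq_mul2r lt_o orbT.
  by rewrite mulSn mulnC ltn_add2r.
Qed.

Lemma name_offset_inj i j : valid_name i -> valid_name j -> name_offset i = name_offset j -> i = j.
Proof.
have rank_lt (F : finType) (x : F) : enum_rank x < #|F| by exact: ltn_ord.
rewrite /name_offset; case: i => [[q|u]|[o p]]; case: j => [[q'|u']|[o' p']] _ _ same.
- by move/ord_inj/enum_rank_inj: same => ->.
- by exfalso; have := rank_lt _ q; lia.
- by exfalso; have := rank_lt _ q; lia.
- by exfalso; have := rank_lt _ q'; lia.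
- by move/addnI/ord_inj/enum_rank_inj: same => ->.
- by exfalso; have := rank_lt _ u; lia.
- by exfalso; have := rank_lt _ q'; lia.
- by exfalso; have := rank_lt _ u'; lia.
- by case/addnI/(digit_inj (ltn_ord _) (ltn_ord _)): same => [/ord_inj/enum_rank_inj -> ->].
Qed.

Definition var_number (t : nat) (i : var_name) : nat := name_offset i + period * t.

Definition state_var (t : nat) (q : Q) : nat := var_number t (inl (inl q)).
Definition choice_var (t : nat) (u : U) : nat := var_number t (inl (inr u)).
Definition cell_var (t o : nat) (j : 'I_(ntapes M).+1) (s : symb M) : nat :=
  var_number t (inr (o, (j, s))).

Lemma variables_independent (states : nat -> Q -> bool) (choices : nat -> U -> bool)
    (contents : nat -> nat -> 'I_(ntapes M).+1 -> symb M -> bool) :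
  exists x, forall t, t <= T ->
  [/\ forall q, x (state_var t q) = states t q, forall u, x (choice_var t u) = choices t u
    & forall o j s, o <= 2 * T.+1 -> x (cell_var t o j s) = contents t o j s].
Proof.
have [|x xE] := @extend_along (nat * var_name) (fun i => var_number i.1 i.2)
    (fun i => valid_name i.2)
    (fun i => match i.2 with
              | inl (inl q) => states i.1 q
              | inl (inr u) => choices i.1 u
              | inr (o, p) => contents i.1 o p.1 p.2
              end).
  move=> [t i] [t' j] /= valid_i valid_j.
  case/(digit_inj (name_offset_lt valid_i) (name_offset_lt valid_j)) => ij ->.
  by rewrite (name_offset_inj valid_i valid_j ij).
exists x => t _; split=> [q|u|o j s le_o]; first exact: (xE (t, inl (inl q)) isT).
  exact: (xE (t, inl (inr u)) isT).
exact: (xE (t, inr (o, (j, s))) le_o).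
Qed.

End Numbering.

Fixpoint horner_nat (s : seq nat) (n : nat) : nat :=
  if s is a :: s' then horner_nat s' n * n + a else 0.

Lemma horner_natE (p : {poly nat}) (n : nat) : horner_nat (polyseq p) n = p.[n]%R.
Proof. by rewrite /horner; elim: (polyseq p) => //= a s ->. Qed.

Lemma ptime_horner (E : Type) (eE : Enc E) (s : seq nat) (f : E -> nat) :
  ptime f -> ptime (fun e => horner_nat s (f e)).
Proof.
move=> hf; elim: s => [|a s IH] /=; first exact: ptime_const.
by apply: ptime_add; [apply: ptime_mul | exact: ptime_const].
Qed.

Section Literals.
Variables (E : Type) (eE : Enc E) (M : tm).

Lemma ptime_pos_lit (f : E -> nat) : ptime f -> ptime (fun e => pos_lit (f e)).
Proof. by move=> hf; apply: ptime_pair hf (ptime_const _). Qed.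

Lemma ptime_neg_lit (f : E -> nat) : ptime f -> ptime (fun e => neg_lit (f e)).
Proof. by move=> hf; apply: ptime_pair hf (ptime_const _). Qed.

Variables (T t : E -> nat) (hT : ptime T) (ht : ptime t).

Lemma ptime_var_number (i : E -> var_name M) :
  ptime (fun e => name_offset (i e)) -> ptime (fun e => var_number (T e) (t e) (i e)).
Proof. by move=> hi; rewrite /var_number /period; prove_ptime. Qed.

Lemma ptime_state_var (q : state M) : ptime (fun e => state_var (T e) (t e) q).
Proof. exact: ptime_var_number (ptime_const _). Qed.

Lemma ptime_choice_var (u : choice_of M) : ptime (fun e => choice_var (T e) (t e) u).
Proof. exact: ptime_var_number (ptime_const _). Qed.

Lemma ptime_cell_var (o : E -> nat) (j : 'I_(ntapes M).+1) (s : symb M) :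
  ptime o -> ptime (fun e => cell_var (T e) (t e) (o e) j s).
Proof. by move=> ho; apply: ptime_var_number; rewrite /name_offset; prove_ptime. Qed.

Lemma ptime_moved_offset (mv : move) : ptime (fun e => moved_offset mv (t e)).
Proof. by case: mv; [exact: ptime_succ | exact: ptime_pred | exact: ht]. Qed.

Lemma ptime_offsets : ptime (fun e => offsets (T e)).
Proof.
by rewrite /offsets; prove_ptime.
Qed.

End Literals.

Ltac prove_ptime_literal := repeat first
  [ assumption | exact: ptime_const | apply: ptime_cons | apply: ptime_pos_lit
  | apply: ptime_neg_lit | apply: ptime_state_var | apply: ptime_choice_var
  | apply: ptime_cell_var | apply: ptime_moved_offset | apply: ptime_succ ].

Section Formula.
Variables (M : tm).

Section AtTime.
Variables (E : Type) (eE : Enc E) (T t : E -> nat) (hT : ptime T) (ht : ptime t).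

Lemma ptime_choose_clauses : ptime (fun e => choose_clauses (@choice_var M (T e)) (t e)).
Proof.
rewrite /choose_clauses; apply: ptime_cons; last exact: ptime_const.
by apply: ptime_map_const => u; prove_ptime_literal.
Qed.

Lemma ptime_read_clauses :
  ptime (fun e =>
    read_clauses (T e) (@state_var M (T e)) (@choice_var M (T e)) (@cell_var M (T e)) (t e)).
Proof.
rewrite /read_clauses; apply: ptime_flatmap_const => u; apply: ptime_cons;
  first by prove_ptime_literal.
by apply: ptime_map_const => j; prove_ptime_literal.
Qed.

Lemma ptime_unique_clauses :
  ptime (fun e => unique_clauses (T e) (@state_var M (T e)) (@cell_var M (T e)) (t e)).
Proof.
rewrite /unique_clauses; apply: ptime_cat; first by apply: ptime_map_const => p;
  prove_ptime_literal.
by apply: ptime_flatmap_const => j; apply: ptime_map_const => p; prove_ptime_literal.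
Qed.

Lemma ptime_move_clauses :
  ptime (fun e =>
    move_clauses (T e) (@state_var M (T e)) (@choice_var M (T e)) (@cell_var M (T e)) (t e)).
Proof.
rewrite /move_clauses; apply: ptime_flatmap_const => u; apply: ptime_cons;
  first by prove_ptime_literal.
apply: ptime_flatmap_const => j; apply: ptime_cons; first by prove_ptime_literal.
apply: ptime_flatmap_const => x; apply: ptime_map; last exact: ptime_offsets.
have ptime_T : ptime (fun p : E * nat => T p.1) by apply: ptime_comp hT (ptime_fst ptime_id).
have ptime_t : ptime (fun p : E * nat => t p.1) by apply: ptime_comp ht (ptime_fst ptime_id).
have ho : ptime (fun p : E * nat => p.2) by exact: ptime_snd ptime_id.
by apply: ptime_if; [prove_ptime | prove_ptime_literal | prove_ptime_literal].
Qed.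

End AtTime.

Local Instance enc_symb : Enc (symb M) := enc_fin (symb M).

Lemma ptime_formula (E : Type) (eE : Enc E) (W : E -> seq (symb M)) (T : E -> nat) :
  ptime W -> ptime T ->
  ptime (fun e =>
    formula (W e) (T e) (@state_var M (T e)) (@choice_var M (T e)) (@cell_var M (T e))).
Proof.
move=> hW hT; rewrite /formula; apply: ptime_cat; last apply: ptime_cat; last apply: ptime_cat.
- rewrite /init_clauses; apply: ptime_cat; first by prove_ptime_literal.
  apply: ptime_flatmap_const => j; apply: ptime_map; last exact: ptime_offsets.
  have ptime_T : ptime (fun p : E * nat => T p.1) by apply: ptime_comp hT (ptime_fst ptime_id).
  have ptime_W : ptime (fun p : E * nat => W p.1) by apply: ptime_comp hW (ptime_fst ptime_id).
  have ho : ptime (fun p : E * nat => p.2) by exact: ptime_snd ptime_id.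
  apply: (ptime_fin_case (F := symb M) (f := fun p : E * nat => init_cell (W p.1) (T p.1) j p.2)
    (g := fun s p => [:: pos_lit (cell_var (T p.1) 0 p.2 j s)])); last by move=> s;
      prove_ptime_literal.
  by rewrite /init_cell; case: (j == ord0); prove_ptime.
- rewrite /final_clauses; apply: ptime_cons; last exact: ptime_const.
  by apply: ptime_map_const => u; prove_ptime_literal.
- apply: ptime_flatmap; last by apply: ptime_iota; [exact: ptime_const | exact: ptime_succ].
  have ptime_T : ptime (fun p : E * nat => T p.1) by apply: ptime_comp hT (ptime_fst ptime_id).
  have ho : ptime (fun p : E * nat => p.2) by exact: ptime_snd ptime_id.
  apply: ptime_cat; first exact: (ptime_choose_clauses ptime_T ho).
  apply: ptime_cat; first exact: (ptime_read_clauses ptime_T ho).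
  exact: (ptime_unique_clauses ptime_T ho).
- apply: ptime_flatmap; last by apply: ptime_iota; [exact: ptime_const | exact: hT].
  have ptime_T : ptime (fun p : E * nat => T p.1) by apply: ptime_comp hT (ptime_fst ptime_id).
  have ho : ptime (fun p : E * nat => p.2) by exact: ptime_snd ptime_id.
  exact: (ptime_move_clauses ptime_T ho).
Qed.

End Formula.

(** * Computing the region *)

Definition max_var (F : cnf) : nat := \max_(l <- flatten F) l.1.

Lemma max_varP F : all (all (fun l : literal => l.1 < (max_var F).+1)) F.
Proof.
apply/allP => clause F_clause; apply/allP => l l_clause; rewrite ltnS.
by apply: (leq_bigmax_seq (F := fun l : literal => l.1)) => //; apply/flattenP; exists clause.
Qed.

Definition column_letter : finType := (option bool * option bool)%type.

Definition literal_letters (V : nat) (l : literal) : seq column_letter :=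
  [seq ((if p == V - l.1.+1 then Some l.2 else None, if p == V then Some true else None) :
    column_letter)
  | p <- iota 0 V.+1].

Definition cnf_letters (V : nat) (F : cnf) : seq column_letter :=
  flatten [seq flatten [seq literal_letters V l | l <- cl] ++ [:: (None, Some false)] | cl <- F].

Lemma cnf_word_letters V F : cnf_word V F = cnf_letters V F.
Proof.
rewrite /cnf_word /cnf_letters; elim: F => // cl F IH.
have -> : cnf_pieces (cl :: F) = rcons (map Some cl) None ++ cnf_pieces F by [].
rewrite /word_values map_cat flatten_cat -!/(word_values _ _ _) /unzip1 map_cat -!/(unzip1 _) IH /=.
congr (_ ++ _); elim: cl => // l cl IHc; rewrite map_cons rcons_cons word_values_some.
have blockE : unzip1 (block V xpred0 l) = literal_letters V l.
  by rewrite /block /literal_letters /unzip1 -map_comp.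
by rewrite /unzip1 map_cat -!/(unzip1 _) IHc blockE catA.
Qed.

Definition word_border (V : nat) (w : seq column_letter) (i k : nat) : color :=
  if k == 0 then left_vertex (i == V.+1) else if k == (size w).+1 then right_vertex
  else if i == 0 then
    bottom_vertex ((nth (None, None) w k.-1).1,
      if k.-1 == 0 then None else (nth (None, None) w k.-1.-1).1,
        (nth (None, None) w k.-1).2)
  else top_vertex.

Lemma grid_borderE V F i k : grid_border V F i k = word_border V (cnf_word V F) i k.
Proof.
rewrite /grid_border /word_border /grid_width /trigger_at /kind_at; case: k => // k;
  rewrite [k.+1 == 0]/= [k.+1.-1]/=.
by case: k.
Qed.

Section GridText.
Variables (V : nat) (w : seq column_letter).
Local Notation m := V.+2.
Local Notation n := (size w).+1.
Local Notation Y := (boundary_level (word_border V w)).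

Definition cell_text (x y : nat) : seq letter :=
  rev [seq Bit b | b <- bits x] ++ Comma :: rev [seq Bit b | b <- bits y] ++ [:: Semicolon].

Definition grid_text : seq letter :=
  flatten [seq flatten [seq cell_text x y
    | y <- iota (frontier m n Y 0 x) (frontier m n Y m x - frontier m n Y 0 x)]
          | x <- iota 0 (region_width m n)].

Lemma grid_textE : grid_text = encode (grid_cells m n (word_border V w)).
Proof.
rewrite /grid_text /grid_cells /encode; elim: (iota 0 _) => //= x s IH.
rewrite map_cat flatten_cat -IH; congr (_ ++ _); rewrite -map_comp; congr flatten.
by apply/eq_map => y; rewrite /cell_text /= !encode_natE.
Qed.

End GridText.

Local Instance enc_column_letter : Enc column_letter := enc_fin column_letter.

Section Grid.
Variables (E : Type) (eE : Enc E).

Lemma ptime_nat_of_bool (f : E -> bool) : ptime f -> ptime (fun e => nat_of_bool (f e)).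
Proof.
move=> hf; apply: ptime_ext (ptime_if hf (ptime_const 1) (ptime_const 0)) => e; by case: (f e).
Qed.

Variables (V : E -> nat) (w : E -> seq column_letter) (hV : ptime V) (hw : ptime w).

Lemma ptime_color_level (i k : E -> nat) (c : color) : ptime i -> ptime k ->
  ptime (fun e => color_level (i e) (k e) c).
Proof.
move=> hi hk; rewrite /color_level /base_level /parity_digits /digits4 /digit_if.
by repeat first [apply: ptime_add | apply: ptime_mul | apply: ptime_if | apply: ptime_andb
  | apply: ptime_negb | apply: ptime_odd | exact: ptime_const | exact: hi | exact: hk].
Qed.

Lemma ptime_boundary_level (i k : E -> nat) : ptime i -> ptime k ->
  ptime (fun e => boundary_level (word_border (V e) (w e)) (i e) (k e)).
Proof.
move=> hi hk;
  apply: (ptime_fin_case (F := color) (f := fun e => word_border (V e) (w e) (i e) (k e))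
  (g := fun c e => color_level (i e) (k e) c)); last by move=> c; exact: ptime_color_level.
pose ec : Enc color := enc_fin color.
rewrite /word_border; apply: ptime_if; first by apply: ptime_eq => //; exact: ptime_const.
  apply: ptime_ext (ptime_if (c :=
    fun e => i e == (V e).+1) _ (ptime_const (left_vertex true))
      (ptime_const (left_vertex false))) => [e|].
    by case: (i e == _).
  by apply: ptime_eq => //; exact: ptime_succ.
apply: ptime_if; first by apply: ptime_eq => //; apply: ptime_succ; exact: ptime_size.
  exact: ptime_const.
apply: ptime_if; [by apply: ptime_eq => //; exact: ptime_const| |exact: ptime_const].
apply: (ptime_fin_case (F := column_letter) (f := fun e => nth (None, None) (w e) (k e).-1)
  (g := fun x e => bottom_vertex (x.1,
    if (k e).-1 == 0 then None else (nth (None, None) (w e) (k e).-1.-1).1, x.2))).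
  by apply: ptime_nth => //; [exact: ptime_const | exact: ptime_pred].
move=> x; apply: ptime_ext (ptime_if (c :=
  fun e => (k e).-1 == 0) _ (ptime_const (bottom_vertex (x.1, None, x.2)))
  (ptime_fin_const ec (f := fun e => nth ((None, None) : column_letter) (w e) (k e).-1.-1) (fun y :
    column_letter => bottom_vertex (x.1, y.1, x.2)) _)) => [e||].
- by case: (_ == 0).
- by apply: ptime_eq; [exact: ptime_pred | exact: ptime_const].
- by apply: ptime_nth => //; [exact: ptime_const | apply: ptime_pred; exact: ptime_pred].
Qed.

Lemma ptime_col_start (f : E -> nat) : ptime f -> ptime (fun e => col_start (f e)).
Proof. by move=> hf; rewrite /col_start; prove_ptime. Qed.

Lemma ptime_frontier (i x : E -> nat) : ptime i -> ptime x ->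
  ptime (fun e =>
    frontier (V e).+2 (size (w e)).+1 (boundary_level (word_border (V e) (w e))) (i e) (x e)).
Proof.
move=> hi hx; rewrite /frontier.
have hn : ptime (fun e => (size (w e)).+1) by apply: ptime_succ; exact: ptime_size.
have hW := ptime_col_start hn.
have ptime_shift : ptime (fun e => 4 * ((V e).+2 - i e)) by prove_ptime.
apply: ptime_if; first by prove_ptime.
  by apply: ptime_boundary_level; [prove_ptime | exact: ptime_const].
apply: ptime_if; first by apply: ptime_leq => //; apply: ptime_succ; exact: ptime_sub.
  apply: ptime_boundary_level => //; rewrite /col_of; apply: ptime_add; first by prove_ptime.
  by apply: ptime_nat_of_bool; prove_ptime.
apply: ptime_boundary_level => //; apply: ptime_sub; first by prove_ptime.
by apply: ptime_div; exact: ptime_sub.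
Qed.

End Grid.

Lemma ptime_grid_text : ptime (fun e : nat * seq column_letter => grid_text e.1 e.2).
Proof.
pose Z := (nat * seq column_letter)%type.
pose edge (e : Z) i x :=
  frontier e.1.+2 (size e.2).+1 (boundary_level (word_border e.1 e.2)) i x.
have lower : ptime (fun p : Z * nat => edge p.1 0 p.2).
  by apply: (ptime_frontier (V := fun p => p.1.1) (w := fun p => p.1.2)); prove_ptime.
have upper : ptime (fun p : Z * nat => edge p.1 p.1.1.+2 p.2).
  by apply: (ptime_frontier (V := fun p => p.1.1) (w := fun p => p.1.2)); prove_ptime.
apply: (ptime_flatmap (f := fun (e : Z) x =>
    flatten [seq cell_text x y | y <- iota (edge e 0 x) (edge e e.1.+2 x - edge e 0 x)])).
  apply: (ptime_flatmap (f := fun (p : Z * nat) y => cell_text p.2 y)).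
    rewrite /cell_text; apply: ptime_cat.
      by apply: ptime_bit_letters; apply: ptime_bits; prove_ptime.
    apply: ptime_cons; first exact: ptime_const.
    apply: ptime_cat; last exact: ptime_const.
    by apply: ptime_bit_letters; apply: ptime_bits; prove_ptime.
  by apply: ptime_iota => //; exact: ptime_sub.
apply: ptime_iota; first exact: ptime_const.
rewrite /region_width; apply: ptime_add; last by prove_ptime.
by apply: ptime_col_start; prove_ptime.
Qed.

Lemma ptime_max_var : ptime max_var.
Proof.
pose larger (a : nat) (l : literal) := a + (l.1 - a).
have flat : ptime (fun F : cnf => flatten [seq id cl | cl <- F]).
  by apply: (ptime_flatmap (f := fun (_ : cnf) (cl : seq literal) => id cl)); prove_ptime.
have folded : ptime (fun F : cnf => foldl larger 0 (flatten [seq id cl | cl <- F])).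
  apply: (ptime_foldl (E := cnf) (step := fun _ => larger)) => //; last exact: ptime_const.
    by rewrite /larger; prove_ptime.
  exists id => [|F a [v b]]; first by poly_bound.
  by rewrite /larger enc_size_pair !enc_size_nat /=; lia.
apply: ptime_ext folded => F; rewrite map_id /max_var.
suff foldlE s a : foldl larger a s = maxn a (\max_(l <- s) l.1) by rewrite foldlE max0n.
elim: s a => [|l s IH] a /=; first by rewrite big_nil maxn0.
by rewrite IH big_cons maxnA /larger -maxnE.
Qed.

Lemma ptime_cnf_letters : ptime (fun e : nat * cnf => cnf_letters e.1 e.2).
Proof.
apply: (ptime_flatmap (f := fun (e : nat * cnf) cl => flatten [seq literal_letters e.1 l
  | l <- cl] ++ [:: (None, Some false)])); last by prove_ptime.
apply: ptime_cat; last exact: ptime_const.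
apply: (ptime_flatmap (f := fun (p : (nat * cnf) * seq literal) l => literal_letters p.1.1 l));
  last by prove_ptime.
pose Z := (((nat * cnf) * seq literal) * literal)%type.
apply: (ptime_map (f := fun (z : Z) p => ((if p == z.1.1.1 - z.2.1.+1 then Some z.2.2 else None,
   if p == z.1.1.1 then Some true else None) : column_letter))); last by prove_ptime.
pose own (z : Z * nat) := z.2 == z.1.1.1.1 - z.1.2.1.+1.
pose trigger (z : Z * nat) := z.2 == z.1.1.1.1.
have ptime_own : ptime own by rewrite /own; prove_ptime.
have ptime_trigger : ptime trigger by rewrite /trigger; prove_ptime.
have ptime_sign : ptime (fun z : Z * nat => z.1.2.2) by prove_ptime.
pose k (a b : option bool) : column_letter := (a, b).
apply: ptime_ext (ptime_if ptime_own (ptime_if ptime_trigger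
   (ptime_if ptime_sign (ptime_const (k (Some true) (Some true)))
     (ptime_const (k (Some false) (Some true))))
   (ptime_if ptime_sign (ptime_const (k (Some true) None)) (ptime_const (k (Some false) None))))
  (ptime_if ptime_trigger (ptime_const (k None (Some true))) (ptime_const (k None None)))) => z.
by rewrite -/(own z) -/(trigger z); case: (own z); case: (trigger z); case: (z.1.2.2).
Qed.

Lemma encode_inj : injective encode.
Proof.
move=> s s' /(congr1 (map (fun x => (x, tt)))); rewrite !label_word_const.
move=> /(congr1 (@parse unit)); rewrite !parse_label_word /entries -!map_comp.
by apply: inj_map => c c' [] cE c'E; apply: square_bits_inj; rewrite /square_bits cE c'E.
Qed.

Lemma colorable_tiling_problem (R : realType) V w :
  colorable hcompat vcompat V.+2 (size w).+1 (word_border V w) <->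
  tiling_problem R (tile_set hcompat vcompat) (grid_text V w).
Proof.
rewrite grid_textE; set s := grid_cells _ _ _; split=> [col|[s' [[_ /encode_inj <-] _ _]]];
  last first.
  exact: tileable_colorable.
have [s' shelled_s' sE] : exists2 s', shelled s' & [fset c in s]%fset = [fset c in s']%fset.
  exact: grid_shelled.
have [conn simple] : region R [fset c in s]%fset /\ simply_connected (realize R [fset c in s]%fset).
  by apply/shellableP; exists s'.
by exists s; split=> //; [split=> //; exact: uniq_grid_cells | exact: colorable_tileable].
Qed.

Definition cnf_text (F : cnf) : seq letter :=
  let V := (max_var F).+1 in grid_text V (cnf_letters V F).

Lemma ptime_cnf_text : ptime cnf_text.
Proof.
have var_count : ptime (fun F => (max_var F).+1) by apply: ptime_succ ptime_max_var.
apply: (ptime_comp ptime_grid_text (ptime_pair var_count _)).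
exact: ptime_comp ptime_cnf_letters (ptime_pair var_count ptime_id).
Qed.

Lemma sat_tiling_problem (R : realType) F :
  (exists x, satisfies x F) <-> tiling_problem R (tile_set hcompat vcompat) (cnf_text F).
Proof.
rewrite -colorable_tiling_problem; set V := (max_var F).+1.
have <- : grid_border V F = word_border V (cnf_letters V F).
  by apply/funext => i; apply/funext => k; rewrite grid_borderE cnf_word_letters.
rewrite -cnf_word_letters -/(grid_width V F) -/(grid_height V); split; last first.
  exact: colorable_sat (max_varP F).
by case=> x; exact: sat_colorable (max_varP F) x.
Qed.

Definition tm_formula (M : tm) (w : seq (symb M)) (T : nat) : cnf :=
  formula w T (@state_var M T) (@choice_var M T) (@cell_var M T).

Lemma tm_formulaP (M : tm) (w : seq (symb M)) T : (forall n c, steps n (init w) c -> n <= T) ->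
  (exists x, satisfies x (tm_formula w T)) <->
  exists n c, [/\ steps n (init w) c, halted c & c.1 \in accept M].
Proof.
move=> bounded; split=> [[x]|[n [c [run halts acc]]]]; first exact: formula_sound.
exact: formula_complete run halts acc (bounded _ _ run) (@variables_independent M T).
Qed.

Lemma tiling_NP_hard (R : realType) : NP_hard (tiling_problem R (tile_set hcompat vcompat)).
Proof.
move=> A L [M [e [p [_ L_machine]]]].
pose eA : Enc A := enc_fin A; pose eS : Enc (symb M) := enc_fin (symb M).
exists (fun w => cnf_text (tm_formula (map e w) (horner_nat (polyseq p) (size w)))).
  apply: ptime_polytime; apply: (ptime_comp ptime_cnf_text).
  apply: ptime_formula; last by apply: ptime_horner; apply: ptime_size; exact: ptime_id.
  apply: (ptime_map (f := fun _ a => e a)); last exact: ptime_id.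
  by apply: (ptime_fin_const eS (f := fun p : seq A * A => p.2) e); exact: ptime_snd ptime_id.
move=> w; have [bounded L_iff] := L_machine w.
by rewrite L_iff -sat_tiling_problem tm_formulaP // horner_natE.
Qed.

Theorem theorem1p1 (R : realType) :
  exists T : {fset cells},
    [/\ forall t, t \in T -> rectangular t,
        (#|` T|%fset <= 10 ^ 6)%N
      & NP_complete (tiling_problem R T)].
Proof.
exists (tile_set hcompat vcompat); split.
- by move=> t; exact: tile_set_rectangular.
- exact: leq_trans (card_tile_set hcompat vcompat) card_color.
- split; last exact: tiling_NP_hard.
  by apply: tiling_NP => t; exact: tile_set_rectangular.
Qed.
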